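(* Let $T>0$, let $u_0\in L^2(\mathbb{T}^3)$ be a divergence-free vector field, and let $u$ be a Leray-Hopf weak solution on $(0,T)\times\mathbb{T}^3$ of the 3D anisotropic Navier-Stokes equations $$u_t+u\cdot\nabla u-\Delta_h u+\nabla\Pi=0,\qquad \operatorname{div}u=0,\qquad u|_{t=0}=u_0 .$$ Suppose that at least one of the following three conditions holds: (1) $u\in L^4(0,T;L^4(\mathbb{T}^3))$; (2) $u\in L^p(0,T;L^q(\mathbb{T}^3))$ for some real $p,q$ with $\frac2p+\frac2q=1$ and $q\ge 4$; (3) $\nabla u\in L^p(0,T;L^q(\mathbb{T}^3))$ for some real $p,q$ with $\frac1p+\frac{6}{5q}=1$ and $q\ge\frac95$. Then the energy equality holds: for every $t\in[0,T]$, $$\frac12\int_{\mathbb{T}^3}|u(x,t)|^2\,dx+\int_0^t\|\nabla_h u(s)\|_{L^2(\mathbb{T}^3)}^2\,ds=\frac12\int_{\mathbb{T}^3}|u_0(x)|^2\,dx .$$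
   Context: $\mathbb{T}^3$ is the three-dimensional torus (periodic domain). $u=(u_1,u_2,u_3)$ is the velocity and $\Pi$ the pressure; $\nabla_h=(\partial_1,\partial_2)$ is the horizontal gradient, $\Delta_h=\partial_1^2+\partial_2^2$ the horizontal Laplacian, and $\nabla=(\partial_1,\partial_2,\partial_3)$ the full gradient. $L^p(0,T;X)$ is the set of measurable functions $f$ on $(0,T)$ with values in $X$ such that $\|f\|_X\in L^p(0,T)$. Definition (weak solution), with $\Omega=\mathbb{T}^3$: a vector field $u$ is a weak solution of the 3D anisotropic Navier-Stokes equations if $u\in L^\infty(0,T;L^2(\Omega))$, $\nabla_h u\in L^2(0,T;L^2(\Omega))$; $u$ is weakly divergence-free, i.e. $\int_\Omega u\cdot\nabla\psi\,dx=0$ for all $\psi\in C_0^\infty(\Omega)$ and almost every $t$; and $$\int_0^T\int_\Omega \partial_t\phi\cdot u+\nabla\phi:(u\otimes u)-\nabla_h\phi\cdot\nabla_h u\,dx\,dt=0$$ for every divergence-free vector field $\phi\in C_0^\infty((0,T)\times\Omega)$. ''Leray-Hopf weak solution'' means a weak solution in this sense. The initial condition is understood as follows: $u$ is identified with its representative that is weakly continuous from $[0,T]$ into $L^2(\Omega)$, and $u(0)=u_0$. *)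

(* Defs.v *)
From HB Require Import structures.
From mathcomp Require Import all_boot all_order all_algebra.
From mathcomp Require Import all_classical all_reals all_analysis.

Set Implicit Arguments.
Unset Strict Implicit.
Unset Printing Implicit Defensive.

Import Order.TTheory GRing.Theory Num.Theory.
Import numFieldNormedType.Exports.

Local Open Scope classical_set_scope.
Local Open Scope ring_scope.

(* Conventions.  T^3 = R^3 / Z^3: a function on the torus is a function on
   [point3 R] with period 1 in each coordinate, and it is integrated over the
   period cell.  A velocity is a row vector, (u t x) 0 i being its i-th
   component; in a gradient A, the entry A i j stands for the derivative of the
   i-th component in the j-th direction.  Measurability is with respect to the
   Borel sets, so that elements of L^p are given by Borel representatives. *)

Notation point3 R := (R * R * R)%type.

(* The library's Lebesgue measure lives on [measurableTypeR R], a copy of R;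
   [mpoint3 R] is the corresponding copy of [point3 R]. *)
Notation mpoint3 R :=
  (measurableTypeR R * measurableTypeR R * measurableTypeR R)%type.

Section Torus.
Context {R : realType}.

Definition lebesgue3 : set (mpoint3 R) -> \bar R :=
  (@lebesgue_measure R \x @lebesgue_measure R \x @lebesgue_measure R)%E.
HB.instance Definition _ := Measure.on lebesgue3.

Definition cell : set (point3 R) := (`[0, 1] `*` `[0, 1]) `*` `[0, 1].

Definition basis3 (i : 'I_3) : point3 R :=
  ((i == 0%N :> nat)%:R, (i == 1%N :> nat)%:R, (i == 2%N :> nat)%:R).

Definition hindex (j : 'I_2) : 'I_3 := widen_ord (leqnSn 2) j.

Definition periodic3 {W : Type} (f : point3 R -> W) :=
  forall x i, f (x + basis3 i) = f x.

(* Euclidean norm of a vector, Frobenius norm of a matrix (the library's norm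
   on matrices is the maximum norm). *)
Definition enorm {m n} (A : 'M[R]_(m, n)) : R :=
  Num.sqrt (\sum_i \sum_j A i j ^+ 2).

Definition dot {n} (v w : 'rV[R]_n) : R := \sum_i v 0 i * w 0 i.

(* C^infinity: all iterated directional derivatives exist and are continuous. *)
Definition iter_derive {V W : normedModType R} (vs : seq V) (f : V -> W) :
  V -> W := foldr (fun v g => 'D_v g) f vs.

Definition smooth {V W : normedModType R} (f : V -> W) :=
  forall vs : seq V, continuous (iter_derive vs f) /\
    forall x v, derivable (iter_derive vs f) x v.

Definition torus_test (psi : point3 R -> R) :=
  smooth psi /\ periodic3 psi.

(* C_0^infinity((0,T) x T^3), extended by 0 to all times. *)
Definition spacetime_test (T : R) (phi : R * point3 R -> 'rV[R]_3) :=
  [/\ smooth phi,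
      forall t, periodic3 (fun x => phi (t, x)) &
      exists a b, [/\ 0 < a, b < T &
        forall t x, t \notin `[a, b] -> phi (t, x) = 0]].

Definition dt {W : normedModType R} (phi : R * point3 R -> W) :=
  'D_(1, 0) phi.

Definition dx {W : normedModType R} (i : 'I_3) (phi : R * point3 R -> W) :=
  'D_(0, basis3 i) phi.

Local Open Scope ereal_scope.

(* The norm of L^q(T^3) and the space L^q(T^3). *)
Definition Lq_norm {m n} (q : \bar R) (f : point3 R -> 'M[R]_(m, n)) : \bar R :=
  'N[lebesgue3]_q[(fun x => (enorm (f x))%:E) \_ cell].

Definition Lq {m n} (q : \bar R) (f : point3 R -> 'M[R]_(m, n)) :=
  [/\ periodic3 f,
      forall i j, measurable_fun [set: mpoint3 R] (fun x => f x i j) &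
      Lq_norm q f < +oo].

(* L^p(0,T; L^q(T^3)). *)
Definition LpLq {m n} (T : R) (p q : \bar R)
    (f : R -> point3 R -> 'M[R]_(m, n)) :=
  [/\ forall t, t \in `]0%R, T[ -> periodic3 (f t),
      forall i j, measurable_fun
        (`]0%R, T[ `*` [set: point3 R] : set (measurableTypeR R * mpoint3 R))
        (fun z => f z.1 z.2 i j) &
      'N[lebesgue_measure]_p[(fun t => Lq_norm q (f t)) \_ `]0%R, T[] < +oo].

(* g is the weak i-th partial derivative of f on T^3. *)
Definition weak_partial (i : 'I_3) (f g : point3 R -> R) :=
  [/\ lebesgue3.-integrable cell (EFin \o f),
      lebesgue3.-integrable cell (EFin \o g) &
      forall psi : point3 R -> R, torus_test psi ->
        \int[lebesgue3]_(x in cell) (f x * 'D_(basis3 i) psi x)%:E =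
        - \int[lebesgue3]_(x in cell) (g x * psi x)%:E].

Definition weak_grad (T : R) (u : R -> point3 R -> 'rV[R]_3)
    (A : R -> point3 R -> 'M[R]_3) :=
  {ae lebesgue_measure, forall t, t \in `]0%R, T[ ->
    forall i j, weak_partial j (fun x => u t x 0%R i) (fun x => A t x i j)}.

Definition weak_hgrad (T : R) (u : R -> point3 R -> 'rV[R]_3)
    (A : R -> point3 R -> 'M[R]_(3, 2)) :=
  {ae lebesgue_measure, forall t, t \in `]0%R, T[ ->
    forall i j,
      weak_partial (hindex j) (fun x => u t x 0%R i) (fun x => A t x i j)}.

Definition orthogonal_to_grad (v : point3 R -> 'rV[R]_3) (psi : point3 R -> R) :=
  \int[lebesgue3]_(x in cell) (\sum_i v x 0 i * 'D_(basis3 i) psi x)%R%:E = 0.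

Definition weakly_divfree (v : point3 R -> 'rV[R]_3) :=
  forall psi, torus_test psi -> orthogonal_to_grad v psi.

Definition divfree (phi : R * point3 R -> 'rV[R]_3) :=
  forall z, (\sum_i dx i phi z 0 i = 0)%R.

(* The integrand d_t phi . u + grad phi : (u (x) u) - grad_h phi : grad_h u at
   (t, x), where A = grad_h u. *)
Definition weak_integrand (u : R -> point3 R -> 'rV[R]_3)
    (A : R -> point3 R -> 'M[R]_(3, 2)) (phi : R * point3 R -> 'rV[R]_3)
    (t : R) (x : point3 R) : R :=
  (dot (dt phi (t, x)) (u t x)
   + \sum_i \sum_j dx j phi (t, x) 0 i * (u t x 0 i * u t x 0 j)
   - \sum_i \sum_(j < 2) dx (hindex j) phi (t, x) 0 i * A t x i j)%R.

(* u is a weak solution on (0,T) x T^3 of the anisotropic Navier-Stokes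
   equations, with horizontal gradient A. *)
Definition weak_solution (T : R) (u : R -> point3 R -> 'rV[R]_3)
    (A : R -> point3 R -> 'M[R]_(3, 2)) :=
  [/\ LpLq T +oo 2%:E u,
      weak_hgrad T u A /\ LpLq T 2%:E 2%:E A,
      forall psi, torus_test psi ->
        {ae lebesgue_measure, forall t, t \in `]0%R, T[ ->
          orthogonal_to_grad (u t) psi} &
      forall phi, spacetime_test T phi -> divfree phi ->
        \int[lebesgue_measure]_(t in `]0%R, T[)
          \int[lebesgue3]_(x in cell) (weak_integrand u A phi t x)%:E = 0].

(* Continuity from [0,T] to L^2(T^3) with its weak topology. *)
Definition weakly_continuous (T : R) (u : R -> point3 R -> 'rV[R]_3) :=
  (forall t, t \in `[0%R, T] -> Lq 2%:E (u t)) /\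
  forall v : point3 R -> 'rV[R]_3, Lq 2%:E v ->
    {within `[0%R, T], continuous (fun t =>
      \int[lebesgue3]_(x in cell) (dot (u t x) (v x)))%R}.

End Torus.

(* Main.v *)
(* Mollify the solution in space with a periodic kernel K_n and test the
   equation with K'_n * K_n * u(s), where K'_n(x) = K_n(-x).  This determines
   the increments in t of g(t, s) = <K_n * u(t), K_n * u(s)>, and Riemann sums
   along the diagonal turn them into the energy balance of K_n * u, up to a flux
   term.  As u is divergence free, the flux equals
     sum_(i, j) int D_j (K_n * u_i) Cov_n(u_i, u_j),
   where Cov_n is the covariance over the window of K_n.  The energy equality
   follows by dominated convergence once the flux tends to 0 for almost every
   time and is dominated by an integrable function of time.

   In case (1) the horizontal derivatives are handled by Young's inequality.  A
   vertical derivative of K_n costs a factor n, but D_3 u_3 is minus the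
   horizontal divergence, so that u_3 has a full gradient in L^2 and its
   increments over the window are O(1/n).  Case (2) reduces to case (1) by
   interpolation with the bound of u in L^2.  In case (3), Young's inequality
   with exponents q, 2q', 2q' bounds the flux by int |grad u|^q and
   int |u|^(2q'), and the latter is controlled by the former through the
   Gagliardo-Nirenberg inequality for u^3; with the best weight the bound is a
   power of int |grad u|^q that is integrable in time exactly when
   1/p + 6/(5q) = 1. *)

From HB Require Import structures.
From mathcomp Require Import all_boot all_order all_algebra.
From mathcomp Require Import all_classical all_reals all_analysis.
From mathcomp Require Import measurable_realfun ess_sup_inf ring lra.
Require Import Defs.
Set Implicit Arguments.
Unset Strict Implicit.
Unset Printing Implicit Defensive.
Import Order.TTheory GRing.Theory Num.Theory.
Import numFieldNormedType.Exports.
Local Open Scope classical_set_scope.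
Local Open Scope ring_scope.

(** * Integration over the period cell *)

(** No time derivative of the solution is at hand, so a mollification of u(t) cannot serve as a test
    function at time t. With s frozen, the test field does not depend on t: a cutoff in time makes
    it admissible, and weak continuity in time yields the increments between all times, not just
    almost all.

    The obstacle is that the dissipation controls no vertical derivative. A covariance is unchanged
    when constants are subtracted from its factors, so it only sees increments of u over the window,
    and these tend to 0 in each L^p that contains u. A Young inequality with a free weight k bounds
    the flux by k times a fixed quantity plus a negative power of k times a vanishing one. Fixing a
    small k before taking n large gives the limit; a suitable k for each time gives the dominating
    function. In the vertical term the weights also carry powers of n, so that the loss on the
    derivative of K_n is paid by the gain on the increments of u_3.

    Integrals over the cell become integrals for [mu3], a probability on all of R^3 that is
    invariant under translations of periodic functions. *)

Section Restriction.
Context d (X : measurableType d) (R : realType).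

Lemma integral_mrestr (m : {measure set X -> \bar R}) (D : set X)
    (mD : measurable D) (f : X -> \bar R) :
  measurable_fun setT f -> (forall x, 0 <= f x)%E ->
  (\int[mrestr m mD]_x f x = \int[m]_(x in D) f x)%E.
Proof.
move=> mf f0.
have -> : (\int[m]_(x in D) f x = \int[mrestr m mD]_(x in D) f x)%E.
  apply: eq_measure_integral => A mA AD.
  by rewrite /= /mrestr setIidl.
rewrite (@ge0_negligible_integral _ _ _ _ setT (~` D)) //; last 2 first.
- exact: measurableC.
- by rewrite /= /mrestr setICl measure0.
by rewrite setDE setCK setTI.
Qed.

End Restriction.

Section UnitInterval.
Context {R : realType}.
Notation lam := (@lebesgue_measure R).

Lemma measurable_itv01 : measurable (`[0, 1]%classic : set (measurableTypeR R)).
Proof. exact: measurable_itv. Qed.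

(** Carried by the whole line although it only charges the unit interval: integrals over the cell
    then need no domain, and products of copies are probabilities. *)
Definition mu1 : set (measurableTypeR R) -> \bar R := mrestr lam measurable_itv01.
HB.instance Definition _ := Measure.on mu1.

Lemma mu1T : mu1 setT = 1%E.
Proof.
rewrite /mu1 /mrestr setTI lebesgue_measure_itv /= lte_fin ltr01.
by rewrite oppr0 adde0.
Qed.

HB.instance Definition _ := Measure_isProbability.Build _ _ _ mu1 mu1T.

(** Uniqueness of Lebesgue measure reduces this to half-open intervals, whose length a translation
    preserves. *)
Lemma lebesgue_measure_shift (a : R) (A : set R) : measurable A ->
  pushforward lam ((fun x => x + a) : _ -> measurableTypeR R) A = lam A.
Proof.
move=> mA; apply/esym/lebesgue_measure_unique => //=.
  exact: (@measurable_funD _ _ _ _ id (cst a)).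
move=> _ mphi [[s t] _ <-]; rewrite /pushforward.
have -> : (fun x => x + a) @^-1` `]s, t]%classic = `]s - a, t - a]%classic.
  by apply/seteqP; split=> x /=; rewrite !in_itv /= ltrBlDr lerBrDr.
rewrite !lebesgue_measure_itv /= !lte_fin ltrD2r.
by case: ifP => // _; rewrite -!EFinB; congr (_%:E); ring.
Qed.

Lemma integral_itv_shift (a s t : R) (f : R -> \bar R) :
  measurable_fun setT f -> (forall x, 0 <= f x)%E ->
  (\int[lam]_(x in `[s, t[) f (x + a)%R = \int[lam]_(x in `[(s + a)%R, (t + a)%R[) f x)%E.
Proof.
move=> mf f0.
have mphi : measurable_fun setT ((fun x => x + a) : R -> measurableTypeR R).
  exact: (@measurable_funD _ _ _ _ id (cst a)).
have -> : `[s, t[%classic = (fun x => x + a) @^-1` `[(s + a)%R, (t + a)%R[%classic.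
  by apply/seteqP; split=> x /=; rewrite !in_itv /= lerD2r ltrD2r.
transitivity (\int[pushforward lam ((fun x => (x + a)%R) : R -> measurableTypeR R)]_(x in `[(s + a)%R, (t + a)%R[) f x)%E.
  by rewrite ge0_integral_pushforward //; exact: measurable_funTS.
by apply: eq_measure_integral => //= A mA _; exact: lebesgue_measure_shift.
Qed.

Lemma integral_itv_opp (s t : R) (f : R -> \bar R) :
  measurable_fun setT f -> (forall x, 0 <= f x)%E ->
  (\int[lam]_(x in `[s, t]) f (- x)%R = \int[lam]_(x in `[(- t)%R, (- s)%R]) f x)%E.
Proof.
move=> mf f0.
have -> : `[s, t]%classic = (-%R : _ -> measurableTypeR R) @^-1` `[- t, - s]%classic.
  by apply/seteqP; split=> x /=; rewrite !in_itv /= lerN2 lerN2 andbC.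
rewrite -[LHS]ge0_integral_pushforward //=.
  by apply: eq_measure_integral => //= A mA _; exact: lebesgue_measureN.
exact: measurable_funTS.
Qed.

Definition per1 {W : Type} (f : R -> W) := forall x, f (x + 1) = f x.

Lemma per1_int {W : Type} (f : R -> W) (z : int) x : per1 f -> f (x + z%:~R) = f x.
Proof.
move=> pf; have pn (n : nat) y : f (y + n%:R) = f y.
  elim: n y => [|n IH] y; first by rewrite addr0.
  by rewrite -natr1 addrA pf IH.
case: z => n; first exact: pn.
by rewrite NegzE mulrNz -(pn n.+1) subrK.
Qed.

Lemma integral_mu1 (f : R -> \bar R) :
  measurable_fun setT f -> (forall x, 0 <= f x)%E ->
  (\int[mu1]_x f x = \int[lam]_(x in `[0%R, 1%R[) f x)%E.
Proof.
move=> mf f0; rewrite /mu1 integral_mrestr // -integral_itv_bndo_bndc //.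
exact: measurable_funTS.
Qed.

(** Some integer n lies in [a, a + 1[. Periodicity moves the piece over [a, n[ to [a + 1, n + 1[,
    which leaves the integral over [n, n + 1[, and a translation by n leads to [0, 1[. *)
Lemma integral_itv_per1 (a : R) (f : R -> \bar R) :
  measurable_fun setT f -> (forall x, 0 <= f x)%E -> per1 f ->
  (\int[lam]_(x in `[a, (a + 1)%R[) f x = \int[lam]_(x in `[0%R, 1%R[) f x)%E.
Proof.
move=> mf f0 pf; pose n : R := (Num.ceil a)%:~R.
have an : a <= n by exact: Num.Theory.ceil_ge.
have na : n < a + 1 by rewrite -ltrBlDr; have := Num.Theory.gt_pred_ceil a; rewrite intrB.
have split3 (s t r : R) : s <= t -> t <= r ->
   (\int[lam]_(x in `[s, r[) f x =
    \int[lam]_(x in `[s, t[) f x + \int[lam]_(x in `[t, r[) f x)%E.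
  move=> st tr; rewrite (@itv_bndbnd_setU _ _ _ (BLeft t)) //.
  rewrite ge0_integral_setU //=; first exact: measurable_funTS.
  apply/disj_setPS => y [/=]; rewrite !in_itv /= => /andP[_ yt] /andP[ty _].
  by move: (lt_le_trans yt ty); rewrite ltxx.
have -> : (\int[lam]_(x in `[a, (a + 1)%R[) f x =
   \int[lam]_(x in `[n, (n + 1)%R[) f x)%E.
  have -> := split3 a n (a + 1) an (ltW na).
  have -> := split3 n (a + 1) (n + 1) (ltW na); last by rewrite lerD2r.
  rewrite addeC; congr (_ + _)%E; rewrite -integral_itv_shift //.
  by apply: eq_integral => x _; rewrite pf.
transitivity (\int[lam]_(x in `[0%R, 1%R[) f (x + n)%R)%E.
  by rewrite integral_itv_shift // add0r [(1 + n)%R]addrC.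
by apply: eq_integral => x _; rewrite per1_int.
Qed.

Lemma integral_mu1_shift (a : R) (f : R -> \bar R) :
  measurable_fun setT f -> (forall x, 0 <= f x)%E -> per1 f ->
  (\int[mu1]_x f (x + a)%R = \int[mu1]_x f x)%E.
Proof.
move=> mf f0 pf.
have mfa : measurable_fun setT (fun x : R => f (x + a)).
  by apply: measurableT_comp => //; exact: (@measurable_funD _ _ _ _ id (cst a)).
rewrite !integral_mu1 // integral_itv_shift // add0r [(1 + a)%R]addrC.
exact: integral_itv_per1.
Qed.

Lemma integral_mu1_opp (f : R -> \bar R) :
  measurable_fun setT f -> (forall x, 0 <= f x)%E -> per1 f ->
  (\int[mu1]_x f (- x)%R = \int[mu1]_x f x)%E.
Proof.
move=> mf f0 pf.
have mfa : measurable_fun setT (fun x : R => f (- x)) by exact: measurableT_comp.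
rewrite {1}/mu1 integral_mrestr // integral_itv_opp // oppr0.
rewrite -integral_itv_bndo_bndc; last exact: measurable_funTS.
have := @integral_itv_per1 (- 1) f mf f0 pf; rewrite addNr => ->.
by rewrite integral_mu1.
Qed.

End UnitInterval.

Section ProductInvariance.
Context d1 d2 (X : measurableType d1) (Y : measurableType d2) (R : realType).
Variables (m1 : {sigma_finite_measure set X -> \bar R})
  (m2 : {sigma_finite_measure set Y -> \bar R}).
Variables (s : X -> X) (t : Y -> Y) (f : X * Y -> \bar R).
Hypotheses (ms : measurable_fun setT s) (mt : measurable_fun setT t).
Hypotheses (mf : measurable_fun setT f) (f0 : forall z, (0 <= f z)%E).
Hypothesis fs : forall y, (\int[m1]_x f (s x, y) = \int[m1]_x f (x, y))%E.
Hypothesis ft : forall x, (\int[m2]_y f (x, t y) = \int[m2]_y f (x, y))%E.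

(** Tonelli in one order removes [t] from the inner integral, in the other order [s]. Applied twice,
    it passes the invariance of [mu1] to [mu3]. *)
Lemma integral_prod_invariant :
  (\int[m1 \x m2]_z f (s z.1, t z.2) = \int[m1 \x m2]_z f z)%E.
Proof.
have mst : measurable_fun setT (fun z : X * Y => f (s z.1, t z.2)).
  apply: measurableT_comp => //; apply: measurable_fun_pair.
    by apply: measurableT_comp => //.
  by apply: measurableT_comp => //.
rewrite fubini_tonelli1 // /fubini_F /=.
under eq_integral do rewrite ft.
have ms1 : measurable_fun setT (fun z : X * Y => f (s z.1, z.2)).
  apply: measurableT_comp => //; apply: measurable_fun_pair => //.
  by apply: measurableT_comp => //.
rewrite -[LHS](fubini_tonelli1 (fun z => f (s z.1, z.2))) //.
rewrite fubini_tonelli2 // /fubini_G /=.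
under eq_integral do rewrite fs.
by rewrite -[LHS](fubini_tonelli2 f).
Qed.

End ProductInvariance.

Section Torus.
Context {R : realType}.
Notation lam := (@lebesgue_measure R).

Definition mu2 := (@mu1 R \x @mu1 R)%E.
HB.instance Definition _ := Probability.on mu2.
Definition mu3 : set (mpoint3 R) -> \bar R := (@mu1 R \x @mu1 R \x @mu1 R)%E.
HB.instance Definition _ := Probability.on mu3.

(** The sections of C lie in B and are empty outside A, so the integral of section measures that
    defines the product only sees both factors where they agree. This is how restriction to the cell
    commutes with products. *)
Lemma product_measure_local d1 d2 (X : measurableType d1) (Y : measurableType d2)
  (m1 m1' : {measure set X -> \bar R}) (m2 m2' : {sigma_finite_measure set Y -> \bar R})
  (A : set X) (B : set Y) C : measurable A -> measurable C ->
  (forall D, measurable D -> D `<=` A -> m1' D = m1 D) ->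
  (forall D, measurable D -> D `<=` B -> m2' D = m2 D) -> C `<=` A `*` B ->
  (m1' \x m2')%E C = (m1 \x m2)%E C.
Proof.
move=> mA mC m1E m2E CAB.
have sB x : xsection C x `<=` B by move=> y; rewrite /xsection /= inE => /CAB[].
rewrite /product_measure1 /=.
have E x : m2' (xsection C x) = m2 (xsection C x).
  by apply: m2E => //; exact: measurable_xsection.
transitivity (\int[m1']_x m2 (xsection C x))%E; first exact: eq_integral.
have off (x : X) : x \notin A -> m2 (xsection C x) = 0%E.
  rewrite notin_setE => nA; rewrite (_ : xsection C x = set0) ?measure0 //.
  by apply/seteqP; split=> y //; rewrite /xsection /= inE => /CAB[].
have onA (m : {measure set X -> \bar R}) :
    (\int[m]_x m2 (xsection C x) = \int[m]_(x in A) m2 (xsection C x))%E.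
  rewrite [RHS]integral_mkcond; apply: eq_integral => x _; rewrite patchE.
  by case: ifPn => // /off.
by rewrite !onA; apply: eq_measure_integral => D mD DA; exact: m1E.
Qed.

Lemma mu1_sub (D : set (measurableTypeR R)) : measurable D ->
  D `<=` (`[0, 1]%classic : set R) -> mu1 D = lam D.
Proof. by move=> mD DI; rewrite /mu1 /mrestr setIidl. Qed.

Lemma measurable_cell : measurable (cell : set (mpoint3 R)).
Proof. by apply: measurableX => //; apply: measurableX. Qed.

Lemma mu3_sub (C : set (mpoint3 R)) : measurable C -> C `<=` cell ->
  mu3 C = lebesgue3 C.
Proof.
move=> mC Ccell.
apply: (@product_measure_local _ _ (measurableTypeR R * measurableTypeR R)%type
  (measurableTypeR R) (lam \x lam)%E mu2 lam mu1 (`[0, 1] `*` `[0, 1]) `[0, 1]%classic) => //.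
- exact: measurableX.
- move=> D mD DII.
  apply: (@product_measure_local _ _ (measurableTypeR R) (measurableTypeR R)
    lam mu1 lam mu1 `[0, 1]%classic `[0, 1]%classic) => //.
  + exact: mu1_sub.
  + exact: mu1_sub.
- exact: mu1_sub.
Qed.

Lemma mu3_cell : mu3 cell = 1%E.
Proof.
rewrite /mu3 /cell product_measure1E //; last exact: measurableX.
pose I : set (measurableTypeR R) := `[0, 1]%classic.
have E : mu1 I = 1%E by rewrite -mu1T /mu1 /mrestr setIid setTI.
transitivity (mu1 I * mu1 I * mu1 I)%E; first by congr (_ * _)%E; exact: product_measure1E.
by rewrite E !mule1.
Qed.

(** The bridge from the integrals of the statement to [mu3]. Positive and negative parts are treated
    separately, so no integrability is at stake. *)
Lemma integral_cell (f : mpoint3 R -> \bar R) : measurable_fun setT f ->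
  (\int[lebesgue3]_(x in cell) f x = \int[mu3]_x f x)%E.
Proof.
move=> mf.
transitivity (\int[mu3]_(x in cell) f x)%E.
  by apply: eq_measure_integral => A mA Acell; rewrite /= mu3_sub.
have cell0 : mu3 (~` cell) = 0%E.
  apply: etrans (@probability_setC _ _ _ mu3 cell measurable_cell) _.
  by have E : (1 - mu3 cell = 0)%E by rewrite mu3_cell subee.
rewrite integralE [RHS]integralE.
have E (g : mpoint3 R -> \bar R) : measurable_fun setT g -> (forall x, 0 <= g x)%E ->
    (\int[mu3]_(x in cell) g x = \int[mu3]_x g x)%E.
  move=> mg g0; 
  have mC : measurable (~` (cell : set (mpoint3 R))) by exact: measurableC measurable_cell.
  have := @ge0_negligible_integral _ _ _ mu3 setT (~` cell) g mC measurableT mg (fun x _ => g0 x) cell0.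
  by rewrite setDE setCK setTI => ->.
congr (_ - _)%E; apply: E.
- exact: measurable_funepos.
- by move=> x; exact: funepos_ge0.
- exact: measurable_funeneg.
- by move=> x; exact: funeneg_ge0.
Qed.

Lemma periodic3P {W : Type} (f : point3 R -> W) : periodic3 f <->
  [/\ forall x y z, f (x + 1, y, z) = f (x, y, z),
      forall x y z, f (x, y + 1, z) = f (x, y, z) &
      forall x y z, f (x, y, z + 1) = f (x, y, z)].
Proof.
have E0 (x y z : R) : (x, y, z) + basis3 ord0 = (x + 1, y, z).
  by rewrite (_ : _ + _ = (x + 1, y + 0, z + 0)) // !addr0.
have E1 (x y z : R) : (x, y, z) + basis3 (lift ord0 ord0) = (x, y + 1, z).
  by rewrite (_ : _ + _ = (x + 0, y + 1, z + 0)) // !addr0.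
have E2 (x y z : R) : (x, y, z) + basis3 (ord_max) = (x, y, z + 1).
  by rewrite (_ : _ + _ = (x + 0, y + 0, z + 1)) // !addr0.
split=> [pf|[p0 p1 p2] [[x y] z] i].
  by split=> x y z; [rewrite -E0 pf|rewrite -E1 pf|rewrite -E2 pf].
case: i => -[|[|[|//]]] lti.
- by rewrite (_ : Ordinal lti = ord0) ?E0 //; exact: val_inj.
- by rewrite (_ : Ordinal lti = lift ord0 ord0) ?E1 //; exact: val_inj.
- by rewrite (_ : Ordinal lti = ord_max) ?E2 //; exact: val_inj.
Qed.

Lemma measurable_add3 d (X : measurableType d) (f g : X -> mpoint3 R) :
  measurable_fun setT f -> measurable_fun setT g ->
  measurable_fun setT (fun x => (f x : point3 R) + g x : mpoint3 R).
Proof.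
move=> mf mg.
have m11 (k : X -> mpoint3 R) : measurable_fun setT k -> measurable_fun setT (fun x => (k x).1.1).
  by move=> mk; do 2 apply: (measurableT_comp measurable_fst).
have m12 (k : X -> mpoint3 R) : measurable_fun setT k -> measurable_fun setT (fun x => (k x).1.2).
  by move=> mk; apply: (measurableT_comp measurable_snd); apply: (measurableT_comp measurable_fst).
have m2 (k : X -> mpoint3 R) : measurable_fun setT k -> measurable_fun setT (fun x => (k x).2).
  by move=> mk; apply: (measurableT_comp measurable_snd).
have -> : (fun x => (f x : point3 R) + g x : mpoint3 R) =
   (fun x => ((f x).1.1 + (g x).1.1, (f x).1.2 + (g x).1.2, (f x).2 + (g x).2)) by [].
apply: measurable_fun_pair; last by apply: measurable_funD; apply: m2.
by apply: measurable_fun_pair; apply: measurable_funD; [apply: m11|apply: m11|apply: m12|apply: m12].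
Qed.

Lemma measurable_opp3 d (X : measurableType d) (f : X -> mpoint3 R) :
  measurable_fun setT f -> measurable_fun setT (fun x => - (f x : point3 R) : mpoint3 R).
Proof.
move=> mf.
have -> : (fun x => - (f x : point3 R) : mpoint3 R) =
   (fun x => (- (f x).1.1, - (f x).1.2, - (f x).2)) by [].
apply: measurable_fun_pair; last first.
  by apply: measurable_funN; apply: (measurableT_comp measurable_snd).
by apply: measurable_fun_pair; apply: measurable_funN; [
  apply: (measurableT_comp measurable_fst)|apply: (measurableT_comp measurable_snd)];
  apply: (measurableT_comp measurable_fst).
Qed.

Lemma measurable_sub3 d (X : measurableType d) (f g : X -> mpoint3 R) :
  measurable_fun setT f -> measurable_fun setT g ->
  measurable_fun setT (fun x => (f x : point3 R) - g x : mpoint3 R).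
Proof. by move=> mf mg; apply: measurable_add3 => //; exact: measurable_opp3. Qed.

Lemma ge0_integral_mu3_shift (h : point3 R) (f : mpoint3 R -> \bar R) :
  measurable_fun setT f -> (forall x, 0 <= f x)%E -> periodic3 f ->
  (\int[mu3]_x f ((x : point3 R) + h)%R = \int[mu3]_x f x)%E.
Proof.
move=> mf f0 /periodic3P[p0 p1 p2]; case: h => -[a b] c.
have mD (e : R) : measurable_fun setT (fun x : measurableTypeR R => x + e).
  exact: (@measurable_funD _ _ _ _ id (cst e)).
have mpair (e e' : R) : measurable_fun setT
    (fun z : measurableTypeR R * measurableTypeR R => (z.1 + e, z.2 + e')).
  apply: measurable_fun_pair.
    by apply: (measurableT_comp (mD e)).
  by apply: (measurableT_comp (mD e')).
apply: (@integral_prod_invariant _ _ _ _ R mu2 mu1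
  (fun z => (z.1 + a, z.2 + b)) (fun x => x + c) f) => //.
- exact: mpair.
- exact: mD.
  move=> z; apply: (@integral_prod_invariant _ _ _ _ R mu1 mu1
    (fun x => x + a) (fun x => x + b) (fun w => f (w, z))) => //.
  - exact: mD.
  - exact: mD.
  - by apply: (measurableT_comp mf); apply: measurable_fun_pair.
  - move=> y; apply: (@integral_mu1_shift R a (fun x => f (x, y, z))) => //.
      by apply: (measurableT_comp mf); apply: measurable_fun_pair => //; apply: measurable_fun_pair.
  - move=> x; apply: (@integral_mu1_shift R b (fun y => f (x, y, z))) => //.
      by apply: (measurableT_comp mf); apply: measurable_fun_pair => //; apply: measurable_fun_pair.
move=> [x y]; apply: (@integral_mu1_shift R c (fun z => f (x, y, z))) => //.
  by apply: (measurableT_comp mf); apply: measurable_fun_pair.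
Qed.

Lemma ge0_integral_mu3_opp (f : mpoint3 R -> \bar R) :
  measurable_fun setT f -> (forall x, 0 <= f x)%E -> periodic3 f ->
  (\int[mu3]_x f (- (x : point3 R))%R = \int[mu3]_x f x)%E.
Proof.
move=> mf f0 /periodic3P[p0 p1 p2].
have mN : measurable_fun setT (fun x : measurableTypeR R => - x).
  exact: (@measurable_funN _ _ _ _ id).
have mpair : measurable_fun setT
    (fun z : measurableTypeR R * measurableTypeR R => (- z.1, - z.2)).
  by apply: measurable_fun_pair; apply: (measurableT_comp mN).
apply: (@integral_prod_invariant _ _ _ _ R mu2 mu1
  (fun z => (- z.1, - z.2)) (fun x => - x) f) => //.
  move=> z; apply: (@integral_prod_invariant _ _ _ _ R mu1 mu1
    (fun x => - x) (fun x => - x) (fun w => f (w, z))) => //.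
  - by apply: (measurableT_comp mf); apply: measurable_fun_pair.
  - move=> y; apply: (@integral_mu1_opp R (fun x => f (x, y, z))) => //.
      by apply: (measurableT_comp mf); apply: measurable_fun_pair => //; apply: measurable_fun_pair.
  - move=> x; apply: (@integral_mu1_opp R (fun y => f (x, y, z))) => //.
      by apply: (measurableT_comp mf); apply: measurable_fun_pair => //; apply: measurable_fun_pair.
move=> [x y]; apply: (@integral_mu1_opp R (fun z => f (x, y, z))) => //.
  by apply: (measurableT_comp mf); apply: measurable_fun_pair.
Qed.

Lemma integral_mu3_shift (h : point3 R) (f : mpoint3 R -> \bar R) :
  measurable_fun setT f -> periodic3 f ->
  (\int[mu3]_x f ((x : point3 R) + h)%R = \int[mu3]_x f x)%E.
Proof.
move=> mf pf; rewrite integralE [RHS]integralE; congr (_ - _)%E.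
  transitivity (\int[mu3]_x (f^\+ ((x : point3 R) + h)%R))%E.
    by apply: eq_integral => x _; rewrite !funeposE.
  apply: (@ge0_integral_mu3_shift h (f^\+)%E) => //; first exact: measurable_funepos.
  by move=> x i; rewrite !funeposE pf.
transitivity (\int[mu3]_x (f^\- ((x : point3 R) + h)%R))%E.
    by apply: eq_integral => x _; rewrite !funenegE.
  apply: (@ge0_integral_mu3_shift h (f^\-)%E) => //; first exact: measurable_funeneg.
by move=> x i; rewrite !funenegE pf.
Qed.

Lemma integral_mu3_sub (h : point3 R) (f : mpoint3 R -> \bar R) :
  measurable_fun setT f -> periodic3 f ->
  (\int[mu3]_x f (h - (x : point3 R))%R = \int[mu3]_x f x)%E.
Proof.
move=> mf pf.
have mfh : measurable_fun setT (fun x : mpoint3 R => f (h - (x : point3 R)) : \bar R).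
  by apply: (measurableT_comp mf); apply: measurable_sub3.
have mfh' : measurable_fun setT (fun x : mpoint3 R => f (h + (x : point3 R)) : \bar R).
  by apply: (measurableT_comp mf); apply: measurable_add3.
have E (g : mpoint3 R -> \bar R) : measurable_fun setT g -> (forall x, 0 <= g x)%E ->
    periodic3 g -> (\int[mu3]_x g (h - (x : point3 R))%R = \int[mu3]_x g x)%E.
  move=> mg g0 pg.
  rewrite (@ge0_integral_mu3_opp (fun x => g (h + x))) //.
  - by under eq_integral do rewrite addrC; exact: ge0_integral_mu3_shift.
  - by apply: (measurableT_comp mg); apply: measurable_add3.
  - by move=> x i; rewrite addrA pg.
rewrite integralE [RHS]integralE; congr (_ - _)%E.
  transitivity (\int[mu3]_x (f^\+ (h - (x : point3 R))%R))%E.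
    by apply: eq_integral => x _; rewrite !funeposE.
  apply: (E (f^\+)%E) => //; first exact: measurable_funepos.
  by move=> x i; rewrite !funeposE pf.
transitivity (\int[mu3]_x (f^\- (h - (x : point3 R))%R))%E.
    by apply: eq_integral => x _; rewrite !funenegE.
  apply: (E (f^\-)%E) => //; first exact: measurable_funeneg.
by move=> x i; rewrite !funenegE pf.
Qed.

End Torus.

(** * Real-valued integrals *)

Section RealIntegral.
Context d (T : measurableType d) (R : realType) (mu : {measure set T -> \bar R}).
Implicit Types f g h : T -> R.

Definition integ f := mu.-integrable setT (EFin \o f).

Lemma integ_meas f : integ f -> measurable_fun setT f.
Proof. by move=> /integrableP[/measurable_EFinP]. Qed.

Lemma integ_le f g : measurable_fun setT f -> integ g ->
  (forall x, `|f x| <= g x) -> integ f.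
Proof.
move=> mf ig fg; apply: (le_integrable measurableT _ _ ig).
  exact/measurable_EFinP.
by move=> x _ /=; rewrite lee_fin (le_trans (fg x)) // ler_norm.
Qed.

Lemma integ_abs f : integ f -> integ (fun x => `|f x|).
Proof.
move=> i; apply: (le_integrable measurableT _ _ i) => [|x _ /=].
  by apply/measurable_EFinP; apply: measurableT_comp => //; exact: integ_meas.
by rewrite lee_fin normr_id.
Qed.

Lemma integD f g : integ f -> integ g -> integ (fun x => f x + g x).
Proof. by move=> i j; have := integrableD measurableT i j. Qed.

Lemma integZ k f : integ f -> integ (fun x => k * f x).
Proof. by move=> i; have := integrableZl measurableT k i. Qed.

Lemma integN f : integ f -> integ (fun x => - f x).
Proof. by move=> i; have := integrableN i. Qed.

Lemma integB f g : integ f -> integ g -> integ (fun x => f x - g x).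
Proof. by move=> i j; apply: integD => //; exact: integN. Qed.

Lemma integ0 : integ (fun _ => 0).
Proof. exact: integrable0. Qed.

Lemma integ_sum I (s : seq I) (P : pred I) (F : I -> T -> R) :
  (forall i, integ (F i)) -> integ (fun x => \sum_(i <- s | P i) F i x).
Proof.
move=> iF; elim: s => [|i s IH].
  by under eq_fun do rewrite big_nil; exact: integ0.
have [Pi|Pi] := boolP (P i).
  by under eq_fun do rewrite big_cons Pi; exact: integD.
by under eq_fun do rewrite big_cons (negbTE Pi).
Qed.

Lemma eq_integ f g : f =1 g -> integ f -> integ g.
Proof. by move=> /funext ->. Qed.

Lemma RintD f g : integ f -> integ g ->
  \int[mu]_x (f x + g x) = \int[mu]_x f x + \int[mu]_x g x.
Proof. exact: RintegralD. Qed.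

Lemma RintB f g : integ f -> integ g ->
  \int[mu]_x (f x - g x) = \int[mu]_x f x - \int[mu]_x g x.
Proof. exact: RintegralB. Qed.

Lemma RintZ k f : integ f -> \int[mu]_x (k * f x) = k * \int[mu]_x f x.
Proof. exact: RintegralZl. Qed.

Lemma Rint0 : \int[mu]_x 0 = 0.
Proof. by rewrite /Rintegral integral0. Qed.

Lemma eq_Rint f g : f =1 g -> \int[mu]_x f x = \int[mu]_x g x.
Proof. by move=> fg; apply: eq_Rintegral => x _. Qed.

Lemma RintN f : integ f -> \int[mu]_x (- f x) = - \int[mu]_x f x.
Proof.
by move=> i; rewrite -mulN1r -RintZ //; apply: eq_Rint => x; rewrite mulN1r.
Qed.

Lemma Rint_sum I (s : seq I) (P : pred I) (F : I -> T -> R) :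
  (forall i, integ (F i)) ->
  \int[mu]_x (\sum_(i <- s | P i) F i x) = \sum_(i <- s | P i) \int[mu]_x F i x.
Proof.
move=> iF; elim: s => [|i s IH].
  by rewrite big_nil -[RHS]Rint0; apply: eq_Rint => x; rewrite big_nil.
rewrite big_cons; have [Pi|Pi] := boolP (P i).
  rewrite -IH -RintD //; last exact: integ_sum.
  by apply: eq_Rint => x; rewrite big_cons Pi.
by rewrite -IH; apply: eq_Rint => x; rewrite big_cons (negbTE Pi).
Qed.

Lemma Rint_le f g : integ f -> integ g -> (forall x, f x <= g x) ->
  \int[mu]_x f x <= \int[mu]_x g x.
Proof. by move=> fi gi fg; apply: le_Rintegral. Qed.

Lemma Rint_ge0 f : (forall x, 0 <= f x) -> 0 <= \int[mu]_x f x.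
Proof. by move=> f0; apply: Rintegral_ge0. Qed.

Lemma Rint_abs f : integ f -> `|\int[mu]_x f x| <= \int[mu]_x `|f x|.
Proof. by move=> i; apply: le_normr_Rintegral. Qed.

Lemma EFin_Rint f : integ f -> (\int[mu]_x f x)%:E = (\int[mu]_x (f x)%:E)%E.
Proof. by move=> i; rewrite /Rintegral fineK //; exact: integrable_fin_num. Qed.

Lemma ge0_integ f : measurable_fun setT f -> (forall x, 0 <= f x) ->
  (\int[mu]_x (f x)%:E < +oo)%E -> integ f.
Proof.
move=> mf f0 fy; apply/integrableP; split; first exact/measurable_EFinP.
by under eq_integral do rewrite /= ger0_norm //.
Qed.

Lemma ae_eq_Rint f g : measurable_fun setT f -> measurable_fun setT g ->
  {ae mu, forall x, f x = g x} -> \int[mu]_x f x = \int[mu]_x g x.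
Proof.
move=> mf mg fg; rewrite /Rintegral; congr fine.
apply: ae_eq_integral => //; try exact/measurable_EFinP.
by apply: filterS fg => x /= -> _.
Qed.

(** Replacing g by max(f, g), which equals g almost everywhere, turns the inequality into a
    pointwise one. *)
Lemma ae_Rint_le f g : integ f -> integ g -> {ae mu, forall x, f x <= g x} ->
  \int[mu]_x f x <= \int[mu]_x g x.
Proof.
move=> fi gi fg; have mf := integ_meas fi; have mg := integ_meas gi.
have mM : measurable_fun setT (fun x => Num.max (f x) (g x)) by exact: measurable_maxr.
rewrite (@ae_eq_Rint g (fun x => Num.max (f x) (g x))) //; last first.
  by apply: filterS fg => x fg; rewrite max_r.
apply: Rint_le => // [|x]; last by rewrite le_max lexx.
apply: (@integ_le _ (fun x => `|f x| + `|g x|)) => //.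
  by apply: integD; exact: integ_abs.
by move=> x; case: (leP (f x) (g x)) => _; rewrite ?lerDl ?lerDr.
Qed.

Lemma integ_mul_bounded f g M : measurable_fun setT f -> (forall x, `|f x| <= M) ->
  integ g -> integ (fun x => f x * g x).
Proof.
move=> mf fM ig; apply: (@integ_le _ (fun x => M * `|g x|)).
- by apply: measurable_funM => //; exact: integ_meas ig.
- by apply: integZ; exact: integ_abs.
- by move=> x; rewrite normrM ler_wpM2r.
Qed.

End RealIntegral.

Section FiniteIntegral.
Context d (T : measurableType d) (R : realType) (mu : {finite_measure set T -> \bar R}).
Implicit Types f g h : T -> R.

Lemma integ_cst (k : R) : integ mu (fun _ => k).
Proof.
exact: finite_measure_integrable_cst.
Qed.

Lemma integ_bounded f M : measurable_fun setT f -> (forall x, `|f x| <= M) -> integ mu f.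
Proof. by move=> mf fM; apply: (integ_le mf (integ_cst M)). Qed.

End FiniteIntegral.

Lemma Rint_cst d (T : measurableType d) (R : realType) (mu : probability T R) (k : R) :
  \int[mu]_x k = k.
Proof.
have := @Rintegral_cst _ _ _ mu setT measurableT k.
have -> : fine (mu setT) = 1 by have -> : mu setT = 1%E by exact: probability_setT.
by rewrite mulr1.
Qed.

Lemma Rint_dct d (T : measurableType d) (R : realType) (mu : {measure set T -> \bar R})
    (F : nat -> T -> R) (f g : T -> R) :
  (forall n, measurable_fun setT (F n)) -> measurable_fun setT f ->
  {ae mu, forall x, F n x @[n --> \oo] --> f x} -> integ mu g ->
  {ae mu, forall x, forall n, `|F n x| <= g x} ->
  integ mu f /\ \int[mu]_x F n x @[n --> \oo] --> \int[mu]_x f x.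
Proof.
move=> mF mf Ff ig Fg.
have [||||fi _] := @dominated_convergence _ _ _ mu setT measurableT
  (fun n => EFin \o F n) (EFin \o f) (EFin \o g) _ _ _ ig _.
- by move=> n; exact/measurable_EFinP.
- exact/measurable_EFinP.
- by apply: filterS Ff => x Fx _; apply: cvg_EFin => //; exact: nearW.
- by apply: filterS Fg => x Fx n _; rewrite /= lee_fin.
move=> cv; split=> //; apply: fine_cvg.
by rewrite fineK //; exact: integrable_fin_num.
Qed.

Section FubiniReal.
Context d1 d2 (X : measurableType d1) (Y : measurableType d2) (R : realType).
Variables (m1 : {sigma_finite_measure set X -> \bar R})
  (m2 : {sigma_finite_measure set Y -> \bar R}).
Implicit Type h : X * Y -> R.

(** The extended integral is a difference of two Tonelli integrals, each measurable in x; [fine]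
    then gives infinite values the default 0 in a measurable way. *)
Lemma measurable_Rint h : measurable_fun setT h ->
  measurable_fun setT (fun x => \int[m2]_y h (x, y)).
Proof.
move=> mh; have mH : measurable_fun setT (EFin \o h) by exact/measurable_EFinP.
apply: (measurableT_comp (@fine_measurable R setT measurableT)) => /=.
have -> : (fun x => \int[m2]_y (h (x, y))%:E)%E =
    (fun x => \int[m2]_y ((EFin \o h)^\+ (x, y)) - \int[m2]_y ((EFin \o h)^\- (x, y)))%E.
  by apply/funext => x; rewrite integralE; congr (_ - _)%E; apply: eq_integral => y _;
    rewrite ?funeposE ?funenegE.
apply: emeasurable_funB.
  apply: (@measurable_fun_fubini_tonelli_F _ _ _ _ _ m2 ((EFin \o h)^\+)%E) => //.
  exact: measurable_funepos.
apply: (@measurable_fun_fubini_tonelli_F _ _ _ _ _ m2 ((EFin \o h)^\-)%E) => //.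
exact: measurable_funeneg.
Qed.

Lemma integ_Rint h : integ (m1 \x m2)%E h -> integ m1 (fun x => \int[m2]_y h (x, y)).
Proof.
move=> ih; have iF := integrable_fubini_F ih.
have mh := integ_meas ih.
apply: (le_integrable measurableT _ _ iF).
  by apply/measurable_EFinP; exact: measurable_Rint.
move=> x _; rewrite /= /Rintegral /fubini_F /=.
by case: (\int[m2]_y (h (x, y))%:E)%E => [r| |] //=; rewrite ?leey // normr0.
Qed.

(** The slices of h are integrable for almost every x only; there [fine] loses nothing, and the
    remaining x form a null set. *)
Lemma Rint_prod h : integ (m1 \x m2)%E h ->
  \int[m1]_x \int[m2]_y h (x, y) = \int[(m1 \x m2)%E]_z h z.
Proof.
move=> ih; rewrite [in RHS]/Rintegral -integral12_prod_meas1 //.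
rewrite [LHS]/Rintegral; congr fine.
have iF := integrable_fubini_F ih.
apply: ae_eq_integral => //.
- by apply/measurable_EFinP/measurable_Rint; exact: integ_meas ih.
- by case/integrableP: iF.
have := ae_integrable1 ih.
apply: filterS => x ix _; rewrite /fubini_F /= /Rintegral fineK //.
exact: integrable_fin_num.
Qed.

Lemma Rint_prod2 h : integ (m1 \x m2)%E h ->
  \int[m2]_y \int[m1]_x h (x, y) = \int[(m1 \x m2)%E]_z h z.
Proof.
move=> ih; rewrite [in RHS]/Rintegral -integral21_prod_meas1 //.
rewrite [LHS]/Rintegral; congr fine.
have mh := integ_meas ih.
apply: ae_eq_integral => //.
- apply/measurable_EFinP.
  apply: (measurableT_comp (@fine_measurable R setT measurableT)) => /=.
  exact: measurable_fubini_G ih.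
- exact: measurable_fubini_G ih.
have := ae_integrable2 ih.
apply: filterS => x ix _; rewrite /fubini_G /= /Rintegral fineK //.
exact: integrable_fin_num.
Qed.

Lemma Rint_swap h : integ (m1 \x m2)%E h ->
  \int[m1]_x \int[m2]_y h (x, y) = \int[m2]_y \int[m1]_x h (x, y).
Proof. by move=> ih; rewrite Rint_prod // Rint_prod2. Qed.

Lemma integ_prod h (k : X -> Y -> R) : measurable_fun setT h -> (forall x y, `|h (x, y)| <= k x y) ->
  (forall x, integ m2 (k x)) -> integ m1 (fun x => \int[m2]_y k x y) ->
  integ (m1 \x m2)%E h.
Proof.
move=> mh hk ik iK; have mH : measurable_fun setT (EFin \o h) by exact/measurable_EFinP.
apply/(integrable12ltyP m1 m2 mH).
have iA x : integ m2 (fun y => `|h (x, y)|).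
  apply: (integ_le _ (ik x)) => [|y]; last by rewrite normr_id.
  by apply: measurableT_comp => //; apply: (measurableT_comp mh); exact: measurable_fun_pair.
apply: (@le_lt_trans _ _ (\int[m1]_x (\int[m2]_y k x y)%:E)%E); last first.
  by have /integrableP[_] := iK; apply: le_lt_trans; apply: le_integral => //;
     [exact: integ_abs|move=> x _; rewrite /= lee_fin ler_norm].
apply: ge0_le_integral => //.
- by move=> x _; apply: integral_ge0.
- apply: (@measurable_fun_fubini_tonelli_F _ _ _ _ _ m2 (fun z => `|(h z)%:E|%E)) => //.
  exact: measurableT_comp.
- by apply/measurable_EFinP; exact: integ_meas iK.
move=> x _; rewrite -(EFin_Rint (iA x)) lee_fin; apply: Rint_le => // y; exact: hk.
Qed.

End FubiniReal.

(** * Smooth functions *)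

Section Smooth.
Context {R : realType}.
Implicit Types V W : normedModType R.

(** Smoothness speaks of all iterated derivatives at once. It is proved by exhibiting a class of
    continuous derivable functions stable under every directional derivative; the closure properties
    below only differ in the choice of the class. *)
Lemma smooth_coind V W (P : (V -> W) -> Prop) :
  (forall f, P f -> [/\ continuous f, forall x v, derivable f x v & forall v, P ('D_v f)]) ->
  forall f, P f -> smooth f.
Proof.
move=> HP f Pf vs; suff Pvs : P (iter_derive vs f) by have [] := HP _ Pvs.
by elim: vs => [//|v vs IH] /=; have [] := HP _ IH.
Qed.

Lemma smooth_continuous V W (f : V -> W) : smooth f -> continuous f.
Proof. by move=> /(_ [::])[]. Qed.

Lemma smooth_derivable V W (f : V -> W) x v : smooth f -> derivable f x v.
Proof. by move=> /(_ [::])[]. Qed.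

Arguments smooth_derivable {V W f} x v _.

Lemma smooth_derive V W (f : V -> W) v : smooth f -> smooth ('D_v f).
Proof.
move=> sf vs; have := sf (rcons vs v).
by rewrite /iter_derive foldr_rcons.
Qed.

Arguments smooth_derive {V W f} v _.

Lemma smoothD V W (f g : V -> W) : smooth f -> smooth g -> smooth (fun x => f x + g x).
Proof.
move=> sf sg.
apply: (@smooth_coind _ _ (fun h => exists f g, [/\ smooth f, smooth g & h = f + g])).
  move=> _ [{}f [{}g [{}sf {}sg ->]]]; split.
  - by move=> x; apply: cvgD; apply: smooth_continuous.
  - by move=> x v; apply: derivableD; exact: smooth_derivable.
  move=> v; exists ('D_v f), ('D_v g); split; try exact: smooth_derive.
  by apply/funext => x; rewrite deriveD //; exact: smooth_derivable.
by exists f, g.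
Qed.

Lemma smooth_cst V W (c : W) : smooth (fun _ : V => c).
Proof.
apply: (@smooth_coind _ _ (fun h => exists c, h = cst c)); last by exists c.
move=> _ [{}c ->]; split; [move=> x; exact: cvg_cst|by move=> x v; exact: derivable_cst|].
by move=> v; exists 0; apply/funext => x; rewrite derive_cst.
Qed.

Lemma smoothZ V W (k : R) (f : V -> W) : smooth f -> smooth (fun x => k *: f x).
Proof.
move=> sf.
apply: (@smooth_coind _ _ (fun h => exists2 f, smooth f & h = k \*: f)); last by exists f.
move=> _ [{}f {}sf ->]; split.
- by move=> x; apply: cvgZr; apply: smooth_continuous.
- by move=> x v; apply: derivableZ; exact: smooth_derivable.
move=> v; exists ('D_v f); first exact: smooth_derive.
by apply/funext => x; rewrite deriveZ //; exact: smooth_derivable.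
Qed.

Lemma smoothN V W (f : V -> W) : smooth f -> smooth (fun x => - f x).
Proof.
by move=> sf; under eq_fun do rewrite -scaleN1r; exact: smoothZ.
Qed.

(** Products of smooth functions are not stable under derivation, but by the Leibniz rule their
    finite sums are. *)
Inductive smooth_products V : (V -> R) -> Prop :=
| SmoothProduct (f g : V -> R) : smooth f -> smooth g -> smooth_products (f * g)
| SmoothProductD (f g : V -> R) : smooth_products f -> smooth_products g -> smooth_products (f + g).

Lemma smoothM V (f g : V -> R) : smooth f -> smooth g -> smooth (fun x => f x * g x).
Proof.
move=> sf sg; apply: (@smooth_coind V _ (@smooth_products V)); last exact: SmoothProduct.
move=> h; elim=> {h} [f1 g1 {}sf {}sg|f1 g1 _ [cf df Df] _ [cg dg Dg]]; split.
- by move=> x; exact: (cvgM (smooth_continuous sf (x:=x)) (smooth_continuous sg (x:=x))).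
- by move=> x v; exact: (derivableM (smooth_derivable x v sf) (smooth_derivable x v sg)).
- move=> v; have -> : 'D_v (f1 * g1) = f1 * 'D_v g1 + g1 * 'D_v f1.
    by apply/funext => x; exact: (deriveM (smooth_derivable x v sf) (smooth_derivable x v sg)).
  exact: (SmoothProductD (SmoothProduct sf (smooth_derive v sg)) (SmoothProduct sg (smooth_derive v sf))).
- by move=> x; exact: (cvgD (cf x) (cg x)).
- by move=> x v; exact: (derivableD (df x v) (dg x v)).
move=> v; have -> : 'D_v (f1 + g1) = 'D_v f1 + 'D_v g1.
  by apply/funext => x; exact: (deriveD (df x v) (dg x v)).
exact: (SmoothProductD (Df v) (Dg v)).
Qed.

Section Affine.
Variables (V V' W : normedModType R) (L : V -> V') (l : V -> V').
Hypotheses (cL : continuous L) (LE : forall (h : R) v x, L (h *: v + x) = h *: l v + L x).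

(** [LE] says that L is affine with linear part l. The difference quotients of both sides are then
    literally the same function of h, so the chain rule does not enter. *)
Lemma derive_affine (f : V' -> W) v x : 'D_v (f \o L) x = 'D_(l v) f (L x).
Proof. by rewrite /derive /=; congr (lim _); under eq_fun do rewrite LE. Qed.

Lemma derivable_affine (f : V' -> W) v x :
  derivable f (L x) (l v) -> derivable (f \o L) x v.
Proof. by rewrite /derivable /=; under [in X in _ -> X]eq_fun do rewrite LE. Qed.

Lemma smooth_affine (f : V' -> W) : smooth f -> smooth (fun x => f (L x)).
Proof.
move=> sf.
apply: (@smooth_coind _ _ (fun h => exists2 f, smooth f & h = f \o L)); last by exists f.
move=> _ [{}f {}sf ->]; split.
- by move=> x; apply: continuous_comp; [exact: cL|apply: smooth_continuous].
- by move=> x v; apply: derivable_affine; exact: smooth_derivable.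
move=> v; exists ('D_(l v) f); first exact: smooth_derive.
by apply/funext => x; rewrite derive_affine.
Qed.

End Affine.

Lemma continuous_mx V m n (M : V -> 'M[R]_(m, n)) :
  (forall i j, continuous (fun x => M x i j)) -> continuous M.
Proof.
move=> cM x; apply/cvgrPdist_le => /= e e0; near=> y.
rewrite /Num.Def.normr /= mx_normrE (bigmax_le _ (ltW e0)) //= => i _.
rewrite !mxE; move: i; near: y; apply: filter_forall => /= i.
by have /cvgrPdist_le := cM i.1 i.2 x; exact.
Unshelve. all: by end_near. Qed.

Lemma derive_row V n (M : V -> 'rV[R]_n) v x i : (forall j, derivable (fun x => M x 0 j) x v) ->
  'D_v M x 0 i = 'D_v (fun x => M x 0 i) x.
Proof.
move=> dM; rewrite derive_mx ?mxE //; apply/derivable_mxP => k j.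
by rewrite (ord1 k).
Qed.

Lemma smooth_row V n (f : 'I_n -> V -> R) : (forall i, smooth (f i)) ->
  smooth (fun x => \row_i f i x).
Proof.
move=> sf.
apply: (@smooth_coind _ _ (fun h => exists2 f : 'I_n -> V -> R, forall i, smooth (f i) &
  h = fun x => \row_i f i x)); last by exists f.
move=> _ [{}f {}sf ->].
have dv x v : derivable (fun x => \row_i f i x) x v.
  by apply/derivable_mxP => i j; under eq_fun do rewrite mxE; exact: smooth_derivable.
split=> //.
  by apply: continuous_mx => i j x; under eq_fun do rewrite mxE; apply: smooth_continuous.
move=> v; exists (fun i => 'D_v (f i)); first by move=> i; exact: smooth_derive.
apply/funext => x; apply/rowP => i; rewrite derive_row ?mxE; last first.
  by move=> j; under eq_fun do rewrite mxE; exact: smooth_derivable.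
by congr ('D_v _ x); apply/funext => y; rewrite mxE.
Qed.

Lemma smooth_fst V V' W (f : V -> W) : smooth f -> smooth (fun z : V * V' => f z.1).
Proof.
apply: (@smooth_affine _ _ _ (fun z : V * V' => z.1) (fun z => z.1)) => //.
by move=> x; exact: cvg_fst.
Qed.

Lemma smooth_snd V V' W (f : V' -> W) : smooth f -> smooth (fun z : V * V' => f z.2).
Proof.
apply: (@smooth_affine _ _ _ (fun z : V * V' => z.2) (fun z => z.2)) => //.
by move=> x; exact: cvg_snd.
Qed.

Lemma derive_real (f : R -> R) (x v : R) : derivable f x 1 -> 'D_v f x = v * 'D_1 f x.
Proof.
move=> df; have /derivable1_diffP dif := df.
by rewrite !deriveE // -[in LHS](mulr1 v) -[v * 1]/(v *: 1) linearZ.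
Qed.

End Smooth.

Arguments smooth_derivable {R V W f} x v _.
Arguments smooth_derive {R V W f} v _.
Arguments smooth_continuous {R V W f} _.

Section Flat.
Context {R : realType}.
Implicit Type p : {poly R}.

(** The classical flat function exp(-1/x), multiplied by a polynomial in 1/x so that the family is
    stable under derivation. *)
Definition flat p (x : R) : R := if 0 < x then p.[x^-1] * expR (- x^-1) else 0.
(** With y = 1/x, the derivative of p(y) exp(-y) with respect to x is y^2 (p(y) - p'(y)) exp(-y). *)
Definition dflat p : {poly R} := 'X^2 * (p - p^`()).

Lemma horner_growth p : exists n : nat, exists2 C : R, 0 <= C &
  forall y, 1 <= y -> `|p.[y]| <= C * y ^+ n.
Proof.
elim/poly_ind: p => [|p c [n [C C0 pC]]].
  by exists 0%N, 0 => // y _; rewrite horner0 normr0 mul0r.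
exists n.+1, (C + `|c|) => [|y y1]; first by rewrite addr_ge0.
have y0 : 0 <= y by rewrite (le_trans _ y1).
rewrite hornerMXaddC (le_trans (ler_normD _ _)) // mulrDl lerD //.
  by rewrite normrM (ger0_norm y0) exprSr mulrA ler_wpM2r // pC.
by rewrite ler_peMr // exprn_ege1.
Qed.

(** With y = 1/x at least 1, a polynomial is O(y^n), and y^(n+2) is at most (n+2)! exp(y). The two
    spare powers of y become the factor x^2, which makes the difference quotient at 0 vanish in the
    limit. *)
Lemma flat_bound p : exists2 C : R, 0 <= C & forall x, x <= 1 -> `|flat p x| <= C * x ^+ 2.
Proof.
have [n [C C0 pC]] := horner_growth p.
exists (C * n.+2`!%:R) => [|x x1]; first by rewrite mulr_ge0.
rewrite /flat; case: ifPn => x0; last by rewrite normr0 mulr_ge0 ?sqr_ge0 // mulr_ge0.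
set y := x^-1; have y1 : 1 <= y by rewrite invf_ge1.
have y0 : 0 < y by rewrite invr_gt0.
rewrite normrM (ger0_norm (expR_ge0 _)).
apply: (le_trans (ler_wpM2r (expR_ge0 _) (pC y y1))).
rewrite -!mulrA ler_wpM2l // expRN ler_pdivrMr ?expR_gt0 //.
have := expR_ge1Dxn n.+1 (ltW y0); rewrite -(lerD2l (- 1)) addKr => H.
have {}H : y ^+ n.+2 <= n.+2`!%:R * expR y.
  have f0 : (0 : R) < n.+2`!%:R by rewrite ltr0n fact_gt0.
  rewrite mulrC -ler_pdivrMr //; apply: (le_trans H).
  by rewrite addrC lerBlDr lerDl.
have -> : y ^+ n = y ^+ n.+2 * x ^+ 2.
  by rewrite -addn2 exprD -mulrA -exprMn mulVf ?gt_eqF // expr1n mulr1.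
by rewrite [leRHS]mulrAC ler_wpM2r ?sqr_ge0.
Qed.

Lemma is_derive_flat p (x : R) : is_derive x 1 (flat p) (flat (dflat p) x).
Proof.
have [x0|x0|->] := ltgtP x 0.
- rewrite {2}/flat ltNge (ltW x0) /=.
  apply: (@near_eq_is_derive _ _ _ (cst 0)) => //.
  near=> y; rewrite /flat ifF //; apply/negbTE; rewrite -leNgt ltW //.
  by near: y; exact: lt_nbhsl.
- have xn0 : x != 0 by rewrite gt_eqF.
  have di : is_derive x 1 (fun y : R => y^-1) (- x ^- 2).
    have := is_deriveV xn0 (is_derive_id x (1 : R)).
    by rewrite /GRing.scale /= mulr1.
  have dp : is_derive x 1 (fun y => p.[y^-1]) (p^`().[x^-1] * - x ^- 2).
    exact: (@is_derive1_comp _ (horner p) _ _ _ _ (is_derive_poly p _) di).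
  have dN : is_derive x 1 (fun y : R => - y^-1) (- - x ^- 2) by exact: is_deriveN.
  have de : is_derive x 1 (fun y => expR (- y^-1)) (expR (- x^-1) * - - x ^- 2).
    exact: (@is_derive1_comp _ expR _ _ _ _ (is_derive_expR _) dN).
  have dM := is_deriveM dp de.
  rewrite {2}/flat x0.
  apply: (@near_eq_is_derive _ _ _ ((fun y => p.[y^-1]) * (fun y => expR (- y^-1)))) => //.
    near=> y; rewrite /flat ifT //.
    by near: y; exact: lt_nbhsr.
  apply: (@is_derive_eq _ _ _ _ _ _ _ _ dM).
  rewrite /dflat !hornerE /GRing.scale /= exprVn; ring.
- rewrite {2}/flat ltxx.
  have [C C0 fC] := flat_bound p.
  have H : (h^-1 *: ((flat p \o shift 0) (h *: 1) - flat p 0)) @[h --> 0^'] --> (0 : R).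
    apply/cvgrPdist_le => /= e e0; near=> h.
    have h0 : h != 0 by near: h; exact: nbhs_dnbhs_neq.
    rewrite sub0r normrN addr0 [flat p 0]/flat ltxx subr0.
    rewrite -[h *: 1]/(h * 1) mulr1 -[_ *: _]/(_ * _) normrM normfV.
    rewrite mulrC ler_pdivrMr ?normr_gt0 //.
    have h1 : h <= 1.
      by apply: (le_trans (ler_norm _)); near: h; apply: dnbhs0_le.
    apply: (le_trans (fC _ h1)); rewrite -[h ^+ 2]real_normK ?num_real // expr2 mulrA.
    rewrite ler_wpM2r // (@le_trans _ _ ((C + 1) * `|h|)) //.
      by rewrite ler_wpM2r // lerDl.
    rewrite mulrC -ler_pdivlMr ?ltr_wpDl //.
    by near: h; apply: dnbhs0_le; rewrite divr_gt0 // ltr_wpDl.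
  by split; [apply/cvg_ex; exists 0|apply: cvg_lim].
Unshelve. all: by end_near. Qed.

(** On the line the derivative in direction v is v times the one in direction 1. The scalar
    multiples of members of P are therefore stable under all directional derivatives. *)
Lemma smooth_real_coind (P : (R -> R) -> Prop) :
  (forall f, P f -> exists2 df, P df & forall x : R, is_derive x 1 f (df x)) ->
  forall f, P f -> smooth f.
Proof.
move=> HP f Pf.
apply: (@smooth_coind _ _ _ (fun g => exists2 k : R, exists2 f, P f & g = k \*: f & True)).
  move=> _ [k [{Pf}{}f /HP[df Pdf dfE] ->] _].
  have dif (x : R) : differentiable f x.
    by apply/derivable1_diffP; have [] := dfE x.
  have der x v : derivable f x v by exact: diff_derivable.
  split.
  - by move=> x; apply: cvgZr; exact: differentiable_continuous.
  - by move=> x v; exact: derivableZ.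
  - move=> v; exists (k * v) => //; exists df => //.
    apply/funext => x; rewrite deriveZ // derive_real //.
    have -> : 'D_1 f x = df x by have [] := dfE x.
      by rewrite /GRing.scale /= mulrA.
by exists 1 => //; exists f => //; apply/funext => x; rewrite /= scale1r.
Qed.

Lemma smooth_flat p : smooth (flat p).
Proof.
apply: (@smooth_real_coind (fun f => exists p, f = flat p)); last by exists p.
move=> _ [q ->]; exists (flat (dflat q)); first by exists (dflat q).
exact: is_derive_flat.
Qed.

Definition theta := flat 1.

Lemma theta_gt0 x : 0 < x -> 0 < theta x.
Proof. by move=> x0; rewrite /theta /flat x0 hornerC mul1r expR_gt0. Qed.

Lemma theta_le0 x : x <= 0 -> theta x = 0.
Proof. by move=> x0; rewrite /theta /flat ltNge x0. Qed.

Lemma theta_ge0 x : 0 <= theta x.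
Proof. by have [/theta_le0->|/theta_gt0/ltW] := leP x 0. Qed.

Definition bump0 (x : R) := theta x * theta (1 - x).

Lemma smooth_bump0 : smooth bump0.
Proof.
apply: smoothM; first exact: smooth_flat.
apply: (@smooth_affine _ _ _ _ (fun x : R => 1 - x) (fun v => - v)); last exact: smooth_flat.
  by move=> x; apply: cvgB; [exact: cvg_cst|exact: cvg_id].
by move=> h v x; rewrite opprD scalerN addrCA.
Qed.

Lemma bump0_ge0 x : 0 <= bump0 x.
Proof. by rewrite mulr_ge0 // theta_ge0. Qed.

Lemma bump0_out x : ~~ (0 < x < 1) -> bump0 x = 0.
Proof.
rewrite negb_and -!leNgt => /orP[x0|x1]; first by rewrite /bump0 theta_le0 ?mul0r.
by rewrite /bump0 [theta (1 - x)]theta_le0 ?mulr0 // subr_le0.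
Qed.

Lemma bump0_gt0 x : 0 < x < 1 -> 0 < bump0 x.
Proof. by move=> /andP[x0 x1]; rewrite mulr_gt0 // theta_gt0 // subr_gt0. Qed.

End Flat.

Section Bump.
Context {R : realType}.
Notation lam := (@lebesgue_measure R).

Lemma smooth_is_derive (f : R -> R) (x : R) : smooth f -> is_derive x 1 f ('D_1 f x).
Proof. by move=> sf; apply: derivableP; exact: smooth_derivable. Qed.

Lemma derive_real_smooth (f : R -> R) (x v : R) : smooth f -> 'D_v f x = v * 'D_1 f x.
Proof. by move=> sf; apply: derive_real; exact: smooth_derivable. Qed.

Lemma continuous_measurable (f : R -> R) : continuous f ->
  measurable_fun [set: measurableTypeR R] f.
Proof. exact: continuous_measurable_fun. Qed.

Lemma Rint_mu1 (f : R -> R) : measurable_fun setT f -> (forall x, 0 <= f x) ->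
  \int[mu1]_x f x = \int[lam]_(x in `[0, 1]) f x.
Proof.
move=> mf f0; rewrite /Rintegral /mu1 integral_mrestr //; exact/measurable_EFinP.
Qed.

(** Such an f may be unbounded on the line. Composed with the projection onto [0, 1] it becomes
    bounded, and it does not change where [mu1] lives. *)
Lemma continuous_integ_mu1 (f : R -> R) : continuous f -> integ mu1 f.
Proof.
move=> cf.
have /compact_bounded[M [_ fM]] : compact (f @` `[0, 1]%classic).
  by apply: continuous_compact; [exact: continuous_subspaceT|exact: segment_compact].
have {fM} fM (x : R) : x \in `[0, 1] -> `|f x| <= `|M| + 1.
  by move=> x01; apply: fM; [rewrite (le_lt_trans (ler_norm _)) // ltrDl|exists x].
pose g (x : R) := f (Num.min 1 (Num.max 0 x)).
have cg : continuous g.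
  move=> x; apply: continuous_comp; last exact: cf.
  by apply: continuous_min; [exact: cvg_cst|apply: continuous_max; [exact: cvg_cst|exact: cvg_id]].
have ig : integ mu1 g.
  apply: (@integ_bounded _ _ _ _ _ (`|M| + 1)); first exact: continuous_measurable.
  by move=> x; apply: fM; rewrite in_itv /= le_min ge_min lexx le_max lexx !ler01.
have mf := continuous_measurable cf.
apply/integrableP; split; first exact/measurable_EFinP.
have /integrableP[_] := ig; apply: le_lt_trans.
rewrite /mu1 !integral_mrestr //.
- apply: (@eq_ind _ _ (fun z => (z <= _)%E) (lexx _)); apply: eq_integral => x.
  rewrite inE /= in_itv /= => /andP[x0 x1]; by rewrite /g max_r // min_r.
- by apply: measurableT_comp => //; apply/measurable_EFinP; exact: integ_meas ig.
- by apply: measurableT_comp => //; exact/measurable_EFinP.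
Qed.

Definition bump_mass : R := \int[mu1]_x bump0 x.

(** A zero integral would make [bump0] vanish almost everywhere, but it is positive on ]0, 1[, a set
    of measure 1. *)
Lemma bump_mass_gt0 : 0 < bump_mass.
Proof.
have ib : integ mu1 (@bump0 R).
  by apply: continuous_integ_mu1; exact: smooth_continuous smooth_bump0.
have mb := integ_meas ib.
rewrite lt_neqAle Rint_ge0 ?andbT; last exact: bump0_ge0.
apply/eqP => /esym b0.
have := EFin_Rint ib; rewrite -/bump_mass b0 => /esym b00.
have : ae_eq mu1 setT (EFin \o @bump0 R) (cst 0%E).
  apply/(ae_eq_integral_abs _ measurableT); first exact/measurable_EFinP.
  by rewrite -[RHS]b00; apply: eq_integral => x _; rewrite /= ger0_norm // bump0_ge0.
move=> Z; have nI : mu1.-negligible (`]0, 1[%classic : set (measurableTypeR R)).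
  apply: negligibleS Z => x; rewrite /= in_itv /= => /bump0_gt0 + H.
  by have [->] := H I; rewrite ltxx.
have : mu1 (`]0, 1[%classic : set (measurableTypeR R)) = 0%E.
  by apply/negligibleP => //.
rewrite mu1_sub //; last by move=> x /=; exact: subset_itv_oo_cc.
rewrite lebesgue_measure_itv /= lte_fin ltr01 oppr0 adde0.
by move=> /eqP; rewrite eqe oner_eq0.
Qed.

Definition bump (x : R) := bump_mass^-1 * bump0 x.

Lemma smooth_bump : smooth bump.
Proof. exact: (smoothZ bump_mass^-1 smooth_bump0). Qed.

Lemma bump_ge0 x : 0 <= bump x.
Proof. by rewrite mulr_ge0 ?bump0_ge0 // invr_ge0 ltW // bump_mass_gt0. Qed.

Lemma bump_out x : ~~ (0 < x < 1) -> bump x = 0.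
Proof. by move=> /bump0_out bx; rewrite /bump bx mulr0. Qed.

Lemma measurable_bump : measurable_fun [set: measurableTypeR R] bump.
Proof. by apply: continuous_measurable; exact: smooth_continuous smooth_bump. Qed.

Lemma Rint_bump : \int[lam]_(x in `[0, 1]) bump x = 1.
Proof.
rewrite -Rint_mu1; [|exact: measurable_bump|exact: bump_ge0].
rewrite RintZ; first by rewrite mulVf // gt_eqF // bump_mass_gt0.
by apply: continuous_integ_mu1; exact: smooth_continuous smooth_bump0.
Qed.

Lemma integrable_bump (a b : R) : lam.-integrable `[a, b] (EFin \o bump).
Proof.
apply: continuous_compact_integrable; first exact: segment_compact.
by apply: continuous_subspaceT; exact: smooth_continuous smooth_bump.
Qed.

(** A smooth transition from 0 to 1 across [0, 1]. Starting the integral at -1 changes nothing in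
    the value and makes every x >= 0 an interior point for the fundamental theorem of calculus. *)
Definition step (x : R) : R := \int[lam]_(t in `[-1, x]) bump t.

Lemma step_le0 x : x <= 0 -> step x = 0.
Proof.
move=> x0; rewrite /step /Rintegral (eq_integral (fun=> 0%E)) ?integral0 // => t.
rewrite inE /= in_itv /= => /andP[_ tx]; rewrite bump_out // negb_and -!leNgt.
by rewrite (le_trans tx).
Qed.

Lemma step_ge1 x : 1 <= x -> step x = 1.
Proof.
move=> x1; rewrite -Rint_bump /step Rintegral_mkcond [RHS]Rintegral_mkcond.
apply: eq_Rint => t; rewrite !patchE !mem_setE !in_itv /=.
have [t01|t01] := boolP (0 < t < 1); last by rewrite bump_out // !if_same.
have /andP[t0 t1] := t01.
by rewrite (ltW t0) (ltW t1) (le_trans _ (ltW t0)) ?lerN10 // (le_trans (ltW t1)).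
Qed.

Lemma is_derive_step (x : R) : is_derive x 1 step (bump x).
Proof.
have [x0|x0] := ltP x 0.
  rewrite bump_out; last by rewrite negb_and -!leNgt (ltW x0).
  apply: (@near_eq_is_derive _ _ _ (cst 0)) => //.
  near=> y; rewrite step_le0 //= ltW //.
  by near: y; exact: lt_nbhsl.
have x1 : x < x + 1 by rewrite ltrDl.
have [||d dE] := @continuous_FTC1_closed R bump (-1) x (x + 1) x1 (integrable_bump _ _).
- by rewrite (lt_le_trans _ x0) // ltrN10.
- exact: smooth_continuous smooth_bump _.
split; first exact: d.
by rewrite -derive1E; exact: dE.
Unshelve. all: by end_near. Qed.

Lemma smooth_step : smooth step.
Proof.
apply: (@smooth_real_coind _ (fun f => smooth f \/ f = step)); last by right.
move=> f [sf|->].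
  by exists ('D_1 f); [left; exact: smooth_derive|move=> x; exact: smooth_is_derive].
by exists bump; [left; exact: smooth_bump|exact: is_derive_step].
Qed.

Lemma step_homo : {homo step : x y / x <= y}.
Proof.
move=> x y xy; have [x1|x1] := ltP x (-1).
  rewrite step_le0; last by rewrite (le_trans (ltW x1)) // lerN10.
  by apply: Rintegral_ge0 => t _; exact: bump_ge0.
rewrite /step; rewrite /Rintegral fine_le //.
- by apply: integrable_fin_num => //; exact: integrable_bump.
- by apply: integrable_fin_num => //; exact: integrable_bump.
apply: ge0_subset_integral => //.
- by apply/measurable_EFinP; apply: measurable_funTS; exact: measurable_bump.
- by move=> t _; rewrite lee_fin bump_ge0.
- by apply: subset_itvl; rewrite bnd_simp.
Qed.

Lemma step_ge0 x : 0 <= step x.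
Proof. by apply: Rintegral_ge0 => t _; exact: bump_ge0. Qed.

Lemma step_le1 x : step x <= 1.
Proof.
rewrite -(step_ge1 (x := Num.max x 1)); last by rewrite le_max lexx orbT.
by apply: step_homo; rewrite le_max lexx.
Qed.

End Bump.

(** * Periodic kernels *)

Section Periodization.
Context {R : realType}.
Notation lam := (@lebesgue_measure R).
Implicit Type g : R -> R.

Lemma Rint_FTC (F f : R -> R) (a b : R) : a <= b -> continuous f ->
  (forall x : R, is_derive x 1 F (f x)) -> \int[lam]_(x in `[a, b]) f x = F b - F a.
Proof.
rewrite le_eqVlt => /predU1P[-> _ _|ab cf dF].
  by rewrite set_itv1 Rintegral_set1 subrr.
have cF : continuous F.
  by move=> x; apply/differentiable_continuous/derivable1_diffP; have [] := dF x.
rewrite /Rintegral (@continuous_FTC2 _ f F) //.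
- by apply: continuous_subspaceT.
- split; first by move=> x _; have [] := dF x.
  + exact/cvg_at_right_filter/cF.
  + exact/cvg_at_left_filter/cF.
- by move=> x _; rewrite derive1E; have [_ ->] := dF x.
Qed.

Definition frac (z : R) := z - (Num.floor z)%:~R.
Definition per g z := g (frac z).
(** The margin d around 0 and 1 hides the jump of [frac] at the integers, so that periodization
    preserves smoothness. *)
Definition supp01 g :=
  smooth g /\ exists2 d, 0 < d & forall x, ~~ (d <= x <= 1 - d) -> g x = 0.

Lemma supp01_derive g v : supp01 g -> supp01 ('D_v g).
Proof.
move=> [sg [d d0 gd]]; split; first exact: smooth_derive.
exists d => // x xd; rewrite (@near_eq_derive _ _ _ g (cst 0)) ?derive_cst //.
move: xd; rewrite negb_and -!ltNge => /orP[xd|xd]; near=> y; apply: gd;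
  rewrite negb_and -!ltNge; apply/orP; [left|right]; near: y.
- exact: lt_nbhsl.
- exact: lt_nbhsr.
Unshelve. all: by end_near. Qed.

Lemma frac_itv z : 0 <= frac z < 1.
Proof.
have /andP[h1 h2] := Num.Theory.floor_itv z.
by rewrite /frac subr_ge0 h1 ltrBlDr addrC; move: h2; rewrite intrD.
Qed.

Lemma fracE (z : R) (m : int) : m%:~R <= z < m%:~R + 1 -> frac z = z - m%:~R.
Proof. by move=> h; rewrite /frac (@Num.Theory.floor_def _ _ m) // intrD. Qed.

Lemma fracD1 z : frac (z + 1) = frac z.
Proof.
have /andP[h1 h2] := Num.Theory.floor_itv z; rewrite intrD in h2.
rewrite (@fracE _ (Num.floor z + 1)) ?intrD; first by rewrite /frac; ring.
by rewrite lerD2r h1 ltrD2r.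
Qed.

(** Near every z, integers included, one of the two translates of g vanishes and the other is the
    periodization. Smoothness of [per g] is thereby reduced to that of g. *)
Lemma per_near g (z : R) : supp01 g -> \forall y \near z,
  per g y = g (y - (Num.floor z)%:~R) + g (y - (Num.floor z)%:~R + 1).
Proof.
move=> [_ [d d0 gd]]; set n := Num.floor z; pose m : R := n%:~R.
have /andP[h1 h2] := Num.Theory.floor_itv z; rewrite -/n intrD -/m in h1 h2.
near=> y.
have y1 : m - 1 < y by near: y; apply: lt_nbhsr; rewrite ltrBlDr ltr_pwDr.
have y2 : y < m + 1 by near: y; apply: lt_nbhsl.
rewrite -/m; have [my|ym] := leP m y.
  rewrite /per (@fracE _ n) -/m ?my // [g (_ + 1)]gd ?addr0 //.
  rewrite negb_and -!ltNge; apply/orP; right; lra.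
rewrite /per (@fracE _ (n - 1)); last by rewrite intrB -/m; lra.
rewrite intrB -/m [g (y - m)]gd ?add0r; first by congr g; ring.
rewrite negb_and -!ltNge; apply/orP; left; lra.
Unshelve. all: by end_near. Qed.

Let loc g (m : R) := fun y : R => g (y - m) + g (y - m + 1).

Let smooth_loc g m : smooth g -> smooth (loc g m).
Proof.
move=> sg; apply: smoothD.
  apply: (@smooth_affine _ _ _ _ (fun y : R => y - m) (fun v => v)) => //.
    by move=> x; apply: cvgB; [exact: cvg_id|exact: cvg_cst].
  by move=> h v x; rewrite addrA.
apply: (@smooth_affine _ _ _ _ (fun y : R => y - m + 1) (fun v => v)) => //.
  by move=> x; apply: cvgD; [apply: cvgB; [exact: cvg_id|exact: cvg_cst]|exact: cvg_cst].
by move=> h v x; rewrite !addrA.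
Qed.

Let derive_loc g m v x : smooth g -> 'D_v (loc g m) x = loc ('D_v g) m x.
Proof.
move=> sg.
have E (c y : R) : 'D_v (fun y => g (y + c)) y = 'D_v g (y + c) /\ derivable (fun y => g (y + c)) y v.
  have a1 : forall (h : R) w z, (h *: w + z) + c = h *: w + (z + c) by move=> *; rewrite addrA.
  split; first exact: (@derive_affine _ _ _ _ (fun y : R => y + c) (fun v => v) a1 g v y).
  apply: (@derivable_affine _ _ _ _ (fun y : R => y + c) (fun v => v) a1 g v y).
  exact: smooth_derivable.
have -> : loc g m = (fun y => g (y + - m)) + (fun y => g (y + (- m + 1))).
  by apply/funext => y; rewrite -[RHS]/(g (y - m) + g (y + (- m + 1))) addrA.
have [e1 d1] := E (- m) x; have [e2 d2] := E (- m + 1) x.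
rewrite (deriveD d1 d2); rewrite e1 e2 /loc addrA //.
Qed.

Lemma derive_per g v : supp01 g -> 'D_v (per g) = per ('D_v g).
Proof.
move=> sg; apply/funext => z; have [sm _] := sg.
rewrite (near_eq_derive v (per_near z sg)) -[LHS]/('D_v (loc g _) z) derive_loc //.
by have /nbhs_singleton -> := per_near z (supp01_derive v sg).
Qed.

Lemma smooth_per g : supp01 g -> smooth (per g).
Proof.
move=> sg.
apply: (@smooth_coind _ _ _ (fun f => exists2 g, supp01 g & f = per g)); last by exists g.
move=> _ [{sg}{}g sg ->]; have [sm _] := sg; split.
- move=> z; have N := per_near z sg; rewrite /continuous_at (nbhs_singleton N).
  have : loc g (Num.floor z)%:~R x @[x --> z] --> loc g (Num.floor z)%:~R z.
    exact: (smooth_continuous (smooth_loc (Num.floor z)%:~R sm)).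
  by apply: cvg_trans; apply: near_eq_cvg; apply: filterS N => y.
- move=> z v; apply: (@near_eq_derivable _ _ _ (loc g (Num.floor z)%:~R)).
    by apply: filterS (per_near z sg) => y ->.
  exact: smooth_derivable (smooth_loc _ sm).
- by move=> v; exists ('D_v g); [exact: supp01_derive|exact: derive_per].
Qed.

Lemma per1_per g : per1 (per g).
Proof. by move=> x; rewrite /per fracD1. Qed.

Lemma per_itv g x : supp01 g -> 0 <= x <= 1 -> per g x = g x.
Proof.
move=> [_ [d d0 gd]] /andP[x0]; rewrite le_eqVlt => /predU1P[->|x1].
  have -> : per g 1 = g 0 by rewrite /per (@fracE _ 1) ?subrr // lexx ltrDl ltr01.
  by rewrite !gd // negb_and -!ltNge ?d0 // gtrBl d0 orbT.
by rewrite /per (@fracE _ 0) ?subr0 // x0 add0r.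
Qed.

Lemma per1_bounded (f : R -> R) : continuous f -> per1 f ->
  exists2 M, 0 <= M & forall x, `|f x| <= M.
Proof.
move=> cf pf.
have /compact_bounded[M [_ fM]] : compact (f @` `[0, 1]%classic).
  by apply: continuous_compact; [exact: continuous_subspaceT|exact: segment_compact].
exists (`|M| + 1) => [|x]; first by rewrite addr_ge0.
apply: fM; first by rewrite (le_lt_trans (ler_norm _)) // ltrDl.
exists (frac x); last by rewrite /frac -mulrNz per1_int.
by rewrite /= in_itv /=; have /andP[-> /ltW] := frac_itv x.
Qed.

Lemma supp01_bounded g : supp01 g -> exists2 M, 0 <= M & forall x, `|g x| <= M.
Proof.
move=> sg; have [M M0 gM] := per1_bounded (smooth_continuous (smooth_per sg)) (per1_per g).
exists M => // x; have [x01|x01] := boolP (0 <= x <= 1).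
  by rewrite -(per_itv sg x01).
have [_ [d d0 ->]] := sg; first by rewrite normr0.
by move: x01; rewrite !negb_and -!ltNge => /orP[x0|x1]; apply/orP; [left|right]; lra.
Qed.

End Periodization.

Section Kernel.
Context {R : realType}.
Notation lam := (@lebesgue_measure R).
Notation mu1 := (@mu1 R).
Notation mu3 := (@mu3 R).

(** Unit mass on [1/m, 2/m]. The shift by 1 keeps the support away from 0, and m >= 3 keeps it away
    from 1, as [supp01] demands. *)
Definition spike (m : nat) (s : R) : R := m%:R * bump (m%:R * s - 1).

Let affine_m (m : nat) : forall h v x : R, m%:R * (h *: v + x) - 1 = h *: (m%:R * v) + (m%:R * x - 1).
Proof. by move=> h v x; rewrite mulrDr addrA; congr (_ + _ - 1); rewrite /GRing.scale /= mulrCA. Qed.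

Let cont_m (m : nat) : continuous (fun x : R => m%:R * x - 1).
Proof.
by move=> x; apply: cvgB; [apply: cvgMr; exact: cvg_id|exact: cvg_cst].
Qed.

Lemma spike_supp01 m : (2 < m)%N -> supp01 (spike m).
Proof.
move=> m3; have m3R : (3 : R) <= m%:R by rewrite ler_nat.
split.
  apply: smoothM; first exact: smooth_cst.
  by apply: (@smooth_affine _ _ _ _ _ _ (@cont_m m) (@affine_m m)); exact: smooth_bump.
exists m%:R^-1 => [|x xm]; first by rewrite invr_gt0; lra.
rewrite /spike bump_out ?mulr0 //; apply: contra xm => /andP[h1 h2].
have m0 : (0 : R) < m%:R by lra.
have i0 : m%:R * m%:R^-1 = 1 :> R by rewrite mulfV // gt_eqF.
have i3 : m%:R^-1 <= 3^-1 :> R by rewrite lef_pV2 // posrE.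
have i2 : (0 : R) < m%:R^-1 by rewrite invr_gt0.
have x1 : x = (m%:R * x) * m%:R^-1 by rewrite mulrAC i0 mul1r.
have h3 : m%:R^-1 <= (m%:R * x) * m%:R^-1 by rewrite ler_peMl ?ltW //; lra.
have h4 : (m%:R * x) * m%:R^-1 <= 2 * m%:R^-1 by rewrite ler_wpM2r ?ltW //; lra.
by apply/andP; split; lra.
Qed.

Lemma spike_ge0 m s : 0 <= spike m s.
Proof. by rewrite mulr_ge0 // bump_ge0. Qed.

Lemma spike_neq0 m (s : R) : (2 < m)%N -> spike m s != 0 -> 0 <= s <= 2 / m%:R.
Proof.
move=> m3; have m3R : (3 : R) <= m%:R by rewrite ler_nat.
have m0 : (0 : R) < m%:R by lra.
have [/andP[h1 h2] _|h /eqP[]] := boolP (0 < m%:R * s - 1 < 1); last first.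
  by rewrite /spike bump_out ?mulr0.
rewrite -(pmulr_rge0 _ m0) ler_pdivlMr // (mulrC s); apply/andP; split; lra.
Qed.

Lemma Rint_spike m : (2 < m)%N -> \int[lam]_(s in `[0, 1]) spike m s = 1.
Proof.
move=> m3; have m3R : (3 : R) <= m%:R by rewrite ler_nat.
have dS (x : R) : is_derive x 1 (fun s : R => step (m%:R * s - 1)) (spike m x).
  have dl : is_derive x 1 (fun s : R => m%:R * s - 1) m%:R.
    have dZ : is_derive x 1 (fun s : R => m%:R * s) m%:R.
      have := @is_deriveZ _ _ _ id m%:R x 1 1 (is_derive_id _ _).
      by rewrite /GRing.scale /= mulr1.
    by have := is_deriveB dZ (is_derive_cst (1 : R) x 1); rewrite subr0.
  have := @is_derive1_comp _ step _ _ _ _ (is_derive_step _) dl.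
  by rewrite mulrC.
rewrite (Rint_FTC ler01 (smooth_continuous (spike_supp01 m3).1) dS).
by rewrite mulr1 mulr0 step_ge1 ?step_le0 ?subr0 //; lra.
Qed.

Lemma derive_spike m (s : R) : 'D_1 (spike m) s = m%:R ^+ 2 * 'D_1 bump (m%:R * s - 1).
Proof.
have E := @derive_affine _ _ _ _ _ _ (@affine_m m) bump 1 s.
have df : derivable (bump \o (fun s : R => m%:R * s - 1)) s 1.
  apply: (@derivable_affine _ _ _ _ _ _ (@affine_m m)).
  exact: smooth_derivable smooth_bump.
have -> : spike m = m%:R \*: (bump \o (fun s : R => m%:R * s - 1)) by [].
rewrite (deriveZ _ df) E mulr1 (derive_real_smooth _ _ smooth_bump).
by rewrite /GRing.scale /= mulrA expr2.
Qed.

(** The support of [bump] reaches the ends 0 and 1. The copy s -> bump(2 s - 1/2) lives in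
    [1/4, 3/4], so [supp01_bounded] applies to its derivative. *)
Lemma bump_derive_bounded : exists2 C : R, 0 <= C & forall s, `|'D_1 bump s| <= C.
Proof.
have sb : supp01 (fun s : R => bump (2 * s - 1 / 2)).
  split.
    apply: (@smooth_affine _ _ _ _ (fun s : R => 2 * s - 1 / 2) (fun v => 2 * v)); last exact: smooth_bump.
      by move=> x; apply: cvgB; [apply: cvgMr; exact: cvg_id|exact: cvg_cst].
    by move=> h v x; rewrite mulrDr addrA; congr (_ + _ - _); rewrite /GRing.scale /= mulrCA.
  exists (4^-1) => [|x]; first by rewrite invr_gt0.
  rewrite negb_and -!ltNge => H; rewrite bump_out // negb_and -!leNgt.
  by case/orP: H => H; apply/orP; [left|right]; lra.
have [M M0 MB] := supp01_bounded (supp01_derive 1 sb).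
exists M; first exact: M0.
move=> s; have := MB ((s + 1 / 2) / 2).
have E := @derive_affine _ _ _ _ (fun s : R => 2 * s - 1 / 2) (fun v => 2 * v) _ bump 1 ((s + 1 / 2) / 2).
rewrite -/(bump \o _) E; last first.
  by move=> h v x; rewrite mulrDr addrA; congr (_ + _ - _); rewrite /GRing.scale /= mulrCA.
rewrite mulr1 (derive_real_smooth _ _ smooth_bump).
have -> : 2 * ((s + 1 / 2) / 2) - 1 / 2 = s by field.
rewrite normrM (ger0_norm (ler0n _ 2)) => H; apply: le_trans H.
by rewrite ler_peMl ?normr_ge0 // ler1n.
Qed.

Lemma derive_bump_out (s : R) : ~~ (0 <= s <= 1) -> 'D_1 bump s = 0.
Proof.
move=> s01; have -> : 'D_1 bump s = 'D_1 (cst 0 : R -> R) s; last by rewrite derive_cst.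
apply: near_eq_derive; move: s01; rewrite negb_and -!ltNge => /orP[s0|s1]; near=> y;
  rewrite bump_out // negb_and -!leNgt; apply/orP; [left|right]; apply: ltW; near: y.
  exact: lt_nbhsl.
exact: lt_nbhsr.
Unshelve. all: by end_near. Qed.

(** The derivative is at most C m^2, where C bounds the derivative of [bump], and it lives on an
    interval of length 1/m. *)
Lemma derive_spike_L1 : exists2 C : R, 0 <= C & forall m, (2 < m)%N ->
  \int[lam]_(s in `[0, 1]) `|'D_1 (spike m) s| <= C * m%:R.
Proof.
have [C C0 bC] := bump_derive_bounded; exists C => // m m3.
have m3R : (3 : R) <= m%:R by rewrite ler_nat.
have m0 : (0 : R) < m%:R by lra.
have iD : lam.-integrable `[0, 1] (EFin \o (fun s => `|'D_1 (spike m) s|)).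
  apply: continuous_compact_integrable; first exact: segment_compact.
  have c : continuous (fun s : R => `|'D_1 (spike m) s|).
    have cD : continuous ('D_1 (spike m) : R -> R).
      by apply: smooth_continuous; apply: smooth_derive; exact: (spike_supp01 m3).1.
    by move=> x; apply: cvg_norm; exact: cD.
  exact: continuous_subspaceT.
pose J : set R := `[m%:R^-1, (2 / m%:R)]%classic.
have mJ : measurable J by exact: measurable_itv.
have lJ : lam J = (m%:R^-1)%:E.
  rewrite lebesgue_measure_itv /= lte_fin ifT; first by rewrite -EFinB; congr EFin; field; rewrite gt_eqF.
  by rewrite -[ltLHS]mul1r ltr_pM2r ?invr_gt0 //; lra.
have JI : J `<=` `[0, 1].
  apply: subset_itv; rewrite bnd_simp ?invr_ge0 ?ltW //.
  by rewrite ltr_pdivrMr // mul1r; lra.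
rewrite -lee_fin /Rintegral fineK; last exact: integrable_fin_num.
apply: (@le_trans _ _ (\int[lam]_(s in `[0%R, 1%R]) (C * m%:R ^+ 2 * \1_J s)%:E)%E).
  apply: ge0_le_integral => //.
  - by case/integrableP: iD.
  - by apply/measurable_EFinP; apply: measurable_funM => //; exact: measurable_indic.
  - move=> s _; rewrite lee_fin derive_spike normrM (ger0_norm (sqr_ge0 _)).
    rewrite indicE; have [sJ|sJ] := boolP (s \in J).
      by rewrite mulr1 mulrC ler_wpM2r ?sqr_ge0.
    suff -> : 'D_1 bump (m%:R * s - 1) = 0 by rewrite normr0 !mulr0.
    move: sJ; rewrite notin_setE /J /= in_itv /= => /negP; rewrite negb_and -!ltNge => sJ.
    apply: derive_bump_out; case/orP: sJ => sJ; rewrite negb_and -!ltNge; apply/orP; [left|right].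
      by rewrite subr_lt0 mulrC -ltr_pdivlMr // mul1r.
    by rewrite ltrBrDr mulrC; move: sJ; rewrite ltr_pdivrMr.
under eq_integral do rewrite EFinM.
rewrite ge0_integralZl_EFin //; last first.
- by rewrite mulr_ge0 // sqr_ge0.
- by apply/measurable_EFinP; exact: measurable_indic.
have -> : (\int[lam]_(x in `[0%R, 1%R]) (\1_J x)%:E = (m%:R^-1)%:E)%E.
  by rewrite integral_indic // setIidl //; exact: lJ.
rewrite -EFinM lee_fin.
by rewrite -mulrA expr2 -mulrA mulfV ?mulr1 // gt_eqF.
Qed.

Lemma Rint_prod3 (a b c : R -> R) : integ mu1 a -> integ mu1 b -> integ mu1 c ->
  integ mu3 (fun x => a x.1.1 * b x.1.2 * c x.2) /\
  \int[mu3]_x (a x.1.1 * b x.1.2 * c x.2) =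
    \int[mu1]_x a x * \int[mu1]_x b x * \int[mu1]_x c x.
Proof.
have P d1 d2 (X : measurableType d1) (Y : measurableType d2)
    (m1 : {sigma_finite_measure set X -> \bar R}) (m2 : {sigma_finite_measure set Y -> \bar R})
    (f : X -> R) (g : Y -> R) : integ m1 f -> integ m2 g ->
    integ (m1 \x m2)%E (fun z => f z.1 * g z.2) /\
    \int[(m1 \x m2)%E]_z (f z.1 * g z.2) = \int[m1]_x f x * \int[m2]_y g y.
  move=> fi gi.
  have i : integ (m1 \x m2)%E (fun z => f z.1 * g z.2).
    apply: (@integ_prod _ _ _ _ _ _ _ _ (fun x y => `|f x| * `|g y|)).
    - apply: measurable_funM.
        by apply: (measurableT_comp (integ_meas fi)).
      by apply: (measurableT_comp (integ_meas gi)).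
    - by move=> x y; rewrite normrM.
    - by move=> x; apply: integZ; exact: integ_abs.
    apply: (@eq_integ _ _ _ _ (fun x => (\int[m2]_y `|g y|) * `|f x|)).
      by move=> x; rewrite (RintZ _ (integ_abs gi)) mulrC.
    by apply: integZ; exact: integ_abs.
  split=> //; rewrite -Rint_prod //=.
  transitivity (\int[m1]_x (\int[m2]_y g y * f x)); last by rewrite (RintZ _ fi) mulrC.
  by apply: eq_Rint => x; rewrite (RintZ _ gi) mulrC.
move=> ia ib ic; have [iab abE] := P _ _ _ _ mu1 mu1 _ _ ia ib.
have [iabc abcE] := P _ _ _ _ mu2 mu1 _ _ iab ic.
by split=> //; rewrite -abE; exact: abcE.
Qed.

End Kernel.

(** * Test functions and convolution *)

Section TorusFunctions.
Context {R : realType}.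
Notation mu1 := (@mu1 R).
Notation mu3 := (@mu3 R).

(** The measurable sets are those of a product, so an open set has to be written as a countable
    union of boxes: the boxes contained in it with rational centre and half side 1/(n+1). *)
Lemma open_measurable3 (U : set (point3 R)) : open U -> measurable (U : set (mpoint3 R)).
Proof.
move=> oU.
pose B (p q r : rat) (n : nat) : set (mpoint3 R) :=
  (ball (ratr p : R) n.+1%:R^-1 `*` ball (ratr q : R) n.+1%:R^-1) `*` ball (ratr r : R) n.+1%:R^-1.
have mB p q r n : measurable (B p q r n).
  by apply: measurableX; [apply: measurableX|]; exact: measurable_ball.
pose C p q r n := if `[< B p q r n `<=` (U : set (mpoint3 R)) >] then B p q r n else set0.
have -> : (U : set (mpoint3 R)) = \bigcup_p \bigcup_q \bigcup_r \bigcup_n C p q r n.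
  apply/seteqP; split=> [[[x y] z] Uxyz|x [p _ [q _ [r _ [n _]]]]]; last first.
    by rewrite /C; case: asboolP => // BU /BU.
  have /nbhs_ballP[e /= e0 eU] : nbhs ((x, y, z) : point3 R) U by exact: open_nbhs_nbhs.
  have [n n2] : exists n : nat, n.+1%:R^-1 < e / 2.
    have e2 : 0 < e / 2 by rewrite divr_gt0.
    have [n _ /(_ n (leqnn n)) nH] := near_infty_natSinv_lt (PosNum e2).
    by exists n.
  set d : R := n.+1%:R^-1 in n2; have d0 : 0 < d by rewrite invr_gt0.
  have rat_near (t : R) : exists q : rat, `|t - ratr q| < d.
    have [q] : exists q : rat, ratr q \in `](t - d), (t + d)[ by apply: rat_in_itvoo; lra.
    by rewrite in_itv /= => /andP[h1 h2]; exists q; rewrite ltr_norml; apply/andP; split; lra.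
  have [p hp] := rat_near x; have [q hq] := rat_near y; have [r hr] := rat_near z.
  exists p => //; exists q => //; exists r => //; exists n => //; rewrite /C.
  case: asboolP => [BU|[]].
    by split; [split|]; rewrite /= /ball /= distrC.
  move=> [[a b] c] [[/= ha hb] hc]; apply: eU.
  have tri (s t u : R) : ball t d s -> `|u - t| < d -> ball u e s.
    rewrite /ball /= => h1 h2; rewrite -(subrKA t).
    by rewrite (le_lt_trans (ler_normD _ _)) //; lra.
  by split; [split|]; [exact: tri ha hp|exact: tri hb hq|exact: tri hc hr].
apply: bigcupT_measurable_rat => p; apply: bigcupT_measurable_rat => q.
apply: bigcupT_measurable_rat => r; apply: bigcupT_measurable => n.
by rewrite /C; case: asboolP.
Qed.

Lemma continuous_measurable3 (f : point3 R -> R) : continuous f ->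
  measurable_fun [set: mpoint3 R] f.
Proof.
move=> /continuousP cf.
apply: (measurability _ (RGenOpens.measurableE R)).
move=> _ [_ [a [b ->] <-]]; rewrite setTI; apply: open_measurable3.
by apply: cf; exact: interval_open.
Qed.

Lemma periodic_subr {W : Type} (f : point3 R -> W) x i : periodic3 f ->
  f (x - basis3 i) = f x.
Proof. by move=> pf; have := pf (x - basis3 i) i; rewrite subrK => ->. Qed.

Lemma periodic_reflect {W : Type} (f : point3 R -> W) h : periodic3 f ->
  periodic3 (fun x => f (h - x)).
Proof. by move=> pf x i; rewrite opprD addrA periodic_subr. Qed.

Lemma periodic_bounded (f : point3 R -> R) : continuous f -> periodic3 f ->
  exists2 M, 0 <= M & forall x, `|f x| <= M.
Proof.
move=> cf /periodic3P[p0 p1 p2].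
have /compact_bounded[M [_ fM]] : compact (f @` (cell : set (point3 R))).
  apply: continuous_compact; first exact: continuous_subspaceT.
  by apply: compact_setX; [apply: compact_setX|]; exact: segment_compact.
exists (`|M| + 1) => [|[[x y] z]]; first by rewrite addr_ge0.
apply: fM; first by rewrite (le_lt_trans (ler_norm _)) // ltrDl.
have fc (t : R) : `[0, 1]%classic (frac t).
  by rewrite /= in_itv /=; have /andP[-> /ltW] := frac_itv t.
exists (frac x, frac y, frac z); first by split; [split|]; exact: fc.
rewrite /frac -!mulrNz.
rewrite (@per1_int _ _ (fun z => f (_, _, z))); last by move=> t; exact: p2.
rewrite (@per1_int _ _ (fun y => f (_, y, _))); last by move=> t; exact: p1.
by rewrite (@per1_int _ _ (fun x => f (x, _, _))) // => t; exact: p0.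
Qed.

Implicit Types (f g : point3 R -> R).

Lemma measurable_shift3 f h : measurable_fun [set: mpoint3 R] f ->
  measurable_fun [set: mpoint3 R] (fun x : mpoint3 R => f ((x : point3 R) + h)).
Proof. by move=> mf; apply: (measurableT_comp mf); apply: measurable_add3. Qed.

Lemma measurable_reflect3 f h : measurable_fun [set: mpoint3 R] f ->
  measurable_fun [set: mpoint3 R] (fun x : mpoint3 R => f (h - (x : point3 R))).
Proof. by move=> mf; apply: (measurableT_comp mf); apply: measurable_sub3. Qed.

Lemma Rint_shift3 f h : measurable_fun [set: mpoint3 R] f -> periodic3 f ->
  \int[mu3]_x f ((x : point3 R) + h) = \int[mu3]_x f x.
Proof.
move=> mf pf; rewrite /Rintegral.
rewrite (@integral_mu3_shift R h (EFin \o f)) //; first exact/measurable_EFinP.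
by move=> x i; rewrite /= pf.
Qed.

Lemma Rint_reflect3 f h : measurable_fun [set: mpoint3 R] f -> periodic3 f ->
  \int[mu3]_x f (h - (x : point3 R)) = \int[mu3]_x f x.
Proof.
move=> mf pf; rewrite /Rintegral.
rewrite (@integral_mu3_sub R h (EFin \o f)) //; first exact/measurable_EFinP.
by move=> x i; rewrite /= pf.
Qed.

Lemma integ_shift3 f h : integ mu3 f -> periodic3 f ->
  integ mu3 (fun x : mpoint3 R => f ((x : point3 R) + h)).
Proof.
move=> /integrableP[/measurable_EFinP mf fy] pf; apply/integrableP; split.
  by apply/measurable_EFinP; exact: measurable_shift3.
rewrite (@integral_mu3_shift R h (fun x => `|(f x)%:E|)%E) //.
  by apply: measurableT_comp => //; exact/measurable_EFinP.
by move=> x i; rewrite /= pf.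
Qed.

Lemma integ_reflect3 f h : integ mu3 f -> periodic3 f ->
  integ mu3 (fun x : mpoint3 R => f (h - (x : point3 R))).
Proof.
move=> /integrableP[/measurable_EFinP mf fy] pf; apply/integrableP; split.
  by apply/measurable_EFinP; exact: measurable_reflect3.
rewrite (@integral_mu3_sub R h (fun x => `|(f x)%:E|)%E) //.
  by apply: measurableT_comp => //; exact/measurable_EFinP.
by move=> x i; rewrite /= pf.
Qed.

Lemma mu3_ae_cell : {ae mu3, forall x, (cell : set (point3 R)) x}.
Proof.
exists (~` (cell : set (mpoint3 R))); split => //.
  by apply: measurableC; exact: measurable_cell.
apply: etrans (@probability_setC _ _ _ mu3 cell measurable_cell) _.
by have E : (1 - mu3 cell = 0)%E by rewrite mu3_cell subee.
Qed.

End TorusFunctions.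

Section TestFunctions.
Context {R : realType}.
Notation mu3 := (@mu3 R).
Implicit Types (b psi : point3 R -> R) (v : point3 R).

Lemma test_continuous psi : torus_test psi -> continuous psi.
Proof. by move=> [+ _]; exact: smooth_continuous. Qed.

Lemma test_measurable psi : torus_test psi -> measurable_fun [set: mpoint3 R] psi.
Proof. by move=> /test_continuous; exact: continuous_measurable3. Qed.

Lemma test_bounded psi : torus_test psi -> exists2 M, 0 <= M & forall x, `|psi x| <= M.
Proof. by move=> [/smooth_continuous]; exact: periodic_bounded. Qed.

Lemma test_integ psi : torus_test psi -> integ mu3 psi.
Proof.
move=> tp; have [M _ pM] := test_bounded tp.
exact: integ_bounded (test_measurable tp) pM.
Qed.

Lemma test_derive psi v : torus_test psi -> torus_test ('D_v psi).
Proof.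
move=> [sp pp]; split; first exact: smooth_derive.
move=> x i; have E := @derive_affine _ _ _ _ (fun x => x + basis3 i) (fun v => v) _ psi v x.
rewrite -E; last by move=> h w z; rewrite addrA.
by congr ('D_v _ x); apply/funext => y; rewrite /= pp.
Qed.

Lemma testM psi phi : torus_test psi -> torus_test phi -> torus_test (fun x => psi x * phi x).
Proof.
move=> [s1 p1] [s2 p2]; split; first exact: smoothM.
by move=> x i; rewrite p1 p2.
Qed.

Lemma testD psi phi : torus_test psi -> torus_test phi -> torus_test (fun x => psi x + phi x).
Proof.
move=> [s1 p1] [s2 p2]; split; first exact: smoothD.
by move=> x i; rewrite p1 p2.
Qed.

Lemma testZ k psi : torus_test psi -> torus_test (fun x => k * psi x).
Proof.
move=> [s1 p1]; split; first exact: (smoothZ k s1).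
by move=> x i; rewrite p1.
Qed.

Let reflect_aff (z : point3 R) (h : R) v x : z - (h *: v + x) = h *: (- v) + (z - x).
Proof. by rewrite opprD addrCA scalerN. Qed.

Lemma test_reflect z psi : torus_test psi -> torus_test (fun y => psi (z - y)).
Proof.
move=> [sp pp]; split; last exact: periodic_reflect.
apply: (@smooth_affine _ _ _ _ (fun y => z - y) (fun v => - v)) => //.
by move=> x; apply: cvgB; [exact: cvg_cst|exact: cvg_id].
Qed.

(** The reflection turns the direction into -v. On the line through z - y along v, where psi is a
    function of one variable, a derivative scales with its direction, which gives the sign. *)
Lemma derive_reflect z psi v y : smooth psi ->
  'D_v (fun y => psi (z - y)) y = - 'D_v psi (z - y).
Proof.
move=> sp.
rewrite -/(psi \o (fun y => z - y)).
rewrite (@derive_affine _ _ _ _ (fun y => z - y) (fun v => - v)); last by move=> *; exact: reflect_aff.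
have /derivable1P d1 := smooth_derivable (z - y) v sp.
have E : 'D_(- v) psi (z - y) = 'D_(-1) (fun h : R => psi (h *: v + (z - y))) 0.
  have a1 : forall h w x : R, (h *: w + x) *: v + (z - y) = h *: (w *: v) + (x *: v + (z - y)).
    by move=> h w x; rewrite scalerDl -addrA scalerA.
  rewrite (@derive_affine _ _ _ _ (fun h : R => h *: v + (z - y)) (fun w : R => w *: v) a1 psi).
  by rewrite scaleN1r scale0r add0r.
have E1 : 'D_v psi (z - y) = 'D_1 (fun h : R => psi (h *: v + (z - y))) 0.
  have a1 : forall h w x : R, (h *: w + x) *: v + (z - y) = h *: (w *: v) + (x *: v + (z - y)).
    by move=> h w x; rewrite scalerDl -addrA scalerA.
  rewrite (@derive_affine _ _ _ _ (fun h : R => h *: v + (z - y)) (fun w : R => w *: v) a1 psi).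
  by rewrite scale1r scale0r add0r.
by rewrite E E1 derive_real // mulN1r.
Qed.

Lemma mvt0 (f df : R -> R) (h : R) : (forall x : R, is_derive x 1 f (df x)) ->
  exists2 c, `|c| <= `|h| & f h - f 0 = df c * h.
Proof.
move=> dF.
have cf : continuous f.
  by move=> x; apply/differentiable_continuous/derivable1_diffP; have [] := dF x.
have [h0|h0|->] := ltgtP h 0; last by exists 0; rewrite ?normr0 // subrr mulr0.
- have [c] := MVT h0 (fun x _ => dF x) (continuous_subspaceT cf).
  rewrite in_itv /= => /andP[h1 h2] E; exists c.
    by rewrite !ltr0_norm // lerN2 ltW.
  by rewrite -opprB E sub0r mulrN opprK.
- have [c] := MVT h0 (fun x _ => dF x) (continuous_subspaceT cf).
  rewrite in_itv /= => /andP[h1 h2] E; exists c.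
    by rewrite !gtr0_norm // ltW.
  by rewrite E subr0.
Qed.

Lemma is_derive_line psi v x (s : R) : smooth psi ->
  is_derive s 1 (fun s : R => psi (s *: v + x)) ('D_v psi (s *: v + x)).
Proof.
move=> sp.
have a1 : forall h w y : R, (h *: w + y) *: v + x = h *: (w *: v) + (y *: v + x).
  by move=> h w y; rewrite scalerDl -addrA scalerA.
split.
  apply: (@derivable_affine _ _ _ _ (fun s : R => s *: v + x) (fun w : R => w *: v) a1 psi).
  exact: smooth_derivable.
rewrite (@derive_affine _ _ _ _ (fun s : R => s *: v + x) (fun w : R => w *: v) a1 psi).
by rewrite scale1r.
Qed.

Lemma test_lipschitz psi v : torus_test psi -> exists2 C, 0 <= C &
  forall x (h : R), `|psi (h *: v + x) - psi x| <= C * `|h|.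
Proof.
move=> tp; have [C C0 DC] := test_bounded (test_derive v tp).
exists C => // x h; have [c _] := mvt0 h (fun s => is_derive_line v x s tp.1).
by rewrite scale0r add0r => ->; rewrite normrM ler_wpM2r.
Qed.

Lemma test_taylor psi v : torus_test psi -> exists2 C, 0 <= C &
  forall x (h : R), `|psi (h *: v + x) - psi x - h * 'D_v psi x| <= C * h ^+ 2.
Proof.
move=> tp; have [C C0 DC] := test_lipschitz v (test_derive v tp).
exists C => // x h; have [c ch] := mvt0 h (fun s => is_derive_line v x s tp.1).
rewrite scale0r add0r => ->; rewrite mulrC -mulrBr normrM.
rewrite (le_trans (ler_wpM2l _ (DC _ _))) // mulrCA ler_wpM2l //.
by rewrite -real_normK ?num_real // expr2 ler_wpM2l.
Qed.

Lemma taylor_derive (V : normedModType R) (F : V -> R) x w (l C : R) : 0 <= C ->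
  (forall h : R, `|F (h *: w + x) - F x - h * l| <= C * h ^+ 2) ->
  derivable F x w /\ 'D_w F x = l.
Proof.
move=> C0 H.
have K : (h^-1 *: ((F \o shift x) (h *: w) - F x)) @[h --> 0^'] --> l.
  apply/cvgrPdist_le => /= e e0; near=> h.
  have h0 : h != 0 by near: h; exact: nbhs_dnbhs_neq.
  rewrite distrC -[_ *: _]/(_ * _) -[l in X in `|X|](mulKf h0) -mulrBr normrM normfV.
  rewrite mulrC ler_pdivrMr ?normr_gt0 //.
  apply: (le_trans (H h)); rewrite -[h ^+ 2]real_normK ?num_real // expr2 mulrA.
  rewrite ler_wpM2r // (@le_trans _ _ ((C + 1) * `|h|)) //.
    by rewrite ler_wpM2r // lerDl.
  rewrite mulrC -ler_pdivlMr ?ltr_wpDl //.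
  by near: h; apply: dnbhs0_le; rewrite divr_gt0 // ltr_wpDl.
by split; [apply/cvg_ex; exists l|apply: cvg_lim].
Unshelve. all: by end_near. Qed.

(** The path from x to y follows the three axes in turn; each leg is at most |y - x| long and takes
    at most a third of e. *)
Lemma lipschitz_continuous3 (F : point3 R -> R) (C : R) : 0 <= C ->
  (forall i x (h : R), `|F (h *: basis3 i + x) - F x| <= C * `|h|) -> continuous F.
Proof.
move=> C0 H x; apply/cvgrPdist_le => /= e e0; near=> y.
have yx : `|y - x| <= e / (3 * (C + 1)).
  rewrite distrC; near: y; apply: cvgr_dist_le => //.
  by rewrite divr_gt0 // mulr_gt0 // ltr_wpDl.
have n1 : `|y.1.1 - x.1.1| <= `|y - x|.
  by rewrite prod_normE /= le_max prod_normE /= le_max lexx.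
have n2 : `|y.1.2 - x.1.2| <= `|y - x|.
  by rewrite prod_normE /= le_max prod_normE /= le_max lexx orbT.
have n3 : `|y.2 - x.2| <= `|y - x| by rewrite prod_normE /= le_max lexx orbT.
have E (p q : point3 R) : q = (q.2 - p.2) *: basis3 ord_max +
    ((q.1.2 - p.1.2) *: basis3 (lift ord0 ord0) + ((q.1.1 - p.1.1) *: basis3 ord0 + p)).
  case: q p => -[y1 y2] y3 [[x1 x2] x3].
  transitivity ((y3 - x3) * 0 + ((y2 - x2) * 0 + ((y1 - x1) * 1 + x1)),
    (y3 - x3) * 0 + ((y2 - x2) * 1 + ((y1 - x1) * 0 + x2)),
    (y3 - x3) * 1 + ((y2 - x2) * 0 + ((y1 - x1) * 0 + x3))); last by [].
  by congr (_, _, _); ring.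
rewrite distrC {1}(E x y).
set a := (y.1.1 - x.1.1) in n1 *; set b := (y.1.2 - x.1.2) in n2 *; set c := (y.2 - x.2) in n3 *.
have h1 := H ord0 x a; set xa := a *: _ + x in h1 *.
have h2 := H (lift ord0 ord0) xa b; set xb := b *: _ + xa in h2 *.
have h3 := H ord_max xb c; set xc := c *: _ + xb in h3 *.
have -> : F xc - F x = (F xc - F xb) + (F xb - F xa) + (F xa - F x) by ring.
have C10 : 0 < C + 1 by rewrite ltr_wpDl.
have t : (C + 1) * `|y - x| <= e / 3.
  by rewrite mulrC -ler_pdivlMr // -mulrA -invfM.
have u (z : R) : `|z| <= `|y - x| -> C * `|z| <= (C + 1) * `|y - x|.
  by move=> zz; apply: ler_pM => //; rewrite lerDl.
have := u _ n1; have := u _ n2; have := u _ n3 => k3 k2 k1.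
rewrite (le_trans (ler_normD _ _)) // (le_trans (lerD (ler_normD _ _) (lexx _))) //.
lra.
Unshelve. all: by end_near. Qed.

End TestFunctions.

Section Convolution.
Context {R : realType}.
Notation mu3 := (@mu3 R).
Implicit Types (b psi : point3 R -> R) (v : point3 R) (f g : point3 R -> R).

Definition pint f := periodic3 f /\ integ mu3 f.

Definition conv b f (x : point3 R) : R := \int[mu3]_y (b (x - (y : point3 R)) * f y).

Definition check3 b (x : point3 R) := b (- x).

Lemma check3_test b : torus_test b -> torus_test (check3 b).
Proof.
move=> /(test_reflect 0); congr (torus_test _).
by apply/funext => y; rewrite sub0r.
Qed.

Lemma test_mul_integ psi f : torus_test psi -> integ mu3 f -> integ mu3 (fun x => psi x * f x).
Proof.
move=> tp fi; have [M _ pM] := test_bounded tp.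
exact: integ_mul_bounded (test_measurable tp) pM fi.
Qed.

Lemma conv_integ b f x : torus_test b -> integ mu3 f ->
  integ mu3 (fun y => b (x - (y : point3 R)) * f y).
Proof. by move=> tb; apply: test_mul_integ; exact: test_reflect. Qed.

Lemma convE b f x : torus_test b -> pint f ->
  conv b f x = \int[mu3]_y (b y * f (x - (y : point3 R))).
Proof.
move=> tb [pf fi].
rewrite -(@Rint_reflect3 _ (fun y => b y * f (x - y)) x).
- by apply: eq_Rint => y; rewrite opprB addrCA subrr addr0.
- apply: (@measurable_funM _ (mpoint3 R) R setT b (fun y => f (x - y))).
    exact: test_measurable.
  by apply: measurable_reflect3; exact: integ_meas fi.
- by move=> y i; rewrite tb.2 periodic_reflect.
Qed.

Lemma conv_periodic b f : torus_test b -> periodic3 (conv b f).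
Proof.
move=> [_ pb] x i; apply: eq_Rint => y; congr (_ * _).
by rewrite addrAC pb.
Qed.

(** The Taylor remainder of the kernel is uniform in the base point, so it survives integration
    against |f|. This stands in for differentiation under the integral sign and shows that
    derivatives fall on the kernel. *)
Lemma conv_taylor b f v : torus_test b -> integ mu3 f -> exists2 C, 0 <= C &
  forall x (h : R), `|conv b f (h *: v + x) - conv b f x - h * conv ('D_v b) f x| <= C * h ^+ 2.
Proof.
move=> tb fi; have [C C0 bC] := test_taylor v tb.
have tD := test_derive v tb.
exists (C * \int[mu3]_y `|f y|) => [|x h]; first by rewrite mulr_ge0 // Rint_ge0.
have i1 := conv_integ (h *: v + x) tb fi; have i2 := conv_integ x tb fi.
have i3 := conv_integ x tD fi.
have i12 := integB i1 i2; have i3h := integZ h i3.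
rewrite -RintB // -RintZ // -RintB //.
apply: le_trans (Rint_abs (integB i12 i3h)) _.
rewrite mulrAC -RintZ; last exact: integ_abs.
apply: Rint_le; [exact/integ_abs/integB|exact/integZ/integ_abs|].
move=> y; rewrite mulrA -!mulrBl normrM ler_wpM2r // mulrC.
by have := bC (x - y) h; rewrite addrA mulrC.
Qed.

Lemma conv_lipschitz b f v : torus_test b -> integ mu3 f -> exists2 C, 0 <= C &
  forall x (h : R), `|conv b f (h *: v + x) - conv b f x| <= C * `|h|.
Proof.
move=> tb fi; have [C C0 bC] := test_lipschitz v tb.
exists (C * \int[mu3]_y `|f y|) => [|x h]; first by rewrite mulr_ge0 // Rint_ge0.
have i1 := conv_integ (h *: v + x) tb fi; have i2 := conv_integ x tb fi.
rewrite -RintB //; apply: le_trans (Rint_abs (integB i1 i2)) _.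
rewrite mulrAC -RintZ; last exact: integ_abs.
apply: Rint_le; [exact/integ_abs/integB|exact/integZ/integ_abs|].
move=> y; rewrite -!mulrBl normrM ler_wpM2r //.
by have := bC (x - y) h; rewrite addrA.
Qed.

Lemma derive_conv b f v x : torus_test b -> integ mu3 f ->
  'D_v (conv b f) x = conv ('D_v b) f x.
Proof.
by move=> tb fi; have [C C0 H] := conv_taylor v tb fi; have [] := taylor_derive C0 (H x).
Qed.

Lemma conv_test b f : torus_test b -> integ mu3 f -> torus_test (conv b f).
Proof.
move=> tb fi; split; last exact: conv_periodic.
apply: (@smooth_coind _ _ _ (fun g => exists2 b, torus_test b & g = conv b f)); last by exists b.
move=> _ [{tb}{}b tb ->]; split.
- pose C i := sval (cid2 (conv_lipschitz (basis3 i) tb fi)).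
  have C0 i : 0 <= C i by rewrite /C; case: cid2.
  have CH i x h : `|conv b f (h *: basis3 i + x) - conv b f x| <= C i * `|h|.
    by rewrite /C; case: cid2.
  apply: (@lipschitz_continuous3 _ _ (\sum_i C i)); first exact: sumr_ge0.
  move=> i x h; apply: le_trans (CH i x h) _; rewrite ler_wpM2r //.
  by rewrite (bigD1 i) //= lerDl sumr_ge0.
- by move=> x v; have [C C0 H] := conv_taylor v tb fi; have [] := taylor_derive C0 (H x).
- move=> v; exists ('D_v b); first exact: test_derive.
  by apply/funext => x; exact: derive_conv.
Qed.

(** By translation invariance psi(x + h v) - psi(x) has integral 0, while Taylor's formula gives h l
    up to C h^2. Hence |h l| <= C h^2 for all h, which for h = |l| / (2 (C + 1)) is impossible
    unless l = 0. *)
Lemma Rint_derive_test psi v : torus_test psi -> \int[mu3]_x 'D_v psi x = 0.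
Proof.
move=> tp; have [C C0 H] := test_taylor v tp.
set l := \int[mu3]_x _; have B (h : R) : `|h * l| <= C * h ^+ 2.
  have tD := test_derive v tp.
  have i0 := test_integ tp; have iD := integZ h (test_integ tD).
  have ih : integ mu3 (fun x : mpoint3 R => psi ((x : point3 R) + h *: v)).
    by apply: integ_shift3 => //; case: tp.
  have : \int[mu3]_x (psi ((x : point3 R) + h *: v) - psi x - h * 'D_v psi x) = - (h * l).
    rewrite (RintB (integB ih i0) iD) (RintB ih i0) (RintZ h (test_integ tD)).
    rewrite Rint_shift3; [by rewrite subrr sub0r|exact: test_measurable|by case: tp].
  move=> E; rewrite -normrN -E.
  apply: le_trans (Rint_abs (integB (integB ih i0) iD)) _.
  rewrite -[leRHS](Rint_cst mu3).
  apply: Rint_le; [exact/integ_abs/integB/iD/integB|exact: integ_cst|].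
  by move=> x; rewrite [(x : point3 R) + _]addrC; exact: H.
apply/eqP/contraT => l0; have l1 : 0 < `|l| by rewrite normr_gt0.
have := B (`|l| / (2 * (C + 1))); set h := _ / _.
have C1 : 0 < 2 * (C + 1) by rewrite mulr_gt0 // ltr_wpDl.
have h0 : 0 < h by rewrite divr_gt0.
rewrite normrM (gtr0_norm h0) expr2 mulrCA ler_pM2l // => K.
have : C * h <= `|l| / 2.
  have -> : `|l| / 2 = (C + 1) * h.
    by rewrite /h; field; rewrite gt_eqF // ltr_wpDl.
  by apply: ler_wpM2r; [exact: ltW|rewrite lerDl].
by move=> K2; exfalso; move: (le_trans K K2); rewrite leNgt; apply/negP; rewrite negbK; lra.
Qed.

Lemma conv_adjoint b f g : torus_test b -> integ mu3 f -> integ mu3 g ->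
  \int[mu3]_x (conv b f x * g x) = \int[mu3]_y (f y * conv (check3 b) g y).
Proof.
move=> tb fi gi; have [M M0 bM] := test_bounded tb.
have mf := integ_meas fi; have mg := integ_meas gi.
pose h (z : mpoint3 R * mpoint3 R) := b ((z.1 : point3 R) - z.2) * f z.2 * g z.1.
have mh : measurable_fun setT h.
  apply: measurable_funM; last exact: measurableT_comp.
  apply: measurable_funM; last exact: measurableT_comp.
  by apply: (measurableT_comp (test_measurable tb)); apply: measurable_sub3.
have ih : integ (mu3 \x mu3)%E h.
  apply: (@integ_prod _ _ (mpoint3 R) (mpoint3 R) R mu3 mu3 h (fun x y => M * `|g x| * `|f y|)) => //.
  - move=> x y; rewrite /h /= !normrM mulrAC ler_wpM2r // ler_wpM2r //.
  - by move=> x; apply: integZ; exact: integ_abs.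
  - apply: (@eq_integ _ _ _ mu3 (fun x : mpoint3 R => (M * \int[mu3]_y `|f y|) * `|g x| : R)).
      by move=> x; rewrite (RintZ _ (integ_abs fi)) mulrAC.
    by apply: integZ; exact: integ_abs.
transitivity (\int[mu3]_x \int[mu3]_y h (x, y)).
  apply: eq_Rint => x; rewrite mulrC -RintZ; last exact: conv_integ.
  by apply: eq_Rint => y; rewrite /h /= mulrC.
rewrite (Rint_swap ih); apply: eq_Rint => y.
rewrite -RintZ; last by apply: conv_integ => //; exact: check3_test.
by apply: eq_Rint => x; rewrite /h /check3 /= opprB; ring.
Qed.

End Convolution.

(** * Continuity of translations *)

Section TranslationContinuity.
Context {R : realType}.
Notation lam := (@lebesgue_measure R).
Notation mu1 := (@mu1 R).
Notation mu2 := (@mu2 R).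
Notation mu3 := (@mu3 R).

#[global] Instance mu1_ae_filter : Filter (nbhs (almost_everywhere mu1)).
Proof. exact: (ae_filter_ringOfSetsType mu1). Qed.

#[global] Instance mu3_ae_filter : Filter (nbhs (almost_everywhere mu3)).
Proof. exact: (ae_filter_ringOfSetsType mu3). Qed.

Lemma eq_cvgn (v w : nat -> R) (l : R) : (forall n, w n = v n) ->
  v n @[n --> \oo] --> l -> w n @[n --> \oo] --> l.
Proof. by move=> /funext->. Qed.

Lemma cvgn_sum (I : Type) (r : seq I) (v : I -> nat -> R) (l : I -> R) :
  (forall i, v i n @[n --> \oo] --> l i) ->
  \sum_(i <- r) v i n @[n --> \oo] --> \sum_(i <- r) l i.
Proof.
move=> vl; elim: r => [|i r IH].
  by rewrite big_nil; apply: (@eq_cvgn (fun=> 0)); [move=> n; rewrite big_nil|exact: cvg_cst].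
rewrite big_cons; apply: (@eq_cvgn (fun n => v i n + \sum_(j <- r) v j n)).
  by move=> n; rewrite big_cons.
by apply: cvgD => //; exact: vl.
Qed.

Lemma mu1_ae_itv :
  {ae (mu1 : {measure set (measurableTypeR R) -> \bar R}), forall x, x \in `[0, 1]}.
Proof.
exists (~` `[0, 1]%classic); split => //.
- exact: measurableC.
- by rewrite -[LHS]/(lam (~` `[0%R, 1%R] `&` `[0%R, 1%R])) setICl measure0.
Qed.

Lemma integ_shift1 (f : R -> R) h : integ mu1 f -> per1 f -> integ mu1 (fun x => f (x + h)).
Proof.
move=> /integrableP[/measurable_EFinP mf fy] pf; apply/integrableP; split.
  by apply/measurable_EFinP/(measurableT_comp mf); exact: (@measurable_funD _ _ _ _ id (cst h)).
rewrite (@integral_mu1_shift R h (fun x => `|(f x)%:E|)%E) //.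
  by apply: measurableT_comp => //; exact/measurable_EFinP.
by move=> x; rewrite /= pf.
Qed.

Lemma ge0_integral_itv_split (f : R -> \bar R) (s t r : R) :
  measurable_fun setT f -> (forall x, 0 <= f x)%E -> s <= t -> t <= r ->
  (\int[lam]_(x in `[s, r[) f x =
   \int[lam]_(x in `[s, t[) f x + \int[lam]_(x in `[t, r[) f x)%E.
Proof.
move=> mf f0 st tr; rewrite (@itv_bndbnd_setU _ _ _ (BLeft t)) //.
rewrite ge0_integral_setU //=; first exact: measurable_funTS.
apply/disj_setPS => y [/=]; rewrite !in_itv /= => /andP[_ yt] /andP[ty _].
by move: (lt_le_trans yt ty); rewrite ltxx.
Qed.

Lemma per1_integrable (f : R -> R) : integ mu1 f -> per1 f ->
  lam.-integrable `[-1, 2] (EFin \o f).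
Proof.
move=> /integrableP[/measurable_EFinP mf fy] pf; apply/integrableP; split.
  by apply/measurable_EFinP; exact: measurable_funTS.
pose F x := `|(f x)%:E|%E.
have mF : measurable_fun setT F by apply: measurableT_comp => //; exact/measurable_EFinP.
have F0 x : (0 <= F x)%E by exact: abse_ge0.
have pF : per1 F by move=> x; rewrite /F pf.
rewrite -integral_itv_bndo_bndc; last exact: measurable_funTS.
suff : (\int[lam]_(x in `[(-1)%R, 2%R[) F x < +oo)%E by [].
rewrite (@ge0_integral_itv_split F _ 0) // (@ge0_integral_itv_split F 0 1) //; last lra.
have J : (\int[lam]_(x in `[0%R, 1%R[) F x < +oo)%E.
  by rewrite -integral_mu1.
have -> : (\int[lam]_(x in `[(-1)%R, 0%R[) F x = \int[lam]_(x in `[0%R, 1%R[) F x)%E.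
  by have := integral_itv_per1 (-1) mF F0 pF; rewrite addNr.
have -> : (\int[lam]_(x in `[1%R, 2%R[) F x = \int[lam]_(x in `[0%R, 1%R[) F x)%E.
  exact: (integral_itv_per1 1 mF F0 pF).
by apply: lte_add_pinfty => //; exact: lte_add_pinfty.
Qed.

(** Density of continuous functions in L^1. The approximation g is taken on [-1, 2], so that it
    stays within e/4 of f after any shift by at most 1; for g itself dominated convergence
    applies. *)
Lemma shift_cvg1 (f : R -> R) (h : nat -> R) : integ mu1 f -> per1 f ->
  h n @[n --> \oo] --> 0 -> (forall n, `|h n| <= 1) ->
  \int[mu1]_x `|f (x + h n) - f x| @[n --> \oo] --> 0.
Proof.
move=> fi pf h0 h1; have mf := integ_meas fi.
apply/cvgrPdist_le => /= e e0.
have mI : measurable (`[-1, 2]%classic : set (measurableTypeR R)) by [].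
have lI : (lam (`[(-1)%R, 2%R]%classic : set (measurableTypeR R)) < +oo)%E.
  by rewrite lebesgue_measure_itv /= lte_fin; case: ifP => _; rewrite ?ltry // -EFinB ltry.
have [g_ [cg ig ag]] := approximation_continuous_integrable mI lI (per1_integrable fi pf).
have [g [c_g fg]] : exists g : R -> R, continuous g /\
    (\int[lam]_(z in `[(-1)%R, 2%R]) `|(f z - g z)%:E| <= (e / 4)%:E)%E.
  move/fine_cvgP : ag => [[N1 _ fN] /cvgrPdist_le /(_ (e / 4)) -[|N2 _ gN]].
    by rewrite divr_gt0.
  exists (g_ (maxn N1 N2)); split; first exact: cg.
  rewrite -[leLHS]fineK; last by apply: fN; exact: leq_maxl.
  rewrite lee_fin; apply: le_trans (ler_norm _) _.
  by have := gN _ (leq_maxr N1 N2); rewrite sub0r normrN.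
have mg : measurable_fun setT g by exact: continuous_measurable_fun.
have mD a : measurable_fun setT (fun x : R => x + a) by exact: (@measurable_funD _ _ _ _ id (cst a)).
pose F x := `|(f x - g x)%:E|%E.
have mF : measurable_fun setT F.
  by apply: measurableT_comp => //; apply/measurable_EFinP; exact: measurable_funB.
have F0 x : (0 <= F x)%E by exact: abse_ge0.
have Fh n : (\int[mu1]_x F (x + h n)%R <= (e / 4)%:E)%E.
  have := h1 n; rewrite ler_norml => /andP[l1 l2].
  rewrite integral_mu1 //; last exact: (measurableT_comp mF (mD _)).
  rewrite integral_itv_shift //; apply: le_trans fg.
  apply: ge0_subset_integral => //; first exact: measurable_funTS.
  by apply: subset_itv; rewrite bnd_simp; lra.
have cgs (a : R) : continuous (fun x : R => g (x + a)).
  by move=> x; apply: continuous_comp; [apply: cvgD; [exact: cvg_id|exact: cvg_cst]|exact: c_g].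
have igs a : integ mu1 (fun x => g (x + a)) by exact: continuous_integ_mu1.
have ifs a : integ mu1 (fun x => f (x + a)) by exact: integ_shift1.
have ifg a : integ mu1 (fun x => `|f (x + a) - g (x + a)|) by exact/integ_abs/integB.
have igg a : integ mu1 (fun x => `|g (x + a) - g x|).
  by apply/integ_abs/integB => //; have := igs 0; under eq_fun do rewrite addr0.
have Rh n : \int[mu1]_x `|f (x + h n) - g (x + h n)| <= e / 4.
  by rewrite -lee_fin EFin_Rint //; exact: Fh.
have R0 : \int[mu1]_x `|f (x + 0) - g (x + 0)| <= e / 4.
  rewrite -lee_fin EFin_Rint //; apply: le_trans fg.
  under eq_integral do rewrite addr0.
  rewrite -[leLHS]/(\int[mu1]_x F x)%E integral_mu1 //.
  apply: ge0_subset_integral => //; first exact: measurable_funTS.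
  by apply: subset_itv; rewrite bnd_simp; lra.
have [_ cvg_g] : integ mu1 (fun=> 0) /\ \int[mu1]_x `|g (x + h n) - g x| @[n --> \oo] --> \int[mu1]_x 0.
  have /compact_bounded[M [_ gM]] : compact (g @` `[-1, 2]%classic).
    by apply: continuous_compact; [exact: continuous_subspaceT|exact: segment_compact].
  have {gM} gM (x : R) : x \in `[-1, 2] -> `|g x| <= `|M| + 1.
    by move=> x01; apply: gM; [rewrite (le_lt_trans (ler_norm _)) // ltrDl|exists x].
  apply: (Rint_dct _ _ _ (integ_cst mu1 (2 * (`|M| + 1)))).
  - by move=> n; exact: integ_meas (igg _).
  - exact: measurable_cst.
  - apply: nearW => x.
    have : `|g (x + h n) - g x| @[n --> \oo] --> `|g x - g x|.
      apply: cvg_norm; apply: cvgB; last exact: cvg_cst.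
      apply: continuous_cvg; first exact: c_g.
      by rewrite -[X in _ --> X]addr0; apply: cvgD => //; exact: cvg_cst.
    by rewrite subrr normr0.
  - apply: filterS mu1_ae_itv => x; rewrite in_itv /= => /andP[x0 x1] n.
    rewrite normr_id (le_trans (ler_normB _ _)) // mulr_natl mulr2n lerD // gM // in_itv /=.
      by have := h1 n; rewrite ler_norml => /andP[l1 l2]; apply/andP; split; lra.
    by apply/andP; split; lra.
move: cvg_g; rewrite Rint0 => /cvgrPdist_le /(_ (e / 4)) -[|N _ gN]; first by rewrite divr_gt0.
exists N => // n /gN; rewrite !sub0r !normrN.
rewrite !ger0_norm; [|exact: Rint_ge0|exact: Rint_ge0] => H.
have ifn : integ mu1 (fun x => `|f (x + h n) - f x|).
  by apply/integ_abs/integB => //; have := ifs 0; under eq_fun do rewrite addr0.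
apply: (@le_trans _ _ (\int[mu1]_x (`|f (x + h n) - g (x + h n)| + `|g (x + h n) - g x| +
   `|f (x + 0) - g (x + 0)|))).
  apply: Rint_le => //; first by apply: integD => //; exact: integD.
  move=> x; rewrite addr0 (distrC (f x)).
  have -> : f (x + h n) - f x = (f (x + h n) - g (x + h n)) + (g (x + h n) - g x) + (g x - f x) by ring.
  by rewrite (le_trans (ler_normD _ _)) // lerD2r ler_normD.
rewrite RintD //; last exact: integD.
have e4 (a b c : R) : a <= e / 4 -> b <= e / 4 -> c <= e / 4 -> a + b + c <= e by lra.
by rewrite RintD //; apply: e4 => //; exact: Rh.
Qed.

(* Continuity of translations in one factor of a product follows from the same
   statement on the slices by dominated convergence. *)
Lemma shift_cvg_prod d1 d2 (X : measurableType d1) (Y : measurableType d2)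
    (m1 : {sigma_finite_measure set X -> \bar R})
    (m2 : {sigma_finite_measure set Y -> \bar R})
    (P : (Y -> R) -> Prop) (t : nat -> Y -> Y) (f : X * Y -> R) :
  (forall n, measurable_fun setT (t n)) ->
  (forall g n, P g -> integ m2 g -> integ m2 (fun y => g (t n y)) /\
     \int[m2]_y `|g (t n y)| = \int[m2]_y `|g y|) ->
  (forall g, P g -> integ m2 g -> \int[m2]_y `|g (t n y) - g y| @[n --> \oo] --> 0) ->
  (forall x, P (fun y => f (x, y))) -> integ (m1 \x m2)%E f ->
  (forall n, integ (m1 \x m2)%E (fun z => f (z.1, t n z.2))) ->
  \int[(m1 \x m2)%E]_z `|f (z.1, t n z.2) - f z| @[n --> \oo] --> 0.
Proof.
move=> mt Pt Pc Pf fi fti; have mf := integ_meas fi.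
have di n : integ (m1 \x m2)%E (fun z => `|f (z.1, t n z.2) - f z|) by exact/integ_abs/integB.
pose F n x := \int[m2]_y `|f (x, t n y) - f (x, y)|.
have FE n : \int[(m1 \x m2)%E]_z `|f (z.1, t n z.2) - f z| = \int[m1]_x F n x.
  by rewrite -(Rint_prod (di n)).
under eq_fun do rewrite FE.
have aei : {ae m1, forall x, integ m2 (fun y => f (x, y))} by exact: (ae_integrable1 fi).
have [_] : integ m1 (fun=> 0) /\ \int[m1]_x F n x @[n --> \oo] --> \int[m1]_x 0.
  apply: (Rint_dct (g := fun x => 2 * \int[m2]_y `|f (x, y)|)).
  - by move=> n; exact: (measurable_Rint _ (integ_meas (di n))).
  - exact: measurable_cst.
  - by apply: filterS aei => x ix; exact: Pc.
  - exact/integZ/(integ_Rint (integ_abs fi)).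
  - apply: filterS aei => x ix n.
    have [it tE] := Pt _ n (Pf x) ix.
    rewrite ger0_norm; last exact: Rint_ge0.
    apply: (@le_trans _ _ (\int[m2]_y (`|f (x, t n y)| + `|f (x, y)|))).
      apply: Rint_le; [exact/integ_abs/integB|by apply: integD; exact: integ_abs|].
      by move=> y; exact: ler_normB.
    by rewrite RintD ?tE ?mulr_natl ?mulr2n //; exact: integ_abs.
by rewrite Rint0.
Qed.

Lemma integ_swap d1 d2 (X : measurableType d1) (Y : measurableType d2)
    (m1 : {sigma_finite_measure set X -> \bar R})
    (m2 : {sigma_finite_measure set Y -> \bar R}) (f : X * Y -> R) :
  integ (m1 \x m2)%E f -> integ (m2 \x m1)%E (fun z => f (z.2, z.1)) /\
  \int[(m2 \x m1)%E]_z f (z.2, z.1) = \int[(m1 \x m2)%E]_z f z.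
Proof.
move=> fi; have mf := integ_meas fi.
have mf' : measurable_fun setT (EFin \o (fun z : Y * X => f (z.2, z.1))).
  by apply/measurable_EFinP/(measurableT_comp mf); exact: measurable_fun_pair.
have i' : integ (m2 \x m1)%E (fun z => f (z.2, z.1)).
  apply/(integrable12ltyP m2 m1 mf').
  by have /(integrable21ltyP m1 m2) := (fi : (m1 \x m2)%E.-integrable setT _); apply;
     exact/measurable_EFinP.
by split=> //; rewrite -(Rint_prod i') -(Rint_prod2 fi).
Qed.

Lemma integ_invariant d (X : measurableType d) (m : {measure set X -> \bar R})
    (t : X -> X) (f : X -> R) : measurable_fun setT t ->
  (\int[m]_x `|f (t x)|%:E = \int[m]_x `|f x|%:E)%E -> integ m f ->
  integ m (fun x => f (t x)) /\ \int[m]_x `|f (t x)| = \int[m]_x `|f x|.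
Proof.
move=> mt tE fi; split; last by rewrite /Rintegral tE.
move/integrableP : fi => [/measurable_EFinP mf fy]; apply/integrableP; split.
  exact/measurable_EFinP/(measurableT_comp mf).
by rewrite (_ : (\int[m]_x _)%E = (\int[m]_x `|f (t x)|%:E)%E) ?tE.
Qed.

Let measurable_addc (a : R) : measurable_fun setT (fun x : measurableTypeR R => x + a).
Proof. exact: (@measurable_funD _ _ _ _ id (cst a)). Qed.

Lemma shift1_invariant (g : R -> R) (a : R) : per1 g -> integ mu1 g ->
  integ mu1 (fun y => g (y + a)) /\ \int[mu1]_y `|g (y + a)| = \int[mu1]_y `|g y|.
Proof.
move=> pg gi; have mg := integ_meas gi.
apply: integ_invariant gi; first exact: measurable_addc.
apply: (@integral_mu1_shift R a (fun x => `|g x|%:E)%E) => //.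
  by apply/measurable_EFinP; exact: measurableT_comp.
by move=> x; rewrite pg.
Qed.

Let per2 (g : R * R -> R) := (forall x y, g (x + 1, y) = g (x, y)) /\
  (forall x y, g (x, y + 1) = g (x, y)).

Lemma shift2_invariant (g : R * R -> R) (a b : R) : per2 g -> integ mu2 g ->
  integ mu2 (fun z => g (z.1 + a, z.2 + b)) /\
  \int[mu2]_z `|g (z.1 + a, z.2 + b)| = \int[mu2]_z `|g z|.
Proof.
move=> [p0 p1] gi; have mg := integ_meas gi.
apply: (@integ_invariant _ (measurableTypeR R * measurableTypeR R)%type mu2
  (fun z => (z.1 + a, z.2 + b)) g) => //.
  apply: measurable_fun_pair.
    by apply: (measurableT_comp (@measurable_addc a)).
  by apply: (measurableT_comp (@measurable_addc b)).
have mG : measurable_fun setT (fun z : measurableTypeR R * measurableTypeR R => `|g z|%:E).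
  by apply/measurable_EFinP; exact: measurableT_comp.
apply: (@integral_prod_invariant _ _ _ _ R mu1 mu1
    (fun x => x + a) (fun x => x + b) (fun w => `|g w|%:E)) => //.
- exact: measurable_addc.
- exact: measurable_addc.
- move=> y; apply: (@integral_mu1_shift R a (fun x => `|g (x, y)|%:E)) => //.
    by apply: (measurableT_comp mG); apply: measurable_fun_pair.
  by move=> x; rewrite p0.
- move=> x; apply: (@integral_mu1_shift R b (fun y => `|g (x, y)|%:E)) => //.
    by apply: (measurableT_comp mG); apply: measurable_fun_pair.
  by move=> y; rewrite p1.
Qed.

Section Sequence.
Variable a : nat -> R.
Hypotheses (a0 : a n @[n --> \oo] --> 0) (a1 : forall n, `|a n| <= 1).

Lemma shift_cvg2r (g : R * R -> R) : per2 g -> integ mu2 g ->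
  \int[mu2]_z `|g (z.1, z.2 + a n) - g z| @[n --> \oo] --> 0.
Proof.
move=> pg gi.
apply: (@shift_cvg_prod _ _ _ _ mu1 mu1 (@per1 R R) (fun n y => y + a n) g) => //.
- by move=> n; exact: measurable_addc.
- by move=> h n ph hi; exact: shift1_invariant.
- by move=> h ph hi; exact: shift_cvg1.
- by move=> x y; exact: pg.2.
- move=> n; have [+ _] := shift2_invariant 0 (a n) pg gi.
  by apply: eq_integ => z; rewrite addr0.
Qed.

Lemma shift_cvg2l (g : R * R -> R) : per2 g -> integ mu2 g ->
  \int[mu2]_z `|g (z.1 + a n, z.2) - g z| @[n --> \oo] --> 0.
Proof.
move=> pg gi.
have pg' : per2 (fun z => g (z.2, z.1)) by split=> x y; [exact: pg.2|exact: pg.1].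
have [gi' _] := @integ_swap _ _ _ _ mu1 mu1 g gi.
have E n : \int[mu2]_z `|g (z.2 + a n, z.1) - g (z.2, z.1)| = \int[mu2]_z `|g (z.1 + a n, z.2) - g z|.
  have [ia _] := shift2_invariant (a n) 0 pg gi.
  have ia' : integ mu2 (fun z => g (z.1 + a n, z.2)).
    by apply: eq_integ ia => z; rewrite addr0.
  exact: (@integ_swap _ _ _ _ mu1 mu1 _ (integ_abs (integB ia' gi))).2.
have := shift_cvg2r pg' gi'.
by apply: cvg_trans; apply: near_eq_cvg; apply: nearW => n; rewrite -E.
Qed.

Lemma shift_cvg3 (f : point3 R -> R) : periodic3 f -> integ mu3 f ->
  [/\ \int[mu3]_z `|f (z.1.1 + a n, z.1.2, z.2) - f z| @[n --> \oo] --> 0,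
     \int[mu3]_z `|f (z.1.1, z.1.2 + a n, z.2) - f z| @[n --> \oo] --> 0 &
     \int[mu3]_z `|f (z.1.1, z.1.2, z.2 + a n) - f z| @[n --> \oo] --> 0].
Proof.
move=> pf fi; have [p0 p1 p2] := (periodic3P f).1 pf.
have ish (h : point3 R) := integ_shift3 h fi pf.
pose f' (z : R * (R * R)) := f (z.2, z.1).
have [fi' _] := @integ_swap _ _ _ _ mu2 mu1 f fi.
(* [shift_cvg_prod] moves the second factor of a product. The first two coordinates form the first
   factor of [mu3], so the factors are swapped before it is applied. *)
have L (t : nat -> R * R -> R * R) (h : nat -> point3 R) :
    (forall n z, f ((z : point3 R) + h n) = f (t n z.1, z.2)) ->
    (forall n, measurable_fun setT (t n : measurableTypeR R * measurableTypeR R -> measurableTypeR R * measurableTypeR R)) ->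
    (forall g n, per2 g -> integ mu2 g -> integ mu2 (fun y => g (t n y)) /\
       \int[mu2]_y `|g (t n y)| = \int[mu2]_y `|g y|) ->
    (forall g, per2 g -> integ mu2 g -> \int[mu2]_y `|g (t n y) - g y| @[n --> \oo] --> 0) ->
    \int[mu3]_z `|f (t n z.1, z.2) - f z| @[n --> \oo] --> 0.
  move=> th mt ti tc.
  have iti n : integ mu3 (fun z => f (t n z.1, z.2)).
    by apply: eq_integ (ish (h n)) => z; exact: th.
  have H : \int[(mu1 \x mu2)%E]_z `|f (t n z.2, z.1) - f (z.2, z.1)| @[n --> \oo] --> 0.
    apply: (@shift_cvg_prod _ _ _ _ mu1 mu2 per2 t (fun z => f (z.2, z.1)) mt ti tc) => //.
    - by move=> z; split=> x y; [exact: p0|exact: p1].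
    - by move=> n; have [] := @integ_swap _ _ _ _ mu2 mu1 _ (iti n).
  apply: eq_cvgn H => n; symmetry.
  exact: (@integ_swap _ _ _ _ mu2 mu1 _ (integ_abs (integB (iti n) fi))).2.
split.
- apply: (L (fun n w => (w.1 + a n, w.2)) (fun n => (a n, 0, 0))).
  + by move=> n [[x y] z]; rewrite -[LHS]/(f (x + a n, y + 0, z + 0)) !addr0.
  + by move=> n; apply: measurable_fun_pair => //; apply: (measurableT_comp (@measurable_addc (a n))).
  + move=> g n pg gi; have := shift2_invariant (a n) 0 pg gi.
    by under eq_fun do rewrite addr0; under [in X in _ /\ X -> _]eq_fun do rewrite addr0.
  + by move=> g; exact: shift_cvg2l.
- apply: (L (fun n w => (w.1, w.2 + a n)) (fun n => (0, a n, 0))).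
  + by move=> n [[x y] z]; rewrite -[LHS]/(f (x + 0, y + a n, z + 0)) !addr0.
  + by move=> n; apply: measurable_fun_pair => //; apply: (measurableT_comp (@measurable_addc (a n))).
  + move=> g n pg gi; have := shift2_invariant 0 (a n) pg gi.
    by under eq_fun do rewrite addr0; under [in X in _ /\ X -> _]eq_fun do rewrite addr0.
  + by move=> g; exact: shift_cvg2r.
- have H : \int[mu3]_z `|f (z.1, z.2 + a n) - f z| @[n --> \oo] --> 0.
    apply: (@shift_cvg_prod _ _ _ _ mu2 mu1 (@per1 R R) (fun n y => y + a n) f) => //.
    + by move=> n; exact: measurable_addc.
    + by move=> g n pg gi; exact: shift1_invariant.
    + by move=> g pg gi; exact: shift_cvg1.
    + by move=> [x y] z; exact: p2.
    + move=> n; apply: eq_integ (ish (0, 0, a n)) => -[[x y] z].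
      by rewrite -[LHS]/(f (x + 0, y + 0, z + a n)) !addr0.
  by apply: eq_cvgn H => n; apply: eq_Rint => -[[x y] z].
Qed.

Lemma shift_cvgx (f : point3 R -> R) : periodic3 f -> integ mu3 f ->
  forall i, \int[mu3]_z `|f ((z : point3 R) + a n *: basis3 i) - f z| @[n --> \oo] --> 0.
Proof.
move=> pf fi i; have [c0 c1 c2] := shift_cvg3 pf fi.
case: i => [[|[|[|]]]] // ?; [apply: eq_cvgn c0|apply: eq_cvgn c1|apply: eq_cvgn c2]
  => n; apply: eq_Rint => -[[x y] z] /=;
  rewrite -[_ *: _]/(a n * _, a n * _, a n * _) -[(x, y, z) + _]/(x + _, y + _, z + _) /=;
  by rewrite ?mulr1 ?mulr0 ?addr0.
Qed.

End Sequence.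

(** The shift is made along the three axes in turn; invariance brings each of the three increments
    back to one that starts at z. *)
Lemma shift_cvg (f : point3 R -> R) (h : nat -> point3 R) :
  periodic3 f -> integ mu3 f ->
  h n @[n --> \oo] --> (0 : point3 R) -> (forall n, `|h n| <= 1) ->
  \int[mu3]_z `|f ((z : point3 R) + h n) - f z| @[n --> \oo] --> 0.
Proof.
move=> pf fi h0 h1.
pose a (i : 'I_3) n := if i == 0 :> nat then (h n).1.1 else if i == 1%N :> nat then (h n).1.2 else (h n).2.
have ah i n : `|a i n| <= `|h n|.
  by rewrite /a !prod_normE /=; case: ifP => _; [|case: ifP => _]; rewrite !le_max lexx ?orbT.
have a1 i n : `|a i n| <= 1 by exact: le_trans (h1 n).
have a0 i : a i n @[n --> \oo] --> 0.
  apply/norm_cvg0P; apply: (@squeeze_cvgr _ _ _ _ (fun=> 0) (fun n => `|h n|)).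
  - by apply: nearW => n; rewrite normr_ge0 ah.
  - exact: cvg_cst.
  - by rewrite -(@normr0 _ (point3 R)); exact: cvg_norm.
have C i := shift_cvgx (a0 i) (a1 i) pf fi.
pose S n := \sum_(i < 3) \int[mu3]_z `|f ((z : point3 R) + a i n *: basis3 i) - f z|.
apply: (@squeeze_cvgr _ _ _ _ (fun=> 0) S); last first.
- rewrite (_ : 0 = \sum_(i < 3) (0 : R)); last by rewrite big1.
  by apply: cvgn_sum => i; exact: C.
- exact: cvg_cst.
apply: nearW => n; rewrite Rint_ge0 // /S !big_ord_recl big_ord0 addr0 /=.
have hE : h n = a ord0 n *: basis3 ord0 + a (lift ord0 ord0) n *: basis3 (lift ord0 ord0)
   + a (lift ord0 (lift ord0 ord0)) n *: basis3 (lift ord0 (lift ord0 ord0)).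
  rewrite /a /=; case: (h n) => [[x y] z].
  rewrite -[RHS]/(x * _ + y * _ + z * _, x * _ + y * _ + z * _, x * _ + y * _ + z * _) /=.
  by rewrite !(mulr1, mulr0, addr0, add0r).
rewrite hE; move: (_ *: _) (_ *: _) (_ *: _) => r q p.
pose g v x := `|f (x + v) - f x|.
have pg v : periodic3 (g v) by move=> x i; rewrite /g addrAC !pf.
have ig v : integ mu3 (g v) by apply/integ_abs/integB => //; exact: integ_shift3.
have I v w : integ mu3 (fun x => g v (x + w)) by exact: integ_shift3.
have -> : \int[mu3]_z `|f ((z : point3 R) + p) - f z| +
   (\int[mu3]_z `|f ((z : point3 R) + q) - f z| + \int[mu3]_z `|f ((z : point3 R) + r) - f z|) =
   \int[mu3]_x (g p x + (g q (x + p) + g r (x + (p + q)))).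
  rewrite (RintD (ig p) (integD (I q p) (I r (p + q)))) (RintD (I q p) (I r (p + q))).
  by rewrite (Rint_shift3 p (integ_meas (ig q)) (pg q)) (Rint_shift3 (p + q) (integ_meas (ig r)) (pg r)).
apply: Rint_le; [exact: ig|by apply: integD => //; exact: integD|].
move=> x; rewrite /g.
have -> : f (x + (p + q + r)) - f x = (f (x + p) - f x) + ((f (x + p + q) - f (x + p)) +
   (f (x + (p + q) + r) - f (x + (p + q)))).
  by rewrite !addrA; ring.
by rewrite (le_trans (ler_normD _ _)) // lerD2l ler_normD.
Qed.

(** By contradiction: shifts of size at most 1/(n+1) with a large increment would form a sequence
    that violates [shift_cvg]. The gain is a radius that is uniform in the shift. *)
Lemma shift_small (f : point3 R -> R) : periodic3 f -> integ mu3 f ->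
  forall e : R, 0 < e -> exists2 d : R, 0 < d &
    forall h : point3 R, `|h| <= d -> \int[mu3]_z `|f ((z : point3 R) + h) - f z| <= e.
Proof.
move=> pf fi e e0; apply: contrapT => /forall2NP H.
have {}H (n : nat) : exists h : point3 R, `|h| <= n.+1%:R^-1 /\
    e < \int[mu3]_z `|f ((z : point3 R) + h) - f z|.
  have [[]|/existsNP[h /not_implyP[h1 /negP h2]]] := H n.+1%:R^-1.
    by rewrite invr_gt0 ltr0n.
  by exists h; rewrite ltNge.
have [h hP] := choice H.
have h0 : h n @[n --> \oo] --> (0 : point3 R).
  apply/norm_cvg0P; apply: (@squeeze_cvgr _ _ _ _ (fun=> 0) (fun n => n.+1%:R^-1)).
  - by apply: nearW => n; rewrite normr_ge0 (hP n).1.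
  - exact: cvg_cst.
  - exact: cvg_harmonic.
have h1 n : `|h n| <= 1.
  by apply: le_trans (hP n).1 _; rewrite invf_le1 ?ltr0n // ler1n.
have /cvgrPdist_lt /(_ e e0) [N _ /(_ N (leqnn N))] := shift_cvg pf fi h0 h1.
rewrite /= sub0r normrN ger0_norm; last exact: Rint_ge0.
by have [_ eh] := hP N; move=> /(lt_trans eh); rewrite ltxx.
Qed.

(** The ratios of a and b to a + b lie in [0, 1], where the p-th power is below the identity, and
    they add up to 1. *)
Lemma powR_superadd (p a b : R) : 1 <= p -> 0 <= a -> 0 <= b ->
  a `^ p + b `^ p <= (a + b) `^ p.
Proof.
move=> p1 a0 b0; have p0 : p != 0 by rewrite gt_eqF // (lt_le_trans _ p1).
have [ab0|ab0] := eqVneq (a + b) 0.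
  have -> : a = 0 by lra.
  have -> : b = 0 by lra.
  by rewrite addr0 powR0 // addr0.
have ab : 0 < a + b by rewrite lt_neqAle eq_sym ab0 addr_ge0.
have E c : 0 <= c -> c <= a + b -> c `^ p <= c / (a + b) * (a + b) `^ p.
  move=> c0 cab; have c1 : 0 <= c / (a + b) <= 1.
    by rewrite divr_ge0 ?(ltW ab) // ler_pdivrMr // mul1r.
  have -> : c `^ p = (c / (a + b)) `^ p * (a + b) `^ p.
    by rewrite -powRM ?(ltW ab) ?(andP c1).1 // divfK.
  apply: ler_wpM2r; first exact: powR_ge0.
  have [/eqP z|z] := boolP (c / (a + b) == 0); first by rewrite z powR0.
  by rewrite -[leRHS](@powRr1 _ (c / (a + b))) ?(andP c1).1 // ger_powR // lt_neqAle eq_sym z.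
have := lerD (E a a0 _) (E b b0 _).
rewrite -mulrDl -mulrDl divff // mul1r; apply; lra.
Qed.

(** The signed power sgn(t) |t|^p. It sends L^p to L^1 and keeps the sign, so that continuity of
    translations in L^p is inherited from L^1. *)
Definition spow (p : R) (t : R) := Num.max t 0 `^ p - Num.max (- t) 0 `^ p.

Lemma spowN p t : spow p (- t) = - spow p t.
Proof. by rewrite /spow opprK opprB. Qed.

Lemma spow_ge0 p t : 0 <= t -> p != 0 -> spow p t = t `^ p.
Proof.
move=> t0 p0; rewrite /spow (max_idPl t0) (max_idPr _) ?oppr_le0 //.
by rewrite powR0 // subr0.
Qed.

Lemma norm_spow p t : p != 0 -> `|spow p t| <= `|t| `^ p.
Proof.
move=> p0; wlog t0 : t / 0 <= t.
  move=> W; have [|t0] := leP 0 t; first exact: W.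
  by have := W (- t); rewrite spowN !normrN; apply; lra.
by rewrite spow_ge0 // !ger0_norm ?powR_ge0.
Qed.

Lemma measurable_spow p : measurable_fun setT (spow p).
Proof.
apply: measurable_funB; apply: (measurableT_comp (measurable_powR _)).
  exact: measurable_maxr.
by apply: measurable_maxr => //; exact: measurable_oppr.
Qed.

(** For equal signs this is superadditivity of the power. For opposite signs |a - b| is at most
    twice the larger absolute value, whence the factor 2^p. *)
Lemma spow_dist (p a b : R) : 1 <= p ->
  `|a - b| `^ p <= 2 `^ p * `|spow p a - spow p b|.
Proof.
move=> p1; have p0 : p != 0 by rewrite gt_eqF // (lt_le_trans _ p1).
have p0' : 0 <= p by lra.
have two : 1 <= 2 `^ p :> R 
  by have := @ge0_ler_powR R p p0' 1 2; rewrite !nnegrE powR1; apply; lra.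
have same c d : 0 <= d -> d <= c -> `|c - d| `^ p <= 2 `^ p * `|spow p c - spow p d|.
  move=> d0 dc; have c0 : 0 <= c by lra.
  rewrite !spow_ge0 // ger0_norm ?subr_ge0 //.
  have := powR_superadd p1 (_ : 0 <= c - d) d0; rewrite subr_ge0 => /(_ dc).
  rewrite subrK => H; rewrite ger0_norm; last by have := powR_ge0 (c - d) p; lra.
  by apply: le_trans (ler_peMl _ two); have := powR_ge0 (c - d) p; lra.
have opp c d : 0 <= c -> 0 <= d -> `|c - (- d)| `^ p <= 2 `^ p * `|spow p c - spow p (- d)|.
  move=> c0 d0; rewrite spowN !opprK !spow_ge0 // !ger0_norm ?addr_ge0 ?powR_ge0 //.
  wlog dc : c d c0 d0 / d <= c.
    move=> W; have [|/ltW] := leP d c; first exact: W.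
    by rewrite addrC (addrC (c `^ p)); exact: W.
  apply: (@le_trans _ _ ((2 * c) `^ p)).
    by apply: ge0_ler_powR => //; rewrite ?nnegrE; lra.
  by rewrite powRM // ler_wpM2l ?powR_ge0 // lerDl powR_ge0.
wlog a0 : a b / 0 <= a.
  move=> W; have [|a0] := leP 0 a; first exact: W.
  have E (x y : R) : `|- x - - y| = `|x - y| by rewrite -normrN; congr `| _ |; ring.
  by have := W (- a) (- b); rewrite !spowN !E; apply; lra.
have [b0|b0] := leP 0 b; last first.
  by have := @opp a (- b) a0; rewrite !opprK; apply; lra.
have [ba|/ltW ab] := leP b a; first exact: same.
by rewrite distrC (distrC (spow p a)); exact: same.
Qed.

Lemma integ_spow d (X : measurableType d) (m : {measure set X -> \bar R}) (p : R) (f : X -> R) :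
  p != 0 -> measurable_fun setT f -> integ m (fun x => `|f x| `^ p) ->
  integ m (fun x => spow p (f x)).
Proof.
move=> p0 mf fi; apply: (integ_le _ fi).
  exact: (measurableT_comp (@measurable_spow p)).
by move=> x; exact: norm_spow.
Qed.

Lemma shift_small_pow (p : R) (f : point3 R -> R) : 1 <= p -> periodic3 f ->
  measurable_fun [set: mpoint3 R] f -> integ mu3 (fun x => `|f x| `^ p) ->
  forall e : R, 0 < e -> exists2 d : R, 0 < d & forall h : point3 R, `|h| <= d ->
    integ mu3 (fun x => `|f ((x : point3 R) + h) - f x| `^ p) /\
    \int[mu3]_x `|f ((x : point3 R) + h) - f x| `^ p <= e.
Proof.
move=> p1 pf mf fi e e0; have p0 : p != 0 by rewrite gt_eqF // (lt_le_trans _ p1).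
have si : integ mu3 (fun x => spow p (f x)) by exact: integ_spow.
have ps : periodic3 (fun x => spow p (f x)) by move=> x i; rewrite pf.
have two : 0 < 2 `^ p :> R by exact: powR_gt0.
have [d d0 H] := shift_small ps si (divr_gt0 e0 two).
exists d => // h hd.
have sd : integ mu3 (fun x => 2 `^ p * `|spow p (f ((x : point3 R) + h)) - spow p (f x)|).
  by apply/integZ/integ_abs/integB => //; exact: integ_shift3 h si ps.
have K (x : point3 R) : `|f (x + h) - f x| `^ p <= 2 `^ p * `|spow p (f (x + h)) - spow p (f x)|.
  exact: spow_dist.
have ip : integ mu3 (fun x => `|f ((x : point3 R) + h) - f x| `^ p).
  apply: (integ_le _ sd).
    apply: (measurableT_comp (measurable_powR _)); apply: measurableT_comp => //.
    by apply: measurable_funB => //; exact: measurable_shift3.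
  by move=> x; rewrite ger0_norm ?powR_ge0.
split=> //; apply: le_trans (Rint_le ip sd K) _.
rewrite RintZ; last by apply/integ_abs/integB => //; exact: integ_shift3 h si ps.
by rewrite mulrC -ler_pdivlMr //; exact: H.
Qed.

End TranslationContinuity.

(** * The mollifying kernel on the torus *)

Section Kernel.
Context {R : realType}.
Notation lam := (@lebesgue_measure R).
Notation mu1 := (@mu1 R).
Notation mu3 := (@mu3 R).
Variable n : nat.

Let kp : R -> R := per (spike n.+3).
Let sp := @spike_supp01 R n.+3 isT.
Let skp : smooth kp. Proof. exact: smooth_per. Qed.

(** The index n + 3 meets the requirement m >= 3 of [spike_supp01]. Within the cell the support lies
    on one side of 0, so the kernel is not even; hence the reflected kernels [check3] in the
    adjoints. *)
Definition kern (x : point3 R) : R :=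
  per (spike n.+3) x.1.1 * per (spike n.+3) x.1.2 * per (spike n.+3) x.2.

Lemma kern_test : torus_test kern.
Proof.
split.
  have s1 := @smooth_fst R R R R _ skp; have s2 := @smooth_snd R R R R _ skp.
  have s3 := @smooth_snd R (R * R)%type R R _ skp.
  have s12 := smoothM s1 s2.
  have s123 := @smooth_fst R (R * R)%type R R _ s12.
  exact: smoothM s123 s3.
apply/periodic3P; have pp := @per1_per R (spike n.+3).
by split=> x y z; rewrite /kern /= pp.
Qed.

Lemma kern_ge0 x : 0 <= kern x.
Proof. rewrite /kern; apply: mulr_ge0; last exact: spike_ge0.
by apply: mulr_ge0; exact: spike_ge0. Qed.

Lemma cell_coords (x : point3 R) : (cell : set (point3 R)) x ->
  [/\ 0 <= x.1.1 <= 1, 0 <= x.1.2 <= 1 & 0 <= x.2 <= 1].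
Proof. by case: x => [[x y] z] [[]] /=; rewrite !in_itv. Qed.

Let norm_small (x : point3 R) (d : R) : 0 <= x.1.1 <= d -> 0 <= x.1.2 <= d -> 0 <= x.2 <= d ->
  `|x| <= d.
Proof.
move=> /andP[a0 ad] /andP[b0 bd] /andP[c0 cd].
by rewrite !prod_normE /= !ge_max !ger0_norm // ad bd cd.
Qed.

Let kp_supp s : 0 <= s <= 1 -> kp s != 0 -> 0 <= s <= 2 / n.+3%:R.
Proof. by move=> s01; rewrite /kp per_itv //; exact: spike_neq0. Qed.

Lemma kern_neq0 x : (cell : set (point3 R)) x -> kern x != 0 -> `|x| <= 2 / n.+3%:R.
Proof.
move=> /cell_coords[x0 x1 x2]; rewrite /kern -!/(kp _) => k.
have [k0 k1 k2] : [/\ kp x.1.1 != 0, kp x.1.2 != 0 & kp x.2 != 0].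
  by split; apply: contra_neq k => ->; rewrite ?mulr0 ?mul0r ?mulr0 ?mul0r.

by apply: norm_small; exact: kp_supp.
Qed.

Let ikp : integ mu1 kp. Proof. by apply: continuous_integ_mu1; exact: smooth_continuous skp. Qed.

Let Rint_kp : \int[mu1]_x kp x = 1.
Proof.
rewrite Rint_mu1; first last.
- by move=> x; exact: spike_ge0.
- exact: integ_meas ikp.
rewrite -[RHS](@Rint_spike R n.+3 isT); apply: eq_Rintegral => x.
by rewrite inE /= in_itv /= => x01; rewrite /kp per_itv.
Qed.

Lemma Rint_kern : \int[mu3]_x kern x = 1.
Proof. by have [_ ->] := Rint_prod3 ikp ikp ikp; rewrite Rint_kp !mulr1. Qed.

Let dkp : R -> R := per ('D_1 (spike n.+3)).
Let sdp := supp01_derive 1 sp.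

Let derive_kern x : 'D_(basis3 ord_max) kern x = kp x.1.1 * kp x.1.2 * dkp x.2.
Proof.
have -> : 'D_(basis3 ord_max) kern x =
    'D_1 (fun z : R => (kp x.1.1 * kp x.1.2) *: kp z) x.2.
  rewrite /derive; congr (lim _); apply: (congr1 (fun F => F @ 0^')); apply/funext => h /=.
  case: x => [[x y] z] /=.
  rewrite -[h *: basis3 _ + _]/(h * _ + x, h * _ + y, h * _ + z) /kern /=.
  by rewrite !mulr0 !add0r -/kp.
rewrite deriveZ; last exact: smooth_derivable.
by rewrite /dkp -(derive_per 1 sp).
Qed.

Lemma Rint_derive_kern : \int[mu3]_x `|'D_(basis3 ord_max) kern x| =
  \int[lam]_(s in `[0, 1]) `|'D_1 (spike n.+3) s|.
Proof.
have cd : continuous dkp := smooth_continuous (smooth_per sdp).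
have ca : continuous (fun s => `|dkp s|) by move=> s; apply: cvg_norm; exact: cd.
have id := continuous_integ_mu1 ca.
rewrite (_ : \int[mu3]_x _ = \int[mu3]_x (kp x.1.1 * kp x.1.2 * `|dkp x.2|)); last first.
  apply: eq_Rint => x; rewrite derive_kern normrM ger0_norm //.
  by apply: mulr_ge0; exact: spike_ge0.
apply: etrans (Rint_prod3 ikp ikp id).2 _; rewrite Rint_kp mulr1 mul1r.
apply: etrans (Rint_mu1 (integ_meas id) _) _; first by move=> s; exact: normr_ge0.
by apply: eq_Rintegral => x; rewrite inE /= in_itv /= => x01; rewrite /dkp per_itv.
Qed.

End Kernel.

Section KernelAverage.
Context {R : realType}.
Notation mu3 := (@mu3 R).

Lemma derive_kern_L1 : exists2 C : R, 0 <= C & forall n,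
  \int[mu3]_x `|'D_(basis3 ord_max) (kern n) x| <= C * n.+3%:R.
Proof.
have [C C0 H] := @derive_spike_L1 R; exists C => // n.
by rewrite Rint_derive_kern; exact: H.
Qed.

Lemma Rint_average_le (b : point3 R -> R) (P : point3 R -> R) (c A : R) :
  measurable_fun [set: mpoint3 R] b -> integ mu3 (fun y => `|b y|) ->
  \int[mu3]_y `|b y| <= c -> 0 <= A ->
  (forall y, (cell : set (point3 R)) y -> b y != 0 -> `|P y| <= A) ->
  integ mu3 (fun y => b y * P y) ->
  `|\int[mu3]_y (b y * P y)| <= c * A.
Proof.
move=> mb ib bc A0 bP iP.
apply: le_trans (Rint_abs iP) _.
apply: (@le_trans _ _ (\int[mu3]_y (A * `|b y|))).
  apply: ae_Rint_le; [exact: integ_abs|exact: integZ|].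
  apply: filterS mu3_ae_cell => y cy; rewrite normrM mulrC.
  have [->|b0] := eqVneq (b y) 0; first by rewrite normr0 !mulr0.
  by rewrite ler_wpM2r // bP.
by rewrite RintZ // mulrC ler_wpM2r.
Qed.

End KernelAverage.

(** * Convexity of powers and Jensen's inequality *)

Section PowerInequalities.
Context {R : realType}.
Implicit Types a b p q : R.

Lemma powR_normD_le a b p : 0 <= p -> `|a + b| `^ p <= 2 `^ p * (`|a| `^ p + `|b| `^ p).
Proof.
move=> p0; wlog ab : a b / `|b| <= `|a|.
  move=> W; have [|/ltW] := leP `|b| `|a|; first exact: W.
  by rewrite addrC (addrC (`|a| `^ p)); exact: W.
apply: (@le_trans _ _ ((2 * `|a|) `^ p)).
  apply: ge0_ler_powR => //; rewrite ?nnegrE ?normr_ge0 ?mulr_ge0 //.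
  by rewrite (le_trans (ler_normD _ _)) // mulr_natl mulr2n lerD2l.
by rewrite powRM // ler_wpM2l ?powR_ge0 // lerDl powR_ge0.
Qed.

(** The power lies above its tangent at b. This is Young's inequality for a and b^(p-1) with the
    conjugate exponents p and p/(p-1). *)
Lemma powR_tangent p a b : 1 <= p -> 0 <= a -> 0 <= b ->
  p * b `^ (p - 1) * a <= a `^ p + (p - 1) * b `^ p.
Proof.
move=> + a0 b0; rewrite le_eqVlt => /predU1P[<-|p1].
  by rewrite subrr powRr0 powRr1 // !mul1r mul0r addr0.
have p0 : 0 < p by lra.
have q0 : 0 < p - 1 by lra.
have := @conjugate_powR R a (b `^ (p - 1)) p (p / (p - 1)) a0 (powR_ge0 _ _) p0 (divr_gt0 p0 q0).
rewrite -powRrM (_ : (p - 1) * (p / (p - 1)) = p); last by field; rewrite gt_eqF.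
have -> : p^-1 + (p / (p - 1))^-1 = 1 by field; rewrite !gt_eqF.
move=> /(_ erefl) H.
have -> : p * b `^ (p - 1) * a = p * (a * b `^ (p - 1)) by ring.
apply: le_trans (ler_wpM2l (ltW p0) H) _.
rewrite mulrDr le_eqVlt; apply/orP; left; apply/eqP.
by field; rewrite !gt_eqF.
Qed.

Lemma powR_split p a : 1 <= p -> 0 <= a -> a `^ (p - 1) * a = a `^ p.
Proof.
move=> p1; rewrite le_eqVlt => /predU1P[<-|a0].
  by rewrite mulr0 powR0 // gt_eqF // (lt_le_trans _ p1).
by rewrite -{2}(powRr1 (ltW a0)) -powRD ?subrK // (gt_eqF a0) implybT.
Qed.

(** The tangent inequality at the point M, the absolute value of the mean, integrated against K,
    gives p M^p <= E + (p - 1) M^p times the mass of K, where E is the right-hand side; a mass of at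
    most 1 suffices. *)
Lemma Rint_jensen d (X : measurableType d) (m : {measure set X -> \bar R}) (K P : X -> R) p :
  1 <= p -> (forall x, 0 <= K x) -> integ m K -> \int[m]_x K x <= 1 ->
  integ m (fun x => K x * P x) -> integ m (fun x => K x * `|P x| `^ p) ->
  `|\int[m]_x (K x * P x)| `^ p <= \int[m]_x (K x * `|P x| `^ p).
Proof.
move=> p1 K0 iK K1 iP iPp; set M := `| _ |.
have iPa : integ m (fun x => K x * `|P x|).
  by apply: eq_integ (integ_abs iP) => x; rewrite normrM ger0_norm.
have ME : M <= \int[m]_x (K x * `|P x|).
  apply: le_trans (Rint_abs iP) _; rewrite le_eqVlt; apply/orP; left; apply/eqP.
  by apply: eq_Rint => x; rewrite normrM ger0_norm.
have M0 : 0 <= M by exact: normr_ge0.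
have c0 : 0 <= p * M `^ (p - 1) by rewrite mulr_ge0 ?powR_ge0 //; lra.
have : \int[m]_x (p * M `^ (p - 1) * (K x * `|P x|)) <=
   \int[m]_x (K x * `|P x| `^ p + (p - 1) * M `^ p * K x).
  apply: Rint_le; [exact: integZ|by apply: integD => //; exact: integZ|].
  move=> x; have := ler_wpM2l (K0 x) (powR_tangent p1 (normr_ge0 (P x)) M0).
  by rewrite mulrCA mulrDr (mulrC (K x) ((p - 1) * _)).
rewrite RintZ // RintD //; last exact: integZ.
rewrite RintZ // => H.
have := le_trans (ler_wpM2l c0 ME) H.
rewrite -[p * _ * M]mulrA (powR_split p1 M0) => H2.
have := ler_wpM2l (mulr_ge0 (_ : 0 <= p - 1) (powR_ge0 M p)) K1.
rewrite mulr1 subr_ge0 => /(_ p1).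
by move: (\int[m]_x (K x * `|P x| `^ p)) H2 => E; lra.
Qed.

End PowerInequalities.

(** * Mollification in L^p and weak derivatives *)

Section Mollification.
Context {R : realType}.
Notation mu3 := (@mu3 R).
Implicit Types f g : point3 R -> R.

Lemma conv_cst1 n x : conv (kern n) (fun=> 1) x = 1 :> R.
Proof.
rewrite convE; [|exact: kern_test|by split=> //; exact: integ_cst].
by rewrite -[RHS](Rint_kern n); apply: eq_Rint => y; rewrite mulr1.
Qed.

Lemma integ_pow_integ p f : 1 <= p -> measurable_fun [set: mpoint3 R] f ->
  integ mu3 (fun x => `|f x| `^ p) -> integ mu3 f.
Proof.
move=> p1 mf fp; apply: (integ_le mf (integD (integ_cst mu3 1) fp)) => x.
have [h|/ltW h] := leP `|f x| 1; first by rewrite ler_wpDr // powR_ge0.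
rewrite ler_wpDl // -[leLHS]powRr1 //; exact: ler_powR.
Qed.

Lemma measurable_pow d (X : measurableType d) p (f : X -> R) :
  measurable_fun setT f -> measurable_fun setT (fun x => `|f x| `^ p).
Proof.
by move=> mf; apply: (measurableT_comp (measurable_powR _)); exact: measurableT_comp.
Qed.

Lemma measurable_subxy f : measurable_fun [set: mpoint3 R] f ->
  measurable_fun setT (fun z : mpoint3 R * mpoint3 R => f ((z.1 : point3 R) - z.2)).
Proof. by move=> mf; apply: (measurableT_comp mf); exact: measurable_sub3. Qed.

Lemma Rint_norm_kern n : \int[mu3]_y `|kern n y| = 1 :> R.
Proof. by rewrite -[RHS](Rint_kern n); apply: eq_Rint => y; rewrite ger0_norm ?kern_ge0. Qed.

Lemma kern_radius (d : R) : 0 < d -> \forall n \near \oo, 2 / n.+3%:R <= d.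
Proof.
move=> d0; near=> n.
rewrite ler_pdivrMr ?ltr0n // mulrC -ler_pdivrMr //.
apply: (@le_trans _ _ (n%:R : R)); last by rewrite ler_nat -addn3 leq_addr.
near: n; exact: nbhs_infty_ger.
Unshelve. all: by end_near. Qed.

Lemma integ_subxy f : periodic3 f -> integ mu3 f ->
  integ (mu3 \x mu3)%E (fun z => f ((z.1 : point3 R) - z.2)).
Proof.
move=> pf fi; have mf := integ_meas fi.
have pa : periodic3 (fun x => `|f x|) by move=> x i; rewrite pf.
apply: (@integ_prod _ _ (mpoint3 R) (mpoint3 R) R mu3 mu3 _
   (fun x y => `|f ((x : point3 R) - y)|)) => //=.
- exact: measurable_subxy.
- by move=> x; exact: integ_reflect3 x (integ_abs fi) pa.
- apply: (@eq_integ _ (mpoint3 R) R mu3 (fun x => \int[mu3]_y `|f y|)); last exact: integ_cst.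
  by move=> x; rewrite (Rint_reflect3 x (integ_meas (integ_abs fi)) pa).
Qed.

Definition delta f (x y : point3 R) := f (x - y) - f x.

Lemma measurable_delta f : measurable_fun [set: mpoint3 R] f ->
  measurable_fun setT (fun z : mpoint3 R * mpoint3 R => delta f z.1 z.2).
Proof.
by move=> mf; apply: measurable_funB; [exact: measurable_subxy|exact: measurableT_comp].
Qed.

Lemma delta_pow_le p f x y : 0 <= p ->
  `|delta f x y| `^ p <= 2 `^ p * (`|f (x - y)| `^ p + `|f x| `^ p).
Proof. by move=> p0; rewrite -(normrN (f x)); exact: powR_normD_le. Qed.

Section Power.
Variables (p : R) (f : point3 R -> R).
Hypotheses (p1 : 1 <= p) (pf : periodic3 f) (mf : measurable_fun [set: mpoint3 R] f)
  (fp : integ mu3 (fun x => `|f x| `^ p)).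

Let p0 : 0 <= p. Proof. exact: le_trans ler01 p1. Qed.
Let pfp : periodic3 (fun x => `|f x| `^ p). Proof. by move=> x i; rewrite pf. Qed.

Let integ_bound x : integ mu3 (fun y => 2 `^ p * (`|f (x - (y : point3 R))| `^ p + `|f x| `^ p)).
Proof. by apply/integZ/integD; [exact: integ_reflect3 x fp pfp|exact: integ_cst]. Qed.

Lemma integ_delta : integ (mu3 \x mu3)%E (fun z => `|delta f z.1 z.2| `^ p).
Proof.
apply: (@integ_prod _ _ (mpoint3 R) (mpoint3 R) R mu3 mu3 _
   (fun x y => 2 `^ p * (`|f ((x : point3 R) - y)| `^ p + `|f x| `^ p))) => //=.
- by apply: measurable_pow; exact: measurable_delta.
- by move=> x y; rewrite ger0_norm ?powR_ge0 //; exact: delta_pow_le.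
apply: (@eq_integ _ (mpoint3 R) R mu3 (fun x => 2 `^ p * (\int[mu3]_y `|f y| `^ p + `|f x| `^ p))).
  move=> x; rewrite RintZ; last by apply: integD; [exact: integ_reflect3 x fp pfp|exact: integ_cst].
  rewrite RintD ?Rint_cst; [|exact: integ_reflect3 x fp pfp|exact: integ_cst].
  by rewrite (Rint_reflect3 x (integ_meas fp) pfp).
by apply/integZ/integD => //; exact: integ_cst.
Qed.

Lemma integ_delta_slice x : integ mu3 (fun y => `|delta f x y| `^ p).
Proof.
apply: (integ_le _ (integ_bound x)) => [|y]; last by rewrite ger0_norm ?powR_ge0 //; exact: delta_pow_le.
apply: measurable_pow; apply: measurable_funB => //; exact: (measurable_reflect3 x).
Qed.

Lemma integ_delta_slice2 y : integ mu3 (fun x => `|delta f x y| `^ p).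
Proof.
have ib : integ mu3 (fun x => 2 `^ p * (`|f ((x : point3 R) - y)| `^ p + `|f x| `^ p)).
  by apply/integZ/integD => //; exact: integ_shift3 (- y) fp pfp.
apply: (integ_le _ ib) => [|x]; last by rewrite ger0_norm ?powR_ge0 //; exact: delta_pow_le.
apply: measurable_pow; apply: measurable_funB => //; exact: (measurable_shift3 (- y)).
Qed.

Let fi : integ mu3 f. Proof. exact: (integ_pow_integ p1 mf fp). Qed.

Lemma conv_delta n x : conv (kern n) f x - f x = \int[mu3]_y (kern n y * delta f x y).
Proof.
have ik : integ mu3 (fun y => kern n y * f (x - (y : point3 R))).
  exact: (test_mul_integ (kern_test n) (integ_reflect3 x fi pf)).
have ic : integ mu3 (fun y => kern n y * f x).
  exact: (test_mul_integ (kern_test n) (integ_cst _ _)).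
rewrite (convE x (kern_test n)); last by split.
have {1}-> : f x = \int[mu3]_y (kern n y * f x).
  under eq_Rintegral do rewrite mulrC.
  by rewrite RintZ ?Rint_kern ?mulr1 //; exact: test_integ (kern_test n).
by rewrite -RintB //; apply: eq_Rint => y; rewrite -mulrBr.
Qed.

(** Young's convolution inequality. The weight |b| / C has mass at most 1, so Jensen applies for
    each x; Fubini and translation invariance do the rest. Using a bound C > 0 on the mass avoids a
    division by zero. *)
Lemma conv_pow_leM b C : torus_test b -> 0 < C -> \int[mu3]_y `|b y| <= C ->
  \int[mu3]_x `|conv b f x| `^ p <= C `^ p * \int[mu3]_x `|f x| `^ p.
Proof.
move=> tb C0 bC; have tc : torus_test (conv b f) by exact: conv_test.
have [M M0 cM] := test_bounded tc; have [B B0 bB] := test_bounded tb.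
have mb := test_measurable tb; have ib := integ_abs (test_integ tb).
pose K y := C^-1 * `|b y|.
have K0 y : 0 <= K y by rewrite mulr_ge0 ?invr_ge0 // ltW.
have mK : measurable_fun [set: mpoint3 R] K by apply: measurable_funM => //; exact: measurableT_comp.
have KB y : `|K y| <= C^-1 * B by rewrite ger0_norm // ler_wpM2l // invr_ge0 ltW.
have iK : integ mu3 K by exact: integZ.
have K1 : \int[mu3]_y K y <= 1 by rewrite RintZ // mulrC ler_pdivrMr // mul1r.
have ig x : integ mu3 (fun y => f (x - (y : point3 R))) by exact: integ_reflect3.
have ip : integ (mu3 \x mu3)%E (fun z => K z.2 * `|f ((z.1 : point3 R) - z.2)| `^ p).
  apply: (@integ_mul_bounded _ (mpoint3 R * mpoint3 R)%type R (mu3 \x mu3)%E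
    (fun z => K z.2) _ _ _ (fun z => KB z.2) (integ_subxy pfp fp)).
  exact: (measurableT_comp mK).
apply: (@le_trans _ _ (C `^ p * \int[mu3]_x \int[mu3]_y (K y * `|f ((x : point3 R) - y)| `^ p))).
  rewrite -RintZ; last exact: (integ_Rint ip).
  apply: Rint_le; last 1 first.
  - move=> x; rewrite (convE x tb) //.
    have bE : \int[mu3]_y `|b y * f (x - (y : point3 R))| =
        C * \int[mu3]_y (K y * `|f (x - (y : point3 R))|).
      rewrite -RintZ; last exact: (integ_mul_bounded mK KB (integ_abs (ig x))).
      by apply: eq_Rint => y; rewrite /K normrM !mulrA mulfV ?mul1r // gt_eqF.
    have I0 : 0 <= \int[mu3]_y (K y * `|f (x - (y : point3 R))|).
      by apply: Rint_ge0 => y; rewrite mulr_ge0.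
    apply: (@le_trans _ _ ((C * \int[mu3]_y (K y * `|f (x - (y : point3 R))|)) `^ p)).
      apply: ge0_ler_powR; rewrite ?nnegrE ?mulr_ge0 ?(ltW C0) //.
      by rewrite -bE; apply: Rint_abs; exact: test_mul_integ.
    rewrite powRM ?(ltW C0) // ler_wpM2l ?powR_ge0 // -{1}(ger0_norm I0).
    have E2 y : K y * `| `|f (x - y)| | `^ p = K y * `|f (x - y)| `^ p by rewrite normr_id.
    have J := @Rint_jensen R _ _ mu3 K (fun y => `|f (x - (y : point3 R))|) p p1 K0 iK K1
      (integ_mul_bounded mK KB (integ_abs (ig x))).
    apply: le_trans (J _) _; last by under eq_Rintegral do rewrite E2.
    under eq_fun do rewrite E2.
    exact: (integ_mul_bounded mK KB (integ_reflect3 x fp pfp)).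
  - apply: (@integ_bounded _ _ _ _ _ (M `^ p)); first exact: measurable_pow (test_measurable tc).
    by move=> x; rewrite ger0_norm ?powR_ge0 //; apply: ge0_ler_powR; rewrite ?nnegrE.
  - exact/integZ/(integ_Rint ip).
rewrite ler_wpM2l ?powR_ge0 // (Rint_swap ip) /=.
set J := \int[mu3]_x `|f x| `^ p.
have J0 : 0 <= J by apply: Rint_ge0 => x; exact: powR_ge0.
have -> : \int[mu3]_y \int[mu3]_x (K y * `|f ((x : point3 R) - y)| `^ p) = J * \int[mu3]_y K y.
  rewrite -RintZ //; apply: eq_Rint => y; rewrite RintZ; last exact: (integ_shift3 (- y) fp pfp).
  by rewrite mulrC (Rint_shift3 (- y) (integ_meas fp) pfp).
by rewrite ler_piMr.
Qed.

Lemma conv_pow_le n :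
  \int[mu3]_x `|conv (kern n) f x| `^ p <= \int[mu3]_x `|f x| `^ p.
Proof.
have := conv_pow_leM (@kern_test R n) ltr01; rewrite Rint_norm_kern.
by move=> /(_ (lexx _)); rewrite powR1 mul1r.
Qed.

(** The p-th power of the L^p modulus of continuity of f, averaged over the window of the kernel.
    All flux estimates are expressed through it. *)
Definition davg n := \int[mu3]_x \int[mu3]_y (kern n y * `|delta f x y| `^ p).

Lemma integ_davg n :
  integ (mu3 \x mu3)%E (fun z => kern n z.2 * `|delta f z.1 z.2| `^ p).
Proof.
have kt := @kern_test R n; have [M M0 kM] := test_bounded kt.
apply: (@integ_mul_bounded _ (mpoint3 R * mpoint3 R)%type R (mu3 \x mu3)%E
  (fun z => kern n z.2) _ M _ (fun z => kM z.2) integ_delta).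
exact: (measurableT_comp (test_measurable kt)).
Qed.

Lemma davgE n : davg n = \int[mu3]_y (kern n y * \int[mu3]_x `|delta f x y| `^ p).
Proof.
rewrite /davg (Rint_swap (integ_davg n)) /=.
by apply: eq_Rint => y; rewrite RintZ //; exact: integ_delta_slice2.
Qed.

Lemma davg_ge0 n : 0 <= davg n.
Proof.
apply: Rint_ge0 => x; apply: Rint_ge0 => y; apply: mulr_ge0; [exact: kern_ge0|exact: powR_ge0].
Qed.

Lemma davg_le_sup n A : 0 <= A -> (forall y : point3 R, `|y| <= 2 / n.+3%:R ->
  \int[mu3]_x `|delta f x y| `^ p <= A) -> davg n <= A.
Proof.
move=> A0 HA; rewrite davgE; apply: le_trans (ler_norm _) _; rewrite -[leRHS]mul1r.
have kt := @kern_test R n.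
apply: Rint_average_le => //.
- exact: test_measurable kt.
- exact/integ_abs/test_integ.
- by rewrite Rint_norm_kern.
- move=> y cy /(kern_neq0 cy) ny; rewrite ger0_norm; last by apply: Rint_ge0 => x; exact: powR_ge0.
  exact: HA.
- have [ip' _] := @integ_swap R _ _ (mpoint3 R) (mpoint3 R) mu3 mu3 _ (integ_davg n).
  have := integ_Rint ip'; apply: eq_integ => y /=; rewrite RintZ //; exact: integ_delta_slice2.
Qed.

Lemma davg_le n : davg n <= 2 `^ p * (2 * \int[mu3]_x `|f x| `^ p).
Proof.
apply: davg_le_sup => [|y _].
  by rewrite !mulr_ge0 ?powR_ge0 // Rint_ge0 // => x; exact: powR_ge0.
have ib := integ_shift3 (- y) fp pfp.
apply: (@le_trans _ _ (\int[mu3]_x (2 `^ p * (`|f ((x : point3 R) - y)| `^ p + `|f x| `^ p)))).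
  apply: Rint_le; [exact: integ_delta_slice2|by apply/integZ/integD|].
  by move=> x; exact: delta_pow_le.
rewrite RintZ; last exact: integD.
by rewrite RintD // (Rint_shift3 (- y) (integ_meas fp) pfp) mulr_natl mulr2n.
Qed.

Lemma davg_cvg0 : davg n @[n --> \oo] --> 0.
Proof.
apply/cvgrPdist_le => /= e e0.
have [d d0 H] := shift_small_pow p1 pf mf fp e0.
near=> n; rewrite sub0r normrN ger0_norm ?davg_ge0 //.
apply: davg_le_sup => [|y ny]; first exact: ltW.
apply: (H (- y) _).2; rewrite normrN (le_trans ny) //.
near: n; exact: kern_radius.
Unshelve. all: by end_near. Qed.

(** The mollification error is an average of increments ([conv_delta]), so Jensen bounds its p-th
    moment by [davg]. *)
Lemma conv_pow_cvg : \int[mu3]_x `|conv (kern n) f x - f x| `^ p @[n --> \oo] --> 0.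
Proof.
apply: (@squeeze_cvgr _ _ _ _ (fun=> 0) davg) davg_cvg0; last exact: cvg_cst.
apply: nearW => n; rewrite Rint_ge0 /= => [|x]; last exact: powR_ge0.
have kt := @kern_test R n.
have tc : torus_test (conv (kern n) f) by exact: conv_test.
have [M' M'0 cM] := test_bounded tc.
apply: Rint_le.
- have ib : integ mu3 (fun x => 2 `^ p * (M' `^ p + `|f x| `^ p)).
    by apply/integZ/integD => //; exact: integ_cst.
  apply: (integ_le _ ib) => [|x].
    by apply: measurable_pow; apply: measurable_funB => //; exact: test_measurable tc.
  rewrite ger0_norm ?powR_ge0 // -(normrN (f x)).
  apply: le_trans (powR_normD_le _ _ p0) _; rewrite ler_wpM2l ?powR_ge0 // lerD2r.
  by apply: ge0_ler_powR; rewrite ?nnegrE.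
- exact: (integ_Rint (integ_davg n)).
move=> x; rewrite conv_delta; apply: Rint_jensen => //.
- exact: kern_ge0.
- exact: test_integ.
- by rewrite Rint_kern.
- apply: (test_mul_integ kt); apply: integB; last exact: integ_cst.
  exact: integ_reflect3.
- exact: (test_mul_integ kt (integ_delta_slice x)).
Qed.

End Power.
Definition wpart i f g := [/\ integ mu3 f, integ mu3 g &
  forall psi, torus_test psi ->
    \int[mu3]_x (f x * 'D_(basis3 i) psi x) = - \int[mu3]_x (g x * psi x)].

(** The test function is the reflected kernel y -> b(x - y). Its derivative produces a minus sign,
    which cancels the one in the definition of the weak derivative. *)
Lemma wpart_conv i f g b x : torus_test b -> wpart i f g ->
  'D_(basis3 i) (conv b f) x = conv b g x.
Proof.
move=> tb [fi gi fg]; rewrite derive_conv //.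
have := fg _ (test_reflect x tb).
under eq_Rintegral do rewrite (derive_reflect _ _ _ tb.1) mulrN.
rewrite RintN; last first.
  by under eq_fun do rewrite mulrC; exact: conv_integ (test_derive _ tb) fi.
move=> /oppr_inj H; rewrite /conv; under eq_Rintegral do rewrite mulrC.
by rewrite H; apply: eq_Rint => y; rewrite mulrC.
Qed.

Definition wdiv (v : 'I_3 -> point3 R -> R) := (forall i, integ mu3 (v i)) /\
  forall psi, torus_test psi -> \int[mu3]_x (\sum_i v i x * 'D_(basis3 i) psi x) = 0.

Lemma div_conv v b x : torus_test b -> wdiv v ->
  \sum_i 'D_(basis3 i) (conv b (v i)) x = 0.
Proof.
move=> tb [vi v0]; have := v0 _ (test_reflect x tb).
have iv i : integ mu3 (fun y => 'D_(basis3 i) b (x - (y : point3 R)) * v i y).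
  exact: conv_integ (test_derive _ tb) (vi i).
rewrite (_ : \int[mu3]_y _ = - \sum_i 'D_(basis3 i) (conv b (v i)) x) => [/eqP|].
  by rewrite oppr_eq0 => /eqP.
under [in RHS]eq_bigr do rewrite derive_conv // /conv.
rewrite -Rint_sum // -RintN; last exact: integ_sum.
apply: eq_Rint => y; rewrite -sumrN; apply: eq_bigr => i _.
by rewrite derive_reflect ?mulrN 1?mulrC //; exact: tb.1.
Qed.

(** The mollified field has zero divergence pointwise by [div_conv], so its product with grad psi is
    the divergence of psi times the field, and derivatives of test functions have integral 0. *)
Lemma wdiv_conv v b : torus_test b -> wdiv v -> wdiv (fun i => conv b (v i)).
Proof.
move=> tb wv; have [vi _] := wv; split=> [i|psi tp]; first exact: test_integ (conv_test tb (vi i)).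
have tv i : torus_test (conv b (v i)) by exact: conv_test.
rewrite (_ : \int[mu3]_x _ =
  \int[mu3]_x (\sum_i 'D_(basis3 i) (fun x => conv b (v i) x * psi x) x)); last first.
  apply: eq_Rint => x.
  under [RHS]eq_bigr => i _.
    rewrite (deriveM (smooth_derivable x _ (tv i).1) (smooth_derivable x _ tp.1)).
    over.
  rewrite big_split /=.
  rewrite -[X in _ = _ + X]scaler_sumr div_conv // scaler0 addr0.
  by apply: eq_bigr.
rewrite Rint_sum => [|i]; last by apply/test_integ/test_derive/testM.
by rewrite big1 // => i _; apply/Rint_derive_test/testM.
Qed.

(** The integrand is half of v . grad(w^2), and w^2 is a test function. This cancellation allows
    products of mollified components to be subtracted in the flux. *)
Lemma wdiv_transport v (w : point3 R -> R) : wdiv v -> torus_test w ->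
  (forall i, torus_test (v i)) ->
  \int[mu3]_x (\sum_i 'D_(basis3 i) w x * (w x * v i x)) = 0.
Proof.
move=> [_ v0] tw tv; have := v0 _ (testM tw tw).
rewrite (_ : \int[mu3]_x _ = 2 * \int[mu3]_x (\sum_i 'D_(basis3 i) w x * (w x * v i x))).
  by move=> /eqP; rewrite mulf_eq0 pnatr_eq0 /= => /eqP.
rewrite -RintZ; last first.
  by apply: integ_sum => i; apply: (test_integ (testM (test_derive _ tw) (testM tw (tv i)))).
apply: eq_Rint => x; rewrite mulr_sumr; apply: eq_bigr => i _.
rewrite (deriveM (smooth_derivable x _ tw.1) (smooth_derivable x _ tw.1)) /GRing.scale /=.
by ring.
Qed.

Lemma wdiv_partial v (g : 'I_2 -> point3 R -> R) : wdiv v ->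
  (forall j, wpart (hindex j) (v (hindex j)) (g j)) ->
  wpart ord_max (v ord_max) (fun x => - \sum_j g j x).
Proof.
move=> [vi v0] vg; have ig j : integ mu3 (g j) by have [] := vg j.
have E (F : 'I_3 -> R) : \sum_i F i = \sum_(j < 2) F (hindex j) + F ord_max.
  by rewrite big_ord_recr.
split=> //; first by apply/integN/integ_sum.
move=> psi tp; have := v0 _ tp.
have iD i (f : point3 R -> R) : integ mu3 f -> integ mu3 (fun x => f x * 'D_(basis3 i) psi x).
  by move=> fi; under eq_fun do rewrite mulrC; apply: test_mul_integ => //; exact: test_derive.
have im (f : point3 R -> R) : integ mu3 f -> integ mu3 (fun x => f x * psi x).
  by move=> fi; under eq_fun do rewrite mulrC; exact: test_mul_integ.
under eq_Rintegral do rewrite E.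
rewrite RintD //; [|by apply: integ_sum => j; exact: iD|exact: iD].
move=> /eqP; rewrite addrC addr_eq0 => /eqP ->; congr (- _).
rewrite Rint_sum => [|j]; last exact: iD.
under eq_bigr => j _ do rewrite (let: And3 _ _ H := vg j in H _ tp).
under [in RHS]eq_Rintegral do rewrite mulNr mulr_suml.
rewrite RintN; last by apply: integ_sum => j; exact: im.
by rewrite Rint_sum => [|j]; [rewrite sumrN|exact: im].
Qed.

End Mollification.

(** * Square-integrable functions *)

Section SquareIntegrable.
Context d (X : measurableType d) (R : realType) (m : {measure set X -> \bar R}).
Implicit Types f g : X -> R.

Definition sqint f := measurable_fun setT f /\ integ m (fun x => f x ^+ 2).

Lemma sqintD f g : sqint f -> sqint g -> sqint (fun x => f x + g x).
Proof.
move=> [mf fi] [mg gi]; split; first exact: measurable_funD.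
apply: (integ_le _ (integZ 2 (integD fi gi))) => [|x].
  by apply: measurable_funX; exact: measurable_funD.
rewrite ger0_norm ?sqr_ge0 // -subr_ge0.
have -> : 2 * (f x ^+ 2 + g x ^+ 2) - (f x + g x) ^+ 2 = (f x - g x) ^+ 2 by ring.
exact: sqr_ge0.
Qed.

Lemma sqintZ k f : sqint f -> sqint (fun x => k * f x).
Proof.
move=> [mf fi]; split; first exact: measurable_funM.
by apply: eq_integ (integZ (k ^+ 2) fi) => x; rewrite exprMn.
Qed.

Lemma sqintN f : sqint f -> sqint (fun x => - f x).
Proof. by move=> /(sqintZ (-1)) [mf fi]; split; under eq_fun do rewrite -mulN1r. Qed.

Lemma sqintB f g : sqint f -> sqint g -> sqint (fun x => f x - g x).
Proof. by move=> sf /sqintN; exact: sqintD. Qed.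

Lemma sqint0 : sqint (fun=> 0).
Proof. by split=> //; apply: eq_integ (integ0 m) => x; rewrite expr0n. Qed.

Lemma sqint_sum I (s : seq I) (F : I -> X -> R) : (forall i, sqint (F i)) ->
  sqint (fun x => \sum_(i <- s) F i x).
Proof.
move=> sF; elim: s => [|i s IH].
  by under eq_fun do rewrite big_nil; exact: sqint0.
by under eq_fun do rewrite big_cons; exact: sqintD.
Qed.

Lemma sqintM f g : sqint f -> sqint g -> integ m (fun x => f x * g x).
Proof.
move=> [mf fi] [mg gi]; apply: (integ_le _ (integD fi gi)) => [|x].
  exact: measurable_funM.
by rewrite ler_norml; apply/andP; split; nra.
Qed.

Lemma Rint_sqrD_le (e : R) f g : 0 < e -> sqint f -> sqint g ->
  \int[m]_x (f x + g x) ^+ 2 <=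
    (1 + e) * \int[m]_x f x ^+ 2 + (1 + e^-1) * \int[m]_x g x ^+ 2.
Proof.
move=> e0 sf sg; have [_ fi] := sf; have [_ gi] := sg.
rewrite -!RintZ // -RintD; [|exact: integZ|exact: integZ].
apply: Rint_le; [exact: (sqintD sf sg).2|by apply: integD; exact: integZ|].
move=> x; set a := f x; set b := g x.
have H : 0 <= (e * a - b) ^+ 2 / e by rewrite divr_ge0 ?sqr_ge0 // ltW.
have -> : (1 + e) * a ^+ 2 + (1 + e^-1) * b ^+ 2 = (a + b) ^+ 2 + (e * a - b) ^+ 2 / e.
  by field; rewrite gt_eqF.
by rewrite lerDl.
Qed.

(** The quadratic form H(s, t), the integral of (s f + t g)^2, is nonnegative. If A > 0, the choice
    (C, -A) gives the claim; if A = 0, the choice (B + 1, -C) forces C = 0. *)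
Lemma Rint_CS f g : sqint f -> sqint g ->
  (\int[m]_x (f x * g x)) ^+ 2 <= \int[m]_x f x ^+ 2 * \int[m]_x g x ^+ 2.
Proof.
move=> sf sg; have [_ fi] := sf; have [_ gi] := sg; have fg := sqintM sf sg.
set A := \int[m]_x f x ^+ 2; set B := \int[m]_x g x ^+ 2; set C := \int[m]_x (f x * g x).
have H (s t : R) : 0 <= s ^+ 2 * A + 2 * (s * t) * C + t ^+ 2 * B.
  rewrite -!RintZ // -RintD; [|exact: integZ|exact: integZ].
  rewrite -RintD; [|by apply: integD; exact: integZ|exact: integZ].
  by apply: Rint_ge0 => x; have := sqr_ge0 (s * f x + t * g x); nra.
have A0 : 0 <= A by apply: Rint_ge0 => x; exact: sqr_ge0.
have B0 : 0 <= B by apply: Rint_ge0 => x; exact: sqr_ge0.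
move: A0; rewrite le_eqVlt => /predU1P[A0|A0]; last by have := H C (- A); nra.
by rewrite -A0 mul0r; have := H (B + 1) (- C); rewrite -A0; nra.
Qed.

End SquareIntegrable.

(** * Translations of functions with a square-integrable gradient *)

Section TranslationEstimate.
Context {R : realType}.
Notation mu3 := (@mu3 R).
Implicit Types f g : point3 R -> R.

Lemma sqint_shift f h : periodic3 f -> sqint mu3 f ->
  sqint mu3 (fun x => f ((x : point3 R) + h)).
Proof.
move=> pf [mf fi]; split; first exact: measurable_shift3.
by apply: (integ_shift3 h fi) => x i; rewrite pf.
Qed.

Lemma Rint_sqr_shift f h : periodic3 f -> sqint mu3 f ->
  \int[mu3]_x f ((x : point3 R) + h) ^+ 2 = \int[mu3]_x f x ^+ 2.
Proof.
move=> pf [mf fi]; apply: (@Rint_shift3 R (fun x => f x ^+ 2)); first exact: measurable_funX.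
by move=> x i; rewrite pf.
Qed.

Lemma test_sqint f : torus_test f -> sqint mu3 f.
Proof.
move=> tf; split; first exact: test_measurable.
by apply: eq_integ (test_integ (testM tf tf)) => x; rewrite expr2.
Qed.

Definition shiftD f (h x : point3 R) := f (x + h) - f x.

Lemma sqint_shiftD f h : periodic3 f -> sqint mu3 f -> sqint mu3 (shiftD f h).
Proof. by move=> pf sf; apply: sqintB => //; exact: sqint_shift. Qed.

Lemma periodic_shiftD f h : periodic3 f -> periodic3 (shiftD f h).
Proof. by move=> pf x i; rewrite /shiftD addrAC !pf. Qed.

Lemma shiftDD f (g h x : point3 R) : shiftD f (g + h) x = shiftD f g x + shiftD f h (x + g).
Proof. by rewrite /shiftD addrA; ring. Qed.

(** The triangle inequality in L^2 for m equal steps, in squared form. The weight 1/(m+1) in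
    [Rint_sqrD_le] keeps the constant exact: (1 + 1/(m+1)) (m+1)^2 + (1 + (m+1)) = (m+2)^2. *)
Lemma shiftD_mul f h m : periodic3 f -> sqint mu3 f ->
  \int[mu3]_x shiftD f (h *+ m) x ^+ 2 <= m%:R ^+ 2 * \int[mu3]_x shiftD f h x ^+ 2.
Proof.
move=> pf sf; elim: m => [|[|m] IH].
- under eq_Rintegral do rewrite mulr0n /shiftD addr0 subrr expr0n /=.
  by rewrite Rint0 expr0n mul0r.
- by rewrite mulr1n expr1n mul1r.
rewrite mulrSr; under eq_Rintegral do rewrite shiftDD.
have m0 : 0 < m.+1%:R^-1 :> R by rewrite invr_gt0 ltr0n.
have sd := sqint_shiftD h pf sf; have pd := periodic_shiftD h pf.
apply: le_trans (Rint_sqrD_le m0 (sqint_shiftD _ pf sf) (sqint_shift _ pd sd)) _.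
rewrite Rint_sqr_shift // invrK.
have N0 : 0 <= \int[mu3]_x shiftD f h x ^+ 2 by apply: Rint_ge0 => x; exact: sqr_ge0.
set N := Rintegral _ _ _ in N0 IH *.
apply: (@le_trans _ _ ((1 + m.+1%:R^-1) * (m.+1%:R ^+ 2 * N) + (1 + m.+1%:R) * N)).
  by rewrite lerD2r ler_wpM2l // addr_ge0 // ltW.
rewrite le_eqVlt; apply/orP; left; apply/eqP; rewrite -[m.+2%:R]natr1.
by field; rewrite ?nat1r ?natr1 ?pnatr_eq0.
Qed.

(** For a short step a, Taylor's formula gives the estimate up to a relative error of order |a|. A
    step h is cut into m equal ones; [shiftD_mul] restores the factor m^2, and the error tends to 0
    as m grows. *)
Lemma shiftD_test f i (h : R) : torus_test f ->
  \int[mu3]_x shiftD f (h *: basis3 i) x ^+ 2 <=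
    h ^+ 2 * \int[mu3]_x ('D_(basis3 i) f x) ^+ 2.
Proof.
move=> tf; have [C C0 H] := test_taylor (basis3 i) tf.
have tD := test_derive (basis3 i) tf; have [_ iD] := test_sqint tD.
have [M M0 HM] := test_bounded tD.
set J := \int[mu3]_x ('D_(basis3 i) f x) ^+ 2.
pose K := 2 * C * M + C ^+ 2.
have small (a : R) : `|a| <= 1 ->
    \int[mu3]_x shiftD f (a *: basis3 i) x ^+ 2 <= a ^+ 2 * (J + K * `|a|).
  move=> a1; have iK : integ mu3 (fun x => ('D_(basis3 i) f x) ^+ 2 + K * `|a|).
    by apply: integD => //; exact: integ_cst.
  rewrite -[K * `|a|](Rint_cst mu3) -RintD //; last exact: integ_cst.
  rewrite -RintZ //; apply: Rint_le; [|exact: integZ|].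
    exact: (sqint_shiftD _ tf.2 (test_sqint tf)).2.
  move=> x; have := H x a; rewrite (addrC _ x) -/(shiftD f (a *: basis3 i) x).
  set D := 'D_(basis3 i) f x; set t := shiftD _ _ _ => Ht.
  have DM : `|D| <= M by exact: HM.
  have tb : `|t| <= `|a| * (`|D| + C * `|a|).
    rewrite mulrDr -normrM mulrCA -normrM -[X in _ <= _ + X]ger0_norm ?mulr_ge0 //.
    rewrite (_ : C * `|a * a| = C * a ^+ 2); last by rewrite ger0_norm -?expr2 ?sqr_ge0.
    rewrite (ger0_norm (mulr_ge0 C0 (sqr_ge0 _))).
    have -> : t = a * D + (t - a * D) by ring.
    by rewrite (le_trans (ler_normD _ _)) // lerD2l.
  have t2 : t ^+ 2 <= (`|a| * (`|D| + C * `|a|)) ^+ 2.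
    by rewrite -(real_normK (num_real t)) lerXn2r // nnegrE ?mulr_ge0 ?addr_ge0 ?mulr_ge0.
  apply: le_trans t2 _; rewrite exprMn (real_normK (num_real a)) ler_wpM2l ?sqr_ge0 //.
  rewrite -(real_normK (num_real D)) /K sqrrD -addrA lerD2l mulrDl.
  apply: lerD; last first.
    by rewrite exprMn ler_wpM2l ?sqr_ge0 // expr2 ler_piMr.
  rewrite -mulr_natl (_ : 2 * C * M * `|a| = 2 * (M * (C * `|a|))); last by ring.
  by rewrite ler_wpM2l // ler_wpM2r // mulr_ge0.
apply/ler_addgt0Pr => e e0.
(* An m above B makes |h / m| at most 1, so that [small] applies, and the remaining error h^2 K |h|
   / m at most e. *)
pose B := `|h| + h ^+ 2 * K * `|h| / e.
have K0 : 0 <= K by rewrite /K addr_ge0 ?sqr_ge0 // !mulr_ge0.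
have hK : 0 <= h ^+ 2 * K * `|h| by apply: mulr_ge0 => //; apply: mulr_ge0 => //; exact: sqr_ge0.
have B0 : 0 <= B by rewrite addr_ge0 // divr_ge0 // ltW.
have := archi_boundP B0; set m := Num.bound B => Bm.
have m0 : (0 : R) < m%:R by exact: le_lt_trans Bm.
have hE : h *: basis3 i = ((h / m%:R) *: basis3 i) *+ m :> point3 R.
  by rewrite -scaler_nat scalerA mulrC divfK // gt_eqF.
have hm : `|h / m%:R| <= 1.
  rewrite normrM normfV (ger0_norm (ltW m0)) ler_pdivrMr // mul1r (le_trans _ (ltW Bm)) //.
  by rewrite lerDl divr_ge0 // ltW.
rewrite hE; apply: le_trans (shiftD_mul _ _ tf.2 (test_sqint tf)) _.
apply: le_trans (ler_wpM2l (sqr_ge0 _) (small _ hm)) _.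
have -> : m%:R ^+ 2 * ((h / m%:R) ^+ 2 * (J + K * `|h / m%:R|)) =
    h ^+ 2 * J + h ^+ 2 * K * `|h| / m%:R.
  rewrite (normrM h) normfV (ger0_norm (ltW m0)).
  by move: (m%:R : R) m0 {hE hm Bm} => c c0; field; rewrite gt_eqF.
rewrite lerD2l ler_pdivrMr // -ler_pdivrMl // mulrC.
by apply: le_trans (ltW Bm); rewrite lerDr.
Qed.

Lemma point3E (h : point3 R) : h = h.1.1 *: basis3 (inord 0) + h.1.2 *: basis3 (inord 1) + h.2 *: basis3 (inord 2).
Proof.
case: h => [[a b] c] /=; rewrite /basis3 !inordK //=.
rewrite -[RHS]/(a * _ + b * _ + c * _, a * _ + b * _ + c * _, a * _ + b * _ + c * _) /=.
by rewrite !(mulr1, mulr0, addr0, add0r).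
Qed.

Lemma sum3E (F : 'I_3 -> R) : \sum_i F i = F (inord 0) + F (inord 1) + F (inord 2).
Proof.
rewrite !big_ord_recl big_ord0 addr0 addrA.
by congr (F _ + F _ + F _); apply: val_inj; rewrite /= inordK.
Qed.

Lemma Rint_sqr3 (f1 f2 f3 : point3 R -> R) : sqint mu3 f1 -> sqint mu3 f2 -> sqint mu3 f3 ->
  \int[mu3]_x (f1 x + f2 x + f3 x) ^+ 2 <= 3 *
   (\int[mu3]_x f1 x ^+ 2 + \int[mu3]_x f2 x ^+ 2 + \int[mu3]_x f3 x ^+ 2).
Proof.
move=> s1 s2 s3; have [_ i1] := s1; have [_ i2] := s2; have [_ i3] := s3.
have s12 := integD i1 i2.
rewrite -(RintD i1 i2) -(RintD s12 i3) -RintZ; last exact: integD.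
apply: Rint_le; [exact: (sqintD (sqintD s1 s2) s3).2|by apply/integZ/integD|].
move=> x; rewrite -subr_ge0.
have -> : 3 * (f1 x ^+ 2 + f2 x ^+ 2 + f3 x ^+ 2) - (f1 x + f2 x + f3 x) ^+ 2 =
  (f1 x - f2 x) ^+ 2 + (f2 x - f3 x) ^+ 2 + (f1 x - f3 x) ^+ 2 by ring.
by rewrite !addr_ge0 ?sqr_ge0.
Qed.

Lemma shiftD_test3 f (h : point3 R) : torus_test f ->
  \int[mu3]_x shiftD f h x ^+ 2 <=
    3 * `|h| ^+ 2 * \sum_i \int[mu3]_x ('D_(basis3 i) f x) ^+ 2.
Proof.
move=> tf; have sf := test_sqint tf; have pf := tf.2.
pose h0 := h.1.1 *: basis3 (inord 0) : point3 R; pose h1 := h.1.2 *: basis3 (inord 1) : point3 R;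
pose h2 := h.2 *: basis3 (inord 2) : point3 R.
have hE : h = h0 + h1 + h2 by exact: point3E.
rewrite {1}hE; under eq_Rintegral do rewrite !shiftDD.
have sD := fun k => sqint_shiftD k pf sf; have pD := fun k => periodic_shiftD k pf.
apply: le_trans (Rint_sqr3 (sD _) (sqint_shift _ (pD _) (sD _)) (sqint_shift _ (pD _) (sD _))) _.
rewrite -mulrA ler_wpM2l // !Rint_sqr_shift //.
have ch (a : R) i : `|a| <= `|h| -> \int[mu3]_x shiftD f (a *: basis3 i) x ^+ 2 <=
    `|h| ^+ 2 * \int[mu3]_x ('D_(basis3 i) f x) ^+ 2.
  move=> ah; apply: le_trans (shiftD_test i a tf) _; apply: ler_wpM2r.
    by apply: Rint_ge0 => x; exact: sqr_ge0.
  by rewrite -(real_normK (num_real a)) lerXn2r // nnegrE.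
rewrite sum3E !mulrDr.
by apply: lerD; [apply: lerD|]; apply: ch; rewrite !prod_normE /= !le_max lexx ?orbT.
Qed.

Lemma shiftD_approx f v (h : point3 R) : periodic3 f -> periodic3 v ->
  sqint mu3 f -> sqint mu3 v ->
  \int[mu3]_x shiftD f h x ^+ 2 <= 3 * (\int[mu3]_x shiftD v h x ^+ 2 +
    2 * \int[mu3]_x (v x - f x) ^+ 2).
Proof.
move=> pf pv sf sv; pose w x := v x - f x.
have sw : sqint mu3 w by exact: sqintB.
have pw : periodic3 w by move=> x i; rewrite /w pf pv.
have E x : shiftD f h x = shiftD v h x + - w (x + h) + w x by rewrite /shiftD /w; ring.
under eq_Rintegral do rewrite E.
apply: le_trans (Rint_sqr3 (sqint_shiftD h pv sv) (sqintN (sqint_shift h pw sw)) sw) _.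
rewrite ler_wpM2l // -addrA lerD2l (_ : \int[mu3]_x (- w (x + h)) ^+ 2 = \int[mu3]_x w x ^+ 2).
  by rewrite mulr_natl mulr2n.
by rewrite -(Rint_sqr_shift h pw sw); apply: eq_Rint => x; rewrite sqrrN.
Qed.

(** The estimate holds for mollifications of f, whose gradients are the mollified g and so have no
    larger norm. One factor 3 comes from exchanging f for its mollification, the other from the
    three axes; the error e/6 enters six times. *)
Lemma shiftD_wpart f (g : 'I_3 -> point3 R -> R) (h : point3 R) :
  periodic3 f -> sqint mu3 f -> (forall i, wpart i f (g i)) ->
  (forall i, periodic3 (g i) /\ sqint mu3 (g i)) ->
  \int[mu3]_x shiftD f h x ^+ 2 <=
    9 * `|h| ^+ 2 * \sum_i \int[mu3]_x (g i x) ^+ 2.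
Proof.
move=> pf sf fg gi; have [mf if2] := sf.
have two (a : R) : `|a| `^ 2 = a ^+ 2 by rewrite powR_mulrn // real_normK ?num_real.
have fp : integ mu3 (fun x => `|f x| `^ 2) by apply: eq_integ if2 => x; rewrite two.
have fi : integ mu3 f by case: (fg ord0).
set G := \sum_i _.
apply/ler_addgt0Pr => e e0.
have e6 : 0 < e / 6 by rewrite divr_gt0.
have /cvgrPdist_le /(_ _ e6) [n _ /(_ n (leqnn n))] := conv_pow_cvg (ler1n R 2) pf mf fp.
rewrite /= sub0r normrN ger0_norm; last by apply: Rint_ge0 => x; exact: powR_ge0.
under eq_Rintegral do rewrite two.
have kt := @kern_test R n; have tv := conv_test kt fi.
set v := conv (kern n) f in tv * => vf.
have vG : \sum_i \int[mu3]_x ('D_(basis3 i) v x) ^+ 2 <= G.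
  apply: ler_sum => i _; have [pg [mg ig]] := gi i.
  have gp : integ mu3 (fun x => `|g i x| `^ 2) by apply: eq_integ ig => x; rewrite two.
  have := conv_pow_le (ler1n R 2) pg mg gp n.
  under eq_Rintegral do rewrite two.
  under [X in _ <= X -> _]eq_Rintegral do rewrite two.
  by apply: le_trans; rewrite le_eqVlt; apply/orP; left; apply/eqP; apply: eq_Rint => x; rewrite (wpart_conv x kt (fg i)).
have := le_trans (shiftD_test3 h tv) (ler_wpM2l (mulr_ge0 (ler0n R 3) (sqr_ge0 `|h|)) vG).
have := shiftD_approx h pf tv.2 sf (test_sqint tv).
clear vG; move: vf; move: (\int[mu3]_x (v x - f x) ^+ 2) (\int[mu3]_x shiftD v h x ^+ 2)
  (\int[mu3]_x shiftD f h x ^+ 2) (`|h| ^+ 2) => a b c k.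
by clearbody G; move=> *; lra.
Qed.

End TranslationEstimate.

(** * The energy flux *)

Section Covariance.
Context {R : realType}.
Notation mu3 := (@mu3 R).

(** [H] is averaged in two ways: at one point y for the mean of the product (B1), and at two
    independent points for the product of the means, one variable after the other (B2, B3). Hence
    the factor 2. *)
Lemma cov_bound d (X : measurableType d) (m : {measure set X -> \bar R}) (K F G : X -> R)
    (a phi c1 c2 p1 p2 : R) :
  (forall y, 0 <= K y) -> integ m K -> \int[m]_y K y = 1 ->
  integ m (fun y => K y * F y) -> integ m (fun y => K y * G y) ->
  integ m (fun y => K y * (F y * G y)) ->
  integ m (fun y => K y * `|F y| `^ p1) -> integ m (fun y => K y * `|G y| `^ p2) ->
  0 <= a ->
  (forall s t, 0 <= s -> 0 <= t -> a * (s * t) <= phi + c1 * s `^ p1 + c2 * t `^ p2) ->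
  a * `|\int[m]_y (K y * (F y * G y)) - \int[m]_y (K y * F y) * \int[m]_y (K y * G y)| <=
    2 * (phi + c1 * \int[m]_y (K y * `|F y| `^ p1) + c2 * \int[m]_y (K y * `|G y| `^ p2)).
Proof.
move=> K0 iK K1 iF iG iFG iF1 iG2 a0 H.
set E1 := \int[m]_y (K y * `|F y| `^ p1); set E2 := \int[m]_y (K y * `|G y| `^ p2).
have iFa : integ m (fun y => K y * `|F y|).
  by apply: eq_integ (integ_abs iF) => y; rewrite normrM ger0_norm.
have iGa : integ m (fun y => K y * `|G y|).
  by apply: eq_integ (integ_abs iG) => y; rewrite normrM ger0_norm.
have iFGa : integ m (fun y => K y * (`|F y| * `|G y|)).
  by apply: eq_integ (integ_abs iFG) => y; rewrite !normrM ger0_norm.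
have abE (f : X -> R) (g : X -> R) : integ m (fun y => K y * f y) ->
    (forall y, `|f y| = g y) -> `|\int[m]_y (K y * f y)| <= \int[m]_y (K y * g y).
  move=> fi fg; apply: le_trans (Rint_abs fi) _; rewrite le_eqVlt; apply/orP; left; apply/eqP.
  by apply: eq_Rint => y; rewrite normrM ger0_norm // fg.
have B1 : a * \int[m]_y (K y * (`|F y| * `|G y|)) <= phi + c1 * E1 + c2 * E2.
  have -> : phi + c1 * E1 + c2 * E2 = \int[m]_y (phi * K y + c1 * (K y * `|F y| `^ p1)
      + c2 * (K y * `|G y| `^ p2)).
    rewrite RintD; [|by apply: integD; exact: integZ|exact: integZ].
    by rewrite RintD; [rewrite !RintZ // K1 mulr1|exact: integZ|exact: integZ].
  rewrite -RintZ //; apply: Rint_le; [exact: integZ|by apply: integD; [apply: integD|]; exact: integZ|].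
  move=> y; have := ler_wpM2l (K0 y) (H _ _ (normr_ge0 (F y)) (normr_ge0 (G y))).
  by move: (`|F y| `^ p1) (`|G y| `^ p2) => P Q; rewrite mulrCA; congr (_ <= _); ring.
have B2 t : 0 <= t -> a * (\int[m]_y (K y * `|F y|) * t) <= phi + c1 * E1 + c2 * t `^ p2.
  move=> t0; have -> : phi + c1 * E1 + c2 * t `^ p2 =
     \int[m]_y ((phi + c2 * t `^ p2) * K y + c1 * (K y * `|F y| `^ p1)).
    by rewrite RintD; [rewrite !RintZ // K1 mulr1 -/E1; ring|exact: integZ|exact: integZ].
  rewrite [_ * t]mulrC mulrA -RintZ //.
  apply: Rint_le; [exact: integZ|by apply: integD; exact: integZ|].
  move=> y; have := ler_wpM2l (K0 y) (H _ _ (normr_ge0 (F y)) t0).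
  by move: (`|F y| `^ p1) (t `^ p2) => P Q HH; apply: le_trans (le_trans _ HH) _;
    rewrite le_eqVlt; apply/orP; left; apply/eqP; ring.
set IF := \int[m]_y (K y * `|F y|) in B2; set IG := \int[m]_y (K y * `|G y|).
have IF0 : 0 <= IF by apply: Rint_ge0 => y; rewrite mulr_ge0.
have B3 : a * (IF * IG) <= phi + c1 * E1 + c2 * E2.
  have -> : phi + c1 * E1 + c2 * E2 =
     \int[m]_y ((phi + c1 * E1) * K y + c2 * (K y * `|G y| `^ p2)).
    by rewrite RintD; [rewrite !RintZ // K1 mulr1|exact: integZ|exact: integZ].
  rewrite mulrA -RintZ //; apply: Rint_le; [exact: integZ|by apply: integD; exact: integZ|].
  move=> y; have := ler_wpM2l (K0 y) (B2 _ (normr_ge0 (G y))).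
  by move: (`|G y| `^ p2) => Q HH; apply: le_trans (le_trans _ HH) _;
    rewrite le_eqVlt; apply/orP; left; apply/eqP; ring.
rewrite mulr_natl mulr2n; apply: le_trans (lerD B1 B3); rewrite -mulrDr ler_wpM2l //.
apply: le_trans (ler_normB _ _) _; apply: lerD.
  by apply: abE => // y; rewrite normrM.
by rewrite normrM ler_pM //; exact: abE.
Qed.

Lemma Rint_le3 d (X : measurableType d) (m : {measure set X -> \bar R}) (e f g h : X -> R)
    (c0 c1 c2 : R) : integ m e -> integ m f -> integ m g -> integ m h ->
  (forall x, e x <= 2 * (c0 * f x + c1 * g x + c2 * h x)) ->
  \int[m]_x e x <= 2 * (c0 * \int[m]_x f x + c1 * \int[m]_x g x + c2 * \int[m]_x h x).
Proof.
move=> ie jf jg jh H.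
have fgi := integD (integZ c0 jf) (integZ c1 jg).
have -> : c0 * \int[m]_x f x + c1 * \int[m]_x g x + c2 * \int[m]_x h x =
    \int[m]_x (c0 * f x + c1 * g x + c2 * h x).
  by rewrite (RintD fgi (integZ c2 jh)) (RintD (integZ c0 jf) (integZ c1 jg)) !RintZ.
have i3 := integD fgi (integZ c2 jh).
by rewrite -RintZ //; apply: Rint_le => //; exact: integZ.
Qed.

(* The increments [delta] enter because a covariance is unchanged when each
   factor is shifted by a constant. *)
Lemma conv_cov n f g x : periodic3 f -> sqint mu3 f -> periodic3 g -> sqint mu3 g ->
  integ mu3 f -> integ mu3 g ->
  conv (kern n) (fun x => f x * g x) x - conv (kern n) f x * conv (kern n) g x =
  \int[mu3]_y (kern n y * (delta f x y * delta g x y)) -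
  \int[mu3]_y (kern n y * delta f x y) * \int[mu3]_y (kern n y * delta g x y).
Proof.
move=> pf sf pg sg fi gi; have kt := @kern_test R n; have ik := test_integ kt.
have fgi := sqintM sf sg.
have pfg : periodic3 (fun x => f x * g x) by move=> z i; rewrite pf pg.
have if' := test_mul_integ kt (integ_reflect3 x fi pf).
have ig' := test_mul_integ kt (integ_reflect3 x gi pg).
have ifg := test_mul_integ kt (integ_reflect3 x fgi pfg).
rewrite !(convE x kt) //.
have df (h : point3 R -> R) : integ mu3 (fun y => kern n y * h (x - (y : point3 R))) ->
    \int[mu3]_y (kern n y * delta h x y) = \int[mu3]_y (kern n y * h (x - (y : point3 R))) - h x.
  move=> hi; have E y : kern n y * delta h x y = kern n y * h (x - y) - h x * kern n y.
    by rewrite /delta; ring.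
  under eq_Rintegral do rewrite E.
  by rewrite RintB //; [rewrite RintZ // Rint_kern mulr1|exact: integZ].
rewrite !df //.
have E y : kern n y * (delta f x y * delta g x y) =
   kern n y * (f (x - y) * g (x - y)) - g x * (kern n y * f (x - y)) - f x * (kern n y * g (x - y))
    + f x * g x * kern n y.
  by rewrite /delta; ring.
under [X in _ = X - _]eq_Rintegral do rewrite E.
rewrite RintD; [|by apply: integB; [apply: integB => //|]; exact: integZ|exact: integZ].
rewrite RintB; [|by apply: integB => //; exact: integZ|exact: integZ].
rewrite RintB //; last exact: integZ.
rewrite !RintZ // Rint_kern.
set A := \int[mu3]_y _; set B := \int[mu3]_y _; set C := \int[mu3]_y _; ring.
Qed.

(** [H] may be any weighted Young inequality for a triple product. The horizontal, the vertical and
    the gradient estimates are three instances, with different exponents and weights. *)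
Lemma flux_bound n (A f g : point3 R -> R) (c0 c1 c2 p0 p1 p2 : R) :
  torus_test A -> periodic3 f -> sqint mu3 f -> periodic3 g -> sqint mu3 g ->
  integ mu3 f -> integ mu3 g ->
  1 <= p0 -> 1 <= p1 -> 1 <= p2 ->
  integ mu3 (fun x => `|f x| `^ p1) -> integ mu3 (fun x => `|g x| `^ p2) ->
  (forall a s t, 0 <= a -> 0 <= s -> 0 <= t ->
     a * (s * t) <= c0 * a `^ p0 + c1 * s `^ p1 + c2 * t `^ p2) ->
  `|\int[mu3]_x (A x * (conv (kern n) (fun x => f x * g x) x -
                       conv (kern n) f x * conv (kern n) g x))| <=
  2 * (c0 * \int[mu3]_x `|A x| `^ p0 + c1 * davg p1 f n + c2 * davg p2 g n).
Proof.
move=> tA pf sf pg sg fi gi q0 q1 q2 fp gp H.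
have kt := @kern_test R n; have ik := test_integ kt.
have fgi := sqintM sf sg; have [mf _] := sf; have [mg _] := sg.
have tc h : integ mu3 h -> torus_test (conv (kern n) h) by exact: conv_test.
have tI := testM tA (testD (tc _ fgi) (testZ (-1) (testM (tc _ fi) (tc _ gi)))).
have iI : integ mu3 (fun x => A x * (conv (kern n) (fun x => f x * g x) x -
                       conv (kern n) f x * conv (kern n) g x)).
  by apply: eq_integ (test_integ tI) => x; rewrite mulN1r.
have iA : integ mu3 (fun x => `|A x| `^ p0).
  have [M M0 AM] := test_bounded tA.
  apply: (@integ_bounded _ _ _ _ _ (M `^ p0)); first exact: measurable_pow (test_measurable tA).
  by move=> x; rewrite ger0_norm ?powR_ge0 //; apply: ge0_ler_powR; rewrite ?nnegrE ?normr_ge0 //; lra.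
have if1 := integ_davg q1 pf mf fp n; have ig2 := integ_davg q2 pg mg gp n.
apply: le_trans (Rint_abs iI) _.
have j1 : integ mu3 (fun x => \int[mu3]_y (kern n y * `|delta f x y| `^ p1)) := integ_Rint if1.
have j2 : integ mu3 (fun x => \int[mu3]_y (kern n y * `|delta g x y| `^ p2)) := integ_Rint ig2.
apply: (Rint_le3 (integ_abs iI) iA j1 j2).
move=> x; rewrite normrM conv_cov //.
apply: cov_bound.
- exact: kern_ge0.
- exact: ik.
- exact: Rint_kern.
- by apply: (test_mul_integ kt); apply: integB; [exact: integ_reflect3|exact: integ_cst].
- by apply: (test_mul_integ kt); apply: integB; [exact: integ_reflect3|exact: integ_cst].
- apply: (test_mul_integ kt); apply: sqintM.
    apply: sqintB; last by split=> //; exact: integ_cst.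
    split; first exact: measurable_reflect3.
    by apply: (integ_reflect3 x sf.2) => z i; rewrite pf.
  apply: sqintB; last by split=> //; exact: integ_cst.
  split; first exact: measurable_reflect3.
  by apply: (integ_reflect3 x sg.2) => z i; rewrite pg.
- exact: (test_mul_integ kt (integ_delta_slice q1 pf mf fp x)).
- exact: (test_mul_integ kt (integ_delta_slice q2 pg mg gp x)).
- exact: normr_ge0.
- by move=> s t s0 t0; exact: H.
Qed.

End Covariance.

Section Flux.
Context {R : realType}.
Notation mu3 := (@mu3 R).
Implicit Types v : 'I_3 -> point3 R -> R.

Definition hslice v (A : 'I_3 -> 'I_2 -> point3 R -> R) :=
  [/\ forall i, periodic3 (v i) /\ sqint mu3 (v i), wdiv v,
      forall i j, wpart (hindex j) (v i) (A i j) &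
      forall i j, periodic3 (A i j) /\ sqint mu3 (A i j)].

Definition flux n v := \sum_i \sum_j
  \int[mu3]_x ('D_(basis3 j) (conv (kern n) (v i)) x * conv (kern n) (fun x => v i x * v j x) x).

Definition cov n (f g : point3 R -> R) x :=
  conv (kern n) (fun x => f x * g x) x - conv (kern n) f x * conv (kern n) g x.

(** For each i the subtracted terms add up to 0 over j, by [wdiv_transport] with the mollified v_i
    as w. *)
Lemma fluxE n v : (forall i, sqint mu3 (v i)) -> wdiv v -> flux n v =
  \sum_i \sum_j \int[mu3]_x ('D_(basis3 j) (conv (kern n) (v i)) x * cov n (v i) (v j) x).
Proof.
move=> sv wv; apply: eq_bigr => i _; have [vi _] := wv.
have kt := @kern_test R n.
have tv j : torus_test (conv (kern n) (v j)) by exact: conv_test.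
have td j : torus_test ('D_(basis3 j) (conv (kern n) (v i))) by exact: test_derive.
have H := wdiv_transport (wdiv_conv kt wv) (tv i) tv.
have tw j := test_integ (testM (td j) (testM (tv i) (tv j))).
move: H; rewrite (Rint_sum _ _ tw) => H.
apply/eqP; rewrite -subr_eq0 -sumrB -[X in _ == X]H; apply/eqP; apply: eq_bigr => j _.
have tij : torus_test (conv (kern n) (fun x => v i x * v j x)).
  exact: conv_test (sqintM (sv i) (sv j)).
rewrite -RintB; first by apply: eq_Rint => x; rewrite /cov; ring.
- exact/test_integ/testM.
- have := testM (td j) (testD tij (testZ (-1) (testM (tv i) (tv j)))).
  by move=> /test_integ; apply: eq_integ => x; rewrite mulN1r.
Qed.

Lemma sum_hindex (F : 'I_3 -> R) : \sum_i F i = \sum_(j < 2) F (hindex j) + F ord_max.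
Proof. by rewrite big_ord_recr. Qed.

Lemma powR2 (a : R) : `|a| `^ 2 = a ^+ 2.
Proof. by rewrite powR_mulrn // real_normK ?num_real. Qed.

(** A sum of squares. A small k makes the dissipation term small, at the price of 1/k on the
    increments. *)
Lemma young_horizontal (k a s t : R) : 0 < k -> 0 <= a -> 0 <= s -> 0 <= t ->
  a * (s * t) <= k * a `^ 2 + (8 * k)^-1 * s `^ 4 + (8 * k)^-1 * t `^ 4.
Proof.
move=> k0 a0 s0 t0; rewrite !powR_mulrn // -subr_ge0.
have -> : k * a ^+ 2 + (8 * k)^-1 * s ^+ 4 + (8 * k)^-1 * t ^+ 4 - a * (s * t) =
   ((2 * k * a - s * t) ^+ 2 / 4 + (s ^+ 2 - t ^+ 2) ^+ 2 / 8) / k.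
  by field; rewrite gt_eqF.
by rewrite divr_ge0 ?(ltW k0) // addr_ge0 // divr_ge0 ?sqr_ge0.
Qed.

(** Again a sum of squares; N will be n + 3. The weight N^(-4) offsets the fourth power of a
    vertical derivative of size N, and N^2 is offset by increments of u_3 of size 1/N in L^2. *)
Lemma young_vertical (k N a s t : R) : 0 < k -> 0 < N -> 0 <= a -> 0 <= s -> 0 <= t ->
  a * (s * t) <= k / (2 * N ^+ 4) * a `^ 4 + (32 * k ^+ 3)^-1 * s `^ 4 + k * N ^+ 2 * t `^ 2.
Proof.
move=> k0 N0 a0 s0 t0; rewrite !powR_mulrn //; set b := a / N.
have -> : a = b * N by rewrite divfK // gt_eqF.
rewrite -subr_ge0.
have -> : k / (2 * N ^+ 4) * (b * N) ^+ 4 + (32 * k ^+ 3)^-1 * s ^+ 4 + k * N ^+ 2 * t ^+ 2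
   - b * N * (s * t) =
   ((2 * k * (N * t) - b * s) ^+ 2 / 4 + (4 * k ^+ 2 * b ^+ 2 - s ^+ 2) ^+ 2 / (32 * k ^+ 2)) / k.
  by field; rewrite !gt_eqF.
rewrite divr_ge0 ?(ltW k0) // addr_ge0 // divr_ge0 ?sqr_ge0 // mulr_ge0 ?sqr_ge0 //.
Qed.

Section Slice.
Variables (v : 'I_3 -> point3 R -> R) (A : 'I_3 -> 'I_2 -> point3 R -> R).
Hypothesis hs : hslice v A.

Let pv i : periodic3 (v i). Proof. by have [/(_ i)[]] := hs. Qed.
Let sv i : sqint mu3 (v i). Proof. by have [/(_ i)[]] := hs. Qed.
Let wv : wdiv v. Proof. by have [] := hs. Qed.
Let vi i : integ mu3 (v i). Proof. by have [] := wv. Qed.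
Let mv i : measurable_fun [set: mpoint3 R] (v i). Proof. by have [] := sv i. Qed.

Definition hdissip := \sum_i \sum_j \int[mu3]_x (A i j x) ^+ 2.

Let A2 i j : 0 <= \int[mu3]_x (A i j x) ^+ 2.
Proof. by apply: Rint_ge0 => x; exact: sqr_ge0. Qed.

Lemma hdissip_ge0 : 0 <= hdissip.
Proof. by apply: sumr_ge0 => i _; apply: sumr_ge0 => j _; exact: A2. Qed.

Lemma ler_term (n : nat) (F : 'I_n -> R) i : (forall j, 0 <= F j) -> F i <= \sum_j F j.
Proof. by move=> F0; rewrite (bigD1 i) //= lerDl sumr_ge0. Qed.

Let A2_le i j : \int[mu3]_x (A i j x) ^+ 2 <= hdissip.
Proof.
apply: le_trans (ler_term i _); last by move=> k; exact: sumr_ge0.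
exact: (@ler_term _ (fun j => \int[mu3]_x (A i j x) ^+ 2)).
Qed.

(** The full gradient g of v_3 has horizontal part A and vertical part minus the horizontal
    divergence, together at most 3, hence 4, times [hdissip]. Then 144 = 9 * 2^2 * 4, with 9 from
    [shiftD_wpart] and 2/(n+3) the radius of the window. *)
Lemma davg2_vertical n : n.+3%:R ^+ 2 * davg 2 (v ord_max) n <= 144 * hdissip.
Proof.
have [_ _ wA pA] := hs.
have w3 := wdiv_partial wv (fun j => wA (hindex j) j).
pose g (k : 'I_3) : point3 R -> R :=
  if k == ord_max then fun x => - \sum_j A (hindex j) j x else A ord_max (inord k).
have kE k : k != ord_max -> hindex (inord k) = k.
  move=> kn; apply: val_inj; rewrite /= inordK //.
  by move: kn; rewrite -val_eqE /=; case: k => [[|[|[|]]]].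
have wg k : wpart k (v ord_max) (g k).
  rewrite /g; case: eqP => [->//|/eqP kn].
  by have := wA ord_max (inord k); rewrite kE.
have pg k : periodic3 (g k) /\ sqint mu3 (g k).
  rewrite /g; case: eqP => _; last exact: pA.
  split=> [x i|]; first by congr (- _); apply: eq_bigr => j _; case: (pA (hindex j) j) => ->.
  by apply: sqintN; apply: sqint_sum => j; case: (pA (hindex j) j).
have gS : \sum_k \int[mu3]_x (g k x) ^+ 2 <= 4 * hdissip.
  rewrite sum_hindex.
  have -> : \sum_(j < 2) \int[mu3]_x (g (hindex j) x) ^+ 2 =
      \sum_(j < 2) \int[mu3]_x (A ord_max j x) ^+ 2.
    apply: eq_bigr => j _; apply: eq_Rint => x; rewrite /g ifN; last first.
      by rewrite -val_eqE /= neq_ltn ltn_ord.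
    by congr (A _ _ x ^+ 2); apply: val_inj; rewrite /= inordK.
  have S1 : \sum_(j < 2) \int[mu3]_x (A ord_max j x) ^+ 2 <= hdissip.
    by apply: (@ler_term _ (fun i => \sum_j \int[mu3]_x (A i j x) ^+ 2)) => i; exact: sumr_ge0.
  have S2 : \int[mu3]_x (g ord_max x) ^+ 2 <= 2 * hdissip.
    rewrite /g eqxx; under eq_Rintegral do rewrite sqrrN big_ord_recl big_ord1.
    have [_ s0] := pA (hindex ord0) ord0; have [_ s1] := pA (hindex (lift ord0 ord0)) (lift ord0 ord0).
    apply: le_trans (Rint_sqrD_le ltr01 s0 s1) _; rewrite invr1 -mulrDr ler_wpM2l //.
    rewrite /hdissip sum_hindex big_ord_recl big_ord1 -[leLHS]addr0 lerD ?sumr_ge0 //.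
    by apply: lerD; apply: (@ler_term _ (fun j => \int[mu3]_x (A _ j x) ^+ 2)).
  by apply: le_trans (lerD S1 S2) _; have := hdissip_ge0; lra.
have N0 : 0 < n.+3%:R :> R by rewrite ltr0n.
have -> : 144 * hdissip = n.+3%:R ^+ 2 * (9 * (2 / n.+3%:R) ^+ 2 * (4 * hdissip)).
  by move: (n.+3%:R : R) N0 => N N0; field; rewrite gt_eqF.
rewrite ler_wpM2l ?sqr_ge0 //.
have fp : integ mu3 (fun x => `|v ord_max x| `^ 2).
  by apply: eq_integ (sv ord_max).2 => x; rewrite powR2.
apply: (davg_le_sup (ler1n R 2) (pv ord_max) (mv ord_max) fp) => [|y yn].
  by rewrite !mulr_ge0 ?sqr_ge0 ?hdissip_ge0.
under eq_Rintegral do rewrite powR2.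
apply: le_trans (shiftD_wpart (- y) (pv _) (sv _) wg pg) _; rewrite normrN.
apply: ler_pM => //.
- by apply: sumr_ge0 => k _; apply: Rint_ge0 => x; exact: sqr_ge0.
- by rewrite ler_wpM2l //; apply: lerXn2r yn; rewrite nnegrE.
Qed.

Definition mass4 := \sum_i \int[mu3]_x `|v i x| `^ 4.

Hypothesis v4 : forall i, integ mu3 (fun x => `|v i x| `^ 4).

Let v4_ge0 i : 0 <= \int[mu3]_x `|v i x| `^ 4.
Proof. by apply: Rint_ge0 => x; exact: powR_ge0. Qed.

Let v4_le i : \int[mu3]_x `|v i x| `^ 4 <= mass4.
Proof. exact: (@ler_term _ (fun i => \int[mu3]_x `|v i x| `^ 4)). Qed.

Let le14 : 1 <= 4 :> R. Proof. by rewrite ler1n. Qed.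
Let le12 : 1 <= 2 :> R. Proof. by rewrite ler1n. Qed.

Let davg4_ge0 i n : 0 <= davg 4 (v i) n.
Proof. exact: davg_ge0. Qed.

Lemma flux_horizontal n i j k : 0 < k ->
  `|\int[mu3]_x ('D_(basis3 (hindex j)) (conv (kern n) (v i)) x * cov n (v i) (v (hindex j)) x)| <=
  2 * k * hdissip + (4 * k)^-1 * (2 * \sum_i davg 4 (v i) n).
Proof.
move=> k0; have [_ _ wA pA] := hs; have kt := @kern_test R n.
have tD := test_derive (basis3 (hindex j)) (conv_test kt (vi i)).
have H := flux_bound n tD (pv i) (sv i) (pv (hindex j)) (sv (hindex j)) (vi i) (vi _) le12 le14 le14
   (v4 i) (v4 _) (fun a s t => @young_horizontal k a s t k0).
apply: le_trans H _.
have DA : \int[mu3]_x `|'D_(basis3 (hindex j)) (conv (kern n) (v i)) x| `^ 2 <= hdissip.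
  have [pg [mg ig]] := pA i j.
  have gp : integ mu3 (fun x => `|A i j x| `^ 2) by apply: eq_integ ig => x; rewrite powR2.
  have := conv_pow_le le12 pg mg gp n.
  under eq_Rintegral do rewrite powR2.
  under [X in _ <= X -> _]eq_Rintegral do rewrite powR2.
  move=> /le_trans /(_ (A2_le i j)); apply: le_trans; rewrite le_eqVlt; apply/orP; left; apply/eqP.
  by apply: eq_Rint => x; rewrite powR2 (wpart_conv x kt (wA i j)).
have dl i' : davg 4 (v i') n <= \sum_i davg 4 (v i) n.
  exact: (@ler_term _ (fun i => davg 4 (v i) n)).
have k8 : 0 <= (8 * k)^-1 by rewrite invr_ge0 mulr_ge0 // ltW.
have -> : 2 * k * hdissip + (4 * k)^-1 * (2 * \sum_i davg 4 (v i) n) =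
  2 * (k * hdissip + (8 * k)^-1 * (\sum_i davg 4 (v i) n) + (8 * k)^-1 * (\sum_i davg 4 (v i) n)).
  by field; rewrite gt_eqF.
by rewrite ler_wpM2l // !lerD // ler_wpM2l // ltW.
Qed.

Variables C0 C : R.
Hypotheses (C00 : 0 <= C0) (CE : (C0 + 1) `^ 4 <= C)
  (HC : forall n, \int[mu3]_x `|'D_(basis3 ord_max) (kern n) x| <= C0 * n.+3%:R).
Let C_ge0 : 0 <= C. Proof. exact: le_trans (powR_ge0 _ _) CE. Qed.
(** 300 rounds up 292 = 288 + 2 + 2, the coefficients of [hdissip] in one vertical and two
    horizontal terms; 3 counts the components i. *)
Let D := 3 * (C + 300).
Let D_ge0 : 0 <= D.
Proof. by apply: (mulr_ge0 (ler0n R 3)); apply: addr_ge0 C_ge0 (ler0n R 300). Qed.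

(** The vertical derivative falls on the kernel, whose derivative has L^1 norm at most (C0 + 1) N,
    so Young's convolution inequality in L^4 costs N^4. All powers of N cancel against the weights
    of [young_vertical]. *)
Lemma flux_vertical n i k : 0 < k ->
  `|\int[mu3]_x ('D_(basis3 ord_max) (conv (kern n) (v i)) x * cov n (v i) (v ord_max) x)| <=
  k * (C * mass4 + 288 * hdissip) + (16 * k ^+ 3)^-1 * \sum_i davg 4 (v i) n.
Proof.
move=> k0; set N : R := n.+3%:R; have N0 : 0 < N by rewrite ltr0n.
have kt := @kern_test R n; have td := test_derive (basis3 ord_max) kt.
have C1 : 0 < C0 + 1 by rewrite ltr_wpDl.
have tD := test_derive (basis3 ord_max) (conv_test kt (vi i)).
have v2 : integ mu3 (fun x => `|v ord_max x| `^ 2).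
  by apply: eq_integ (sv ord_max).2 => x; rewrite powR2.
have H := flux_bound n tD (pv i) (sv i) (pv ord_max) (sv ord_max) (vi i) (vi _) le14 le14 le12
   (v4 i) v2 (fun a s t => @young_vertical k N a s t k0 N0).
apply: le_trans H _.
have DA : \int[mu3]_x `|'D_(basis3 ord_max) (conv (kern n) (v i)) x| `^ 4 <=
    (C * N ^+ 4) * mass4.
  apply: le_trans (ler_wpM2l (mulr_ge0 C_ge0 (exprn_ge0 4 (ltW N0))) (v4_le i)).
  have -> : N ^+ 4 = N `^ 4 by rewrite powR_mulrn // ltW.
  apply: le_trans (ler_wpM2r (v4_ge0 i) (ler_wpM2r (powR_ge0 N 4) CE)).
  rewrite -powRM ?(ltW C1) ?(ltW N0) //.
  have := conv_pow_leM le14 (pv i) (mv i) (v4 i) td (mulr_gt0 C1 N0) _.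
  rewrite (_ : \int[mu3]_x `|conv _ _ x| `^ 4 =
     \int[mu3]_x `|'D_(basis3 ord_max) (conv (kern n) (v i)) x| `^ 4); last first.
    by apply: eq_Rint => x; rewrite derive_conv.
  by apply; apply: le_trans (HC n) _; rewrite ler_wpM2r ?(ltW N0) // lerDl.
have dl : davg 4 (v i) n <= \sum_i davg 4 (v i) n.
  exact: (@ler_term _ (fun i => davg 4 (v i) n)).
have d2 := davg2_vertical n; rewrite -/N in d2.
have -> : k * (C * mass4 + 288 * hdissip) + (16 * k ^+ 3)^-1 * \sum_i davg 4 (v i) n =
  2 * (k / (2 * N ^+ 4) * (C * N ^+ 4 * mass4) + (32 * k ^+ 3)^-1 * (\sum_i davg 4 (v i) n) +
    k * (144 * hdissip)).
  by field; rewrite !gt_eqF.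
rewrite ler_wpM2l // !lerD //.
- by rewrite ler_wpM2l // divr_ge0 ?(ltW k0) // mulr_ge0 // exprn_ge0 // ltW.
- by rewrite ler_wpM2l // invr_ge0 mulr_ge0 // exprn_ge0 // ltW.
- by rewrite -mulrA ler_wpM2l // ltW.
Qed.

Lemma flux4_bound n k : 0 < k ->
  `|flux n v| <= D * k * (mass4 + hdissip) + D * (k^-1 + k ^- 3) * \sum_i davg 4 (v i) n.
Proof.
move=> k0; rewrite fluxE //.
set S := \sum_i davg 4 (v i) n.
have S0 : 0 <= S by exact: sumr_ge0.
have m40 : 0 <= mass4 by exact: sumr_ge0.
have h0 := hdissip_ge0.
have ki : 0 < k^-1 by rewrite invr_gt0.
have k3 : 0 < k ^- 3 by rewrite invr_gt0 exprn_gt0.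
have B i : `|\sum_j \int[mu3]_x ('D_(basis3 j) (conv (kern n) (v i)) x * cov n (v i) (v j) x)| <=
   (C + 300) * k * (mass4 + hdissip) + (C + 300) * (k^-1 + k ^- 3) * S.
  rewrite sum_hindex big_ord_recl big_ord1.
  have h1 := @flux_horizontal n i ord0 k k0; have h2 := @flux_horizontal n i (lift ord0 ord0) k k0.
  have h3 := @flux_vertical n i k k0; rewrite -/S in h1 h2 h3.
  apply: le_trans (ler_normD _ _) _; apply: le_trans (lerD (ler_normD _ _) (lexx _)) _.
  apply: le_trans (lerD (lerD h1 h2) h3) _.
  have -> : 2 * k * hdissip + (4 * k)^-1 * (2 * S) + (2 * k * hdissip + (4 * k)^-1 * (2 * S)) +
    (k * (C * mass4 + 288 * hdissip) + (16 * k ^+ 3)^-1 * S) =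
    k * (C * mass4 + 292 * hdissip) + (k^-1 + 16^-1 * k ^- 3) * S.
    by field; rewrite gt_eqF.
  apply: lerD.
    rewrite [leRHS]mulrAC mulrC ler_wpM2r ?(ltW k0) // mulrDr.
    apply: lerD; rewrite ler_wpM2r //; first by rewrite lerDl ler0n.
    by rewrite -[leLHS]add0r; apply: lerD => //; rewrite ler_nat.
  rewrite ler_wpM2r //.
  have c1 : 1 <= C + 300 by rewrite -[leLHS]add0r lerD // ler1n.
  apply: (@le_trans _ _ (1 * (k^-1 + k ^- 3))).
    by rewrite mul1r lerD2l ler_piMl ?(ltW k3) // invf_le1 // ler1n.
  by rewrite ler_wpM2r // addr_ge0 // ltW.
apply: le_trans (ler_norm_sum _ _ _) _; apply: le_trans (ler_sum _ (fun i _ => B i)) _.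
rewrite sumr_const card_ord -mulr_natl /D le_eqVlt; apply/orP; left; apply/eqP; ring.
Qed.

(** The weight k is fixed first, so that the part multiplying [mass4] and [hdissip] is at most e/2;
    then n is taken large, so that the increments fall below e/2 in spite of the factors 1/k and
    1/k^3. *)
Lemma flux4_cvg0 : flux n v @[n --> \oo] --> 0.
Proof.
have H := flux4_bound; have D0 := D_ge0; clearbody D.
have m40 : 0 <= mass4 by exact: sumr_ge0.
have h0 := hdissip_ge0.
apply/cvgrPdist_le => /= e e0.
pose k := e / (2 * (D + 1) * (mass4 + hdissip + 1)).
have F0 : 0 < 2 * (D + 1) * (mass4 + hdissip + 1) by rewrite !mulr_gt0 // ltr_wpDl // addr_ge0.
have k0 : 0 < k by rewrite divr_gt0.
have : \sum_i davg 4 (v i) n @[n --> \oo] --> 0.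
  have := @cvgn_sum R _ (index_enum 'I_3) (fun i n => davg 4 (v i) n) (fun=> 0)
    (fun i => davg_cvg0 le14 (pv i) (mv i) (v4 i)).
  by rewrite (big1 _ xpredT).
pose E := D * (k^-1 + k ^- 3) + 1.
have E0 : 0 < E.
  by rewrite ltr_wpDl // mulr_ge0 // addr_ge0 // invr_ge0 ?exprn_ge0 // ltW.
have eE : 0 < e / (2 * E) by rewrite divr_gt0 // mulr_gt0.
move=> /cvgrPdist_le /(_ _ eE)[N _ HN]; exists N => // n /HN /=.
rewrite !sub0r !normrN ger0_norm; last by apply: sumr_ge0 => i _; exact: davg4_ge0.
set S := \sum_i _ => SE; have S0 : 0 <= S by apply: sumr_ge0 => i _; exact: davg4_ge0.
apply: le_trans (H n k k0) _; rewrite -/S.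
have -> : e = e / 2 + e / 2 by field.
apply: lerD.
  apply: (@le_trans _ _ ((D + 1) * k * (mass4 + hdissip + 1))).
    apply: ler_pM; rewrite ?lerDl ?addr_ge0 //; first by rewrite mulr_ge0 // ltW.
    by rewrite ler_wpM2r ?(ltW k0) // lerDl.
  rewrite /k le_eqVlt; apply/orP; left; apply/eqP; field.
  by rewrite !gt_eqF // ltr_wpDl // addr_ge0.
apply: (@le_trans _ _ (E * (e / (2 * E)))).
  apply: ler_pM => //; last by rewrite /E lerDl.
  by rewrite mulr_ge0 // addr_ge0 // invr_ge0 ?exprn_ge0 // ltW.
by rewrite le_eqVlt; apply/orP; left; apply/eqP; field; rewrite gt_eqF.
Qed.

(** The weight k = 1. Each [davg] is at most 2^4 * 2 = 32 times the fourth moment, and 65 = 1 + 2 *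
    32. *)
Lemma flux4_le n : `|flux n v| <= D * 65 * (mass4 + hdissip).
Proof.
have := flux4_bound n ltr01; rewrite expr1n invr1 mulr1.
have : \sum_i davg 4 (v i) n <= 32 * mass4.
  rewrite mulr_sumr; apply: ler_sum => i _.
  apply: le_trans (davg_le le14 (pv i) (mv i) (v4 i) n) _.
  by rewrite powR_mulrn // mulrA -natrX -natrM.
have m40 : 0 <= mass4 by exact: sumr_ge0.
have h0 := hdissip_ge0.
move=> Sm H; apply: le_trans H _.
apply: (@le_trans _ _ (D * (mass4 + hdissip) + D * (1 + 1) * (32 * mass4))).
  by rewrite lerD2l ler_wpM2l // mulr_ge0.
have -> : D * 65 * (mass4 + hdissip) =
  D * (mass4 + hdissip) + D * (1 + 1) * (32 * mass4) + D * 64 * hdissip by ring.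
by rewrite lerDl; exact: mulr_ge0 (mulr_ge0 D_ge0 (ler0n R 64)) h0.
Qed.

End Slice.
End Flux.

(** Dominated convergence for the constant sequence f already contains this. *)
Lemma ae_integ_le d (X : measurableType d) (R : realType) (m : {measure set X -> \bar R})
    (f g : X -> R) : measurable_fun setT f -> integ m g ->
  {ae m, forall x, `|f x| <= g x} -> integ m f.
Proof.
move=> mf gi fg; have mg := integ_meas gi.
have [ga _] := Rint_dct (fun n => mf) mf (nearW _ (fun x => cvg_cst _)) gi
  (filterS (fun x h n => h) fg).
exact: ga.
Qed.

(** * The energy balance of the mollified field *)

Section TimeInterval.
Context {R : realType}.
Notation lam := (@lebesgue_measure R).
Variable T : R.

Lemma measurable_itv0T : measurable (`]0, T[%classic : set (measurableTypeR R)).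
Proof. exact: measurable_itv. Qed.

Definition muT : set (measurableTypeR R) -> \bar R := mrestr lam measurable_itv0T.
HB.instance Definition _ := Measure.on muT.

Lemma muT_fin : fin_num_fun muT.
Proof.
apply: lty_fin_num_fun; rewrite -[ltLHS]/(lam (setT `&` `]0%R, T[)) setTI lebesgue_measure_itv /=.
by case: ifP => _; rewrite ?ltry // -EFinB ltry.
Qed.

HB.instance Definition _ := @Measure_isFinite.Build _ _ _ muT muT_fin.

#[global] Instance muT_ae_filter : Filter (nbhs (almost_everywhere muT)).
Proof. exact: (ae_filter_ringOfSetsType muT). Qed.

Lemma muT_ae_itv : {ae muT, forall r, 0 < r < T}.
Proof.
exists (~` `]0, T[%classic); split.
- exact: measurableC.
- by rewrite -[LHS]/(lam (~` `]0%R, T[ `&` `]0%R, T[)) setICl measure0.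
- by move=> r /=; rewrite in_itv.
Qed.

Lemma muT_ae_neq (a : R) : {ae muT, forall r, r != a}.
Proof.
exists [set a]; split; first exact: measurable_set1.
- apply/eqP; rewrite eq_le measure_ge0 andbT.
  apply: (@le_trans _ _ (lam [set a])); last by rewrite lebesgue_measure_set1.
  rewrite -[leLHS]/(lam ([set a] `&` `]0%R, T[)).
  by apply: measureIl; [exact: measurable_set1|exact: measurable_itv0T].
- by move=> r /negP; rewrite negbK => /eqP.
Qed.

Lemma Rint_muT (f : R -> R) : measurable_fun setT f -> (forall x, 0 <= f x) ->
  \int[muT]_x f x = \int[lam]_(x in `[0, T]) f x.
Proof.
move=> mf f0; rewrite /Rintegral /muT integral_mrestr //; last exact/measurable_EFinP.
have mf' D : measurable_fun D (EFin \o f) by apply: measurable_funTS; exact/measurable_EFinP.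
by rewrite -[in RHS]integral_itv_bndo_bndc ?integral_itv_obnd_cbnd.
Qed.

Lemma continuous_integ_muT (f : R -> R) : continuous f -> integ muT f.
Proof.
move=> cf; have mf := continuous_measurable cf.
have /compact_bounded[M [_ fM]] : compact (f @` `[0, T]%classic).
  by apply: continuous_compact; [exact: continuous_subspaceT|exact: segment_compact].
apply: (ae_integ_le mf (integ_cst _ (`|M| + 1))).
apply: filterS muT_ae_itv => r /andP[r0 rT]; apply: fM.
  by rewrite (le_lt_trans (ler_norm _)) // ltrDl.
by exists r => //=; rewrite in_itv /= !ltW.
Qed.

End TimeInterval.

(** * From a weak time derivative to increments *)

Section DuBoisReymond.
Context {R : realType}.
Notation lam := (@lebesgue_measure R).
Variables (T : R) (c f : R -> R).
Hypotheses (T0 : 0 < T) (cc : continuous c)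
  (fi : integ (muT T) f).
Hypothesis weak : forall (eta : R -> R) a b, smooth eta -> 0 < a -> b < T ->
  (forall r, ~~ (a <= r <= b) -> eta r = 0) ->
  \int[muT T]_r ('D_1 eta r * c r + eta r * f r) = 0.

(** A smooth step that starts at s and is complete at s + 1/(m+1); its derivative [dramp] is a
    one-sided approximation of the Dirac mass at s. *)
Let ramp (m : nat) (s r : R) := step (m.+1%:R * (r - s)).
Let dramp (m : nat) (s r : R) := m.+1%:R * bump (m.+1%:R * (r - s)).
Let m0 (m : nat) : 0 < m.+1%:R :> R. Proof. by rewrite ltr0n. Qed.

Let ramp_affine (m : nat) (s : R) : forall h v x : R,
  m.+1%:R * ((h *: v + x) - s) = h *: (m.+1%:R * v) + m.+1%:R * (x - s).
Proof. by move=> h v x; rewrite /GRing.scale /=; ring. Qed.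

Let ramp_cont (m : nat) (s : R) : continuous (fun r : R => m.+1%:R * (r - s)).
Proof. by move=> x; apply: cvgMr; apply: cvgB; [exact: cvg_id|exact: cvg_cst]. Qed.

Let smooth_ramp m s : smooth (ramp m s).
Proof. exact: (smooth_affine (@ramp_cont m s) (@ramp_affine m s) smooth_step). Qed.

Let is_derive_ramp m s (r : R) : is_derive r 1 (ramp m s) (dramp m s r).
Proof.
have dB : is_derive r 1 (fun r : R => r - s) 1.
  by have := is_deriveB (is_derive_id r 1) (is_derive_cst s r 1); rewrite subr0.
have dl : is_derive r 1 (fun r : R => m.+1%:R * (r - s)) m.+1%:R.
  have := @is_deriveZ _ _ _ (fun r : R => r - s) m.+1%:R r 1 1 dB.
  by rewrite /GRing.scale /= mulr1.
have := @is_derive1_comp _ step _ _ _ _ (is_derive_step _) dl.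
by rewrite mulrC.
Qed.

Let cont_dramp m s : continuous (dramp m s).
Proof.
move=> r; apply: cvgMr; apply: (continuous_comp (@ramp_cont m s r)).
exact: (smooth_continuous (@smooth_bump R)).
Qed.

Let meas_dramp m s : measurable_fun [set: measurableTypeR R] (dramp m s).
Proof. exact: continuous_measurable (@cont_dramp m s). Qed.

Let dramp_ge0 m s r : 0 <= dramp m s r.
Proof. by rewrite mulr_ge0 // bump_ge0. Qed.

Let dramp_neq0 m s r : dramp m s r != 0 -> s < r < s + m.+1%:R^-1.
Proof.
have [/andP[h1 h2] _|h] := boolP (0 < m.+1%:R * (r - s) < 1); last first.
  by rewrite /dramp bump_out ?mulr0 ?eqxx.
rewrite -(subr_gt0 s) -(pmulr_rgt0 _ (m0 m)) h1 /= -ltrBlDl.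
by rewrite -[ltRHS]mulr1 ltr_pdivlMl // -ltr_pdivlMl ?invr_gt0 // invrK.
Qed.

Let integ_dramp m s : integ (muT T) (dramp m s).
Proof.
exact: continuous_integ_muT (@cont_dramp m s).
Qed.

Let ic m a : integ (muT T) (fun r => dramp m a r * c r).
Proof.
have cdc : continuous (fun r : R => dramp m a r * c r).
  by move=> r; apply: cvgM; [exact: cont_dramp|exact: cc].
exact: continuous_integ_muT cdc.
Qed.

Let Rint_dramp m (s : R) : 0 < s -> s + m.+1%:R^-1 < T -> \int[muT T]_r dramp m s r = 1.
Proof.
move=> s0 sT; rewrite (Rint_muT T (@meas_dramp m s) (@dramp_ge0 m s)).
rewrite (@Rint_FTC R (ramp m s) (dramp m s) 0 T (ltW T0) (@cont_dramp m s) (@is_derive_ramp m s)).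
rewrite /ramp step_ge1; last first.
  by rewrite -ler_pdivrMl // mulr1 lerBrDl ltW.
by rewrite step_le0 ?subr0 // sub0r mulrN oppr_le0 mulr_ge0 // ltW.
Qed.

Let bump_average (s : R) : 0 < s -> s < T ->
  \int[muT T]_r (dramp m s r * c r) @[m --> \oo] --> c s.
Proof.
move=> s0 sT; apply/cvgrPdist_le => /= e e0.
have /cvgrPdist_le cs : c x @[x --> s] --> c s by exact: cc.
have /nbhs_ballP[d /= d0 Hd] := cs e e0.
have Ts0 : 0 < T - s by rewrite subr_gt0.
near=> m.
have md : m.+1%:R^-1 < d.
  near: m; exact: (near_infty_natSinv_lt (PosNum d0)).
have mT : m.+1%:R^-1 < T - s.
  near: m; exact: (near_infty_natSinv_lt (PosNum Ts0)).
have D1 : \int[muT T]_r dramp m s r = 1 by apply: Rint_dramp => //; rewrite -ltrBrDl.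
rewrite -[X in X - _]mulr1 -D1 -RintZ // -RintB //; last exact: integZ.
apply: le_trans (Rint_abs _) _; first by apply: integB => //; exact: integZ.
rewrite -[e]mulr1 -D1 -RintZ //.
apply: Rint_le; [by apply/integ_abs/integB => //; exact: integZ|exact: integZ|].
move=> r; have -> : c s * dramp m s r - dramp m s r * c r = (c s - c r) * dramp m s r by ring.
rewrite normrM (ger0_norm (dramp_ge0 m s r)).
have [->|/dramp_neq0/andP[h1 h2]] := eqVneq (dramp m s r) 0; first by rewrite !mulr0.
rewrite ler_wpM2r //; apply: Hd; rewrite /ball /= distrC ger0_norm ?subr_ge0 ?(ltW h1) //.
by rewrite ltrBlDl (lt_trans h2) // ltrD2l.
Unshelve. all: by end_near. Qed.

(** The cutoff is the ramp at s minus the ramp at t, which converges pointwise to the indicator of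
    ]s, t]. Its derivative picks out c(s) - c(t) by continuity of c, and the term with f converges
    by domination. *)
Lemma du_bois_reymond_open (s t : R) : 0 < s -> s < t -> t < T ->
  c t - c s = \int[muT T]_r (\1_`]s, t] r * f r).
Proof.
move=> s0 st tT; have t0 := lt_trans s0 st.
pose eta m r := ramp m s r - ramp m t r.
have seta m : smooth (eta m).
  by apply: smoothD => //; exact: smoothN.
have deta m r : 'D_1 (eta m) r = dramp m s r - dramp m t r.
  have := is_deriveB (is_derive_ramp m s r) (is_derive_ramp m t r).
  by move=> [_].
have eta1 m r : `|eta m r| <= 1.
  have := step_ge0 (m.+1%:R * (r - s)); have := step_le1 (m.+1%:R * (r - s)).
  have := step_ge0 (m.+1%:R * (r - t)); have := step_le1 (m.+1%:R * (r - t)).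
  by rewrite /eta /ramp ler_norml => h1 h2 h3 h4; apply/andP; split; lra.
have meta m : measurable_fun [set: measurableTypeR R] (eta m).
  by apply: continuous_measurable; exact: smooth_continuous.
have ief m : integ (muT T) (fun r => eta m r * f r).
  exact: (integ_mul_bounded (meta m) (eta1 m) fi).
have [i1 L1] : integ (muT T) (fun r => \1_`]s, t] r * f r) /\
    \int[muT T]_r (eta m r * f r) @[m --> \oo] --> \int[muT T]_r (\1_`]s, t] r * f r).
  have mf := integ_meas fi.
  apply: (Rint_dct _ _ _ (integ_abs fi)).
  - by move=> m; exact: integ_meas (ief m).
  - by apply: measurable_funM => //; exact: measurable_indic.
  - apply: nearW => r; apply: cvgMl; rewrite indicE mem_setE in_itv /=.
    have big a : a < r -> \forall m \near \oo, ramp m a r = 1.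
      move=> ar; have ra : 0 < r - a by rewrite subr_gt0.
      near=> m; rewrite /ramp step_ge1 // mulrC -ler_pdivrMr // mul1r; apply: ltW.
      by near: m; exact: (near_infty_natSinv_lt (PosNum ra)).
    have small a m : r <= a -> ramp m a r = 0.
      by move=> ra; rewrite /ramp step_le0 // mulr_ge0_le0 // subr_le0.
    have [rs|sr] := leP r s.
      apply: cvg_near_cst; apply: nearW => m.
      by rewrite /eta !small ?subrr // (le_trans rs) // ltW.
    have [rt|tr] := leP r t; apply: cvg_near_cst; near=> m; rewrite /eta.
      rewrite (small _ _ rt) subr0; near: m; exact: big.
    have -> : ramp m s r = 1 by near: m; exact: big.
    have -> : ramp m t r = 1 by near: m; exact: big.
    by rewrite subrr.
  - by apply: nearW => r m; rewrite normrM -[leRHS]mul1r ler_wpM2r.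
have Tt0 : 0 < T - t by rewrite subr_gt0.
have L2 : \int[muT T]_r (eta m r * f r) @[m --> \oo] --> c t - c s.
  have : \int[muT T]_r (dramp m t r * c r) - \int[muT T]_r (dramp m s r * c r)
      @[m --> \oo] --> c t - c s.
    by apply: cvgB; apply: bump_average => //; exact: lt_trans st tT.
  apply: cvg_trans; apply: near_eq_cvg; near=> m.
  have mT : m.+1%:R^-1 < T - t.
    by near: m; exact: (near_infty_natSinv_lt (PosNum Tt0)).
  have := weak (seta m) s0 (_ : t + m.+1%:R^-1 < T).
  rewrite addrC -ltrBrDr => /(_ mT) W.
  have /W : forall r, ~~ (s <= r <= m.+1%:R^-1 + t) -> eta m r = 0.
    move=> r; rewrite negb_and -!ltNge => /orP[rs|tr]; rewrite /eta /ramp.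
      rewrite !step_le0 ?subrr // mulr_ge0_le0 // subr_le0 ?(ltW rs) //.
      by rewrite (le_trans (ltW rs)) // ltW.
    have mr : m.+1%:R^-1 < r - t by rewrite ltrBrDr.
    rewrite !step_ge1 ?subrr // mulrC -ler_pdivrMr // mul1r ltW //.
    by rewrite (lt_trans mr) // ltrD2l ltrN2.
  have E r : 'D_1 (eta m) r * c r + eta m r * f r =
      dramp m s r * c r - dramp m t r * c r + eta m r * f r by rewrite deta mulrBl.
  under eq_Rintegral do rewrite E.
  rewrite RintD //; last exact: integB.
  rewrite RintB // => /eqP; rewrite addrC addr_eq0 opprB => /eqP ->.
  by [].
exact: (cvg_unique _ L2 L1).
Unshelve. all: by end_near. Qed.

(** Cutoffs are supported inside ]0, T[, so the endpoints 0 and T are reached as limits. The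
    interval is shrunk at both ends by (t - s)/(n+3), less than half its length, and c is
    continuous. *)
Lemma du_bois_reymond (s t : R) : 0 <= s -> s <= t -> t <= T ->
  c t - c s = \int[muT T]_r (\1_`]s, t] r * f r).
Proof.
move=> s0; rewrite le_eqVlt => /predU1P[<- _|st tT].
  rewrite subrr; transitivity (\int[muT T]_r (0 : R)); first by rewrite Rint0.
  apply: eq_Rint => r; rewrite indicE mem_setE in_itv /=.
  by case: ltP => h; rewrite ?mul0r // leNgt h mul0r.
have mf := integ_meas fi.
pose h n := (t - s) / n.+3%:R.
have ts : 0 < t - s by rewrite subr_gt0.
have h0 n : 0 < h n by rewrite divr_gt0 // ltr0n.
have h2 n : 2 * h n < t - s.
  rewrite /h mulrA ltr_pdivrMr ?ltr0n // mulrC ltr_pM2l //.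
  by rewrite ltr_nat.
have hc : h n @[n --> \oo] --> 0.
  rewrite -(mulr0 (t - s)); apply: cvgMr.
  have := @cvg_harmonic R; rewrite -(cvg_shiftn 2).
  by apply: cvg_trans; apply: near_eq_cvg; apply: nearW => n; rewrite /= addn2.
have E n : c (t - h n) - c (s + h n) = \int[muT T]_r (\1_`]s + h n, t - h n] r * f r).
  by apply: du_bois_reymond_open; have := h2 n; have := h0 n; lra.
have L1 : c (t - h n) - c (s + h n) @[n --> \oo] --> c t - c s.
  apply: cvgB; apply: continuous_cvg; try exact: cc.
    by rewrite -[X in _ --> X]subr0; apply: cvgB => //; exact: cvg_cst.
  by rewrite -[X in _ --> X]addr0; apply: cvgD => //; exact: cvg_cst.
have mi a b : measurable_fun [set: measurableTypeR R] (fun r : R => \1_`]a, b] r * f r).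
  by apply: measurable_funM => //; exact: measurable_indic.
have [_ L2] : integ (muT T) (fun r => \1_`]s, t] r * f r) /\
    \int[muT T]_r (\1_`]s + h n, t - h n] r * f r) @[n --> \oo] -->
    \int[muT T]_r (\1_`]s, t] r * f r).
  apply: (Rint_dct _ _ _ (integ_abs fi)) => //.
  - apply: filterS (muT_ae_neq T t) => r rt; apply: cvgMl.
    apply: cvg_near_cst; rewrite !indicE !mem_setE !in_itv /=.
    have [rs|sr] := leP r s.
      by apply: nearW => n; rewrite indicE mem_setE in_itv /= ltNge (le_trans rs) // lerDl ltW.
    have [rt'|tr] := leP r t; last first.
      apply: nearW => n; rewrite indicE mem_setE in_itv /= andbC leNgt (lt_le_trans _ (ltW tr)) //.
      by rewrite gtrDl oppr_lt0.
    have rt2 : 0 < t - r by rewrite subr_gt0 lt_neqAle rt.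
    have sr2 : 0 < r - s by rewrite subr_gt0.
    near=> n; rewrite indicE mem_setE in_itv /=.
    have H1 : h n < t - r by near: n; exact: cvgr_lt hc _ rt2.
    have H2 : h n < r - s by near: n; exact: cvgr_lt hc _ sr2.
    by rewrite (_ : (_ < _ <= _) = true) //; apply/andP; split; lra.
  - apply: nearW => r n; rewrite normrM -[leRHS]mul1r ler_wpM2r // indicE.
    by case: (_ \in _); rewrite ?normr1 ?normr0 ?ler01.
exact: (cvg_unique _ L1 (eq_cvgn E L2)).
Unshelve. all: by end_near. Qed.

End DuBoisReymond.

Section JointMeasurability.
Context {R : realType}.
Notation mu3 := (@mu3 R).

Lemma measurable_curry_comp d1 d2 d3 (X : measurableType d1) (Y : measurableType d2)
    (Z : measurableType d3) (h : X -> Y -> R) (p : Z -> X) (q : Z -> Y) :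
  measurable_fun [set: X * Y] (fun z => h z.1 z.2) ->
  measurable_fun setT p -> measurable_fun setT q ->
  measurable_fun setT (fun z => h (p z) (q z)).
Proof.
move=> mh mp mq.
exact: (measurableT_comp (f := fun z : X * Y => h z.1 z.2) (g := fun z => (p z, q z)) mh
  (measurable_fun_pair mp mq)).
Qed.

Lemma measurable_conv_time d (X : measurableType d) (b : point3 R -> R) (h : X -> point3 R -> R) :
  torus_test b ->
  measurable_fun [set: X * mpoint3 R] (fun z => h z.1 z.2) ->
  measurable_fun [set: X * mpoint3 R] (fun z => conv b (h z.1) z.2).
Proof.
move=> tb mh; apply: (@measurable_Rint _ _ (X * mpoint3 R)%type (mpoint3 R) R mu3
  (fun z : (X * mpoint3 R) * mpoint3 R => b ((z.1.2 : point3 R) - z.2) * h z.1.1 z.2)).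
apply: measurable_funM.
  apply: (measurableT_comp (test_measurable tb)); apply: measurable_sub3 => //.
  exact: (measurableT_comp measurable_snd measurable_fst).
apply: (measurable_curry_comp mh) => //.
exact: (measurableT_comp measurable_fst measurable_fst).
Qed.

Lemma measurable_Rint3 d (X : measurableType d) (h : X -> point3 R -> R) :
  measurable_fun [set: X * mpoint3 R] (fun z => h z.1 z.2) ->
  measurable_fun [set: X] (fun r => \int[mu3]_x h r x).
Proof. by move=> mh; exact: (@measurable_Rint _ _ X (mpoint3 R) R mu3 (fun z => h z.1 z.2)). Qed.

Lemma test_wpart i (f : point3 R -> R) : torus_test f -> wpart i f ('D_(basis3 i) f).
Proof.
move=> tf; have td := test_derive (basis3 i) tf; split; try exact: test_integ.
move=> psi tp; have tdp := test_derive (basis3 i) tp.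
have := Rint_derive_test (basis3 i) (testM tf tp).
rewrite (_ : \int[mu3]_x _ =
  \int[mu3]_x (f x * 'D_(basis3 i) psi x) + \int[mu3]_x ('D_(basis3 i) f x * psi x)).
  by move=> /eqP; rewrite addr_eq0 => /eqP.
rewrite -RintD; [|exact/test_integ/testM|exact/test_integ/testM].
apply: eq_Rint => x.
rewrite (deriveM (smooth_derivable x _ tf.1) (smooth_derivable x _ tp.1)) /GRing.scale /=.
by rewrite (mulrC (psi x)).
Qed.

Lemma check3K (b : point3 R -> R) : check3 (check3 b) = b.
Proof. by apply/funext => x; rewrite /check3 opprK. Qed.

Lemma sqint_cvg d (X : measurableType d) (m : {measure set X -> \bar R})
    (F : nat -> X -> R) (f : X -> R) : (forall n, sqint m (F n)) -> sqint m f ->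
  \int[m]_x (F n x - f x) ^+ 2 @[n --> \oo] --> 0 ->
  \int[m]_x F n x ^+ 2 @[n --> \oo] --> \int[m]_x f x ^+ 2.
Proof.
move=> sF sf L0; have [_ f2] := sf.
have sD n : sqint m (fun x => F n x - f x) by exact: sqintB.
pose e n := \int[m]_x (F n x - f x) ^+ 2.
pose c n := \int[m]_x (f x * (F n x - f x)).
have e0 n : 0 <= e n by apply: Rint_ge0 => x; exact: sqr_ge0.
have ce n : `|c n| <= Num.sqrt (\int[m]_x f x ^+ 2 * e n).
  by rewrite -sqrtr_sqr ler_wsqrtr //; exact: Rint_CS.
have c0 : c n @[n --> \oo] --> 0.
  apply/norm_cvg0P; apply: (@squeeze_cvgr _ _ _ _ (fun=> 0) (fun n => Num.sqrt (\int[m]_x f x ^+ 2 * e n))).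
  - by apply: nearW => n; rewrite normr_ge0 ce.
  - exact: cvg_cst.
  - have -> : 0 = Num.sqrt (\int[m]_x f x ^+ 2 * 0) by rewrite mulr0 sqrtr0.
    by apply: continuous_cvg; [exact: sqrt_continuous|exact: cvgMr].
have E n : \int[m]_x F n x ^+ 2 = \int[m]_x f x ^+ 2 + 2 * c n + e n.
  have i1 := sqintM sf (sD n); have [_ i2] := sD n.
  rewrite -RintZ // -RintD //; last exact: integZ.
  rewrite -RintD //; last by apply: integD => //; exact: integZ.
  by apply: eq_Rint => x; ring.
apply: (eq_cvgn E); rewrite -[X in _ --> X]addr0; apply: cvgD => //.
rewrite -[X in _ --> X]addr0; apply: cvgD; first exact: cvg_cst.
by rewrite -[X in _ --> X](mulr0 2); exact: cvgMr.
Qed.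

End JointMeasurability.

(** * Increments along the diagonal *)

Section RiemannDiagonal.
Context {R : realType}.
Variables (T : R) (g F : R -> R -> R) (G Fd : R -> R).
Hypotheses (gC : forall t s, g t s = g s t)
  (Fi : forall s, integ (muT T) (F^~ s))
  (g_incr : forall s a b, 0 <= a -> a <= b -> b <= T ->
    g b s - g a s = \int[muT T]_r (\1_`]a, b] r * F r s))
  (Gi : integ (muT T) G) (mFd : measurable_fun [set: measurableTypeR R] Fd)
  (good : {ae muT T, forall r, [/\ continuous (F r), forall s, `|F r s| <= G r & F r r = Fd r]}).

Let ind_integ (a b : R) (f : R -> R) : integ (muT T) f -> integ (muT T) (fun r => \1_`]a, b] r * f r).
Proof.
apply: (@integ_mul_bounded _ _ _ _ _ _ 1); first exact: measurable_indic.
by move=> r; rewrite indicE; case: (_ \in _); rewrite ?normr1 ?normr0 ?ler01.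
Qed.

(* Splitting [g b b - g a a] through the mixed value [g a b = g b a]. *)
Let diag_incr a b : 0 <= a -> a <= b -> b <= T ->
  g b b - g a a = \int[muT T]_r (\1_`]a, b] r * (F r b + F r a)).
Proof.
move=> a0 ab bT.
have -> : g b b - g a a = (g b b - g a b) + (g b a - g a a) by rewrite (gC a b); ring.
rewrite !g_incr // -RintD; [|exact: ind_integ (Fi b)|exact: ind_integ (Fi a)].
by apply: eq_Rint => r; rewrite mulrDr.
Qed.

Let tk (t : R) N k := t * (k%:R / N.+1%:R).

Let tkS t N k : tk t N k.+1 = tk t N k + t / N.+1%:R.
Proof. by rewrite /tk -natr1; ring. Qed.

Let tkN t N : tk t N N.+1 = t.
Proof. by rewrite /tk divff ?mulr1 // pnatr_eq0. Qed.

Let tk0 t N : tk t N 0 = 0.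
Proof. by rewrite /tk mul0r mulr0. Qed.

Let tk_ge0 t N k : 0 <= t -> 0 <= tk t N k.
Proof. by move=> t0; rewrite /tk mulr_ge0 // divr_ge0. Qed.

Let tk_le t N k : 0 <= t -> (k <= N.+1)%N -> tk t N k <= t.
Proof.
by move=> t0 kN; rewrite /tk ler_piMr // ler_pdivrMr ?ltr0n // mul1r ler_nat.
Qed.

Let fN t N r := \sum_(0 <= k < N.+1)
  \1_`]tk t N k, tk t N k.+1] r * (F r (tk t N k.+1) + F r (tk t N k)).

Let fN_integ t N : integ (muT T) (fN t N).
Proof. by apply: integ_sum => k; apply/ind_integ/integD; exact: Fi. Qed.

Let telescope t N : 0 <= t -> t <= T -> g t t - g 0 0 = \int[muT T]_r fN t N r.
Proof.
move=> t0 tT; rewrite Rint_sum => [|k]; last by apply/ind_integ/integD; exact: Fi.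
rewrite -[in LHS](tkN t N) -[in LHS](tk0 t N) -(telescope_sumr (fun k => g (tk t N k) (tk t N k))) //.
apply: eq_big_nat => k /andP[_ kN]; apply: diag_incr; first exact: tk_ge0.
  by rewrite tkS lerDl divr_ge0.
by rewrite (le_trans _ tT) // tk_le.
Qed.

Let sum_ind t N r : 0 <= t ->
  \sum_(0 <= k < N.+1) \1_`]tk t N k, tk t N k.+1] r = \1_`]0, t] r :> R.
Proof.
move=> t0; have S m : \sum_(0 <= k < m) \1_`]tk t N k, tk t N k.+1] r = \1_`]0, tk t N m] r :> R.
  elim: m => [|m IH].
    rewrite big_geq // tk0 indicE mem_setE in_itv /=.
    by case: ltP => // h; rewrite leNgt h.
  rewrite big_nat_recr //= IH !indicE !mem_setE !in_itv /= -natrD.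
  have m0 := @tk_ge0 t N m t0.
  have mS : tk t N m <= tk t N m.+1 by rewrite tkS lerDl divr_ge0.
  have [r1|r1] := leP r (tk t N m).
    by rewrite (le_trans r1 mS) andbT addn0.
  by rewrite andbF add0n (le_lt_trans m0 r1).
by rewrite S tkN.
Qed.

Let ind01 (a b r : R) : 0 <= (\1_`]a, b]%classic r : R) <= 1.
Proof. by rewrite indicE; case: (_ \in _); rewrite ?lexx ler01. Qed.

Let fN_cvg t r : 0 <= t -> continuous (F r) ->
  fN t N r @[N --> \oo] --> \1_`]0, t] r * (2 * F r r).
Proof.
move=> t0 cF; apply/cvgrPdist_le => /= e e0.
have /cvgrPdist_le cr : F r s @[s --> r] --> F r r by exact: cF.
have e2 : 0 < e / 2 by rewrite divr_gt0.
have /nbhs_ballP[d /= d0 Hd] := cr _ e2.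
have t1 : 0 < t + 1 by rewrite ltr_wpDl.
near=> N.
have small : t / N.+1%:R < d.
  rewrite (le_lt_trans (_ : _ <= (t + 1) / N.+1%:R)) ?ler_wpM2r ?lerDl //.
  rewrite mulrC -ltr_pdivlMr //.
  by near: N; exact: (near_infty_natSinv_lt (PosNum (divr_gt0 d0 t1))).
rewrite -(sum_ind N r t0) mulr_suml -sumrB.
apply: le_trans (ler_norm_sum _ _ _) _.
apply: (@le_trans _ _ (\sum_(0 <= k < N.+1) \1_`]tk t N k, tk t N k.+1] r * e)).
  apply: ler_sum_nat => k _; rewrite -mulrBr normrM.
  have /andP[i0 _] := ind01 (tk t N k) (tk t N k.+1) r.
  rewrite (ger0_norm i0); move: i0; rewrite indicE mem_setE in_itv /=.
  have [/andP[h1 h2] _|_ _] := boolP (_ < _ <= _); last by rewrite !mul0r.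
  rewrite ler_wpM2l //.
  have H1 : `|F r r - F r (tk t N k.+1)| <= e / 2.
    apply: Hd; rewrite /ball /= distrC ger0_norm ?subr_ge0 // ltrBlDl.
    by rewrite (le_lt_trans (_ : _ <= tk t N k + t / N.+1%:R)) ?tkS // ltrD.
  have H2 : `|F r r - F r (tk t N k)| <= e / 2.
    apply: Hd; rewrite /ball /= ger0_norm ?subr_ge0 ?(ltW h1) // ltrBlDl.
    by rewrite (le_lt_trans h2) // tkS ltrD2l.
  have -> : 2 * F r r - (F r (tk t N k.+1) + F r (tk t N k)) =
    (F r r - F r (tk t N k.+1)) + (F r r - F r (tk t N k)) by ring.
  apply: le_trans (ler_normD _ _) _; apply: le_trans (lerD H1 H2) _.
  by rewrite -splitr.
by rewrite -mulr_suml sum_ind // ler_piMl ?(ltW e0) //; case/andP: (ind01 0 t r).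
Unshelve. all: by end_near. Qed.

(** Formally the derivative of g(t, t) is 2 F(t, t), but increments are known in one variable only,
    with the other frozen. In the sum over N + 1 equal pieces of [0, t], a time r meets F r at the
    two nodes around it, and continuity of F r gives the limit. [Fd] is a measurable function equal
    to the diagonal almost everywhere. *)
Lemma riemann_diagonal t : 0 <= t -> t <= T ->
  integ (muT T) (fun r => \1_`]0, t] r * (2 * Fd r)) /\
  g t t - g 0 0 = \int[muT T]_r (\1_`]0, t] r * (2 * Fd r)).
Proof.
move=> t0 tT.
have [i L] : integ (muT T) (fun r => \1_`]0, t] r * (2 * Fd r)) /\
    \int[muT T]_r fN t N r @[N --> \oo] --> \int[muT T]_r (\1_`]0, t] r * (2 * Fd r)).
  apply: (Rint_dct _ _ _ (integZ 2 Gi)).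
  - by move=> N; exact: integ_meas (fN_integ t N).
  - by apply: measurable_funM; [exact: measurable_indic|exact: measurable_funM].
  - by apply: filterS good => r [cF _ <-]; exact: fN_cvg.
  - apply: filterS good => r [_ FG _] N.
    have G0 : 0 <= G r by exact: le_trans (FG 0).
    apply: le_trans (ler_norm_sum _ _ _) _.
    apply: (@le_trans _ _ (\sum_(0 <= k < N.+1) \1_`]tk t N k, tk t N k.+1] r * (2 * G r))).
      apply: ler_sum_nat => k _; have /andP[i0 _] := ind01 (tk t N k) (tk t N k.+1) r.
      rewrite normrM (ger0_norm i0) ler_wpM2l // mulr_natl mulr2n.
      by apply: le_trans (ler_normD _ _) _; exact: lerD.
    by rewrite -mulr_suml sum_ind // ler_piMl ?mulr_ge0 //; case/andP: (ind01 0 t r).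
split=> //.
apply: (cvg_unique _ _ L) => //.
by apply: (@eq_cvgn _ (fun=> g t t - g 0 0)); [move=> N; rewrite -telescope|exact: cvg_cst].
Qed.

End RiemannDiagonal.

(** * Energy balance at scale n and its limit *)

Section MollifiedEnergy.
Context {R : realType}.
Notation mu3 := (@mu3 R).
Variables (T : R) (u : R -> 'I_3 -> point3 R -> R) (A : R -> 'I_3 -> 'I_2 -> point3 R -> R) (M : R).
Notation P := (muT T \x mu3)%E.
Hypotheses (T0 : 0 < T)
  (pu : forall t i, periodic3 (u t i)) (su : forall t i, sqint mu3 (u t i))
  (uM : forall t i, \int[mu3]_x u t i x ^+ 2 <= M)
  (wu : forall t, wdiv (u t))
  (uc : forall i g, periodic3 g -> sqint mu3 g ->
    continuous (fun t : R => \int[mu3]_x (u t i x * g x)))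
  (mu : forall i, measurable_fun [set: measurableTypeR R * mpoint3 R] (fun z => u z.1 i z.2))
  (pA : forall t i j, periodic3 (A t i j))
  (sA : forall i j, sqint P (fun z => A z.1 i j z.2))
  (wA : {ae muT T, forall t, forall i j, wpart (hindex j) (u t i) (A t i j)}).

Definition transport (w : 'I_3 -> point3 R -> R) r x :=
  \sum_i \sum_j 'D_(basis3 j) (w i) x * (u r i x * u r j x) -
  \sum_i \sum_j 'D_(basis3 (hindex j)) (w i) x * A r i j x.

Hypothesis weak : forall (w : 'I_3 -> point3 R -> R) (eta : R -> R) a b,
  (forall i, torus_test (w i)) -> (forall x, \sum_i 'D_(basis3 i) (w i) x = 0) ->
  smooth eta -> 0 < a -> b < T -> (forall r, ~~ (a <= r <= b) -> eta r = 0) ->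
  \int[muT T]_r ('D_1 eta r * (\int[mu3]_x \sum_i w i x * u r i x) +
    eta r * \int[mu3]_x transport w r x) = 0.

Let ui t i : integ mu3 (u t i). Proof. by have [] := wu t. Qed.

Let M0 : 0 <= M.
Proof. by apply: le_trans (uM 0 ord0); apply: Rint_ge0 => x; exact: sqr_ge0. Qed.

Lemma sqint_uP i : sqint P (fun z => u z.1 i z.2).
Proof.
split; first exact: mu.
have mu2 : measurable_fun [set: measurableTypeR R * mpoint3 R] (fun z => u z.1 i z.2 ^+ 2).
  exact: measurable_funX.
apply: (@integ_prod _ _ (measurableTypeR R) (mpoint3 R) R (muT T) mu3 _
  (fun t x => u t i x ^+ 2)) => //.
- by move=> t x; rewrite ger0_norm ?sqr_ge0.
- by move=> t; have [] := su t i.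
- apply: (@integ_bounded _ _ _ _ _ M); first exact: (measurable_Rint3 mu2).
  by move=> t; rewrite ger0_norm ?uM // Rint_ge0 // => x; exact: sqr_ge0.
Qed.

Lemma ae_sqint_A : {ae muT T, forall t, forall i j, sqint mu3 (A t i j)}.
Proof.
have H i j : {ae muT T, forall t, sqint mu3 (A t i j)}.
  have [mA iA] := sA i j.
  have : {ae muT T, forall t, integ mu3 (fun x => A t i j x ^+ 2)} by exact: (ae_integrable1 iA).
  apply: filterS => t; split=> //.
  exact: (measurable_curry_comp (h := fun t x => A t i j x) mA).
have G i : {ae muT T, forall t, forall j, sqint mu3 (A t i j)} by exact: filter_forall.
exact: filter_forall.
Qed.

Let Ai2 i j : integ (muT T) (fun r => \int[mu3]_x A r i j x ^+ 2).
Proof. by have [_ /integ_Rint] := sA i j. Qed.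

Lemma sqint_integP (f : measurableTypeR R * mpoint3 R -> R) : sqint P f -> integ P f.
Proof.
move=> [mf fi]; have i1 : integ P (fun=> 1).
  apply: (@integ_prod _ _ (measurableTypeR R) (mpoint3 R) R (muT T) mu3 _ (fun t x => 1)) => //.
  - by move=> t x; rewrite normr1.
  - by move=> t; exact: integ_cst.
  - by under eq_fun do rewrite Rint_cst; exact: integ_cst.
apply: (integ_le mf (integD i1 fi)) => z; rewrite -[f z ^+ 2]real_normK ?num_real //.
by have := normr_ge0 (f z); nra.
Qed.

Section Test.
Variable w : 'I_3 -> point3 R -> R.
Hypotheses (tw : forall i, torus_test (w i)) (dw : forall x, \sum_i 'D_(basis3 i) (w i) x = 0).

Let mtest (psi : point3 R -> R) : torus_test psi ->
  measurable_fun [set: measurableTypeR R * mpoint3 R] (fun z => psi z.2).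
Proof. by move=> tp; exact: (measurableT_comp (test_measurable tp)). Qed.

Lemma integ_transport : integ P (fun z => transport w z.1 z.2).
Proof.
have tD i j := test_derive (basis3 j) (tw i).
apply: integB; apply: integ_sum => i; apply: integ_sum => j.
  have [B _ bB] := test_bounded (tD i j).
  exact: (integ_mul_bounded (mtest (tD i j)) (fun z => bB z.2) (sqintM (sqint_uP i) (sqint_uP j))).
have [B _ bB] := test_bounded (tD i (hindex j)).
exact: (integ_mul_bounded (mtest (tD i (hindex j))) (fun z => bB z.2) (sqint_integP (sA i j))).
Qed.

(** The pairing with w is continuous in time by [uc], so the distributional identity [weak]
    integrates to one that holds for all s and t, the endpoints 0 and T included. *)
Lemma weak_increment s t : 0 <= s -> s <= t -> t <= T ->
  \int[mu3]_x (\sum_i w i x * u t i x) - \int[mu3]_x (\sum_i w i x * u s i x) =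
  \int[muT T]_r (\1_`]s, t] r * \int[mu3]_x transport w r x).
Proof.
have cw : continuous (fun t : R => \int[mu3]_x (\sum_i w i x * u t i x)).
  have E r : \int[mu3]_x (\sum_i w i x * u r i x) = \sum_i \int[mu3]_x (u r i x * w i x).
    rewrite -Rint_sum => [|i]; last exact: sqintM (su r i) (test_sqint (tw i)).
    by apply: eq_Rint => x; apply: eq_bigr => i _; rewrite mulrC.
  rewrite (funext E) => r; apply: cvg_big => [|i _]; first exact: add_continuous.
  by apply: uc; [exact: (tw i).2|exact: test_sqint].
move=> s0 st tT.
by apply: (du_bois_reymond T0 cw (integ_Rint integ_transport)) => // eta a b; exact: weak.
Qed.

End Test.
Lemma conv_bound (b f : point3 R -> R) B x : torus_test b -> integ mu3 f -> (forall y, `|b y| <= B) ->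
  `|conv b f x| <= B * \int[mu3]_y `|f y|.
Proof.
move=> tb fi bB; have ic := conv_integ x tb fi.
apply: le_trans (Rint_abs ic) _; rewrite -RintZ; last exact: integ_abs.
apply: Rint_le; [exact: integ_abs|exact/integZ/integ_abs|].
by move=> y; rewrite normrM ler_wpM2r.
Qed.

Section Mollify.
Variable n : nat.
Let K := @kern R n.
Let kt : torus_test K := kern_test n.
Let ckt : torus_test (check3 K) := check3_test kt.
Let U t i := conv K (u t i).
Let w s i := conv (check3 K) (U s i).
Let tU t i : torus_test (U t i). Proof. exact: conv_test. Qed.
Let tw s i : torus_test (w s i). Proof. by apply: conv_test => //; exact: test_integ. Qed.

Let dw s x : \sum_i 'D_(basis3 i) (w s i) x = 0.
Proof. exact: div_conv ckt (wdiv_conv kt (wu s)). Qed.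

Let g t s := \sum_i \int[mu3]_x (U t i x * U s i x).
Let F r s := \int[mu3]_x transport (w s) r x.

Let gC t s : g t s = g s t.
Proof. by apply: eq_bigr => i _; apply: eq_Rint => x; rewrite mulrC. Qed.

(** Adjointness moves the reflected kernel from the test field onto u(t). What remains is an inner
    product of two mollified fields, symmetric in t and s. *)
Let gE t s : \int[mu3]_x (\sum_i w s i x * u t i x) = g t s.
Proof.
rewrite Rint_sum => [|i]; last exact: sqintM (test_sqint (tw s i)) (su t i).
apply: eq_bigr => i _; rewrite (conv_adjoint ckt (test_integ (tU s i)) (ui t i)).
by rewrite check3K; apply: eq_Rint => x; rewrite mulrC.
Qed.

Let Fi s : integ (muT T) (F^~ s).
Proof. exact: integ_Rint (integ_transport (tw s)). Qed.

Let g_incr s a b : 0 <= a -> a <= b -> b <= T ->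
  g b s - g a s = \int[muT T]_r (\1_`]a, b] r * F r s).
Proof. by move=> a0 ab bT; rewrite -(weak_increment (tw s) (dw s) a0 ab bT) !gE. Qed.

(** The bound must be uniform in s, for the domination in [riemann_diagonal]. It follows from the
    uniform bound M, since |u| <= 1 + u^2 gives an L^1 norm of at most 1 + M. *)
Let Bw : exists2 B, 0 <= B & forall s i j x, `|'D_(basis3 j) (w s i) x| <= B.
Proof.
have [BK BK0 KB] := test_bounded kt.
have /choice[BD HD] : forall j : 'I_3, exists B, forall x, `|'D_(basis3 j) (check3 K) x| <= B.
  by move=> j; have [B _ HB] := test_bounded (test_derive (basis3 j) ckt); exists B.
have BD0 j : 0 <= BD j by exact: le_trans (HD j 0).
exists ((\sum_j BD j) * (BK * (1 + M))) => [|s i j x].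
  by rewrite mulr_ge0 ?sumr_ge0 // mulr_ge0 // addr_ge0.
have iU := test_integ (tU s i).
rewrite (derive_conv (basis3 j) x ckt iU).
apply: le_trans (conv_bound x (test_derive _ ckt) iU (HD j)) _.
apply: ler_pM => //; first by apply: Rint_ge0 => y; exact: normr_ge0.
  exact: ler_term.
rewrite -[leRHS](Rint_cst mu3); apply: Rint_le; [exact: integ_abs|exact: integ_cst|].
move=> y; apply: le_trans (conv_bound y kt (ui s i) KB) _; rewrite ler_wpM2l //.
have [_ u2] := su s i.
apply: (@le_trans _ _ (\int[mu3]_x (1 + u s i x ^+ 2))).
  apply: Rint_le; [exact: integ_abs|by apply: integD => //; exact: integ_cst|].
  move=> z; rewrite -[u s i z ^+ 2]real_normK ?num_real //.
  by have := normr_ge0 (u s i z); nra.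
by rewrite RintD ?Rint_cst ?lerD2l //; exact: integ_cst.
Qed.

Let good r := forall i j, sqint mu3 (A r i j) /\ wpart (hindex j) (u r i) (A r i j).

Let ae_good : {ae muT T, forall r, good r}.
Proof. by move: wA; apply: filterS2 ae_sqint_A => r sAr wAr i j. Qed.

Let H B r x := B * (\sum_i \sum_j `|u r i x * u r j x| + \sum_i \sum_j `|A r i j x|).

Let transport_le B s r x : 0 <= B -> (forall s i j x, `|'D_(basis3 j) (w s i) x| <= B) ->
  `|transport (w s) r x| <= H B r x.
Proof.
move=> B0 HB; rewrite /H mulrDr !mulr_sumr; apply: le_trans (ler_normB _ _) _.
apply: lerD; apply: le_trans (ler_norm_sum _ _ _) _; apply: ler_sum => i _;
  rewrite mulr_sumr; apply: le_trans (ler_norm_sum _ _ _) _; apply: ler_sum => j _;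
  by rewrite normrM ler_wpM2r.
Qed.

Let HP B : integ P (fun z => H B z.1 z.2).
Proof.
apply/integZ/integD; apply: integ_sum => i; apply: integ_sum => j; apply: integ_abs.
  exact: sqintM (sqint_uP i) (sqint_uP j).
exact: sqint_integP (sA i j).
Qed.

Let sq_integ (f : point3 R -> R) : sqint mu3 f -> integ mu3 f.
(* The constant 1 is square integrable as the test function K * 1, so f = f * 1 is a product of two
   square-integrable functions. *)
Proof. by move=> sf; apply: eq_integ (sqintM sf (test_sqint (conv_test kt (integ_cst mu3 1)))) => x;
  rewrite /K conv_cst1 mulr1. Qed.

Let Hr B r : good r -> integ mu3 (H B r).
Proof.
move=> gr; apply/integZ/integD; apply: integ_sum => i; apply: integ_sum => j; apply: integ_abs.
  exact: sqintM (su r i) (su r j).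
by apply: sq_integ; have [] := gr i j.
Qed.

Let transport_meas s r : good r -> measurable_fun [set: mpoint3 R] (transport (w s) r).
Proof.
move=> gr; apply: measurable_funB; apply: measurable_sum => i; apply: measurable_sum => j;
  apply: measurable_funM; try exact: test_measurable (test_derive _ (tw s i)).
  by apply: measurable_funM; have [] := su r i; have [] := su r j.
by have [[]] := gr i j.
Qed.

(** At a fixed x this derivative is a pairing of u(s) with a fixed test function, once both kernels
    have been moved off u(s); weak continuity applies to it. *)
Let dw_cont i j x : continuous (fun s => 'D_(basis3 j) (w s i) x).
Proof.
have td := test_derive (basis3 j) ckt; have tr := test_reflect x td.
have E s : 'D_(basis3 j) (w s i) x =
    \int[mu3]_y (u s i y * conv (check3 K) (fun y => 'D_(basis3 j) (check3 K) (x - y)) y).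
  rewrite (derive_conv (basis3 j) x ckt (test_integ (tU s i))).
  rewrite -(conv_adjoint kt (ui s i) (test_integ tr)).
  by apply: eq_Rint => y; rewrite mulrC.
rewrite (funext E); apply: uc; first exact: conv_periodic.
by apply/test_sqint/conv_test => //; exact: test_integ.
Qed.

Let F_cont r : good r -> continuous (F r).
Proof.
move=> gr s; have [B B0 HB] := Bw.
apply/(@cvg_nbhsP _ R^o) => v vs.
have [_] : integ mu3 (transport (w s) r) /\
    \int[mu3]_x transport (w (v k)) r x @[k --> \oo] --> \int[mu3]_x transport (w s) r x.
  apply: (Rint_dct _ _ _ (Hr B gr)).
  - by move=> k; exact: transport_meas.
  - exact: transport_meas.
  - apply: nearW => x.
    have cd i j : 'D_(basis3 j) (w (v k) i) x @[k --> \oo] --> 'D_(basis3 j) (w s i) x.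
      have dwc : 'D_(basis3 j) (w s0 i) x @[s0 --> s] --> 'D_(basis3 j) (w s i) x.
        exact: dw_cont.
      exact: (cvg_comp _ _ vs dwc).
    apply: cvgB; apply: cvgn_sum => i; apply: cvgn_sum => j; apply: cvgMl; exact: cd.
  - by apply: nearW => x k; exact: transport_le.
by [].
Qed.

Let Fd r := flux n (u r) - \sum_i \sum_j \int[mu3]_x conv K (A r i j) x ^+ 2.

(** For s = r the outer kernel of w passes to the other factor. The convective part becomes the
    flux; in the viscous part both factors become K * A, and the dissipation of the mollified field
    appears. *)
Let F_diag r : good r -> F r r = Fd r.
Proof.
move=> gr.
have iA i j := sq_integ (gr i j).1.
have i1 i j := test_mul_integ (test_derive (basis3 j) (tw r i)) (sqintM (su r i) (su r j)).
have i2 i j := test_mul_integ (test_derive (basis3 (hindex j)) (tw r i)) (iA i j).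
have tD i j := test_derive (basis3 j) (tU r i).
have DE i j x := wpart_conv x ckt (test_wpart j (tU r i)).
have s1 i := integ_sum (index_enum _) xpredT (i1 i).
have s2 i := integ_sum (index_enum _) xpredT (i2 i).
rewrite /F (RintB (integ_sum _ _ s1) (integ_sum _ _ s2)) (Rint_sum _ _ s1) (Rint_sum _ _ s2).
congr (_ - _); apply: eq_bigr => i _;
  [rewrite (Rint_sum _ _ (i1 i))|rewrite (Rint_sum _ _ (i2 i))]; apply: eq_bigr => j _.
- under eq_Rintegral do rewrite DE.
  by rewrite (conv_adjoint ckt (test_integ (tD i j)) (sqintM (su r i) (su r j))) check3K.
- under eq_Rintegral do rewrite DE.
  rewrite (conv_adjoint ckt (test_integ (tD i (hindex j))) (iA i j)) check3K.
  by apply: eq_Rint => x; rewrite expr2 (wpart_conv x kt (gr i j).2).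
Qed.

Let meas_Fd : measurable_fun [set: measurableTypeR R] Fd.
Proof.
apply: measurable_funB.
  have E r : flux n (u r) = \sum_i \sum_j \int[mu3]_x
      (conv ('D_(basis3 j) K) (u r i) x * conv K (fun x => u r i x * u r j x) x).
    apply: eq_bigr => i _; apply: eq_bigr => j _; apply: eq_Rint => x.
    by rewrite (derive_conv (basis3 j) x kt (ui r i)).
  rewrite (funext E); apply: measurable_sum => i; apply: measurable_sum => j.
  apply: (measurable_Rint3 (h := fun r x => conv ('D_(basis3 j) K) (u r i) x *
    conv K (fun x => u r i x * u r j x) x)); apply: measurable_funM.
    exact: (measurable_conv_time (h := fun r => u r i) (test_derive (basis3 j) kt) (mu i)).
  apply: (measurable_conv_time (h := fun r x => u r i x * u r j x) kt).
  exact: measurable_funM (mu i) (mu j).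
apply: measurable_sum => i; apply: measurable_sum => j.
apply: (measurable_Rint3 (h := fun r x => conv K (A r i j) x ^+ 2)); apply: measurable_funX.
by apply: (measurable_conv_time (h := fun r => A r i j) kt); have [] := sA i j.
Qed.

Lemma energy_mollified t : 0 <= t -> t <= T ->
  integ (muT T) (fun r => \1_`]0, t] r * (2 * (flux n (u r) -
      \sum_i \sum_j \int[mu3]_x conv (kern n) (A r i j) x ^+ 2))) /\
  \sum_i \int[mu3]_x conv (kern n) (u t i) x ^+ 2 -
  \sum_i \int[mu3]_x conv (kern n) (u 0 i) x ^+ 2 =
  \int[muT T]_r (\1_`]0, t] r * (2 * (flux n (u r) -
      \sum_i \sum_j \int[mu3]_x conv (kern n) (A r i j) x ^+ 2))).
Proof.
move=> t0 tT; have [B B0 HB] := Bw.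
have Gi := integ_Rint (HP B).
have gd : {ae muT T, forall r, [/\ continuous (F r),
    forall s, `|F r s| <= \int[mu3]_x H B r x & F r r = Fd r]}.
  apply: filterS ae_good => r gr; split; [exact: F_cont| |exact: F_diag].
  move=> s; have iT : integ mu3 (transport (w s) r).
    apply: (integ_le (transport_meas s gr) (Hr B gr)) => x; exact: transport_le.
  apply: le_trans (Rint_abs iT) _; apply: Rint_le; [exact: integ_abs|exact: Hr|].
  by move=> x; exact: transport_le.
have [i E] := riemann_diagonal gC Fi g_incr Gi meas_Fd gd t0 tT.
split=> //; rewrite -E; congr (_ - _); apply: eq_bigr => k _; apply: eq_Rint => x; exact: expr2.
Qed.

End Mollify.

Hypotheses (flux0 : {ae muT T, forall r, flux n (u r) @[n --> \oo] --> 0})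
  (G : R -> R) (Gi : integ (muT T) G) (fluxG : {ae muT T, forall r n, `|flux n (u r)| <= G r}).

Let two (a : R) : `|a| `^ 2 = a ^+ 2 := powR2 a.

Let conv_sq (f : point3 R -> R) : periodic3 f -> sqint mu3 f ->
  \int[mu3]_x conv (kern n) f x ^+ 2 @[n --> \oo] --> \int[mu3]_x f x ^+ 2 /\
  forall n, \int[mu3]_x conv (kern n) f x ^+ 2 <= \int[mu3]_x f x ^+ 2.
Proof.
move=> pf sf; have [mf f2] := sf; have le12 : 1 <= 2 :> R by rewrite ler1n.
have fp : integ mu3 (fun x => `|f x| `^ 2) by apply: eq_integ f2 => x; rewrite two.
have fi := integ_pow_integ le12 mf fp; split=> [|n].
  apply: sqint_cvg => // [n|]; first by apply/test_sqint/conv_test => //; exact: kern_test.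
  apply: eq_cvgn (conv_pow_cvg le12 pf mf fp) => n.
  by apply: eq_Rint => x; rewrite two.
have := conv_pow_le le12 pf mf fp n.
under eq_Rintegral do rewrite two.
by under [X in _ <= X -> _]eq_Rintegral do rewrite two.
Qed.

Lemma energy_limit t : 0 <= t -> t <= T ->
  \sum_i \int[mu3]_x u t i x ^+ 2 +
  2 * \int[muT T]_r (\1_`]0, t] r * \sum_i \sum_j \int[mu3]_x A r i j x ^+ 2) =
  \sum_i \int[mu3]_x u 0 i x ^+ 2.
Proof.
move=> t0 tT.
pose Dn n r := \sum_i \sum_j \int[mu3]_x conv (kern n) (A r i j) x ^+ 2.
pose D r := \sum_i \sum_j \int[mu3]_x A r i j x ^+ 2.
have Di : integ (muT T) D by apply: integ_sum => i; apply: integ_sum => j; exact: Ai2.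
have L1 (s : R) : \sum_i \int[mu3]_x conv (kern n) (u s i) x ^+ 2 @[n --> \oo] -->
    \sum_i \int[mu3]_x u s i x ^+ 2.
  by apply: cvgn_sum => i; have [] := conv_sq (pu s i) (su s i).
have LL : \sum_i \int[mu3]_x conv (kern n) (u t i) x ^+ 2 -
    \sum_i \int[mu3]_x conv (kern n) (u 0 i) x ^+ 2 @[n --> \oo] -->
    \sum_i \int[mu3]_x u t i x ^+ 2 - \sum_i \int[mu3]_x u 0 i x ^+ 2.
  by apply: cvgB; exact: L1.
have D0 r : 0 <= D r.
  by apply: sumr_ge0 => i _; apply: sumr_ge0 => j _; apply: Rint_ge0 => x; exact: sqr_ge0.
have i01 r : `|(\1_`]0, t]%classic r : R)| <= 1.
  by rewrite indicE; case: (_ \in _); rewrite ?normr1 ?normr0 ?ler01.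
have [_ LR] : integ (muT T) (fun r => \1_`]0, t] r * (2 * (0 - D r))) /\
    \int[muT T]_r (\1_`]0, t] r * (2 * (flux n (u r) - Dn n r))) @[n --> \oo] -->
    \int[muT T]_r (\1_`]0, t] r * (2 * (0 - D r))).
  apply: (Rint_dct _ _ _ (integZ 2 (integD Gi Di))).
  - by move=> n; have [/integ_meas] := energy_mollified n t0 tT.
  - apply: measurable_funM; first exact: measurable_indic.
    by apply: measurable_funM => //; apply: measurable_funB => //; exact: integ_meas Di.
  - apply: filterS2 flux0 ae_sqint_A => r f0 sAr; apply: cvgMr; apply: cvgMr; apply: cvgB => //.
    by apply: cvgn_sum => i; apply: cvgn_sum => j; have [] := conv_sq (pA r i j) (sAr i j).
  - apply: filterS2 fluxG ae_sqint_A => r fG sAr n.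
    rewrite normrM -[leRHS]mul1r ler_pM // normrM ger0_norm // ler_wpM2l //.
    apply: le_trans (ler_normB _ _) _; apply: lerD => //.
    rewrite ger0_norm; last first.
      by apply: sumr_ge0 => i _; apply: sumr_ge0 => j _; apply: Rint_ge0 => x; exact: sqr_ge0.
    by apply: ler_sum => i _; apply: ler_sum => j _; have [] := conv_sq (pA r i j) (sAr i j).
have E n : \int[muT T]_r (\1_`]0, t] r * (2 * (flux n (u r) - Dn n r))) =
   \sum_i \int[mu3]_x conv (kern n) (u t i) x ^+ 2 -
   \sum_i \int[mu3]_x conv (kern n) (u 0 i) x ^+ 2.
  by have [_ ->] := energy_mollified n t0 tT.
have := cvg_unique _ LL (eq_cvgn (fun n => esym (E n)) LR).
rewrite (_ : \int[muT T]_r _ = - (2 * \int[muT T]_r (\1_`]0, t] r * D r))) => [H|].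
  by apply/eqP; rewrite -subr_eq0 addrAC H // addNr.
have iD : integ (muT T) (fun r => \1_`]0, t] r * D r).
  by apply: (@integ_mul_bounded _ _ _ _ _ _ 1) => //; exact: measurable_indic.
rewrite -mulNr -RintZ //; apply: eq_Rint => r; ring.
Qed.

End MollifiedEnergy.

(** * Slices of a weak solution *)

Section Conversions.
Context {R : realType}.
Notation lam := (@lebesgue_measure R).
Notation mu3 := (@mu3 R).

Section Enorm.
Variables m n : nat.
Implicit Types A : 'M[R]_(m, n).

Lemma enorm_ge0 A : 0 <= enorm A.
Proof. exact: sqrtr_ge0. Qed.

Lemma enorm_sqr A : enorm A ^+ 2 = \sum_i \sum_j A i j ^+ 2.
Proof.
by rewrite sqr_sqrtr // sumr_ge0 // => i _; apply: sumr_ge0 => j _; exact: sqr_ge0.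
Qed.

Lemma enorm_entry A i j : `|A i j| <= enorm A.
Proof.
rewrite -sqrtr_sqr ler_wsqrtr //.
apply: (@le_trans _ _ (\sum_j A i j ^+ 2)).
  by apply: (@ler_term _ _ (fun j => A i j ^+ 2)) => k; exact: sqr_ge0.
by apply: (@ler_term _ _ (fun i => \sum_j A i j ^+ 2)) => k; apply: sumr_ge0 => l _; exact: sqr_ge0.
Qed.

Lemma measurable_enorm d (X : measurableType d) (f : X -> 'M[R]_(m, n)) :
  (forall i j, measurable_fun setT (fun x => f x i j)) ->
  measurable_fun setT (fun x => enorm (f x)).
Proof.
move=> mf; apply: (measurableT_comp (f := @Num.sqrt R)).
  by apply: continuous_measurable_fun; exact: sqrt_continuous.
by apply: measurable_sum => i; apply: measurable_sum => j; exact: measurable_funX.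
Qed.

Lemma Lq_norm_pow q (f : point3 R -> 'M[R]_(m, n)) : 0 < q ->
  (forall i j, measurable_fun [set: mpoint3 R] (fun x => f x i j)) ->
  (Lq_norm q%:E f `^ q = \int[mu3]_x (enorm (f x) `^ q)%:E)%E.
Proof.
move=> q0 mf; apply: (etrans (@poweR_Lnorm _ _ _ (@lebesgue3 R) _ _ (lt0r_neq0 q0))).
apply: (etrans _ (@integral_cell R (fun x => (enorm (f x) `^ q)%:E) _)); last first.
  apply/measurable_EFinP; apply: (measurableT_comp (measurable_powR _)).
  exact: measurable_enorm.
rewrite [RHS]integral_mkcond; apply: eq_integral => x _.
rewrite !patchE; case: ifP => _; last by rewrite abse0 poweR0r // gt_eqF.
by rewrite gee0_abs ?lee_fin ?enorm_ge0 // poweR_EFin.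
Qed.

Lemma Lq_integ q (f : point3 R -> 'M[R]_(m, n)) : 0 < q -> Lq q%:E f ->
  integ mu3 (fun x => enorm (f x) `^ q).
Proof.
move=> q0 [_ mf fy]; apply/integrableP; split.
  apply/measurable_EFinP; apply: (measurableT_comp (measurable_powR _)).
  exact: measurable_enorm.
under eq_integral do rewrite /= ger0_norm ?powR_ge0 //.
by rewrite -Lq_norm_pow //; apply: poweR_lty.
Qed.

End Enorm.

Lemma integral_mrestr_gen d (X : measurableType d) (m : {measure set X -> \bar R}) (D : set X)
    (mD : measurable D) (f : X -> \bar R) : measurable_fun setT f ->
  (\int[mrestr m mD]_x f x = \int[m]_(x in D) f x)%E.
Proof.
move=> mf; rewrite [LHS]integralE [RHS]integralE; congr (_ - _)%E; apply: integral_mrestr.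
- exact: measurable_funepos.
- by move=> x; exact: funepos_ge0.
- exact: measurable_funeneg.
- by move=> x; exact: funeneg_ge0.
Qed.

Variable T : R.
Hypothesis T0 : 0 < T.

Lemma ae_dense (Q : R -> Prop) a b : {ae muT T, forall s, Q s} -> 0 <= a -> a < b -> b <= T ->
  exists2 s, a < s < b & Q s.
Proof.
move=> [N [mN N0 QN]] a0 ab bT; apply: contrapT => H.
have sub : `]a, b[ `<=` N.
  move=> s /=; rewrite in_itv /= => sab; apply: QN => /= Qs; apply: H; by exists s.
have : (lam `]a, b[ <= 0)%E.
  rewrite -N0; apply: (@le_trans _ _ (lam (`]a, b[ `&` `]0, T[))).
    apply: le_measure; rewrite ?inE //; first by apply: measurableI.
    move=> s /=; rewrite !in_itv /= => /andP[h1 h2]; split; rewrite ?h1 ?h2 //.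
    by rewrite (le_lt_trans a0) // (lt_le_trans h2).
  by apply: le_measure; rewrite ?inE //; [apply: measurableI|apply: measurableI|exact: setSI].
by rewrite lebesgue_measure_itv /= lte_fin ab -EFinB lee_fin subr_le0 leNgt ab.
Qed.

(** Every neighbourhood of t meets ]0, T[ in an interval, which contains good times. Weak continuity
    will use this to carry properties valid at almost every time to all of [0, T]. *)
Lemma ae_le_closed (phi : R -> R) c : continuous phi -> {ae muT T, forall s, phi s <= c} ->
  forall t, 0 <= t -> t <= T -> phi t <= c.
Proof.
move=> cphi ae t t0 tT; apply/ler_addgt0Pr => e e0.
have /cvgrPdist_le ct : phi s @[s --> t] --> phi t by exact: cphi.
have /nbhs_ballP[d /= d0 Hd] := ct e e0.
have [s /andP[s1 s2] sc] : exists2 s, Num.max 0 (t - d) < s < Num.min T (t + d) & phi s <= c.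
  apply: ae_dense => //; first by rewrite le_max lexx.
    by rewrite lt_min !gt_max T0 ltr_wpDl //= !ltrBlDr; apply/andP; split; lra.
  by rewrite ge_min lexx.
have : `|phi t - phi s| <= e.
  apply: Hd; rewrite /ball /=.
  move: s1 s2; rewrite gt_max lt_min => /andP[_ h1] /andP[_ h2].
  by rewrite ltr_norml; apply/andP; split; lra.
by rewrite ler_norml => /andP[_]; lra.
Qed.

Definition clamp (t : R) := Num.min T (Num.max 0 t).

Lemma clamp_itv t : 0 <= clamp t <= T.
Proof. by rewrite /clamp le_min (ltW T0) le_max lexx /= ge_min lexx. Qed.

Lemma clampE t : 0 <= t -> t <= T -> clamp t = t.
Proof. by move=> t0 tT; rewrite /clamp max_r // min_r. Qed.

Lemma continuous_clamp : continuous clamp.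
Proof.
move=> x; apply: continuous_min; first exact: cvg_cst.
by apply: continuous_max; [exact: cvg_cst|exact: cvg_id].
Qed.

Lemma clamp_continuous (f : R -> R) : {within `[0, T], continuous f} ->
  continuous (fun t => f (clamp t)).
Proof.
move/subspace_continuousP => cf t; apply: (cvg_comp _ _ _ (cf (clamp t) _)).
  move=> P wP.
  have Pn : nbhs t (fun s => `[0, T]%classic (clamp s) -> P (clamp s)) by exact: continuous_clamp wP.
  apply: filterS Pn => s; apply; rewrite /= in_itv /=.
  exact: clamp_itv.
rewrite /= in_itv /=; exact: clamp_itv.
Qed.

Definition tpatch (W : Type) (z : W) (f : R -> W) t := if 0 < t < T then f t else z.

Lemma measurable_tpatch d (Y : measurableType d) (f : R -> Y -> R) :
  measurable_fun (`]0, T[ `*` [set: Y] : set (measurableTypeR R * Y)) (fun z => f z.1 z.2) ->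
  measurable_fun [set: measurableTypeR R * Y] (fun z => tpatch (fun=> 0) f z.1 z.2).
Proof.
move=> mf.
have mD : measurable (`]0, T[ `*` [set: Y] : set (measurableTypeR R * Y)).
  by apply: measurableX.
move/(measurable_restrictT _ mD) : mf; apply: eq_measurable_fun => z _.
rewrite patchE /tpatch; case: ifPn => zD.
  by rewrite ifT //; move: zD; rewrite inE => -[/=]; rewrite in_itv.
rewrite ifF //; apply/negP => h; move: zD; rewrite notin_setE; apply; split => //=.
Qed.

End Conversions.

Section SolutionSlices.
Context {R : realType}.
Notation lam := (@lebesgue_measure R).
Notation mu3 := (@mu3 R).

Lemma Lq2_sqint m n (f : point3 R -> 'M[R]_(m, n)) i j : Lq 2%:E f -> sqint mu3 (fun x => f x i j).
Proof.
move=> fL; have [_ mf _] := fL; split; first exact: mf.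
have fi := Lq_integ (ltr0Sn R 1) fL; apply: (integ_le _ fi); first exact: measurable_funX.
move=> x; rewrite ger0_norm ?sqr_ge0 // -powR2.
by rewrite ge0_ler_powR ?nnegrE ?enorm_ge0 ?normr_ge0 //; exact: enorm_entry.
Qed.

Lemma sqint_integ (f : point3 R -> R) : sqint mu3 f -> integ mu3 f.
Proof.
move=> [mf fi]; apply: (integ_le mf (integD (integ_cst mu3 1) fi)) => x.
rewrite -[f x ^+ 2]real_normK ?num_real //.
have := normr_ge0 (f x); have := sqr_ge0 (`|f x| - 1).
by move: `|f x| => a; rewrite sqrrB1; nra.
Qed.

Lemma integrable_cell (f : mpoint3 R -> R) : measurable_fun [set: mpoint3 R] f ->
  lebesgue3.-integrable cell (EFin \o f) -> integ mu3 f.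
Proof.
move=> mf /integrableP[_ fy]; apply/integrableP; split; first exact/measurable_EFinP.
rewrite -integral_cell //; apply/measurable_EFinP; exact: measurableT_comp.
Qed.

Lemma integral_cell_Rint (f : mpoint3 R -> R) : integ mu3 f ->
  (\int[lebesgue3]_(x in cell) (f x)%:E = (\int[mu3]_x f x)%:E)%E.
Proof.
move=> fi; apply: (etrans (@integral_cell R (fun x => (f x)%:E) _)); last exact/esym/EFin_Rint.
by apply/measurable_EFinP; exact: integ_meas fi.
Qed.

Lemma weak_partial_wpart i (f g : point3 R -> R) : measurable_fun [set: mpoint3 R] f ->
  measurable_fun [set: mpoint3 R] g -> weak_partial i f g -> wpart i f g.
Proof.
move=> mf mg [/(integrable_cell mf) fi /(integrable_cell mg) gi H]; split => // psi tp.
have fpi (a b : point3 R -> R) : torus_test b -> integ mu3 a -> integ mu3 (fun x => a x * b x).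
  by move=> tb ai; apply: (eq_integ _ (test_mul_integ tb ai)) => x; rewrite mulrC.
have := H _ tp; rewrite !integral_cell_Rint //; first by case.
  exact: fpi.
by apply: fpi => //; exact: test_derive.
Qed.

Lemma weakly_divfree_wdiv (v : point3 R -> 'rV[R]_3) (psi : point3 R -> R) : (forall i, integ mu3 (fun x => v x 0 i)) ->
  torus_test psi -> orthogonal_to_grad v psi ->
  \int[mu3]_x (\sum_i v x 0 i * 'D_(basis3 i) psi x) = 0.
Proof.
move=> vi tp; rewrite /orthogonal_to_grad integral_cell_Rint; first by case.
apply: integ_sum => i; apply: (eq_integ _ (test_mul_integ (test_derive (basis3 i) tp) (vi i))) => x.
by rewrite mulrC.
Qed.

Section LpLq.
Variables (m n : nat) (T p q : R) (f : R -> point3 R -> 'M[R]_(m, n)).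
Hypotheses (p0 : 0 < p) (q0 : 0 < q) (fL : LpLq T p%:E q%:E f).
Notation F := (tpatch T (fun=> 0) f).

Lemma measurable_tpatch_entry i j :
  measurable_fun [set: measurableTypeR R * mpoint3 R] (fun z => F z.1 z.2 i j).
Proof.
have [_ mf _] := fL.
have := @measurable_tpatch R T _ (mpoint3 R) (fun t x => f t x i j) (mf i j); apply: eq_measurable_fun => z _.
by rewrite /tpatch; case: ifP => //; rewrite mxE.
Qed.

Lemma periodic_tpatch t : periodic3 (F t).
Proof.
have [pf _ _] := fL; move=> x i; rewrite /tpatch; case: ifP => // tT.
by rewrite pf // in_itv.
Qed.

Let h z := (enorm (F z.1 z.2) `^ q)%:E.

Let mh : measurable_fun [set: measurableTypeR R * mpoint3 R] h.
Proof.
apply/measurable_EFinP; apply: (measurableT_comp (measurable_powR _)).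
by apply: measurable_enorm => i j; exact: measurable_tpatch_entry.
Qed.

Let h0 z : (0 <= h z)%E. Proof. by rewrite lee_fin powR_ge0. Qed.

Let mH : measurable_fun [set: measurableTypeR R] (fun t => (\int[mu3]_x h (t, x))%E).
Proof. exact: (@measurable_fun_fubini_tonelli_F _ _ _ _ _ mu3 h mh h0). Qed.

Let H0 t : (0 <= \int[mu3]_x h (t, x))%E.
Proof. by apply: integral_ge0 => x _; exact: h0. Qed.

Lemma LpLq_fin : (\int[muT T]_t (\int[mu3]_x (enorm (F t x) `^ q)%:E) `^ (p / q) < +oo)%E.
Proof.
have mHp : measurable_fun [set: measurableTypeR R] (fun t => ((\int[mu3]_x h (t, x)) `^ (p / q))%E).
  exact: (measurableT_comp (measurable_poweR _)).
rewrite [X in (X < _)%E](_ : _ = \int[muT T]_t ((\int[mu3]_x h (t, x)) `^ (p / q)))%E //.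
rewrite integral_mrestr //; last by move=> t; exact: poweR_ge0.
have [_ mf fy] := fL.
have := poweR_lty p fy.
rewrite (@poweR_Lnorm _ _ _ lam _ _ (lt0r_neq0 p0)).
rewrite [X in (_ < _)%E -> (X < _)%E]integral_mkcond; apply: le_lt_trans.
rewrite le_eqVlt; apply/orP; left; apply/eqP; apply: eq_integral => t _.
rewrite !patchE; case: ifPn => tT; last by rewrite abse0 poweR0r // gt_eqF.
have tT' : 0 < t < T by move: tT; rewrite inE /= in_itv.
rewrite gee0_abs; last exact: Lnorm_ge0.
have pE : q * (p / q) = p by rewrite mulrC divfK // gt_eqF.
have mft i j : measurable_fun [set: mpoint3 R] (fun x => f t x i j).
  have := measurableT_comp (measurable_tpatch_entry i j) (measurable_pair1 t).
  by apply: eq_measurable_fun => x _; rewrite /= /tpatch tT'.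
apply: (etrans (y := ((Lq_norm q%:E (f t) `^ q) `^ (p / q))%E)); last first.
  by apply: (etrans (esym (poweRrM (Lq_norm q%:E (f t)) q (p / q)))); rewrite pE.
congr (_ `^ _)%E; apply: (etrans _ (esym (Lq_norm_pow q0 mft))).
by apply: eq_integral => x _; rewrite /h /tpatch tT'.
Qed.

Let mHp : measurable_fun [set: measurableTypeR R] (fun t => ((\int[mu3]_x h (t, x)) `^ (p / q))%E).
Proof. exact: (measurableT_comp (measurable_poweR _)). Qed.

Lemma LpLq_ae_integ : {ae muT T, forall t, integ mu3 (fun x => enorm (F t x) `^ q)}.
Proof.
have Hi : (muT T).-integrable setT (fun t => ((\int[mu3]_x h (t, x)) `^ (p / q))%E).
  apply/integrableP; split => //; under eq_integral do rewrite gee0_abs ?poweR_ge0 //.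
  exact: LpLq_fin.
have := integrable_ae measurableT Hi; apply: filterS => t /(_ I) tf.
apply: ge0_integ => [|x|]; last 1 first.
- rewrite ltey; apply/eqP => e; move: tf; rewrite (eqy_poweR _ e) //.
  by rewrite divr_gt0.
- apply/measurable_EFinP; have := measurableT_comp mh (measurable_pair1 t).
  by [].
- exact: powR_ge0.
Qed.

Lemma LpLq_integ_time : integ (muT T) (fun t => (\int[mu3]_x (enorm (F t x) `^ q)) `^ (p / q)).
Proof.
have mr : measurable_fun [set: measurableTypeR R] (fun t => \int[mu3]_x (enorm (F t x) `^ q)).
  by apply: (measurableT_comp (f := fine)) => //; exact: mH.
apply: ge0_integ => [|x|].
- by apply: (measurableT_comp (measurable_powR _)).
- exact: powR_ge0.
apply: le_lt_trans LpLq_fin; apply: ge0_le_integral => //.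
- by move=> t _; rewrite lee_fin powR_ge0.
- by apply/measurable_EFinP; apply: (measurableT_comp (measurable_powR _)).
move=> t _; have := H0 t; rewrite /Rintegral /h /=; case: integral => [r| |] //= _; last first.
  by rewrite gt_eqF ?divr_gt0 // leey.
Qed.

End LpLq.

End SolutionSlices.

Section Solution.
Context {R : realType}.
Notation lam := (@lebesgue_measure R).
Notation mu3 := (@mu3 R).
Notation P := (muT _ \x mu3)%E.

Lemma ae_muT T (Q : R -> Prop) : {ae lam, forall t, t \in `]0, T[ -> Q t} ->
  {ae muT T, forall t, Q t}.
Proof.
move=> [N [mN N0 QN]].
have : {ae muT T, forall t, t \in `]0, T[ -> Q t}.
  exists N; split => //; apply/eqP; rewrite -measure_le0 -N0.
  apply: (@le_trans _ _ (lam (N `&` `]0, T[))); first by [].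
  by apply: le_measure; [rewrite inE; exact: measurableI|rewrite inE|exact: subIsetl].
by move=> ae; near=> t; apply: (near ae t) => //; rewrite in_itv /=; near: t; exact: muT_ae_itv.
Unshelve. all: by end_near.
Qed.

Lemma Rint_cell (f : mpoint3 R -> R) : measurable_fun [set: mpoint3 R] f ->
  \int[lebesgue3]_(x in cell) f x = \int[mu3]_x f x.
Proof.
move=> mf; apply: (congr1 fine (@integral_cell R (fun x => (f x)%:E) _)).
exact/measurable_EFinP.
Qed.

Lemma sqint_Lq2 (f : 'I_3 -> point3 R -> R) : (forall i, periodic3 (f i)) ->
  (forall i, sqint mu3 (f i)) -> Lq 2%:E (fun x => \row_i f i x).
Proof.
move=> pf sf; split.
- by move=> x i; apply/rowP => k; rewrite !mxE pf.
- move=> i j; have [mf _] := sf j; apply: eq_measurable_fun mf => x _; by rewrite mxE.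
rewrite ltey; apply/eqP => /(eqy_poweR (ltr0Sn R 1)).
rewrite Lq_norm_pow //; last first.
  move=> i j; have [mf _] := sf j; apply: eq_measurable_fun mf => x _; by rewrite mxE.
have fi : integ mu3 (fun x => enorm (\row_i f i x) `^ 2).
  have si : integ mu3 (fun x => \sum_i f i x ^+ 2).
    by apply: integ_sum => i; have [] := sf i.
  apply: (eq_integ _ si) => x; rewrite -[X in _ = X `^ _]ger0_norm ?enorm_ge0 // powR2 enorm_sqr big_ord1.
  by apply: eq_bigr => i _; rewrite mxE.
by rewrite -EFin_Rint.
Qed.

Variables (T : R) (u : R -> point3 R -> 'rV[R]_3) (A : R -> point3 R -> 'M[R]_(3, 2)).
Hypotheses (T0 : 0 < T) (uw : weak_solution T u A) (uc : weakly_continuous T u).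

(* Clamping the time and extending by 0 turn [u] and its horizontal gradient,
   given for times in [0, T] only, into functions of all times. *)
Definition vel t i x := u (clamp T t) x 0 i.
Definition hgrad t i j x := tpatch T (fun=> 0) A t x i j.

Let uL t : Lq 2%:E (u (clamp T t)).
Proof. by have [H _] := uc; apply: H; rewrite in_itv /= clamp_itv. Qed.

Lemma periodic_vel t i : periodic3 (vel t i).
Proof. by have [pu _ _] := uL t; move=> x k; rewrite /vel pu. Qed.

Lemma sqint_vel t i : sqint mu3 (vel t i).
Proof. exact: Lq2_sqint (uL t). Qed.

Let ui t i : integ mu3 (vel t i). Proof. exact/sqint_integ/sqint_vel. Qed.

(** Joint measurability is given on ]0, T[ only. To the left and to the right of it the clamped
    field is a single slice, constant in time. *)
Lemma measurable_vel i :
  measurable_fun [set: measurableTypeR R * mpoint3 R] (fun z => vel z.1 i z.2).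
Proof.
have [[_ mu _] _ _ _] := uw.
have mt := @measurable_tpatch R T _ (mpoint3 R) (fun t x => u t x 0 i) (mu 0 i).
have mend t : measurable_fun [set: measurableTypeR R * mpoint3 R] (fun z => vel t i z.2).
  by have [m _] := sqint_vel t i; exact: (measurableT_comp m measurable_snd).
have m1 : measurable_fun [set: measurableTypeR R * mpoint3 R] (fun z => (z.1 : R) <= 0).
  by apply: measurable_fun_ler => //; exact: measurable_fst.
have m2 : measurable_fun [set: measurableTypeR R * mpoint3 R] (fun z => T <= (z.1 : R)).
  by apply: measurable_fun_ler => //; exact: measurable_fst.
apply: eq_measurable_fun (measurable_fun_ifT m1 (mend 0) (measurable_fun_ifT m2 (mend T) mt)) => z _ /=.
rewrite /tpatch /vel; case: (leP z.1 0) => [z0|z0].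
  by congr (u _ _ _ _); rewrite /clamp !max_l.
case: (leP T z.1) => [zT|zT] /=; last by rewrite clampE ?ltW.
by congr (u _ _ _ _); rewrite /clamp (max_r (ltW T0)) minxx max_r ?ltW // min_l.
Qed.

Lemma continuous_vel_dot (g : 'I_3 -> point3 R -> R) : (forall i, periodic3 (g i)) ->
  (forall i, sqint mu3 (g i)) -> continuous (fun t : R => \sum_i \int[mu3]_x (vel t i x * g i x)).
Proof.
move=> pg sg; have [_ H] := uc; have cw := clamp_continuous T0 (H _ (sqint_Lq2 pg sg)).
suff E : (fun t => \int[lebesgue3]_(x in cell) dot (u (clamp T t) x) (\row_i g i x)) =
    (fun t => \sum_i \int[mu3]_x (vel t i x * g i x)) by rewrite -E; exact: cw.
apply/funext => t; rewrite -Rint_sum; last first.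
  by move=> i; apply: sqintM => //; exact: sqint_vel.
apply: etrans (Rint_cell _) _.
  apply: measurable_sum => i; apply: measurable_funM.
    by have [] := sqint_vel t i.
  by have [mg _] := sg i; apply: eq_measurable_fun mg => x _; rewrite mxE.
by apply: eq_Rint => x; apply: eq_bigr => i _; rewrite mxE.
Qed.

Lemma continuous_vel i (g : point3 R -> R) : periodic3 g -> sqint mu3 g ->
  continuous (fun t : R => \int[mu3]_x (vel t i x * g x)).
Proof.
move=> pg sg; pose G (k : 'I_3) := if k == i then g else fun=> 0.
have pG k : periodic3 (G k) by rewrite /G; case: eqP.
have sG k : sqint mu3 (G k) by rewrite /G; case: eqP => // _; exact: sqint0.
suff E : (fun t => \sum_k \int[mu3]_x (vel t k x * G k x)) =
    (fun t => \int[mu3]_x (vel t i x * g x)) by rewrite -E; exact: continuous_vel_dot.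
apply/funext => t.
rewrite (bigD1 i) //= big1 ?addr0 => [|k /negPf ki]; first by rewrite /G eqxx.
by rewrite -(Rint0 mu3); apply: eq_Rint => x; rewrite /G ki mulr0.
Qed.

(** The definition of a weak solution gives zero divergence at almost every time. The pairing with
    grad psi is continuous in time, so [ae_le_closed] for it and for its opposite gives every
    time. *)
Lemma wdiv_vel t : wdiv (vel t).
Proof.
split=> [i|psi tp]; first exact: ui.
have [_ _ ud _] := uw.
have pD i : periodic3 ('D_(basis3 i) psi) by have [] := test_derive (basis3 i) tp.
have sD i : sqint mu3 ('D_(basis3 i) psi) by exact/test_sqint/test_derive.
have cphi := continuous_vel_dot pD sD.
have E s : \int[mu3]_x (\sum_i vel s i x * 'D_(basis3 i) psi x) =
    \sum_i \int[mu3]_x (vel s i x * 'D_(basis3 i) psi x).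
  by rewrite -Rint_sum // => i; apply: sqintM => //; exact: sqint_vel.
have ae0 : {ae muT T, forall s, \sum_i \int[mu3]_x (vel s i x * 'D_(basis3 i) psi x) = 0}.
  have := ud _ tp => /(@ae_muT T) ae; near=> s; have s0 : 0 < s < T by near: s; exact: muT_ae_itv.
  rewrite -E; apply: weakly_divfree_wdiv => //; first exact: ui.
  by have /andP[s1 s2] := s0; rewrite /= clampE ?ltW //; near: s.
have /andP[c0 cT] := clamp_itv T0 t.
have vc : vel t = vel (clamp T t) by rewrite /vel (clampE c0 cT).
rewrite vc E; apply/eqP; rewrite eq_le; apply/andP; split.
  by apply: (ae_le_closed T0 cphi) => //; apply: filterS ae0 => s ->.
rewrite -oppr_le0; apply: (ae_le_closed T0 (phi := fun s => - \sum_i \int[mu3]_x (vel s i x * 'D_(basis3 i) psi x))) => //.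
  by move=> s; apply: cvgN; exact: cphi.
by apply: filterS ae0 => s ->; rewrite oppr0.
Unshelve. all: by end_near.
Qed.

Let sum_sq s : \sum_i \int[mu3]_x vel s i x ^+ 2 = \int[mu3]_x (enorm (u (clamp T s) x) `^ 2).
Proof.
rewrite -Rint_sum; last by move=> i; have [] := sqint_vel s i.
apply: eq_Rint => x; rewrite -[X in _ = X `^ _]ger0_norm ?enorm_ge0 // powR2 enorm_sqr.
by rewrite big_ord1.
Qed.

Let ae_bound : exists M, {ae muT T, forall s, \sum_i \int[mu3]_x vel s i x ^+ 2 <= M}.
Proof.
have [[_ _ uy] _ _ _] := uw.
(* The norm of exponent infinity unfolds to an essential supremum once the whole space has positive
   measure. *)
have lamT : (0 < lam setT)%E.
  apply: (@lt_le_trans _ _ (lam `[0, 1]%classic)); first by rewrite lebesgue_measure_itv /= lte01 -EFinB subr0 lte01.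
  by apply: le_measure; rewrite ?inE.
move: uy; rewrite unlock lamT; set N := ess_sup _ _ => Ny.
have [r r0 Nr] : exists2 r : R, 0 <= r & (N <= r%:E)%E.
  move: (N) Ny => [r|//|] _; last by exists 0; rewrite ?leNye.
  by exists (Num.max r 0); rewrite ?lee_fin le_max lexx ?orbT.
exists (r ^+ 2).
have : {ae lam, forall t, t \in `]0, T[ -> (Lq_norm 2%:E (u t) <= r%:E)%E}.
  apply: filterS (ess_sup_ge lam (abse \o (fun t => Lq_norm 2 (u t)) \_ `]0%R, T[)) => t H tT.
  apply: le_trans Nr; apply: le_trans H; rewrite /= patchE ifT ?inE //; exact: lee_abs.
move=> /ae_muT ae; near=> s; have s0 : 0 < s < T by near: s; exact: muT_ae_itv.
have Ls : (Lq_norm 2%:E (u s) <= r%:E)%E by near: s.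
have /andP[s1 s2] := s0; have cs : clamp T s = s by rewrite clampE ?ltW.
have uLs := uL s; rewrite cs in uLs; have [_ mu _] := uLs.
rewrite sum_sq cs -lee_fin EFin_Rint; last exact: Lq_integ uLs.
rewrite -Lq_norm_pow // -powR_mulrn // -poweR_EFin.
by apply: gt0_ler_poweR => //; rewrite in_itv /= leey andbT ?Lnorm_ge0 ?lee_fin.
Unshelve. all: by end_near.
Qed.

(** The norm is not weakly continuous, but the pairing with the fixed field u(t) is. For almost
    every s it is at most (M + N)/2, where N is the square of the norm of u(t); letting s tend to t
    gives N <= (M + N)/2, that is N <= M. *)
Lemma vel_bound : exists M, forall t i, \int[mu3]_x vel t i x ^+ 2 <= M.
Proof.
have [M ae] := ae_bound; exists M => t i.
have sq0 s k : 0 <= \int[mu3]_x vel s k x ^+ 2 by apply: Rint_ge0 => x; exact: sqr_ge0.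
apply: (@le_trans _ _ (\sum_i \int[mu3]_x vel t i x ^+ 2)).
  by apply: (@ler_term _ _ (fun i => \int[mu3]_x vel t i x ^+ 2)).
have cphi := continuous_vel_dot (periodic_vel t) (sqint_vel t).
have /andP[c0 cT] := clamp_itv T0 t.
set N := \sum_i _.
have vc : vel (clamp T t) = vel t by rewrite /vel (clampE c0 cT).
suff : \sum_i \int[mu3]_x (vel (clamp T t) i x * vel t i x) <= 2^-1 * (M + N).
  by rewrite vc -/N; lra.
apply: (ae_le_closed T0 cphi) => //; apply: filterS ae => s sM.
apply: (@le_trans _ _ (2^-1 * (\sum_i \int[mu3]_x vel s i x ^+ 2 + N))); last first.
  by rewrite ler_wpM2l ?invr_ge0 // lerD2r.
rewrite /N -big_split mulr_sumr; apply: ler_sum => k _ /=.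
have [_ i1] := sqint_vel s k; have [_ i2] := sqint_vel t k.
rewrite -RintD // -RintZ; last exact: integD.
apply: Rint_le; first exact: sqintM (sqint_vel s k) (sqint_vel t k).
  by apply: integZ; exact: integD.
move=> x; move: (vel s k x) (vel t k x) => a b; have := sqr_ge0 (a - b).
by rewrite sqrrB; lra.
Qed.

Let AL : LpLq T 2%:E 2%:E A. Proof. by have [_ [_ ?] _ _] := uw. Qed.

Lemma periodic_hgrad t i j : periodic3 (hgrad t i j).
Proof. by move=> x k; rewrite /hgrad (periodic_tpatch AL). Qed.

Let measurable_hgrad i j :
  measurable_fun [set: measurableTypeR R * mpoint3 R] (fun z => hgrad z.1 i j z.2).
Proof. exact: (measurable_tpatch_entry AL i j). Qed.

Lemma sqint_hgrad i j : sqint (muT T \x mu3)%E (fun z => hgrad z.1 i j z.2).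
Proof.
split; first exact: measurable_hgrad.
have m2 : measurable_fun [set: measurableTypeR R * mpoint3 R] (fun z => hgrad z.1 i j z.2 ^+ 2).
  by apply: measurable_funX; exact: measurable_hgrad.
apply: ge0_integ => // [z|]; first exact: sqr_ge0.
have mE : measurable_fun [set: measurableTypeR R * mpoint3 R]
    (fun z => (hgrad z.1 i j z.2 ^+ 2)%:E) by exact/measurable_EFinP.
rewrite (@fubini_tonelli1 _ _ _ _ _ (muT T) mu3 _ mE) => [|z]; last by rewrite lee_fin sqr_ge0.
apply: le_lt_trans (LpLq_fin (ltr0Sn R 1) (ltr0Sn R 1) AL).
have mF : measurable_fun [set: measurableTypeR R * mpoint3 R]
    (fun z => (enorm (tpatch T (fun=> 0) A z.1 z.2) `^ 2)%:E).
  apply/measurable_EFinP; apply: (measurableT_comp (measurable_powR _)).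
  by apply: measurable_enorm => k l; exact: (measurable_tpatch_entry AL).
have F0 z : (0 <= (enorm (tpatch T (fun=> 0) A z.1 z.2) `^ 2)%:E)%E by rewrite lee_fin powR_ge0.
apply: ge0_le_integral => //.
- by move=> t _; apply: integral_ge0 => x _; rewrite lee_fin sqr_ge0.
- by apply: measurable_fun_fubini_tonelli_F => // z; rewrite lee_fin sqr_ge0.
- apply: (measurableT_comp (measurable_poweR _)).
  exact: (@measurable_fun_fubini_tonelli_F _ _ _ _ _ mu3 _ mF F0).
move=> t _; rewrite divff // poweRe1; last by apply: integral_ge0 => x _; exact: (F0 (t, x)).
apply: ge0_le_integral => //.
- by move=> x _; rewrite lee_fin sqr_ge0.
- by apply: (measurableT_comp mE (measurable_pair1 t)).
- by apply: (measurableT_comp mF (measurable_pair1 t)).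
move=> x _; rewrite lee_fin -powR2.
by rewrite ge0_ler_powR ?nnegrE ?enorm_ge0 ?normr_ge0 //; exact: enorm_entry.
Qed.

Lemma wpart_hgrad : {ae muT T, forall t, forall i j, wpart (hindex j) (vel t i) (hgrad t i j)}.
Proof.
have [_ [wA _] _ _] := uw; have := ae_muT wA => ae; near=> t => i j.
have t0 : 0 < t < T by near: t; exact: muT_ae_itv.
have /andP[t1 t2] := t0.
have [mv _] := sqint_vel t i.
have mh := measurableT_comp (measurable_hgrad i j) (measurable_pair1 t).
have w : forall i j, weak_partial (hindex j) (fun x => u t x 0 i) (fun x => A t x i j).
  by near: t; exact: ae.
apply: weak_partial_wpart => //.
have -> : vel t i = fun x => u t x 0 i by rewrite /vel clampE ?ltW.
by have -> : hgrad t i j = fun x => A t x i j by rewrite /hgrad /tpatch t0.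
Unshelve. all: by end_near.
Qed.

Section TestFunction.
Variables (w : 'I_3 -> point3 R -> R) (eta : R -> R) (a b : R).
Hypotheses (tw : forall i, torus_test (w i)) (dw : forall x, \sum_i 'D_(basis3 i) (w i) x = 0)
  (seta : smooth eta) (a0 : 0 < a) (bT : b < T) (eta0 : forall r, ~~ (a <= r <= b) -> eta r = 0).

Let phi (z : R * point3 R) : 'rV[R]_3 := \row_i (eta z.1 * w i z.2).

Let sphi i : smooth (fun z : R * point3 R => eta z.1 * w i z.2).
Proof. by have [sw _] := tw i; apply: smoothM; [exact: smooth_fst|exact: smooth_snd]. Qed.

Let derive_phi (h : R) (v : point3 R) z i :
  'D_(h, v) phi z 0 i = 'D_h eta z.1 * w i z.2 + eta z.1 * 'D_v (w i) z.2.
Proof.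
have [sw _] := tw i.
have se : smooth (fun z : R * point3 R => eta z.1) by exact: smooth_fst.
have ss : smooth (fun z : R * point3 R => w i z.2) by exact: smooth_snd.
have E j : (fun z => phi z 0 j) = (fun z => eta z.1 * w j z.2).
  by apply/funext => y; rewrite mxE.
rewrite derive_row => [|j]; last by rewrite E; exact: smooth_derivable (sphi j).
rewrite E.
rewrite (deriveM (smooth_derivable z (h, v) se) (smooth_derivable z (h, v) ss)).
have -> : 'D_(h, v) (fun z : R * point3 R => eta z.1) z = 'D_h eta z.1.
  by apply: (@derive_affine R _ R _ (@fst R (point3 R)) (@fst R (point3 R))).
have -> : 'D_(h, v) (fun z : R * point3 R => w i z.2) z = 'D_v (w i) z.2.
  by apply: (@derive_affine R _ (point3 R) _ (@snd R (point3 R)) (@snd R (point3 R))).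
rewrite /GRing.scale /= addrC; congr (_ + _); exact: mulrC.
Qed.

Let phi_test : spacetime_test T phi.
Proof.
split.
- exact: smooth_row sphi.
- by move=> t x i; apply/rowP => k; rewrite !mxE; have [_ ->] := tw k.
exists a, b; split => // t x; rewrite in_itv /= => tab; apply/rowP => k.
by rewrite !mxE eta0 // mul0r.
Qed.

Let phi_div : divfree phi.
Proof.
move=> z; transitivity (eta z.1 * \sum_i 'D_(basis3 i) (w i) z.2); last by rewrite dw mulr0.
by rewrite mulr_sumr; apply: eq_bigr => i _; rewrite /dx derive_phi derive0 mul0r add0r.
Qed.

Let H z := 'D_1 eta z.1 * (\sum_i w i z.2 * vel z.1 i z.2) + eta z.1 * transport vel hgrad w z.1 z.2.

Let integrandE t x : 0 < t < T -> weak_integrand u A phi t x = H (t, x).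
Proof.
move=> t0; have /andP[t1 t2] := t0; have cs : clamp T t = t by rewrite clampE ?ltW.
rewrite /weak_integrand /H /= /transport mulrBr addrA; congr (_ + _ - _).
- rewrite /dot mulr_sumr; apply: eq_bigr => i _; rewrite /dt derive_phi derive0 mulr0 addr0 /=.
  by rewrite /vel cs mulrA.
- rewrite mulr_sumr; apply: eq_bigr => i _; rewrite mulr_sumr; apply: eq_bigr => j _.
  by rewrite /dx derive_phi derive0 mul0r add0r /= /vel cs -mulrA.
rewrite mulr_sumr; apply: eq_bigr => i _; rewrite mulr_sumr; apply: eq_bigr => j _.
by rewrite /dx derive_phi derive0 mul0r add0r /= /hgrad /tpatch t0 mulrA.
Qed.

(** The product of [eta] and a divergence-free [w] is an admissible test field. Its weak formulation
    has an integrand H that is integrable over space-time, so Fubini splits it into the two time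
    integrals, equal to the original at almost every time. *)
Lemma weak_vel : \int[muT T]_r ('D_1 eta r * (\int[mu3]_x \sum_i w i x * vel r i x) +
    eta r * \int[mu3]_x transport vel hgrad w r x) = 0.
Proof.
have [M vM] := vel_bound.
have [_ _ _ uE] := uw; have := uE _ phi_test phi_div.
have sv i : sqint (muT T \x mu3)%E (fun z => vel z.1 i z.2).
  exact: (sqint_uP T sqint_vel vM measurable_vel).
have bw (i : 'I_3) : exists2 B, 0 <= B & forall x, `|w i x| <= B by exact: test_bounded.
have sd : smooth ('D_1 eta) by exact: smooth_derive.
have bounded_time (f : R -> R) : smooth f -> (forall r, ~~ (a <= r <= b) -> f r = 0) ->
    exists B, forall r, `|f r| <= B.
  move=> sf f0.
  have /compact_bounded[B [_ fB]] : compact (f @` `[a, b]%classic).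
    apply: continuous_compact; last exact: segment_compact.
    by apply: continuous_subspaceT; exact: smooth_continuous.
  exists (Num.max 0 (B + 1)) => r; case: (boolP (a <= r <= b)) => [rab|/f0->]; last first.
    by rewrite normr0 le_max lexx.
  rewrite le_max; apply/orP; right; apply: fB; first by rewrite ltrDl.
  by exists r => //=; rewrite in_itv.
have [B0 hB0] := bounded_time _ seta eta0.
have [B1 hB1] : exists B, forall r, `|'D_1 eta r| <= B.
  apply: bounded_time => // r rab.
  rewrite -(derive_cst (0 : R) r (1 : R)); apply: near_eq_derive => //.
  move: rab; rewrite negb_and -!ltNge => /orP[ra|br].
    by near=> s; apply: eta0; rewrite negb_and -!ltNge; apply/orP; left; near: s; exact: lt_nbhsl.
  by near=> s; apply: eta0; rewrite negb_and -!ltNge; apply/orP; right; near: s; exact: lt_nbhsr.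
have mtime (f : R -> R) : smooth f -> measurable_fun [set: measurableTypeR R * mpoint3 R] (fun z => f z.1).
  move=> /smooth_continuous /continuous_measurable mf; exact: (measurableT_comp mf measurable_fst).
have iS : integ (muT T \x mu3)%E (fun z => \sum_i w i z.2 * vel z.1 i z.2).
  apply: integ_sum => i; have [B _ hB] := bw i.
  apply: (@integ_mul_bounded _ _ _ _ _ _ B) => [|z|]; last 1 first.
  - exact: (sqint_integP (sv i)).
  - by apply: (measurableT_comp _ measurable_snd); exact: test_measurable.
  - exact: hB.
have iT := integ_transport sqint_vel vM measurable_vel sqint_hgrad tw.
have iH : integ (muT T \x mu3)%E H.
  apply: integD.
    exact: (integ_mul_bounded (mtime _ sd) (fun z => hB1 z.1) iS).
  exact: (integ_mul_bounded (mtime _ seta) (fun z => hB0 z.1) iT).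
have H1 t : 0 < t < T -> (\int[lebesgue3]_(x in cell) (weak_integrand u A phi t x)%:E =
    \int[mu3]_x (H (t, x))%:E)%E.
  move=> t0; apply: (etrans (y := (\int[lebesgue3]_(x in cell) (H (t, x))%:E)%E)).
    by apply: eq_integral => x _; congr EFin; exact: integrandE.
  apply: (@integral_cell R (fun x => (H (t, x))%:E)).
  apply/measurable_EFinP; exact: (measurableT_comp (integ_meas iH) (measurable_pair1 t)).
have -> : (\int[lam]_(t in `]0%R, T[) \int[lebesgue3]_(x in cell) (weak_integrand u A phi t x)%:E =
    \int[lam]_(t in `]0%R, T[) \int[mu3]_x (H (t, x))%:E)%E.
  by apply: eq_integral => t; rewrite inE /= in_itv /=; exact: H1.
have mF : measurable_fun [set: measurableTypeR R] (fun t => \int[mu3]_x (H (t, x))%:E)%E.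
  exact: (measurable_fubini_F iH).
rewrite -(integral_mrestr_gen lam (measurable_itv0T T) mF) => E0.
have E1 : \int[(muT T \x mu3)%E]_z H z = 0.
  have -> : \int[(muT T \x mu3)%E]_z H z = fine (\int[muT T]_t \int[mu3]_x (H (t, x))%:E)%E.
    by rewrite /Rintegral -(integral12_prod_meas1 iH).
  by rewrite -[RHS]/(fine 0); congr fine.
apply: (etrans _ E1); rewrite -(Rint_prod iH); apply: ae_eq_Rint.
- apply: measurable_funD; apply: measurable_funM.
  + exact: continuous_measurable (smooth_continuous sd).
  + exact: measurable_Rint (integ_meas iS).
  + exact: continuous_measurable (smooth_continuous seta).
  + exact: measurable_Rint (integ_meas iT).
- exact: measurable_Rint (integ_meas iH).
have aeT : {ae muT T, forall t, integ mu3 (fun x => transport vel hgrad w t x)}.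
  by exact: (ae_integrable1 iT).
apply: filterS aeT => t it.
have i1 : integ mu3 (fun x => \sum_i w i x * vel t i x).
  by apply: integ_sum => i; exact: test_mul_integ.
apply: esym; apply: (etrans (@RintD _ _ _ mu3 (fun x => 'D_1 eta t * \sum_i w i x * vel t i x)
  (fun x => eta t * transport vel hgrad w t x) (integZ _ i1) (integZ _ it))).
by congr (_ + _); exact: RintZ.
Unshelve. all: by end_near.
Qed.

End TestFunction.

End Solution.

(** * Domination of the flux *)

Section EnergyEquality.
Context {R : realType}.
Notation lam := (@lebesgue_measure R).
Notation mu3 := (@mu3 R).

Definition flux_dominated T (v : R -> 'I_3 -> point3 R -> R) := exists2 G : R -> R,
  integ (muT T) G & {ae muT T, forall t,
    flux n (v t) @[n --> \oo] --> 0 /\ forall n, `|flux n (v t)| <= G t}.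

Variables (T : R) (u : R -> point3 R -> 'rV[R]_3) (A : R -> point3 R -> 'M[R]_(3, 2)).
Hypotheses (T0 : 0 < T) (uw : weak_solution T u A) (uc : weakly_continuous T u).
Notation vel := (vel T u).
Notation hgrad := (hgrad T A).

Lemma energy_solution t : flux_dominated T vel -> 0 <= t -> t <= T ->
  \sum_i \int[mu3]_x vel t i x ^+ 2 +
  2 * \int[muT T]_r (\1_`]0, t] r * hdissip (hgrad r)) =
  \sum_i \int[mu3]_x vel 0 i x ^+ 2.
Proof.
move=> [G Gi GH] t0 tT; have [M vM] := vel_bound T0 uw uc.
apply: (energy_limit T0 (periodic_vel T0 uc) (sqint_vel T0 uc) vM (wdiv_vel T0 uw uc)
  (continuous_vel T0 uc) (measurable_vel T0 uw uc) (periodic_hgrad uw) (sqint_hgrad uw)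
  (wpart_hgrad T0 uw uc) (weak_vel T0 uw uc) _ Gi) => //.
  by apply: filterS GH => r [].
by apply: filterS GH => r [].
Qed.

Lemma ae_hslice : {ae muT T, forall t, hslice (vel t) (hgrad t)}.
Proof.
have := wpart_hgrad T0 uw uc; have := ae_sqint_A (sqint_hgrad uw).
apply: filterS2 => t sA wA; split => //.
- by move=> i; split; [exact: periodic_vel|exact: sqint_vel].
- exact: (wdiv_vel T0 uw uc).
by move=> i j; split => //; exact: (periodic_hgrad uw).
Qed.

Lemma integ_hdissip : integ (muT T) (fun t => hdissip (hgrad t)).
Proof.
by apply: integ_sum => i; apply: integ_sum => j; have [_ /integ_Rint] := sqint_hgrad uw i j.
Qed.

Lemma flux_dominated_mass4 (N : R -> R) : integ (muT T) N ->
  {ae muT T, forall t, (forall i, integ mu3 (fun x => `|vel t i x| `^ 4)) /\ mass4 (vel t) <= N t} ->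
  flux_dominated T vel.
Proof.
move=> Ni ae; have [C0 C00 HC] := @derive_kern_L1 R.
have [C CE C1] : exists2 C, (C0 + 1) `^ 4 <= C & 0 <= 3 * (C + 300) * 65.
  exists ((C0 + 1) `^ 4); first exact: lexx.
  by have := powR_ge0 (C0 + 1) 4; move: (_ `^ _) => c c0; lra.
exists (fun t => 3 * (C + 300) * 65 * (N t + hdissip (hgrad t))).
  by apply: integZ; apply: integD => //; exact: integ_hdissip.
have := ae_hslice; move: ae; apply: filterS2 => t [v4 vN] hs; split.
  exact: (flux4_cvg0 hs v4 C00 CE HC).
move=> n; apply: le_trans (flux4_le hs v4 C00 CE HC n) _.
by apply: ler_wpM2l => //; rewrite lerD2r.
Qed.

Let slice_entry t i x : 0 < t < T -> `|vel t i x| <= enorm (tpatch T (fun=> 0) u t x).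
Proof.
move=> t0; have /andP[t1 t2] := t0.
by rewrite /vel (clampE (ltW t1) (ltW t2)) /tpatch t0 enorm_entry.
Qed.

Let mvel t i p : measurable_fun [set: mpoint3 R] (fun x => `|vel t i x| `^ p).
Proof. by apply: measurable_pow; have [] := sqint_vel T0 uc t i. Qed.

Lemma ae_integ_vel p q : 0 < p -> 0 < q -> LpLq T p%:E q%:E u ->
  {ae muT T, forall t i, integ mu3 (fun x => `|vel t i x| `^ q)}.
Proof.
move=> p0 q0 uL; have := muT_ae_itv T; have := LpLq_ae_integ p0 q0 uL.
apply: filterS2 => t Fi t0 i; apply: integ_le (mvel t i q) Fi _ => x.
rewrite ger0_norm ?powR_ge0 // (ge0_ler_powR (ltW q0)) ?nnegrE ?normr_ge0 ?enorm_ge0 //.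
exact: slice_entry.
Qed.

Lemma flux_dominated_L4 : LpLq T 4%:E 4%:E u -> flux_dominated T vel.
Proof.
move=> uL; have h4 : 0 < 4 :> R by [].
apply: (flux_dominated_mass4 (N := fun t => 3 * (\int[mu3]_x (enorm (tpatch T (fun=> 0) u t x) `^ 4)) `^ (4 / 4))).
  by apply: integZ; exact: LpLq_integ_time uL.
have := muT_ae_itv T; move: (ae_integ_vel h4 h4 uL) (LpLq_ae_integ h4 h4 uL).
apply: filterS3 => t v4 Fi t0; split=> //.
rewrite divff // powRr1; last by apply: Rint_ge0 => x; exact: powR_ge0.
have le i : \int[mu3]_x `|vel t i x| `^ 4 <= \int[mu3]_x (enorm (tpatch T (fun=> 0) u t x) `^ 4).
  apply: Rint_le => // x; rewrite ge0_ler_powR ?nnegrE ?normr_ge0 ?enorm_ge0 //.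
  exact: slice_entry.
by apply: le_trans (ler_sum _ (fun i _ => le i)) _; rewrite sumr_const card_ord mulr_natl.
Qed.

End EnergyEquality.

(** * Interpolation between Lebesgue norms *)

Section Interpolation.
Context {R : realType}.

(** Below the threshold l the power rho is compared with a, above it with b. Integrated, and with l
    chosen afterwards, this does the work of interpolation by Hölder's inequality. *)
Lemma pow_split (a rho b l s : R) : a <= rho -> rho <= b -> 0 < a -> 0 < l -> 0 <= s ->
  s `^ rho <= l `^ (rho - a) * s `^ a + l `^ (rho - b) * s `^ b.
Proof.
move=> ar rb a0 l0 s0.
case: (leP s l) => sl.
  have -> : s `^ rho = s `^ (rho - a) * s `^ a.
    rewrite -powRD ?subrK //; apply/implyP => /eqP e.
    by move: (lt_le_trans a0 ar); rewrite e ltxx.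
  rewrite ler_wpDr ?mulr_ge0 ?powR_ge0 // ler_wpM2r ?powR_ge0 //.
  by rewrite ge0_ler_powR ?nnegrE ?subr_ge0 // ltW.
have s1 : 0 < s by exact: lt_trans sl.
have -> : s `^ rho = s `^ (rho - b) * s `^ b.
  by rewrite -powRD ?subrK //; apply/implyP => _; exact: lt0r_neq0.
rewrite ler_wpDl ?mulr_ge0 ?powR_ge0 // ler_wpM2r ?powR_ge0 // -opprB !powRN.
rewrite lef_pV2 ?posrE ?powR_gt0 //.
by rewrite ge0_ler_powR ?nnegrE ?subr_ge0 // ltW.
Qed.

Lemma pow4_split (q l s : R) : 4 <= q -> 0 < l -> 0 <= s ->
  s `^ 4 <= l ^+ 2 * s ^+ 2 + l `^ (4 - q) * s `^ q.
Proof.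
move=> q4 l0 s0; have le24 : 2 <= 4 :> R by rewrite ler_nat.
have := pow_split le24 q4 (ltr0Sn R 1) l0 s0.
have -> : 4 - 2 = 2 :> R by rewrite -natrB.
by rewrite (powR_mulrn 2 (ltW l0)) (powR_mulrn 2 s0).
Qed.

(** The threshold makes l^2 and l^(4-q) (1 + S) equal, both being (1 + S)^(2/(q-2)); taking 1 + S
    instead of S keeps l positive. *)
Lemma interpolation_balance (q S : R) : 4 <= q -> 0 <= S ->
  let l := (1 + S) `^ (q - 2)^-1 in
  0 < l /\ forall E, 0 <= E -> l ^+ 2 * E + l `^ (4 - q) * S <= (E + 1) * (1 + S) `^ (2 / (q - 2)).
Proof.
move=> q4 S0; have S1 : 0 < 1 + S by exact: ltr_pwDl.
have q2 : 0 < q - 2 by rewrite subr_gt0 (lt_le_trans _ q4) // ltr_nat.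
split; first exact: powR_gt0.
move=> E E0; rewrite -powR_mulrn ?powR_ge0 // -!powRrM mulrDl mul1r (mulrC _ E) lerD //.
  by rewrite [2 / _]mulrC.
apply: (@le_trans _ _ ((1 + S) `^ ((q - 2)^-1 * (4 - q)) * (1 + S))).
  by rewrite ler_wpM2l ?powR_ge0 // lerDr.
rewrite -[X in _ * X <= _](powRr1 (ltW S1)) -powRD; last by apply/implyP => _; exact: lt0r_neq0.
rewrite le_eqVlt; apply/orP; left; apply/eqP; congr (_ `^ _).
have /lt0r_neq0 qn := q2; by field.
Qed.

End Interpolation.

Section InterpolatedNorm.
Context {R : realType}.
Notation mu3 := (@mu3 R).
Variables (T : R) (u : R -> point3 R -> 'rV[R]_3) (A : R -> point3 R -> 'M[R]_(3, 2)).
Hypotheses (T0 : 0 < T) (uw : weak_solution T u A) (uc : weakly_continuous T u).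
Notation vel := (vel T u).

Lemma flux_dominated_LpLq p q : 2 / p + 2 / q = 1 -> 4 <= q -> LpLq T p%:E q%:E u ->
  flux_dominated T vel.
Proof.
move=> pq q4 uL.
have q0 : 0 < q by rewrite (lt_le_trans _ q4).
have q2 : 0 < q - 2 by rewrite subr_gt0 (lt_le_trans _ q4) // ltr_nat.
have p0 : 0 < p.
  have : 0 < 2 / p.
    have := congr1 (fun x => x - 2 / q) pq; rewrite addrK => ->.
    by rewrite subr_gt0 ltr_pdivrMr // mul1r -subr_gt0.
  by rewrite pmulr_rgt0 // invr_gt0.
(* This is where 2/p + 2/q = 1 enters: the exponent from [interpolation_balance] becomes p/q, and
   S^(p/q) is integrable in time. *)
have pE : p / q = 2 / (q - 2).
  have pn := lt0r_neq0 p0; have qn := lt0r_neq0 q0; have q2n := lt0r_neq0 q2.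
  have : 2 * q + 2 * p = p * q by have := congr1 (fun x => x * (p * q)) pq; rewrite mul1r => <-; field; rewrite pn qn.
  by move=> e; apply/eqP; rewrite eqr_div // mulrBr (mulrC p q) mulrC -e; apply/eqP; ring.
have [M vM] := vel_bound T0 uw uc.
pose S t := \int[mu3]_x (enorm (tpatch T (fun=> 0) u t x) `^ q).
have S0 t : 0 <= S t by apply: Rint_ge0 => x; exact: powR_ge0.
have M0 : 0 <= M by apply: le_trans (vM 0 ord0); apply: Rint_ge0 => x; exact: sqr_ge0.
pose a := p / q; have a0 : 0 < a by exact: divr_gt0.
apply: (flux_dominated_mass4 T0 uw uc (N := fun t => 3 * ((M + 1) * (2 `^ a * (1 + S t `^ a))))).
  apply: integZ; apply: integZ; apply: integZ; apply: integD; first exact: integ_cst.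
  exact: LpLq_integ_time uL.
have := muT_ae_itv T; move: (ae_integ_vel T0 uc p0 q0 uL) (LpLq_ae_integ p0 q0 uL).
apply: filterS3 => t vq Fi t0.
have [l0 lE] := interpolation_balance q4 (S0 t).
set l := _ `^ _ in l0 lE.
have v2 i : integ mu3 (fun x => vel t i x ^+ 2) by have [] := sqint_vel T0 uc t i.
have mv i : measurable_fun [set: mpoint3 R] (vel t i) by have [] := sqint_vel T0 uc t i.
have bi i : integ mu3 (fun x => l ^+ 2 * vel t i x ^+ 2 + l `^ (4 - q) * `|vel t i x| `^ q).
  by apply: integD; exact: integZ.
have le4 i x : `|vel t i x| `^ 4 <= l ^+ 2 * vel t i x ^+ 2 + l `^ (4 - q) * `|vel t i x| `^ q.
  by rewrite -[vel t i x ^+ 2]real_normK ?num_real //; exact: pow4_split.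
have v4 i : integ mu3 (fun x => `|vel t i x| `^ 4).
  apply: integ_le (measurable_pow _ (mv i)) (bi i) _ => x.
  by rewrite ger0_norm ?powR_ge0.
split => //.
have le i : \int[mu3]_x `|vel t i x| `^ 4 <= (M + 1) * (2 `^ a * (1 + S t `^ a)).
  apply: le_trans (Rint_le (v4 i) (bi i) (le4 i)) _.
  rewrite RintD; [|exact: integZ|exact: integZ]; rewrite !RintZ //.
  apply: (@le_trans _ _ (l ^+ 2 * M + l `^ (4 - q) * S t)).
    apply: lerD; rewrite ler_wpM2l ?sqr_ge0 ?powR_ge0 //.
    apply: Rint_le => // x; rewrite (ge0_ler_powR (ltW q0)) ?nnegrE ?normr_ge0 ?enorm_ge0 //.
    have /andP[t1 t2] := t0; by rewrite /vel (clampE (ltW t1) (ltW t2)) /tpatch t0 enorm_entry.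
  apply: le_trans (lE M M0) _; rewrite -pE -/a ler_wpM2l ?addr_ge0 //.
  have := powR_normD_le 1 (S t) (ltW a0).
  by rewrite normr1 powR1 (ger0_norm (S0 t)) ger0_norm ?addr_ge0.
by apply: le_trans (ler_sum _ (fun i _ => le i)) _; rewrite sumr_const card_ord mulr_natl.
Qed.

End InterpolatedNorm.

(** * The Gagliardo-Nirenberg inequality *)

Section LoomisWhitney.
Context {R : realType}.
Notation lam := (@lebesgue_measure R).
Notation mu1 := (@mu1 R).
Notation mu2 := (@mu2 R).
Notation mu3 := (@mu3 R).

(** For every y in the period, |h(x)| is at most |h(y)| plus the integral of |h'|, and this is
    averaged over y. The term |h| remains because a periodic function need not vanish anywhere. *)
Lemma per1_trace (h : R -> R) : smooth h -> per1 h -> forall x,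
  `|h x| <= \int[mu1]_s (`|h s| + `|'D_1 h s|).
Proof.
move=> sh ph; have ch := smooth_continuous sh.
have cd : continuous ('D_1 h) by exact/smooth_continuous/smooth_derive.
have cn (f : R -> R) : continuous f -> continuous (fun x => `|f x|).
  by move=> cf x; apply: (cvg_comp _ _ (cf x)); exact: norm_continuous.
have ih : integ mu1 (fun s => `|h s|) by exact/continuous_integ_mu1/cn.
have id : integ mu1 (fun s => `|'D_1 h s|) by exact/continuous_integ_mu1/cn.
pose K := \int[mu1]_s `|'D_1 h s|.
have step a b : 0 <= a -> a <= b -> b <= 1 -> `|h b - h a| <= K.
  move=> a0 ab b1.
  rewrite -(Rint_FTC ab cd (fun x => smooth_is_derive x sh)).
  have ii c d (f : R -> R) : continuous f -> lam.-integrable `[c, d] (EFin \o f).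
    move=> cf; apply: continuous_compact_integrable; first exact: segment_compact.
    exact: continuous_subspaceT.
  apply: le_trans (le_normr_Rintegral _ (ii a b _ cd)) _ => //.
  have mD : measurable_fun [set: measurableTypeR R] (fun s => `|'D_1 h s|) := continuous_measurable (cn _ cd).
  rewrite /K (Rint_mu1 mD (fun=> normr_ge0 _)).
  rewrite /Rintegral fine_le //.
  - by apply: integrable_fin_num => //; exact/ii/cn.
  - by apply: integrable_fin_num => //; exact/ii/cn.
  apply: ge0_subset_integral => //.
  - by apply/measurable_EFinP; exact: measurable_funTS mD.
  - by move=> r /=; rewrite !in_itv /= => /andP[r1 r2]; rewrite (le_trans a0 r1) (le_trans r2 b1).
have hfrac x : h (frac x) = h x by rewrite /frac -mulrNz per1_int.
have main x : 0 <= x -> x <= 1 -> `|h x| <= \int[mu1]_s (`|h s| + `|'D_1 h s|).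
  move=> x0 x1; rewrite RintD // -/K -lerBlDr -[leLHS](Rint_cst mu1).
  apply: Rint_le => //; first exact: integ_cst.
  move=> y; have /andP[y0 /ltW y1] := frac_itv y; rewrite -(hfrac y) lerBlDr.
  have Kxy : `|h x - h (frac y)| <= K.
    by case: (leP (frac y) x) => [yx|/ltW xy]; [exact: step|rewrite distrC; exact: step].
  by rewrite -[h x](subrK (h (frac y))) addrC (le_trans (ler_normD _ _)) // lerD2l.
move=> x; have /andP[f0 f1] := frac_itv x.
by rewrite -(hfrac x); apply: main => //; exact: ltW.
Qed.

Section Product.
Variables (f1 f2 f3 : R * R -> R) (B : R).
Notation mR := (measurableTypeR R).
Hypotheses (m1 : measurable_fun [set: mR * mR] f1) (m2 : measurable_fun [set: mR * mR] f2)
  (m3 : measurable_fun [set: mR * mR] f3)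
  (b1 : forall z, 0 <= f1 z <= B) (b2 : forall z, 0 <= f2 z <= B) (b3 : forall z, 0 <= f3 z <= B).

Let msqrt d (X : measurableType d) (f : X -> R) : measurable_fun setT f ->
  measurable_fun setT (fun x => Num.sqrt (f x)).
Proof.
move=> mf; apply: (measurableT_comp (f := @Num.sqrt R)) => //.
by apply: continuous_measurable_fun; exact: sqrt_continuous.
Qed.

Let bounded_sq d (X : measurableType d) (m : {finite_measure set X -> \bar R}) (f : X -> R) C :
  measurable_fun setT f -> (forall x, 0 <= f x <= C) -> sqint m (fun x => Num.sqrt (f x)).
Proof.
move=> mf bf; split; first exact: msqrt.
apply: (@integ_bounded _ _ _ _ _ C); first by apply: measurable_funX; exact: msqrt.
by move=> x; have /andP[f0 fC] := bf x; rewrite sqr_sqrtr // ger0_norm.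
Qed.

Let I z := \int[mu2]_xy (Num.sqrt (f3 xy) * Num.sqrt (f1 (xy.2, z) * f2 (xy.1, z))).
Let a1 z := \int[mu1]_y f1 (y, z).
Let a2 z := \int[mu1]_x f2 (x, z).

Let m12 z : measurable_fun [set: mR * mR] (fun xy => f1 (xy.2, z) * f2 (xy.1, z)).
Proof.
apply: measurable_funM.
  by apply: (measurableT_comp m1); apply: measurable_fun_pair => //; exact: measurable_snd.
by apply: (measurableT_comp m2); apply: measurable_fun_pair => //; exact: measurable_fst.
Qed.

Let B0 : 0 <= B. Proof. by have /andP[h1 h2] := b1 (0, 0); exact: le_trans h1 h2. Qed.

Let b12 z xy : 0 <= f1 (xy.2, z) * f2 (xy.1, z) <= B * B.
Proof.
have /andP[h1 h2] := b1 (xy.2, z); have /andP[k1 k2] := b2 (xy.1, z).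
by rewrite mulr_ge0 // ler_pM.
Qed.

Let slice_integ (f : R * R -> R) z : measurable_fun [set: mR * mR] f -> (forall z, 0 <= f z <= B) ->
  integ mu1 (fun x => f (x, z)).
Proof.
move=> mf bf; apply: (@integ_bounded _ _ _ _ _ B).
  exact: (measurableT_comp mf (measurable_pair2 z)).
by move=> x; have /andP[h1 h2] := bf (x, z); rewrite ger0_norm.
Qed.

Let a_bound (f : R * R -> R) z : measurable_fun [set: mR * mR] f -> (forall z, 0 <= f z <= B) ->
  0 <= \int[mu1]_x f (x, z) <= B.
Proof.
move=> mf bf; rewrite Rint_ge0 => [|x]; last by have /andP[] := bf (x, z).
rewrite -[leRHS](Rint_cst mu1); apply: Rint_le; [exact: slice_integ|exact: integ_cst|].
by move=> x; have /andP[] := bf (x, z).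
Qed.

Let a_meas (f : R * R -> R) : measurable_fun [set: mR * mR] f ->
  measurable_fun [set: mR] (fun z => \int[mu1]_x f (x, z)).
Proof.
move=> mf; apply: (@measurable_Rint _ _ _ _ _ mu1 (fun z => f (z.2, z.1))).
by apply: (measurableT_comp mf); apply: measurable_fun_pair; [exact: measurable_snd|exact: measurable_fst].
Qed.

Let I_le z : I z <= Num.sqrt (\int[mu2]_xy f3 xy) * (Num.sqrt (a1 z) * Num.sqrt (a2 z)).
Proof.
have H : I z ^+ 2 <= \int[mu2]_xy f3 xy * (a1 z * a2 z).
  have CS := @Rint_CS _ _ _ mu2 _ _ (@bounded_sq _ _ mu2 _ _ m3 b3) (@bounded_sq _ _ mu2 _ _ (m12 z) (b12 z)).
  apply: le_trans CS _.
  rewrite le_eqVlt; apply/orP; left; apply/eqP; congr (_ * _).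
    by apply: eq_Rint => xy; have /andP[h _] := b3 xy; rewrite sqr_sqrtr.
  under eq_Rintegral do rewrite sqr_sqrtr ?(proj1 (andP (b12 _ _))) //.
  have i12 : integ mu2 (fun xy => f1 (xy.2, z) * f2 (xy.1, z)).
    apply: (@integ_bounded _ _ _ mu2 _ (B * B)); first exact: m12.
    by move=> xy; have /andP[h1 h2] := b12 z xy; rewrite ger0_norm.
  apply: (etrans (esym (@Rint_prod _ _ _ _ _ mu1 mu1 _ i12))) => /=.
  transitivity (\int[mu1]_x (a1 z * f2 (x, z))).
    apply: eq_Rint => x; rewrite mulrC -RintZ; last exact: slice_integ.
    by apply: eq_Rint => y; rewrite mulrC.
  by rewrite RintZ //; exact: slice_integ.
have I0 : 0 <= I z by apply: Rint_ge0 => xy; rewrite mulr_ge0 ?sqrtr_ge0.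
have F30 : 0 <= \int[mu2]_xy f3 xy by apply: Rint_ge0 => xy; have /andP[] := b3 xy.
have /andP[a10 _] := a_bound z m1 b1.
rewrite -sqrtrM // -sqrtrM // -[leLHS]ger0_norm // -sqrtr_sqr ler_wsqrtr //.
Qed.

Lemma integ_sqrt_prod :
  integ mu3 (fun z => Num.sqrt (f3 z.1) * Num.sqrt (f1 (z.1.2, z.2) * f2 (z.1.1, z.2))).
Proof.
apply: sqintM.
  by apply: (@bounded_sq _ _ _ _ B) => //; exact: (measurableT_comp m3 measurable_fst).
apply: (@bounded_sq _ _ _ _ (B * B)) => [|z]; last exact: (b12 z.2 z.1).
have m11 : measurable_fun [set: mpoint3 R] (fun z => z.1.1) by exact: (measurableT_comp measurable_fst measurable_fst).
have m12' : measurable_fun [set: mpoint3 R] (fun z => z.1.2) by exact: (measurableT_comp measurable_snd measurable_fst).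
apply: measurable_funM.
  by apply: (measurableT_comp m1); apply: measurable_fun_pair => //; exact: measurable_snd.
by apply: (measurableT_comp m2); apply: measurable_fun_pair => //; exact: measurable_snd.
Qed.

(** The Loomis-Whitney inequality in three dimensions. For a fixed third coordinate, Cauchy-Schwarz
    in the first two separates f3 from f1 f2, whose integral factorizes; a second Cauchy-Schwarz in
    the third coordinate separates f1 from f2. *)
Lemma loomis_whitney :
  (\int[mu3]_z (Num.sqrt (f3 z.1) * Num.sqrt (f1 (z.1.2, z.2) * f2 (z.1.1, z.2)))) ^+ 2 <=
  \int[mu2]_z f3 z * (\int[mu2]_z f1 z * \int[mu2]_z f2 z).
Proof.
set L := \int[mu3]_z _.
have bm (f : R * R -> R) : measurable_fun [set: mR * mR] f -> (forall z, 0 <= f z <= B) -> integ mu2 f.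
  move=> mf bf; apply: (@integ_bounded _ _ _ _ _ B) => // z.
  by have /andP[h1 h2] := bf z; rewrite ger0_norm.
have iL := integ_sqrt_prod.
have LE : L = \int[mu1]_z I z.
  exact: (esym (@Rint_prod2 _ _ _ _ _ mu2 mu1 _ iL)).
have s1 : sqint mu1 (fun z => Num.sqrt (a1 z)) by apply: bounded_sq (a_meas m1) (fun z => a_bound z m1 b1).
have s2 : sqint mu1 (fun z => Num.sqrt (a2 z)) by apply: bounded_sq (a_meas m2) (fun z => a_bound z m2 b2).
have A0 (f : R * R -> R) : (forall z, 0 <= f z <= B) -> 0 <= \int[mu2]_z f z.
  by move=> bf; apply: Rint_ge0 => z; have /andP[] := bf z.
have L1 : L <= Num.sqrt (\int[mu2]_z f3 z) * \int[mu1]_z (Num.sqrt (a1 z) * Num.sqrt (a2 z)).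
  have iI : integ mu1 I by exact: (integ_Rint (proj1 (@integ_swap _ _ _ _ _ mu2 mu1 _ iL))).
  rewrite LE -RintZ; last exact: sqintM.
  exact: (Rint_le iI (integZ _ (sqintM s1 s2)) I_le).
have L0 : 0 <= L by apply: Rint_ge0 => z; rewrite mulr_ge0 ?sqrtr_ge0.
have E (f : R * R -> R) : measurable_fun [set: mR * mR] f -> (forall z, 0 <= f z <= B) ->
    \int[mu1]_z Num.sqrt (\int[mu1]_x f (x, z)) ^+ 2 = \int[mu2]_z f z.
  move=> mf bf; rewrite -(Rint_prod2 (bm _ mf bf)); apply: eq_Rint => z.
  by rewrite sqr_sqrtr //; have /andP[] := a_bound z mf bf.
apply: (@le_trans _ _ ((Num.sqrt (\int[mu2]_z f3 z) * \int[mu1]_z (Num.sqrt (a1 z) * Num.sqrt (a2 z))) ^+ 2)).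
  by rewrite ler_pXn2r ?nnegrE // (le_trans L0).
rewrite exprMn sqr_sqrtr ?A0 // ler_wpM2l ?A0 //.
by apply: le_trans (Rint_CS s1 s2) _; rewrite (E _ m1 b1) (E _ m2 b2).
Qed.

End Product.

End LoomisWhitney.

Section Gagliardo.
Context {R : realType}.
Notation mR := (measurableTypeR R).
Notation mu1 := (@mu1 R).
Notation mu2 := (@mu2 R).
Notation mu3 := (@mu3 R).
Variable psi : point3 R -> R.
Hypothesis tpsi : torus_test psi.

Let Psi (j : 'I_3) z := `|psi z| + `|'D_(basis3 j) psi z|.

Let mPsi j : measurable_fun [set: mpoint3 R] (Psi j).
Proof.
by apply: measurable_funD; apply: measurableT_comp => //; apply: test_measurable => //; exact: test_derive.
Qed.

Let bPsi : exists B, forall j z, 0 <= Psi j z <= B.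
Proof.
have [B0 B00 h0] := test_bounded tpsi.
have [b hb] : exists b : 'I_3 -> R, forall j, 0 <= b j /\ forall x, `|'D_(basis3 j) psi x| <= b j.
  have H j : exists b : R, 0 <= b /\ forall x, `|'D_(basis3 j) psi x| <= b.
    by have [b b0 hb] := test_bounded (test_derive (basis3 j) tpsi); exists b.
  by exists (fun j => projT1 (cid (H j))) => j; case: (cid _).
exists (B0 + \sum_j b j) => j z; rewrite addr_ge0 //= lerD //.
have [_ hj] := hb j; apply: le_trans (hj z) _.
by apply: (@ler_term _ _ b) => k; have [] := hb k.
Qed.

(** The line in direction k, with p holding the other two coordinates, so that the three directions
    share their proofs. *)
Let L (k : nat) (p : R * R) (s : R) : point3 R :=
  if k == 0%N then (s, p.1, p.2) else if k == 1%N then (p.1, s, p.2) else (p.1, p.2, s).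

Let l (k : nat) (v : R) : point3 R := L k (0, 0) v.

Let Laffine k p (h v x : R) : L k p (h *: v + x) = h *: l k v + L k p x.
Proof. by rewrite /L /l /L; case: ifP => _; [|case: ifP => _]; congr (_, _, _); rewrite /= ?scaler0 ?add0r. Qed.

Let Lcont k p : continuous (L k p).
Proof.
move=> s; rewrite /L; case: (k == 0%N); [|case: (k == 1%N)].
- exact: (cvg_pair (cvg_pair (@cvg_id _ (nbhs s)) (cvg_cst _)) (cvg_cst _)).
- exact: (cvg_pair (cvg_pair (cvg_cst _) (@cvg_id _ (nbhs s))) (cvg_cst _)).
exact: (cvg_pair (cvg_cst _) (@cvg_id _ (nbhs s))).
Qed.

Let smooth_line k p : smooth (fun s => psi (L k p s)).
Proof. by have [sp _] := tpsi; exact: (smooth_affine (@Lcont k p) (Laffine k p) sp). Qed.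

Let derive_line k p s : (k < 3)%N -> 'D_1 (fun s => psi (L k p s)) s = 'D_(basis3 (inord k)) psi (L k p s).
Proof.
move=> k3; rewrite (derive_affine (Laffine k p)); congr ('D_ _ _ _).
by rewrite /l /L /basis3 inordK //; move: k k3 => [|[|[|]]].
Qed.

Let per1_line k p : per1 (fun s => psi (L k p s)).
Proof.
have [_ /periodic3P[p1 p2 p3]] := tpsi; move=> s; rewrite /L.
by case: ifP => _; [rewrite p1|case: ifP => _; [rewrite p2|rewrite p3]].
Qed.

Let f k p := \int[mu1]_s Psi (inord k) (L k p s).

Let trace k p s : (k < 3)%N -> `|psi (L k p s)| <= f k p.
Proof.
move=> k3; apply: le_trans (per1_trace (smooth_line k p) (@per1_line k p) s) _.
rewrite le_eqVlt; apply/orP; left; apply/eqP; apply: eq_Rint => r.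
by rewrite /Psi derive_line.
Qed.

Let mL k : measurable_fun [set: (mR * mR) * mR] (fun z : (mR * mR) * mR => Psi (inord k) (L k z.1 z.2)).
Proof.
apply: (measurableT_comp (mPsi (inord k))).
have m11 : measurable_fun [set: mpoint3 R] (fun z => z.1.1) by exact: (measurableT_comp measurable_fst measurable_fst).
have m12 : measurable_fun [set: mpoint3 R] (fun z => z.1.2) by exact: (measurableT_comp measurable_snd measurable_fst).
have m2 : measurable_fun [set: mpoint3 R] (fun z => z.2) by exact: measurable_snd.
rewrite /L; case: (k == 0%N); [|case: (k == 1%N)].
- by apply: measurable_fun_pair; [exact: measurable_fun_pair|].
- by apply: measurable_fun_pair; [exact: measurable_fun_pair|].
by apply: measurable_fun_pair; [exact: measurable_fun_pair|].
Qed.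

Let mf k : measurable_fun [set: mR * mR] (f k).
Proof. exact: (@measurable_Rint _ _ _ _ _ mu1 _ (mL k)). Qed.

Let fB B k : (forall j z, 0 <= Psi j z <= B) -> forall p, 0 <= f k p <= B.
Proof.
move=> bB p; rewrite Rint_ge0 => [|s]; last by have /andP[] := bB (inord k) (L k p s).
rewrite -[leRHS](Rint_cst mu1); apply: Rint_le; last by move=> s; have /andP[] := bB (inord k) (L k p s).
  apply: (@integ_bounded _ _ _ _ _ B); first exact: (measurableT_comp (mL k) (measurable_pair1 p)).
  by move=> s; have /andP[h1 h2] := bB (inord k) (L k p s); rewrite ger0_norm.
exact: integ_cst.
Qed.

Let iPsi j : integ mu3 (Psi j).
Proof.
have [B bB] := bPsi; apply: (@integ_bounded _ _ _ mu3 _ B) => // z.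
by have /andP[h1 h2] := bB j z; rewrite ger0_norm.
Qed.

Let f2E : \int[mu2]_p f 2 p = \int[mu3]_z Psi (inord 2) z.
Proof.
apply: (etrans _ (@Rint_prod _ _ _ _ _ mu2 mu1 _ (iPsi (inord 2)))).
by apply: eq_Rint => p; apply: eq_Rint => s; rewrite /L; case: p.
Qed.

Let ae_int2 B (g : R * R -> R) : measurable_fun [set: mR * mR] g -> (forall p, 0 <= g p <= B) -> integ mu2 g.
Proof.
move=> mg gB; apply: (@integ_bounded _ _ _ mu2 _ B) => // p.
by have /andP[h1 h2] := gB p; rewrite ger0_norm.
Qed.

Let slice j s : integ mu2 (fun p => Psi j (p, s)).
Proof.
have [B bB] := bPsi; apply: (@ae_int2 B) => [|p]; last exact: bB.
exact: (measurableT_comp (mPsi j) (measurable_pair2 s)).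
Qed.

Let f0E : \int[mu2]_p f 0 p = \int[mu3]_z Psi (inord 0) z.
Proof.
have [B bB] := bPsi; have if0 := ae_int2 (mf 0) (fB 0 bB).
apply: (etrans (esym (@Rint_prod2 _ _ _ _ _ mu1 mu1 _ if0))).
apply: (etrans _ (@Rint_prod2 _ _ _ _ _ mu2 mu1 _ (iPsi (inord 0)))).
apply: eq_Rint => z.
by apply: (etrans _ (@Rint_prod2 _ _ _ _ _ mu1 mu1 _ (slice (inord 0) z))).
Qed.

Let f1E : \int[mu2]_p f 1 p = \int[mu3]_z Psi (inord 1) z.
Proof.
have [B bB] := bPsi; have if1 := ae_int2 (mf 1) (fB 1 bB).
apply: (etrans (esym (@Rint_prod2 _ _ _ _ _ mu1 mu1 _ if1))).
apply: (etrans _ (@Rint_prod2 _ _ _ _ _ mu2 mu1 _ (iPsi (inord 1)))).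
apply: eq_Rint => z.
by apply: (etrans _ (@Rint_prod _ _ _ _ _ mu1 mu1 _ (slice (inord 1) z))).
Qed.

(** The embedding of W^(1,1) into L^(3/2). By [trace], |psi| is at most each of three functions f k
    that do not depend on coordinate k. Hence |psi|^(3/2) is at most the square root of their
    product, the integrand of Loomis-Whitney. *)
Lemma gagliardo : (\int[mu3]_z Num.sqrt `|psi z| ^+ 3) ^+ 2 <=
  \int[mu3]_z Psi (inord 2) z * (\int[mu3]_z Psi (inord 0) z * \int[mu3]_z Psi (inord 1) z).
Proof.
have [B bB] := bPsi.
have LW := loomis_whitney (mf 0) (mf 1) (mf 2) (fB 0 bB) (fB 1 bB) (fB 2 bB).
apply: (@le_trans _ _ (\int[mu2]_z f 2 z * (\int[mu2]_z f 0 z * \int[mu2]_z f 1 z))); last first.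
  by rewrite le_eqVlt; apply/orP; left; apply/eqP; congr (_ * (_ * _)); [exact: f2E|exact: f0E|exact: f1E].
apply: le_trans LW.
rewrite ler_pXn2r ?nnegrE //; first last.
- by apply: Rint_ge0 => z; rewrite mulr_ge0 ?sqrtr_ge0.
- by apply: Rint_ge0 => z; rewrite exprn_ge0 ?sqrtr_ge0.
have sq_meas d (X : measurableType d) (g : X -> R) : measurable_fun setT g ->
    measurable_fun setT (fun x => Num.sqrt (g x)).
  move=> mg; apply: (measurableT_comp (f := @Num.sqrt R)) => //.
  by apply: continuous_measurable_fun; exact: sqrt_continuous.
apply: Rint_le => [||z].
- have [C C0 hC] := test_bounded tpsi.
  apply: (@integ_bounded _ _ _ mu3 _ (Num.sqrt C ^+ 3)).
    apply: measurable_funX; apply: sq_meas; apply: measurableT_comp => //.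
    exact: test_measurable.
  move=> z; rewrite ger0_norm ?exprn_ge0 ?sqrtr_ge0 //.
  by rewrite lerXn2r ?nnegrE ?sqrtr_ge0 // ler_wsqrtr.
- exact: (integ_sqrt_prod (mf 0) (mf 1) (mf 2) (fB 0 bB) (fB 1 bB) (fB 2 bB)).
have -> : Num.sqrt `|psi z| ^+ 3 = Num.sqrt `|psi z| * Num.sqrt (`|psi z| * `|psi z|).
  by rewrite sqrtrM // exprSr expr2 mulrAC mulrC mulrA.
apply: ler_pM; rewrite ?sqrtr_ge0 //.
  apply: ler_wsqrtr; have := trace (z.1.1, z.1.2) z.2 (ltnSn 2).
  by case: z => -[].
apply: ler_wsqrtr; apply: ler_pM => //.
  by have := @trace 0 (z.1.2, z.2) z.1.1 isT; case: z => -[].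
by have := @trace 1 (z.1.1, z.2) z.1.2 isT; case: z => -[].
Qed.

End Gagliardo.

(** * Young's inequality and the closing of the gradient estimate *)

Section PowerInequalities.
Context {R : realType}.

(** Either s^2 <= k a^(q-1), and the first term alone is large enough, or the converse bounds a by a
    power of s^2 / k, and the second one is. This gives both coefficients without the usual
    constants. *)
Lemma young_sq (q k a s : R) : 1 < q -> 0 < k -> 0 <= a -> 0 <= s ->
  a * s ^+ 2 <= k * a `^ q + k `^ (- (q - 1)^-1) * s `^ (2 * q / (q - 1)).
Proof.
move=> q1 k0 a0 s0; have q10 : 0 < q - 1 by rewrite subr_gt0.
have qn := lt0r_neq0 q10.
set b := s ^+ 2; have b0 : 0 <= b by exact: sqr_ge0.
have sE : s `^ (2 * q / (q - 1)) = b * b `^ (q - 1)^-1.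
  rewrite /b -powR_mulrn // -powRrM -powRD; last first.
    apply/implyP => /eqP e; have : 0 < 2 + 2 * (q - 1)^-1 by rewrite addr_gt0 ?mulr_gt0 ?invr_gt0.
    by rewrite e ltxx.
  by congr (_ `^ _); field.
have t1 : 0 <= k * a `^ q by rewrite mulr_ge0 ?powR_ge0 // ltW.
have t2 : 0 <= k `^ (- (q - 1)^-1) * (b * b `^ (q - 1)^-1) by rewrite !mulr_ge0 ?powR_ge0.
rewrite sE; case: (leP b (k * a `^ (q - 1))) => H.
  rewrite ler_wpDr // -(powR_split (ltW q1) a0) mulrA mulrC ler_wpM2r //.
rewrite ler_wpDl //.
have ale : a <= k `^ (- (q - 1)^-1) * b `^ (q - 1)^-1.
  have -> : a = (a `^ (q - 1)) `^ (q - 1)^-1 by rewrite -powRrM mulfV // powRr1.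
  have -> : k `^ (- (q - 1)^-1) = k^-1 `^ (q - 1)^-1.
    by rewrite -(mulN1r (q - 1)^-1) powRrM powR_inv1 // ltW.
  rewrite -powRM ?invr_ge0 ?(ltW k0) // ge0_ler_powR ?invr_ge0 ?(ltW q10) ?nnegrE ?powR_ge0 //.
    by rewrite mulr_ge0 ?invr_ge0 ?(ltW k0).
  by rewrite mulrC ler_pdivlMr // mulrC ltW.
apply: le_trans (ler_wpM2r b0 ale) _; rewrite le_eqVlt; apply/orP; left; apply/eqP; ring.
Qed.

Lemma powR_ge1 (a p : R) : 1 <= a -> 0 <= p -> 1 <= a `^ p.
Proof. by move=> a1 p0; rewrite -[leLHS](powRr0 a) ler_powR. Qed.

Lemma sqrt_cube (a : R) : 0 <= a -> Num.sqrt (a * a * a) ^+ 3 = a `^ (9 / 2).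
Proof.
move=> a0; have -> : a * a * a = a `^ 3 by rewrite (powR_mulrn 3 a0) !exprS expr0 mulr1 mulrA.
rewrite -(powR12_sqrt (powR_ge0 _ _)) -(powR_mulrn 3 (powR_ge0 _ _)) -!powRrM.
by congr (_ `^ _); field.
Qed.

Lemma root_compare (mu X : R) : 0 <= X -> (mu `^ (5 / 2)) ^+ 2 <= X ^+ 3 -> mu `^ (5 / 3) <= X.
Proof.
move=> X0; rewrite -(powR_mulrn 2 (powR_ge0 _ _)) -(powR_mulrn 3 X0) -powRrM => H.
have -> : X = (X `^ 3) `^ 3^-1 by rewrite -powRrM mulfV // powRr1.
have -> : mu `^ (5 / 3) = (mu `^ (5 / 2 * 2)) `^ 3^-1 by rewrite -powRrM; congr (_ `^ _); field.
by rewrite ge0_ler_powR ?nnegrE ?powR_ge0.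
Qed.

(** The sum of the constants of the two cases of [sobolev_bootstrap], plus 1 so that it is at least
    1. *)
Definition sob_const (q M : R) :=
  6 * (12 * (M + 1)) `^ (q - 1) + (4 * (M + 1)) `^ ((5 * q - 6) / 2) + 1.

Lemma sob_const_ge1 (q M : R) : 1 <= sob_const q M.
Proof. by rewrite /sob_const lerDr addr_ge0 ?mulr_ge0 ?powR_ge0. Qed.

(** The left side X = mu^(5/3) absorbs the right: the weight k turns the last term into X/4, and (M
    + 1) mu <= X/4 unless mu^(2/3) <= 4 (M + 1), when mu is bounded outright. What remains is X/2 <=
    3 k S, and division by the power of mu in k leaves the exponent (5q - 6)/3. *)
Lemma sobolev_bootstrap (q M S mu : R) : 9 / 5 <= q -> 0 <= M -> 0 <= S -> 1 <= mu ->
  (forall k, 0 < k -> mu `^ (5 / 3) <= (M + 1) * mu + 3 * (k * S +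
     k `^ (- (q - 1)^-1) * ((M + 1) * mu `^ (2 / (q - 1))))) ->
  mu `^ ((5 * q - 6) / 3) <= sob_const q M * (1 + S).
Proof.
move=> q95 M0 S0 mu1 H.
have q10 : 0 < q - 1 by lra.
have qn := lt0r_neq0 q10.
have mu0 : 0 < mu by exact: lt_le_trans mu1.
have M1 : 0 < M + 1 by lra.
pose E := (12 * (M + 1)) `^ (q - 1).
have M12 : 0 < 12 * (M + 1) by rewrite mulr_gt0.
have E0 : 0 < E by exact: powR_gt0.
have pD (x y : R) : mu `^ x * mu `^ y = mu `^ (x + y).
  by rewrite powRD //; apply/implyP => _; exact: lt0r_neq0.
(* The exponent for which k^(-1/(q-1)) mu^(2/(q-1)) is proportional to mu^(5/3); the factor E makes
   the proportion 1/12 after multiplication by M + 1. *)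
pose d := (11 - 5 * q) / 3.
have k0 : 0 < E * mu `^ d by rewrite mulr_gt0 ?powR_gt0.
have kE : (E * mu `^ d) `^ (- (q - 1)^-1) = (12 * (M + 1))^-1 * mu `^ (- d / (q - 1)).
  rewrite powRM ?powR_ge0 // /E -!powRrM; congr (_ * _ `^ _); last by rewrite mulrN mulNr.
  by rewrite mulrN divff // powR_inv1 // ltW.
have := H _ k0; rewrite kE.
have -> : (12 * (M + 1))^-1 * mu `^ (- d / (q - 1)) * ((M + 1) * mu `^ (2 / (q - 1))) =
    12^-1 * mu `^ (5 / 3).
  have -> : 5 / 3 = - d / (q - 1) + 2 / (q - 1) by rewrite /d; field.
  by rewrite -pD; field; exact: lt0r_neq0.
have XE : mu `^ (5 / 3) = mu `^ d * mu `^ ((5 * q - 6) / 3).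
  by rewrite pD; congr (_ `^ _); rewrite /d; field.
have X2 : mu `^ (5 / 3) = mu * mu `^ (2 / 3).
  transitivity (mu `^ 1 * mu `^ (2 / 3)); last by rewrite powRr1 // ltW.
  by rewrite pD; congr (_ `^ _); field.
set X := mu `^ (5 / 3) in XE X2 *; set Z := mu `^ d in XE *.
have Z0 : 0 < Z by exact: powR_gt0.
set W := mu `^ ((5 * q - 6) / 3) in XE *; set U := mu `^ (2 / 3) in X2.
move=> main.
have main' : 3 / 4 * X <= (M + 1) * mu + 3 * (E * Z * S) by lra.
rewrite /sob_const -/E; set V := _ `^ ((5 * q - 6) / 2).
have V0 : 0 <= V by exact: powR_ge0.
have ES : 0 <= E * S by rewrite mulr_ge0 // ltW.
case: (leP U (4 * (M + 1))) => HU.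
  have WV : W <= V.
    have -> : W = U `^ ((5 * q - 6) / 2) by rewrite /W /U -powRrM; congr (_ `^ _); field.
    by apply: ge0_ler_powR; rewrite ?nnegrE ?powR_ge0 ?mulr_ge0 ?(ltW M1) //; lra.
  have VS : 0 <= V * S by rewrite mulr_ge0.
  nra.
have mX : (M + 1) * mu <= X / 4.
  rewrite X2 mulrC -mulrA ler_pM2l // ler_pdivlMr //; lra.
have : Z * W <= Z * (6 * (E * S)).
  rewrite -XE; have -> : Z * (6 * (E * S)) = 6 * (E * Z * S) by ring.
  lra.
rewrite ler_pM2l // => WE.
have VS : 0 <= V * S by rewrite mulr_ge0.
nra.
Qed.

End PowerInequalities.

(** * Moments of the velocity from its energy and gradient *)

Section Sobolev.
Context {R : realType}.
Notation mu3 := (@mu3 R).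

Lemma integ_test_pow (w : point3 R -> R) p : 0 <= p -> torus_test w -> integ mu3 (fun x => `|w x| `^ p).
Proof.
move=> p0 tw; have [M M0 wM] := test_bounded tw.
apply: (@integ_bounded _ _ _ mu3 _ (M `^ p)); first by apply: measurable_pow; exact: test_measurable.
by move=> x; rewrite ger0_norm ?powR_ge0 // ge0_ler_powR ?nnegrE.
Qed.

Lemma derive_cube (w : point3 R -> R) v x : torus_test w ->
  'D_v (fun x => w x * w x * w x) x = 3 * w x ^+ 2 * 'D_v w x.
Proof.
move=> [sw _]; have d y : derivable w y v by exact: smooth_derivable.
have d2 : derivable (fun x => w x * w x) x v by exact: (smooth_derivable x v (smoothM sw sw)).
rewrite (@deriveM _ _ (fun x => w x * w x) w x v d2 (d x)) (@deriveM _ _ w w x v (d x) (d x)).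
by rewrite /GRing.scale /=; ring.
Qed.

(** Gagliardo's inequality for w^3 controls Y = int |w|^(9/2). Since grad(w^3) = 3 w^2 grad w,
    [young_sq] brings in int |w|^r with r = 2q/(q-1), to be interpolated between the exponents 2 and
    9/2: r <= 9/2 amounts to q >= 9/5. With mu = Y^(2/5), every moment involved is at most (M + 1)
    mu^(rho-2), so the inequality closes in mu alone. *)
Lemma sobolev_test (q M S : R) (w : point3 R -> R) : 9 / 5 <= q -> torus_test w ->
  \int[mu3]_x w x ^+ 2 <= M -> (forall j, \int[mu3]_x `|'D_(basis3 j) w x| `^ q <= S) ->
  \int[mu3]_x `|w x| `^ (2 * q / (q - 1)) <=
    (M + 1) * ((sob_const q M * (1 + S)) `^ (3 / (5 * q - 6))) `^ (2 / (q - 1)).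
Proof.
move=> q95 tw wM DS.
have q10 : 0 < q - 1 by lra.
have qn := lt0r_neq0 q10.
have b0 : 0 < 5 * q - 6 by lra.
have bn := lt0r_neq0 b0.
have M0 : 0 <= M by apply: le_trans wM; apply: Rint_ge0 => x; exact: sqr_ge0.
have S0 : 0 <= S by apply: le_trans (DS ord0); apply: Rint_ge0 => x; exact: powR_ge0.
pose r := 2 * q / (q - 1).
have r2E : r - 2 = 2 / (q - 1) by rewrite /r; field.
have r2 : 2 <= r by rewrite -subr_ge0 r2E divr_ge0 // ltW.
have r92 : r <= 9 / 2 by rewrite /r ler_pdivrMr //; lra.
pose Y := \int[mu3]_x `|w x| `^ (9 / 2).
have Y0 : 0 <= Y by apply: Rint_ge0 => x; exact: powR_ge0.
have ip p : 0 <= p -> integ mu3 (fun x => `|w x| `^ p) by move=> p0; exact: integ_test_pow.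
(* [pow_split] between 2 and 9/2: the part below l contributes at most M l^(rho-2), and the part
   above at most l^(rho-9/2) Y, which the assumption on Y reduces to l^(rho-2). *)
have interp rho l : 2 <= rho -> rho <= 9 / 2 -> 0 < l -> Y <= l `^ (5 / 2) ->
    \int[mu3]_x `|w x| `^ rho <= (M + 1) * l `^ (rho - 2).
  move=> rh2 rh9 l0 Yl.
  have i9 : integ mu3 (fun x => `|w x| `^ (9 / 2)) by apply: ip; lra.
  have irho : integ mu3 (fun x => `|w x| `^ rho) by apply: ip; lra.
  have i2 : integ mu3 (fun x => `|w x| `^ 2) by exact: ip.
  apply: le_trans (Rint_le irho (integD (integZ (l `^ (rho - 2)) i2) (integZ (l `^ (rho - 9 / 2)) i9))
    (fun x => pow_split rh2 rh9 (ltr0Sn R 1) l0 (normr_ge0 (w x)))) _.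
  rewrite RintD; [|exact: integZ|exact: integZ]; rewrite !RintZ // -/Y.
  have -> : \int[mu3]_x `|w x| `^ 2 = \int[mu3]_x w x ^+ 2 by apply: eq_Rint => x; rewrite powR2.
  have lE : l `^ (rho - 2) = l `^ (rho - 9 / 2) * l `^ (5 / 2).
    rewrite -powRD; last by apply/implyP => _; exact: lt0r_neq0.
    by congr (_ `^ _); field.
  have h1 : l `^ (rho - 2) * \int[mu3]_x w x ^+ 2 <= l `^ (rho - 2) * M by rewrite ler_wpM2l ?powR_ge0.
  have h2 : l `^ (rho - 9 / 2) * Y <= l `^ (rho - 2) by rewrite lE ler_wpM2l ?powR_ge0.
  have -> : (M + 1) * l `^ (rho - 2) = l `^ (rho - 2) * M + l `^ (rho - 2) by ring.
  exact: lerD.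
pose la := (sob_const q M * (1 + S)) `^ (3 / (5 * q - 6)).
have c1 : 1 <= sob_const q M * (1 + S).
  by rewrite -[leLHS]mulr1; apply: ler_pM => //; [exact: sob_const_ge1|rewrite lerDl].
have la1 : 1 <= la.
  by apply: powR_ge1 => //; rewrite divr_ge0 // ltW.
have la0 : 0 < la by exact: lt_le_trans la1.
suff Yl : Y <= la `^ (5 / 2) by rewrite -r2E; exact: interp.
case: (leP Y 1) => Y1.
  by apply: le_trans Y1 _; apply: powR_ge1 => //; lra.
pose mu := Y `^ (2 / 5).
have mu1 : 1 <= mu.
  by apply: powR_ge1; [exact: ltW|lra].
have mu0 : 0 < mu by exact: lt_le_trans mu1.
have YE : Y = mu `^ (5 / 2).
  by rewrite /mu -powRrM -[LHS]powRr1 //; congr (_ `^ _); field.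
suff mula : mu <= la by rewrite YE ge0_ler_powR ?nnegrE ?(ltW mu0) ?(ltW la0) //; lra.
suff H : mu `^ ((5 * q - 6) / 3) <= sob_const q M * (1 + S).
  have -> : mu = (mu `^ ((5 * q - 6) / 3)) `^ (3 / (5 * q - 6)).
    by rewrite -powRrM -[LHS]powRr1 ?(ltW mu0) //; congr (_ `^ _); field.
  by rewrite ge0_ler_powR ?nnegrE ?powR_ge0 ?divr_ge0 ?(ltW b0) // (le_trans ler01).
apply: sobolev_bootstrap => // k k0.
clear la c1 la1 la0 Y1.
pose X := (M + 1) * mu + 3 * (k * S + k `^ (- (q - 1)^-1) * ((M + 1) * mu `^ (2 / (q - 1)))).
rewrite -/X.
pose psi x := w x * w x * w x.
have tpsi : torus_test psi by exact: testM (testM tw tw) tw.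
have NX j : \int[mu3]_x (`|psi x| + `|'D_(basis3 j) psi x|) <= X.
  have tD := test_derive (basis3 j) tw.
  have i3 : integ mu3 (fun x => `|w x| `^ 3) by exact: ip.
  have ir : integ mu3 (fun x => `|w x| `^ r) by apply: ip; exact: le_trans r2.
  have iq : integ mu3 (fun x => `|'D_(basis3 j) w x| `^ q) by apply: integ_test_pow => //; lra.
  have ipsi : integ mu3 (fun x => `|psi x| + `|'D_(basis3 j) psi x|).
    by apply: integD; apply/integ_abs/test_integ => //; exact: test_derive.
  have ib := integD i3 (integZ 3 (integD (integZ k iq) (integZ (k `^ (- (q - 1)^-1)) ir))).
  apply: le_trans (Rint_le ipsi ib _) _ => [x|].
    rewrite derive_cube // /psi; apply: lerD.
      by rewrite !normrM -{1 2 3}[`|w x|]powRr1 // powR_mulrn // !powRr1 // !exprS expr0 mulr1 mulrA.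
    rewrite normrM (normrM 3) normrX ger0_norm // -mulrA (mulrC (_ ^+ 2)) ler_wpM2l //.
    apply: young_sq => //; lra.
  rewrite RintD //; last by apply: integZ; apply: integD; exact: integZ.
  rewrite RintZ; last by apply: integD; exact: integZ.
  rewrite RintD; [|exact: integZ|exact: integZ]; rewrite !RintZ //.
  rewrite /X; apply: lerD.
    have e1 : 3 - 2 = 1 :> R by ring.
    have := interp 3 mu; rewrite e1 powRr1 ?(ltW mu0) //; apply => //; [lra|lra|by rewrite YE].
  rewrite ler_wpM2l //; apply: lerD; rewrite ler_wpM2l ?powR_ge0 ?(ltW k0) //.
  by rewrite -r2E; apply: interp => //; rewrite YE.
have X0 : 0 <= X by apply: le_trans (NX ord0); apply: Rint_ge0 => x; rewrite addr_ge0.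
have YX : Y ^+ 2 <= X ^+ 3.
  have G := gagliardo tpsi.
  have -> : Y = \int[mu3]_x Num.sqrt `|psi x| ^+ 3.
    by apply: eq_Rint => x; rewrite /psi !normrM sqrt_cube.
  apply: le_trans G _; have N0 j : 0 <= \int[mu3]_x (`|psi x| + `|'D_(basis3 j) psi x|).
    by apply: Rint_ge0 => x; rewrite addr_ge0.
  have -> : X ^+ 3 = X * (X * X) by rewrite !exprS expr0 mulr1.
  apply: ler_pM => //; first exact: mulr_ge0.
  exact: ler_pM.
by apply: root_compare => //; rewrite -YE.
Qed.

End Sobolev.

Section Truncation.
Context {R : realType}.

Lemma sob_exponents (q : R) : 9 / 5 <= q -> [/\ 1 < q, 0 < q - 1, 0 < 5 * q - 6 & 1 <= 2 * q / (q - 1)].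
Proof.
move=> q95; have q10 : 0 < q - 1 by lra.
by split; rewrite ?ler_pdivlMr //; lra.
Qed.

Lemma double_sum3 (a : R) (d : 'I_3 -> R) :
  \sum_i \sum_j 2 * (a + d i + d j) = 18 * a + 12 * \sum_i d i.
Proof. by rewrite !sum3E; ring. Qed.

(** The tangent inequality at the truncated value m, where the slope is at most r k^(r-1).
    Truncation thus makes closeness in L^1 enough to compare r-th powers. *)
Lemma truncated_pow_le (r a b k : R) : 1 <= r -> 0 <= a -> 0 <= b -> 0 <= k ->
  Num.min a k `^ r <= b `^ r + r * k `^ (r - 1) * `|a - b|.
Proof.
move=> r1 a0 b0 k0; set m := Num.min a k.
have m0 : 0 <= m by rewrite le_min a0.
have ma : m <= a by rewrite ge_min lexx.
have mk : m <= k by rewrite ge_min lexx orbT.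
have r0 : 0 <= r by exact: le_trans r1.
have h1 := powR_tangent r1 b0 m0.
have h2 : m `^ (r - 1) * m <= m `^ (r - 1) * (b + `|a - b|).
  rewrite ler_wpM2l ?powR_ge0 // (le_trans ma) // -lerBlDl; exact: ler_norm.
have h3 : m `^ (r - 1) * `|a - b| <= k `^ (r - 1) * `|a - b|.
  by rewrite ler_wpM2r // ge0_ler_powR ?nnegrE ?subr_ge0.
move: h1 h2; rewrite -(powR_split r1 m0) => h1 h2.
have h4 := ler_wpM2l r0 h2; have h5 := ler_wpM2l r0 h3.
move: h1 h4 h5 {h2 h3}; move: (m `^ _) (k `^ _) (b `^ _) `|_| => P Q B D; lra.
Qed.

End Truncation.

Section SobolevWeak.
Context {R : realType}.
Notation mu3 := (@mu3 R).

Lemma integ_pow_truncation (r B : R) (v : point3 R -> R) : 0 < r -> measurable_fun [set: mpoint3 R] v ->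
  (forall k : nat, \int[mu3]_x (Num.min `|v x| k%:R `^ r) <= B) ->
  integ mu3 (fun x => `|v x| `^ r) /\ \int[mu3]_x `|v x| `^ r <= B.
Proof.
move=> r0 mv H.
pose b (k : nat) x := Num.min `|v x| k%:R `^ r.
have min0 k x : 0 <= Num.min `|v x| k%:R by rewrite le_min normr_ge0 ler0n.
have mb k : measurable_fun [set: mpoint3 R] (b k).
  apply: (measurableT_comp (measurable_powR _)).
  by apply: measurable_minr => //; exact: measurableT_comp.
have ib k : integ mu3 (b k).
  apply: (@integ_bounded _ _ _ mu3 _ (k%:R `^ r)) => // x.
  rewrite ger0_norm ?powR_ge0 // (ge0_ler_powR (ltW r0)) ?nnegrE ?ler0n //.
  by rewrite ge_min lexx orbT.
have mbE k : measurable_fun [set: mpoint3 R] (fun x => (b k x)%:E) by exact/measurable_EFinP.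
have b0 k x : setT x -> (0 <= (b k x)%:E)%E by move=> _; rewrite lee_fin powR_ge0.
have bhomo x : setT x -> {homo (fun k => (b k x)%:E) : n m / (n <= m)%N >-> (n <= m)%E}.
  move=> _ n m nm; rewrite lee_fin (ge0_ler_powR (ltW r0)) ?nnegrE //.
  by rewrite le_min ge_min lexx /= ge_min ler_nat nm orbT.
have := @cvg_monotone_convergence _ _ _ mu3 setT measurableT (fun k x => (b k x)%:E) mbE b0 bhomo.
have limE x : limn (fun k => (b k x)%:E) = (`|v x| `^ r)%:E.
  apply: cvg_lim => //; apply: cvg_near_cst.
  exists (Num.bound `|v x|) => // k /= Nk; rewrite /b min_l //.
  apply: le_trans (ltW (archi_boundP (normr_ge0 _))) _; by rewrite ler_nat.
under [in X in _ --> X]eq_integral do rewrite limE.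
move=> L; have LB : (\int[mu3]_x (`|v x| `^ r)%:E <= B%:E)%E.
  apply: (cvge_to_le L); near=> k; rewrite -EFin_Rint // lee_fin; exact: H.
have iv : integ mu3 (fun x => `|v x| `^ r).
  apply: ge0_integ => [|x|]; [exact: measurable_pow|exact: powR_ge0|].
  exact: le_lt_trans LB (ltry _).
by split=> //; rewrite -lee_fin EFin_Rint.
Unshelve. all: by end_near.
Qed.

Definition sob_bound (q M S : R) :=
  (M + 1) * ((sob_const q M * (1 + S)) `^ (3 / (5 * q - 6))) `^ (2 / (q - 1)).

(** The bound holds for the mollifications of v. As v is not yet known to lie in L^r, they are
    compared with v in L^1 only: truncations of v inherit the bound in the limit, and monotone
    convergence removes the truncation. *)
Lemma sobolev_weak (q M S : R) (v : point3 R -> R) (g : 'I_3 -> point3 R -> R) : 9 / 5 <= q ->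
  periodic3 v -> sqint mu3 v -> \int[mu3]_x v x ^+ 2 <= M ->
  (forall j, [/\ wpart j v (g j), periodic3 (g j), measurable_fun [set: mpoint3 R] (g j) &
     integ mu3 (fun x => `|g j x| `^ q)]) ->
  (forall j, \int[mu3]_x `|g j x| `^ q <= S) ->
  integ mu3 (fun x => `|v x| `^ (2 * q / (q - 1))) /\
  \int[mu3]_x `|v x| `^ (2 * q / (q - 1)) <= sob_bound q M S.
Proof.
move=> q95 pv sv vM gH gS.
have q10 : 0 < q - 1 by lra.
have q1 : 1 <= q by lra.
set r := 2 * q / (q - 1).
have r1 : 1 <= r by rewrite /r ler_pdivlMr //; lra.
have r0 : 0 < r by exact: lt_le_trans r1.
have vi : integ mu3 v by exact: sqint_integ.
have [mv v2] := sv.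
have vp2 : integ mu3 (fun x => `|v x| `^ 2) by apply: eq_integ v2 => x; rewrite powR2.
have vp1 : integ mu3 (fun x => `|v x| `^ 1) by apply: eq_integ (integ_abs vi) => x; rewrite powRr1.
pose w n := conv (kern n) (v : point3 R -> R).
have tw n : torus_test (w n) by exact: conv_test (kern_test n) vi.
have wM n : \int[mu3]_x w n x ^+ 2 <= M.
  apply: le_trans vM; have := conv_pow_le (ler1n R 2) pv mv vp2 n.
  by under eq_Rintegral do rewrite powR2; under [X in _ <= X -> _]eq_Rintegral do rewrite powR2.
have DS n j : \int[mu3]_x `|'D_(basis3 j) (w n) x| `^ q <= S.
  have [wj pj mj ij] := gH j; apply: le_trans (gS j).
  have := conv_pow_le q1 pj mj ij n; apply: le_trans; rewrite le_eqVlt; apply/orP; left; apply/eqP.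
  by apply: eq_Rint => x; rewrite (wpart_conv x (kern_test n) wj).
have wr n := sobolev_test q95 (tw n) (wM n) (DS n).
apply: integ_pow_truncation => // k.
pose c := r * k%:R `^ (r - 1).
have c0 : 0 <= c by rewrite mulr_ge0 ?powR_ge0 // ltW.
have iwv n : integ mu3 (fun x => `|v x - w n x|) by apply/integ_abs/integB => //; exact: test_integ.
have main n : \int[mu3]_x (Num.min `|v x| k%:R `^ r) <= sob_bound q M S + c * \int[mu3]_x `|w n x - v x| `^ 1.
  have iw : integ mu3 (fun x => `|w n x| `^ r) by apply: integ_test_pow => //; exact: ltW.
  have it : integ mu3 (fun x => Num.min `|v x| k%:R `^ r).
    apply: (@integ_bounded _ _ _ mu3 _ (k%:R `^ r)) => [|x].
      apply: (measurableT_comp (measurable_powR _)).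
      by apply: measurable_minr => //; exact: measurableT_comp.
    rewrite ger0_norm ?powR_ge0 // (ge0_ler_powR (ltW r0)) ?nnegrE ?ler0n ?le_min ?normr_ge0 ?ler0n //.
    by rewrite ge_min lexx orbT.
  apply: (@le_trans _ _ (\int[mu3]_x (`|w n x| `^ r + c * `|v x - w n x|))).
    apply: Rint_le => // [|x]; first by apply: integD => //; exact: integZ.
    apply: le_trans (truncated_pow_le r1 (normr_ge0 _) (normr_ge0 (w n x)) (ler0n _ k)) _.
    by rewrite lerD2l ler_wpM2l // ler_dist_dist.
  rewrite RintD //; last exact: integZ.
  rewrite RintZ //; apply: lerD; first exact: wr.
  rewrite ler_wpM2l // le_eqVlt; apply/orP; left; apply/eqP; apply: eq_Rint => x.
  by rewrite powRr1 // distrC.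
have L := conv_pow_cvg (lexx 1) pv mv vp1.
have L' : sob_bound q M S + c * \int[mu3]_x `|w n x - v x| `^ 1 @[n --> \oo] --> sob_bound q M S + c * 0.
  by apply: cvgD; [exact: cvg_cst|apply: cvgM; [exact: cvg_cst|exact: L]].
rewrite mulr0 addr0 in L'.
by apply: (cvgr_to_ge L'); near=> n; exact: main.
Unshelve. all: by end_near.
Qed.

(** 18 is twice the number of index pairs. In 72 = 12 * 3 * 2, the 12 is twice the six occurrences
    of each [d i] in the double sum, 3 counts the components, and 2 comes from [davg_le]. *)
Definition flux_const (q M : R) :=
  18 + 72 * (2 `^ (2 * q / (q - 1)) * ((M + 1) * (sob_const q M `^ (3 / (5 * q - 6) * (2 / (q - 1)))))).

(* The weight balances the two terms of the Young inequality behind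
   [flux_sobolev_bound]: both become of order (1 + S) ^ (5 / (5 q - 6)). *)
Lemma flux_const_le (q M S D : R) : 9 / 5 <= q -> 0 <= M -> 0 <= S ->
  D <= 3 * (2 `^ (2 * q / (q - 1)) * (2 * sob_bound q M S)) ->
  18 * ((1 + S) `^ (5 / (5 * q - 6) - 1) * S) +
  12 * (((1 + S) `^ (5 / (5 * q - 6) - 1)) `^ (- (q - 1)^-1) * D) <=
    flux_const q M * (1 + S) `^ (5 / (5 * q - 6)).
Proof.
move=> q95 M0 S0 DB; set k := _ `^ (_ - 1); have [_ q10 b0 _] := sob_exponents q95.
have qn := lt0r_neq0 q10; have bn := lt0r_neq0 b0.
have S1 : 0 < 1 + S by rewrite ltr_pwDl.
have pD (x y : R) : (1 + S) `^ x * (1 + S) `^ y = (1 + S) `^ (x + y).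
  by rewrite powRD //; apply/implyP => _; exact: lt0r_neq0.
set X := (1 + S) `^ (5 / (5 * q - 6)).
have h1 : k * S <= X.
  apply: (@le_trans _ _ (k * (1 + S))); first by rewrite ler_wpM2l ?powR_ge0 // lerDr.
  have -> : k * (1 + S) = k * (1 + S) `^ 1 by rewrite powRr1 // ltW.
  by rewrite /k pD subrK.
have c1 : 0 <= sob_const q M by apply: le_trans (sob_const_ge1 q M).
pose th := 3 / (5 * q - 6) * (2 / (q - 1)).
have bE : sob_bound q M S = (M + 1) * (sob_const q M `^ th * (1 + S) `^ th).
  by rewrite /sob_bound -powRrM powRM // ltW.
have h2 : k `^ (- (q - 1)^-1) * (1 + S) `^ th = X.
  by rewrite /k -powRrM pD /X /th; congr (_ `^ _); field; rewrite qn bn.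
have kp : 0 <= k `^ (- (q - 1)^-1) by exact: powR_ge0.
have h3 := ler_wpM2l kp DB.
move: h3; rewrite bE /flux_const -/th; set K := k `^ _ in h2 *; set Z := (1 + S) `^ th in h2 *.
set P := 2 `^ _; set Q := sob_const q M `^ th.
have -> : K * (3 * (P * (2 * ((M + 1) * (Q * Z))))) = 6 * (P * ((M + 1) * Q)) * (K * Z) by ring.
rewrite h2; move: h1; move: (P * _) (k * S) (K * D) => U V W h1 h3.
by rewrite mulrDl; lra.
Qed.

Section FluxSobolev.
Variables (q M S : R) (v : 'I_3 -> point3 R -> R) (g : 'I_3 -> 'I_3 -> point3 R -> R).
Hypotheses (q95 : 9 / 5 <= q)
  (pv : forall i, periodic3 (v i)) (sv : forall i, sqint mu3 (v i)) (wv : wdiv v)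
  (vM : forall i, \int[mu3]_x v i x ^+ 2 <= M)
  (gH : forall i j, [/\ wpart j (v i) (g i j), periodic3 (g i j),
     measurable_fun [set: mpoint3 R] (g i j) & integ mu3 (fun x => `|g i j x| `^ q)])
  (gS : forall i j, \int[mu3]_x `|g i j x| `^ q <= S).
Let r := 2 * q / (q - 1).

Let q1 : 1 < q. Proof. by case: (sob_exponents q95). Qed.
Let q10 : 0 < q - 1. Proof. by case: (sob_exponents q95). Qed.
Let r1 : 1 <= r. Proof. by case: (sob_exponents q95). Qed.
Let S0 : 0 <= S. Proof. by apply: le_trans (gS ord0 ord0); apply: Rint_ge0 => x; exact: powR_ge0. Qed.
Let M0 : 0 <= M. Proof. by apply: le_trans (vM ord0); apply: Rint_ge0 => x; exact: sqr_ge0. Qed.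
Let vr i : integ mu3 (fun x => `|v i x| `^ r) /\ \int[mu3]_x `|v i x| `^ r <= sob_bound q M S.
Proof. exact: (sobolev_weak q95 (pv i) (sv i) (vM i) (gH i) (gS i)). Qed.
Let mv i : measurable_fun [set: mpoint3 R] (v i). Proof. by have [] := sv i. Qed.
Let d i n := davg r (v i) n.

Lemma flux_sobolev_bound n k : 0 < k ->
  `|flux n v| <= 18 * (k * S) + 12 * (k `^ (- (q - 1)^-1) * \sum_i d i n).
Proof.
move=> k0; have [vi _] := wv.
pose c := k `^ (- (q - 1)^-1); have c0 : 0 <= c by exact: powR_ge0.
rewrite (fluxE n sv wv).
have term i j : `|\int[mu3]_x ('D_(basis3 j) (conv (kern n) (v i)) x * cov n (v i) (v j) x)| <=
    2 * (k * S + c * d i n + c * d j n).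
  have [wij pij mij iij] := gH i j.
  have tA : torus_test ('D_(basis3 j) (conv (kern n) (v i))).
    by apply/test_derive/conv_test => //; exact: kern_test.
  (* By a s t <= (a s^2 + a t^2) / 2, with [young_sq] applied to each half. *)
  have young a s t : 0 <= a -> 0 <= s -> 0 <= t -> a * (s * t) <= k * a `^ q + c * s `^ r + c * t `^ r.
    move=> a0 s0 t0.
    have hs := young_sq q1 k0 a0 s0; have ht := young_sq q1 k0 a0 t0.
    have cs : 0 <= c * s `^ r by rewrite mulr_ge0 ?powR_ge0.
    have ct : 0 <= c * t `^ r by rewrite mulr_ge0 ?powR_ge0.
    have st : a * (s * t) <= 2^-1 * (a * s ^+ 2 + a * t ^+ 2).
      have := mulr_ge0 a0 (sqr_ge0 (s - t)); lra.
    rewrite -/c -/r in hs ht.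
    move: hs ht cs ct st; move: (c * s `^ r) (c * t `^ r) (k * a `^ q) => X Y Z; lra.
  apply: le_trans (flux_bound n tA (pv i) (sv i) (pv j) (sv j) (vi i) (vi j) (ltW q1) r1 r1
    (vr i).1 (vr j).1 young) _.
  rewrite ler_wpM2l // -/(d i n) -/(d j n) !lerD2r ler_wpM2l ?(ltW k0) //.
  apply: le_trans (gS i j); apply: le_trans (conv_pow_le (ltW q1) pij mij iij n).
  rewrite le_eqVlt; apply/orP; left; apply/eqP; apply: eq_Rint => x.
  by rewrite (wpart_conv x (kern_test n) wij).
apply: le_trans (ler_norm_sum _ _ _) _.
apply: (@le_trans _ _ (\sum_i \sum_j 2 * (k * S + c * d i n + c * d j n))).
  apply: ler_sum => i _; apply: le_trans (ler_norm_sum _ _ _) _.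
  by apply: ler_sum => j _; exact: term.
by rewrite (double_sum3 _ (fun i => c * d i n)) -mulr_sumr.
Qed.

Let d0 i n : 0 <= d i n. Proof. exact: davg_ge0. Qed.

Lemma flux_sobolev_cvg0 : flux n v @[n --> \oo] --> 0.
Proof.
have : \sum_i d i n @[n --> \oo] --> 0.
  have := @cvgn_sum R _ (index_enum 'I_3) (fun i n => d i n) (fun=> 0)
    (fun i => davg_cvg0 r1 (pv i) (mv i) (vr i).1).
  by rewrite (big1 _ xpredT).
move=> L; apply/cvgrPdist_le => /= e e0.
pose k := e / (36 * (S + 1)).
have S1 : 0 < S + 1 by rewrite ltr_wpDl.
have k0 : 0 < k by rewrite divr_gt0 ?mulr_gt0.
pose c := k `^ (- (q - 1)^-1); have c0 : 0 < c by exact: powR_gt0.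
have ce : 0 < e / (24 * c) by rewrite divr_gt0 ?mulr_gt0.
move/cvgrPdist_le : L => /(_ _ ce)[N _ HN]; exists N => // n /HN /=.
rewrite !sub0r !normrN ger0_norm; last exact: sumr_ge0.
move=> Sn; apply: le_trans (flux_sobolev_bound n k0) _; rewrite -/c.
have h1 : 18 * (k * S) <= e / 2.
  have -> : e / 2 = 18 * (k * (S + 1)) by rewrite /k; field; rewrite gt_eqF.
  by rewrite ler_wpM2l // ler_wpM2l ?(ltW k0) // lerDl.
have h2 : 12 * (c * \sum_i d i n) <= e / 2.
  have -> : e / 2 = 12 * (c * (e / (24 * c))) by field; rewrite gt_eqF.
  by rewrite ler_wpM2l // ler_wpM2l // ltW.
by move: h1 h2; lra.
Qed.

Lemma flux_sobolev_le n : `|flux n v| <= flux_const q M * (1 + S) `^ (5 / (5 * q - 6)).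
Proof.
have [_ _ b0 _] := sob_exponents q95.
have S1 : 0 < 1 + S by rewrite ltr_pwDl.
have dn i : d i n <= 2 `^ r * (2 * sob_bound q M S).
  apply: le_trans (davg_le r1 (pv i) (mv i) (vr i).1 n) _.
  by rewrite ler_wpM2l ?powR_ge0 // ler_wpM2l // (vr i).2.
have Sd : \sum_i d i n <= 3 * (2 `^ r * (2 * sob_bound q M S)).
  by apply: le_trans (ler_sum _ (fun i _ => dn i)) _; rewrite sumr_const card_ord (mulr_natl _ 3).
have k0 : 0 < (1 + S) `^ (5 / (5 * q - 6) - 1) by exact: powR_gt0.
apply: le_trans (flux_sobolev_bound n k0) _.
exact: flux_const_le.
Qed.

End FluxSobolev.

End SobolevWeak.

(** * The energy equality *)

Section GradientCase.
Context {R : realType}.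
Notation mu3 := (@mu3 R).
Variables (T : R) (u : R -> point3 R -> 'rV[R]_3) (A : R -> point3 R -> 'M[R]_(3, 2)).
Hypotheses (T0 : 0 < T) (uw : weak_solution T u A) (uc : weakly_continuous T u).
Notation vel := (vel T u).

(** The relation between p and q makes p/q equal to the power of 1 + S in [flux_sobolev_le], and the
    power p/q of int |grad u|^q is what the hypothesis makes integrable in time. *)
Lemma grad_exponents (p q : R) : 1 / p + 6 / (5 * q) = 1 -> 9 / 5 <= q ->
  [/\ 0 < p, 0 < q & p / q = 5 / (5 * q - 6)].
Proof.
move=> pq q95; have q0 : 0 < q by lra.
have b0 : 0 < 5 * q - 6 by lra.
have qn := lt0r_neq0 q0; have bn := lt0r_neq0 b0.
have pV : p^-1 = (5 * q - 6) / (5 * q).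
  have -> : p^-1 = 1 - 6 / (5 * q) by have := congr1 (fun x => x - 6 / (5 * q)) pq; rewrite addrK div1r.
  by field.
have p0 : 0 < p by rewrite -invr_gt0 pV divr_gt0 // mulr_gt0.
split=> //; rewrite -[p]invrK pV invf_div; field; by rewrite bn qn.
Qed.

Lemma flux_dominated_grad (p q : R) (gu : R -> point3 R -> 'M[R]_3) :
  1 / p + 6 / (5 * q) = 1 -> 9 / 5 <= q -> weak_grad T u gu -> LpLq T p%:E q%:E gu ->
  flux_dominated T vel.
Proof.
move=> pq q95 wg gL; have [p0 q0 pE] := grad_exponents pq q95.
have [M vM] := vel_bound T0 uw uc.
have M0 : 0 <= M by apply: le_trans (vM 0 ord0); apply: Rint_ge0 => x; exact: sqr_ge0.
pose F := tpatch T (fun=> 0) gu.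
pose S t := \int[mu3]_x (enorm (F t x) `^ q).
have S0 t : 0 <= S t by apply: Rint_ge0 => x; exact: powR_ge0.
pose a := p / q; have a0 : 0 < a by exact: divr_gt0.
pose C := flux_const q M.
exists (fun t => C * (2 `^ a * (1 + S t `^ a))).
  apply: integZ; apply: integZ; apply: integD; first exact: integ_cst.
  exact: LpLq_integ_time gL.
have := muT_ae_itv T; move: (ae_muT wg) (LpLq_ae_integ p0 q0 gL).
apply: filterS3 => t wt Fi t0; have /andP[t1 t2] := t0.
have cs : clamp T t = t by rewrite (clampE (ltW t1) (ltW t2)).
have mF i j : measurable_fun [set: mpoint3 R] (fun x => F t x i j).
  exact: (measurableT_comp (measurable_tpatch_entry gL i j) (measurable_pair1 t)).
have le i j x : `|F t x i j| `^ q <= enorm (F t x) `^ q.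
  by rewrite (ge0_ler_powR (ltW q0)) ?nnegrE ?normr_ge0 ?enorm_ge0 ?enorm_entry.
have Fij i j : integ mu3 (fun x => `|F t x i j| `^ q).
  by apply: integ_le (measurable_pow _ (mF i j)) Fi _ => x; rewrite ger0_norm ?powR_ge0.
have gH i j : [/\ wpart j (vel t i) (fun x => F t x i j), periodic3 (fun x => F t x i j),
    measurable_fun [set: mpoint3 R] (fun x => F t x i j) & integ mu3 (fun x => `|F t x i j| `^ q)].
  split => //; last by move=> x k; rewrite /F (periodic_tpatch gL).
  apply: weak_partial_wpart => //; first by have [] := sqint_vel T0 uc t i.
  have -> : vel t i = fun x => u t x 0 i by rewrite /vel cs.
  have -> : (fun x => F t x i j) = fun x => gu t x i j by rewrite /F /tpatch t0.
  exact: wt.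
have gS i j : \int[mu3]_x `|F t x i j| `^ q <= S t by exact: Rint_le.
split.
  exact: (flux_sobolev_cvg0 q95 (periodic_vel T0 uc t) (sqint_vel T0 uc t) (wdiv_vel T0 uw uc t) (vM t) gH gS).
move=> n.
apply: le_trans (flux_sobolev_le q95 (periodic_vel T0 uc t) (sqint_vel T0 uc t) (wdiv_vel T0 uw uc t) (vM t) gH gS n) _.
have C0 : 0 <= C.
  have : 0 <= 72 * (2 `^ (2 * q / (q - 1)) * ((M + 1) * (sob_const q M `^ (3 / (5 * q - 6) * (2 / (q - 1)))))).
    by rewrite mulr_ge0 // mulr_ge0 ?powR_ge0 // mulr_ge0 ?powR_ge0 // addr_ge0.
  by rewrite /C /flux_const; lra.
rewrite -pE -/a -/C ler_wpM2l //.
have := powR_normD_le 1 (S t) (ltW a0).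
by rewrite normr1 powR1 (ger0_norm (S0 t)) ger0_norm ?addr_ge0.
Qed.

End GradientCase.

Section Conclusion.
Context {R : realType}.
Notation lam := (@lebesgue_measure R).
Notation mu3 := (@mu3 R).
Variables (T : R) (u : R -> point3 R -> 'rV[R]_3) (A : R -> point3 R -> 'M[R]_(3, 2)).
Hypotheses (T0 : 0 < T) (uw : weak_solution T u A) (uc : weakly_continuous T u).

Let sqr_poweR (x : \bar R) : (0 <= x)%E -> (x ^+ 2 = x `^ 2)%E.
Proof.
case: x => [r|_|] //; first by rewrite lee_fin => r0; rewrite poweR_EFin powR_mulrn // EFin_expe.
by rewrite poweRyr ?pnatr_eq0 //; exact: mulyy.
Qed.

Lemma kinetic_energyE t : 0 <= t -> t <= T ->
  (\int[lebesgue3]_(x in cell) (enorm (u t x) ^+ 2)%:E = (\sum_i \int[mu3]_x vel T u t i x ^+ 2)%:E)%E.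
Proof.
move=> t0 tT; have v2 i : integ mu3 (fun x => vel T u t i x ^+ 2) by have [] := sqint_vel T0 uc t i.
have E x : \sum_i vel T u t i x ^+ 2 = enorm (u t x) ^+ 2.
  by rewrite enorm_sqr big_ord1 /vel clampE.
have ie : integ mu3 (fun x => enorm (u t x) ^+ 2).
  have si : integ mu3 (fun x => \sum_i vel T u t i x ^+ 2) by exact: integ_sum.
  by apply: (eq_integ _ si) => x; exact: E.
rewrite integral_cell_Rint // -Rint_sum //; congr EFin; apply: eq_Rint => x; exact/esym/E.
Qed.

Lemma dissipationE t : 0 <= t -> t <= T ->
  (\int[lam]_(s in `]0%R, t[) Lq_norm 2%:E (A s) ^+ 2 =
   (\int[muT T]_r (\1_`]0, t] r * hdissip (hgrad T A r)))%:E)%E.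
Proof.
move=> t0 tT; have [_ [_ AL] _ _] := uw.
pose F s x := tpatch T (fun=> 0) A s x.
pose h s := (\int[mu3]_x (enorm (F s x) `^ 2)%:E)%E.
have mFz i j : measurable_fun [set: measurableTypeR R * mpoint3 R] (fun z => F z.1 z.2 i j).
  exact: (measurable_tpatch_entry AL i j).
have mF : measurable_fun [set: measurableTypeR R * mpoint3 R] (fun z => (enorm (F z.1 z.2) `^ 2)%:E).
  by apply/measurable_EFinP; apply: (measurableT_comp (measurable_powR _)); exact: measurable_enorm.
have F0 z : (0 <= (enorm (F z.1 z.2) `^ 2)%:E)%E by rewrite lee_fin powR_ge0.
have mh : measurable_fun [set: measurableTypeR R] h.
  exact: (@measurable_fun_fubini_tonelli_F _ _ _ _ _ mu3 _ mF F0).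
have h0 s : (0 <= h s)%E by apply: integral_ge0 => x _; rewrite lee_fin powR_ge0.
have -> : (\int[lam]_(s in `]0%R, t[) Lq_norm 2%:E (A s) ^+ 2 = \int[lam]_(s in `]0%R, t[) h s)%E.
  apply: eq_integral => s; rewrite inE /= in_itv /= => /andP[s0 st].
  have sT : 0 < s < T by rewrite s0 (lt_le_trans st).
  have mA i j : measurable_fun [set: mpoint3 R] (fun x => A s x i j).
    have := measurableT_comp (mFz i j) (measurable_pair1 s).
    by apply: eq_measurable_fun => x _; rewrite /= /F /tpatch sT.
  apply: (etrans (sqr_poweR (Lnorm_ge0 _ _ _))).
  apply: (etrans (Lq_norm_pow (ltr0Sn R 1) mA)); apply: eq_integral => x _.
  by rewrite /F /tpatch sT.
have sub : `]0%R, t[%classic = `]0%R, T[%classic `&` `]0%R, t[%classic :> set R.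
  rewrite setIC; apply/esym/setIidl => s /=; rewrite !in_itv /= => /andP[s0 st].
  by rewrite s0 (lt_le_trans st).
have mt : measurable (`]0%R, t[%classic : set (measurableTypeR R)) by [].
have mhp : measurable_fun [set: measurableTypeR R] (h \_ `]0%R, t[).
  by apply/(measurable_restrictT _ mt); exact: measurable_funTS.
have hp0 s : (0 <= (h \_ `]0%R, t[) s)%E by rewrite patchE; case: ifP.
have iH : integ (muT T) (fun r => \1_`]0, t] r * hdissip (hgrad T A r)).
  apply: (@integ_mul_bounded _ _ _ _ _ _ 1); first exact: measurable_indic.
    by move=> r; rewrite indicE ger0_norm //; case: (_ \in _).
  exact: integ_hdissip uw.
rewrite sub integral_mkcondr -(integral_mrestr lam (measurable_itv0T T) mhp hp0) EFin_Rint //.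
apply: ae_eq_integral => //.
  by apply/measurable_EFinP; exact: integ_meas iH.
(* The energy balance integrates over ]0, t] and the statement over ]0, t[; the point t is
   negligible. *)
have := muT_ae_neq T t; move: (ae_sqint_A (sqint_hgrad uw)).
apply: filterS2 => r sA rt _; rewrite patchE indicE.
have rE : (r \in `]0%R, t]%classic) = (r \in `]0%R, t[%classic).
  apply/idP/idP; rewrite !inE /= !in_itv /= => /andP[-> rle]; first by rewrite lt_neqAle rt rle.
  by rewrite ltW.
rewrite rE; case: ifP => _; last by rewrite mul0r.
rewrite mul1r /h.
have E x : enorm (F r x) `^ 2 = \sum_i \sum_j hgrad T A r i j x ^+ 2.
  by rewrite -[X in X `^ _]ger0_norm ?enorm_ge0 // powR2 enorm_sqr.
under eq_integral do rewrite E.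
have iA i j : integ mu3 (fun x => hgrad T A r i j x ^+ 2) by have [] := sA i j.
rewrite -EFin_Rint; last by apply: integ_sum => i; exact: integ_sum.
rewrite Rint_sum; last by move=> i; exact: integ_sum.
by congr EFin; apply: eq_bigr => i _; rewrite Rint_sum.
Qed.

End Conclusion.

Theorem theorem1p1 (R : realType) (T : R) (u0 : point3 R -> 'rV[R]_3)
    (u : R -> point3 R -> 'rV[R]_3) (gradh_u : R -> point3 R -> 'M[R]_(3, 2))
    (T_gt0 : 0 < T)
    (u0_L2 : Lq 2%:E u0) (u0_divfree : weakly_divfree u0)
    (u_weak : weak_solution T u gradh_u)
    (u_cont : weakly_continuous T u)
    (u_init : {ae lebesgue3, forall x, x \in (cell : set (point3 R)) ->
                 u 0 x = u0 x})
    (u_cond : LpLq T 4%:E 4%:E u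
      \/ (exists p q : R, [/\ 2 / p + 2 / q = 1, 4 <= q &
            LpLq T p%:E q%:E u])
      \/ (exists p q : R, [/\ 1 / p + 6 / (5 * q) = 1, 9 / 5 <= q &
            exists grad_u : R -> point3 R -> 'M[R]_3,
              weak_grad T u grad_u /\ LpLq T p%:E q%:E grad_u])) :
  forall t, 0 <= t <= T ->
    ((2^-1)%:E * \int[lebesgue3]_(x in cell) (enorm (u t x) ^+ 2)%:E
     + \int[lebesgue_measure]_(s in `]0%R, t[) Lq_norm 2%:E (gradh_u s) ^+ 2
     = (2^-1)%:E * \int[lebesgue3]_(x in cell) (enorm (u0 x) ^+ 2)%:E)%E.
Proof.
move=> t /andP[t0 tT].
have fd : flux_dominated T (vel T u).
  case: u_cond => [uL|[[p [q [pq q4 uL]]]|[p [q [pq q95 [gu [wg gL]]]]]]].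
  - exact: (flux_dominated_L4 T_gt0 u_weak u_cont uL).
  - exact: (flux_dominated_LpLq T_gt0 u_weak u_cont pq q4 uL).
  - exact: (flux_dominated_grad T_gt0 u_weak u_cont pq q95 wg gL).
have en := energy_solution T_gt0 u_weak u_cont fd t0 tT.
(* The initial datum agrees with the slice at time 0 almost everywhere in the cell, which is all the
   integral sees. *)
have -> : (\int[lebesgue3]_(x in cell) (enorm (u0 x) ^+ 2)%:E =
    \int[lebesgue3]_(x in cell) (enorm (u 0%R x) ^+ 2)%:E)%E.
  have [_ m0 _] := u0_L2; have [uL _] := u_cont.
  have [|_ m1 _] := uL 0; first by rewrite in_itv /= lexx ltW.
  have mE (f : point3 R -> 'rV[R]_3) :
      (forall i j, measurable_fun [set: mpoint3 R] (fun x => f x i j)) ->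
      measurable_fun (cell : set (mpoint3 R)) (fun x => (enorm (f x) ^+ 2)%:E).
    move=> mf; apply: measurable_funTS; apply/measurable_EFinP.
    by apply: measurable_funX; exact: measurable_enorm.
  apply: ae_eq_integral; [exact: measurable_cell|exact: mE|exact: mE|].
  case: u_init => N [mN N0 sub]; exists N; split => // x /= H; apply: sub => /= ux.
  by apply: H => xc; rewrite ux // inE.
rewrite (kinetic_energyE T_gt0 u_cont t0 tT) (kinetic_energyE T_gt0 u_cont (lexx 0) (ltW T_gt0)).
rewrite (dissipationE u_weak t0 tT) -!EFinM -EFinD -en; congr EFin.
by rewrite mulrDr mulrA mulVf // mul1r.
Qed.
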